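(* Let $M^3$ be a nondegenerate positive definite affine hypersurface of $\mathbb R^4$ which admits a pointwise $SO(2)$-symmetry or a pointwise $\mathbb Z_3$-symmetry, and with the globally defined function $a+\eta^2-\mu_1^2$ not identically zero on $M^3$. Then $M^3$ is affinely equivalent to $$F:I\times N^2\to\mathbb R^4,\qquad (t,u,v)\mapsto(\gamma_1(t),\,\gamma_2(t)\,\phi(u,v)),$$ where $\phi:N^2\to\mathbb R^3$ is an elliptic or hyperbolic affine sphere and $\gamma=(\gamma_1,\gamma_2):I\to\mathbb R^2$ is an affine curve. Moreover, if $M^3$ admits a pointwise $SO(2)$-symmetry, then $N^2$ is either an ellipsoid or a hyperboloid.
   Context: Blaschke structure: for a nondegenerate immersed hypersurface $F:M^n\to\mathbb R^{n+1}$, with $D$ the standard flat connection and $\det$ the standard volume form, the affine (Blaschke) normal $\xi$ is the transversal field, unique up to sign, such that $D_XY=\nabla_XY+h(X,Y)\xi$, $D_X\xi=-SX$ (tangential), and $|\det(X_1,\dots,X_n,\xi)|=|\det(h(X_i,X_j))|^{1/2}$. $\nabla$ is the induced connection, $h$ the affine metric, $S$ the affine shape operator; $\hat\nabla$ is the Levi-Civita connection of $h$, and $K(X,Y)=K_XY=\nabla_XY-\hat\nabla_XY$ is the difference tensor. $h(K(X,Y),Z)$ is totally symmetric and $\operatorname{trace}K_X=0$. $M$ is positive definite if $h$ is (for suitable sign of $\xi$). Symmetry: $M^3$ admits a pointwise $\mathbb Z_3$-symmetry (resp. $SO(2)$-symmetry) if at every $p\in M$ the group of orientation-preserving linear maps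 of $T_pM$ preserving $h$, $S$ and $K$ is isomorphic to $\mathbb Z_3$ (resp. $SO(2)$). Functions: for such $M^3$ there is near every point a smooth $h$-orthonormal frame $e_1,e_2,e_3$ with $K_{e_1}e_1=2\mu_1e_1$, $K_{e_1}e_2=-\mu_1e_2$, $K_{e_1}e_3=-\mu_1e_3$, $K_{e_2}e_2=-\mu_1e_1+\mu_2e_2$, $K_{e_2}e_3=-\mu_2e_3$, $K_{e_3}e_3=-\mu_1e_1-\mu_2e_2$, $Se_1=\lambda e_1$, $Se_2=ae_2$, $Se_3=ae_3$. Here $\mu_1\neq0$ everywhere, and $\mu_2$ vanishes exactly in the $SO(2)$ case. The field $e_1$ is determined up to sign and may be taken globally defined; $\eta$ is the function with $\hat\nabla_Xe_1=\eta X$ for all $X\perp e_1$. Changing the sign of $e_1$ changes the sign of both $\mu_1$ and $\eta$. Affine spheres: a nondegenerate hypersurface is a proper affine sphere if all its affine normal lines pass through a fixed point (the center), equivalently $S=H\,\mathrm{Id}$ with $H\ne0$ constant; a positive definite proper affine sphere is elliptic if $H>0$ and hyperbolic if $H<0$. An affine curve in $\mathbb R^2$ is a smooth nondegenerate curve, $\gamma_1'\gamma_2''-\gamma_1''\gamma_2'\ne0$; $I$ is an open interval. Affinely equivalent means equal up to an affine transformation of $\mathbb R^4$ (and reparametrization).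
   Formalization: M is assumed connected, and ''affinely equivalent'' is proved locally: one affine map of R^4 serves all of M, and each point has a neighborhood of the form I×N (in the SO(2) case φ(N) lies in a quadric); globally false, e.g. for a ball-shaped open part of such a hypersurface. *)

(* Defs.v *)
(* Vectors are row vectors, so linear maps and affine maps act by right
   multiplication: [v *m g]. *)
From HB Require Import structures.
From mathcomp Require Import all_boot all_order all_algebra.
From mathcomp Require Import all_classical all_reals all_analysis.
Set Implicit Arguments.
Unset Strict Implicit.
Unset Printing Implicit Defensive.
Import Order.TTheory GRing.Theory Num.Theory.
Import numFieldNormedType.Exports.
Local Open Scope classical_set_scope.
Local Open Scope ring_scope.

(* C^oo on an open set: every iterated directional derivative, in every list of
   constant directions, is (Frechet) differentiable at every point of [U]. *)
Definition smooth_on (R : realType) (V W : normedModType R)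
    (U : set V) (f : V -> W) : Prop :=
  forall (vs : seq V) (x : V), U x ->
    differentiable (foldr (fun v g => 'D_v g) f vs) x.

(* Charts are given by their inverses, the local parametrizations x : U -> M. *)

Definition open_embedding (T T' : topologicalType) (U : set T) (x : T -> T') :
    Prop :=
  [/\ open U, set_inj U x, {within U, continuous x}
    & forall O, open O -> O `<=` U -> open (x @` O)].

(* [tau] is y^-1 \o x *)
Definition smooth_transition (R : realType) (n : nat) (M : Type)
    (U : set 'rV[R]_n) (x : 'rV[R]_n -> M)
    (U' : set 'rV[R]_n) (y : 'rV[R]_n -> M) : Prop :=
  let W := U `&` x @^-1` (y @` U') in
  exists tau : 'rV[R]_n -> 'rV[R]_n,
    smooth_on W tau /\ (forall s, W s -> U' (tau s) /\ y (tau s) = x s).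

Record smooth_manifold (R : realType) (n : nat) := SmoothManifold {
  carrier :> topologicalType;
  manifold_hausdorff : hausdorff_space carrier;
  manifold_second_countable : @second_countable carrier;
  atlas : set (set 'rV[R]_n * ('rV[R]_n -> carrier));
  atlas_cover : forall p : carrier, exists c, atlas c /\ (c.2 @` c.1) p;
  atlas_embedding : forall c, atlas c -> open_embedding c.1 c.2;
  atlas_compatible : forall c c', atlas c -> atlas c' ->
    smooth_transition c.1 c.2 c'.1 c'.2 }.
Arguments atlas {R n} _.

(* The maximal atlas; equivalently, [x] is a diffeomorphism of the open set [U]
   onto an open subset of [M]. *)
Definition local_param (R : realType) (n : nat) (M : smooth_manifold R n)
    (U : set 'rV[R]_n) (x : 'rV[R]_n -> M) : Prop :=
  open_embedding U x /\
  forall c, atlas M c ->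
    smooth_transition U x c.1 c.2 /\ smooth_transition c.1 c.2 U x.

(* For a parametrized hypersurface f : U -> R^(n+1), tangent vectors at [s] are
   coordinate vectors v : 'rV_n, and vector fields are maps 'rV_n -> 'rV_n.  The tensors at [s] are evaluated by extending
   tangent vectors to constant (coordinate) vector fields. *)

Section Blaschke.
Variables (R : realType) (n : nat).
Local Notation Rn := 'rV[R]_n.
Local Notation Rn1 := 'rV[R]_(n.+1).
Implicit Types (f xi : Rn -> Rn1) (s v w z : Rn) (X Y : Rn -> Rn).

(* Rows: xi, f_* d/ds_1, ..., f_* d/ds_n. *)
Definition moving_frame f xi s : 'M[R]_(1 + n) :=
  col_mx (xi s) (jacobian f s).

(* b = (normal_part b) xi + f_* (tangent_part b), at s *)
Definition components f xi s (b : Rn1) : 'rV[R]_(1 + n) :=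
  b *m invmx (moving_frame f xi s).
Definition normal_part f xi s (b : Rn1) : R := components f xi s b 0 0.
Definition tangent_part f xi s (b : Rn1) : Rn := rsubmx (components f xi s b).

(* D_X (f_* Y) *)
Definition flatD f X Y s : Rn1 := 'D_(X s) (fun y => 'D_(Y y) f y) s.

(* D_X Y = nabla_X Y + h(X,Y) xi *)
Definition induced_connection f xi X Y s : Rn :=
  tangent_part f xi s (flatD f X Y s).
Definition affine_metric f xi s v w : R :=
  normal_part f xi s (flatD f (fun=> v) (fun=> w) s).

(* D_X xi = - S X *)
Definition shape_operator f xi s v : Rn := - tangent_part f xi s ('D_v xi s).

Definition gram (h : Rn -> Rn -> R) (k : nat) (X : 'M[R]_(k, n)) : 'M[R]_k :=
  \matrix_(i, j) h (row i X) (row j X).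

Record affine_normal_on (U : set Rn) f xi : Prop := {
  normal_smooth : smooth_on U xi;
  normal_transversal : forall s, U s -> moving_frame f xi s \in unitmx;
  normal_tangential : forall s v, U s -> normal_part f xi s ('D_v xi s) = 0;
  metric_nondegenerate : forall s, U s ->
    \det (gram (affine_metric f xi s) 1%:M) != 0;
  normal_volume : forall s (X : 'M[R]_n), U s ->
    `| \det (col_mx (xi s) (X *m jacobian f s) : 'M[R]_(1 + n)) | =
    Num.sqrt `| \det (gram (affine_metric f xi s) X) | }.

Definition positive_definite_on (U : set Rn) f xi : Prop :=
  forall s v, U s -> v != 0 -> 0 < affine_metric f xi s v v.

(* Christoffel symbols: h(christoffel v w, z) is
   (v h(w,z) + w h(v,z) - z h(v,w)) / 2 for constant fields v, w, z. *)
Definition christoffel_lower (h : Rn -> Rn -> Rn -> R) s v w z : R :=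
  2^-1 * ('D_v (fun y => h y w z) s + 'D_w (fun y => h y v z) s
          - 'D_z (fun y => h y v w) s).
Definition christoffel (h : Rn -> Rn -> Rn -> R) s v w : Rn :=
  (\row_l christoffel_lower h s v w (delta_mx 0 l)) *m invmx (gram (h s) 1%:M).
Definition levi_civita (h : Rn -> Rn -> Rn -> R) X Y s : Rn :=
  'D_(X s) Y s + christoffel h s (X s) (Y s).

Definition difference_tensor f xi s v w : Rn :=
  induced_connection f xi (fun=> v) (fun=> w) s
  - levi_civita (affine_metric f xi) (fun=> v) (fun=> w) s.

(* The orientation-preserving linear maps of the tangent space at [s] that
   preserve h, S and K. *)
Definition symmetry_group f xi s : set 'M[R]_n :=
  [set g | [/\ 0 < \det g,
      forall v w, affine_metric f xi s (v *m g) (w *m g) =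
                  affine_metric f xi s v w,
      forall v, shape_operator f xi s (v *m g) = shape_operator f xi s v *m g
    & forall v w, difference_tensor f xi s (v *m g) (w *m g) =
                  difference_tensor f xi s v w *m g]].

Definition proper_affine_sphere_on (U : set Rn) f xi : Prop :=
  affine_normal_on U f xi /\
  exists c : Rn1, forall s, U s -> exists r : R, c = f s + r *: xi s.

Definition elliptic_affine_sphere (U : set Rn) f : Prop :=
  exists xi, [/\ proper_affine_sphere_on U f xi, positive_definite_on U f xi
    & exists H : R, 0 < H /\
        forall s v, U s -> shape_operator f xi s v = H *: v].

Definition hyperbolic_affine_sphere (U : set Rn) f : Prop :=
  exists xi, [/\ proper_affine_sphere_on U f xi, positive_definite_on U f xi
    & exists H : R, H < 0 /\
        forall s v, U s -> shape_operator f xi s v = H *: v].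

Definition immersion_on (U : set Rn) f : Prop :=
  smooth_on U f /\ forall s, U s -> row_free (jacobian f s).

End Blaschke.

Section Hypersurface.
Variables (R : realType) (n : nat) (M : smooth_manifold R n).
Implicit Types F xi : M -> 'rV[R]_(n.+1).

Definition immersion F : Prop :=
  forall U (x : 'rV[R]_n -> M), local_param U x -> immersion_on U (F \o x).

Definition affine_normal F xi : Prop :=
  forall U (x : 'rV[R]_n -> M), local_param U x ->
    affine_normal_on U (F \o x) (xi \o x).

Definition positive_definite F xi : Prop :=
  forall U (x : 'rV[R]_n -> M), local_param U x ->
    positive_definite_on U (F \o x) (xi \o x).

End Hypersurface.

Definition group_iso (T T' : Type) (A : set T) (opA : T -> T -> T)
    (B : set T') (opB : T' -> T' -> T') : Prop :=
  exists phi : T -> T', set_bij A B phi /\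
    forall a b, A a -> A b -> phi (opA a b) = opB (phi a) (phi b).

Definition SO2 (R : realType) : set 'M[R]_2 :=
  [set g | g *m g^T = 1%:M /\ \det g = 1].

Section Symmetry.
Variables (R : realType) (M : smooth_manifold R 3).
Implicit Types F xi : M -> 'rV[R]_4.

Definition pointwise_Z3_symmetry F xi : Prop :=
  forall U (x : 'rV[R]_3 -> M) s, local_param U x -> U s ->
    group_iso [set: 'Z_3] +%R (symmetry_group (F \o x) (xi \o x) s) mulmx.

Definition pointwise_SO2_symmetry F xi : Prop :=
  forall U (x : 'rV[R]_3 -> M) s, local_param U x -> U s ->
    group_iso (@SO2 R) mulmx (symmetry_group (F \o x) (xi \o x) s) mulmx.

Record adapted_frame (U : set 'rV[R]_3) (f xi : 'rV[R]_3 -> 'rV[R]_4)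
    (e1 e2 e3 : 'rV[R]_3 -> 'rV[R]_3)
    (mu1 mu2 lambda a eta : 'rV[R]_3 -> R) : Prop := {
  frame_smooth : [/\ smooth_on U e1, smooth_on U e2 & smooth_on U e3];
  frame_orthonormal : forall s, U s -> let h := affine_metric f xi s in
    gram h (col_mx (e1 s) (col_mx (e2 s) (e3 s))) = 1%:M;
  frame_K : forall s, U s -> let K := difference_tensor f xi s in
    K (e1 s) (e1 s) = (2 * mu1 s) *: e1 s /\
    K (e1 s) (e2 s) = - mu1 s *: e2 s /\
    K (e1 s) (e3 s) = - mu1 s *: e3 s /\
    K (e2 s) (e2 s) = - mu1 s *: e1 s + mu2 s *: e2 s /\
    K (e2 s) (e3 s) = - mu2 s *: e3 s /\
    K (e3 s) (e3 s) = - mu1 s *: e1 s - mu2 s *: e2 s;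
  frame_S : forall s, U s -> let S := shape_operator f xi s in
    [/\ S (e1 s) = lambda s *: e1 s, S (e2 s) = a s *: e2 s
      & S (e3 s) = a s *: e3 s];
  frame_eta : forall s v, U s -> affine_metric f xi s v (e1 s) = 0 ->
    levi_civita (affine_metric f xi) (fun=> v) e1 s = eta s *: v }.

(* [r] is the value at [p] of the function a + eta^2 - mu1^2, computed from an
   adapted frame near [p]; it does not depend on the frame. *)
Definition symmetry_function_at F xi (p : M) (r : R) : Prop :=
  exists U (x : 'rV[R]_3 -> M) e1 e2 e3 mu1 mu2 lambda a eta s,
    [/\ local_param U x,
        adapted_frame U (F \o x) (xi \o x) e1 e2 e3 mu1 mu2 lambda a eta,
        U s, x s = p & r = a s + eta s ^+ 2 - mu1 s ^+ 2].

End Symmetry.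

Definition affine_transformation (R : realType) (k : nat)
    (A : 'rV[R]_k -> 'rV[R]_k) : Prop :=
  exists (B : 'M[R]_k) (b : 'rV[R]_k),
    B \in unitmx /\ forall y, A y = y *m B + b.

Definition open_interval (R : realType) (I : set R) : Prop :=
  [/\ open I, is_interval I & I !=set0].

Definition affine_curve (R : realType) (I : set R) (gamma1 gamma2 : R -> R) :
    Prop :=
  [/\ smooth_on I gamma1, smooth_on I gamma2
    & forall t, I t ->
        gamma1^`()%classic t * gamma2^`(2)%classic t
        - gamma1^`(2)%classic t * gamma2^`()%classic t != 0].

Definition point3 (R : realType) (t : R) (u : 'rV[R]_2) : 'rV[R]_3 :=
  row_mx (t%:M : 'rV[R]_1) u.

Definition product_domain (R : realType) (I : set R) (N : set 'rV[R]_2) :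
    set 'rV[R]_3 :=
  [set y | exists t u, [/\ I t, N u & y = point3 t u]].

Definition warped_hypersurface (R : realType) (gamma1 gamma2 : R -> R)
    (phi : 'rV[R]_2 -> 'rV[R]_3) (t : R) (u : 'rV[R]_2) : 'rV[R]_4 :=
  row_mx ((gamma1 t)%:M : 'rV[R]_1) (gamma2 t *: phi u).

Definition is_ellipsoid (R : realType) (E : set 'rV[R]_3) : Prop :=
  exists A : 'rV[R]_3 -> 'rV[R]_3, affine_transformation A /\
    E = [set y | A y 0 0 ^+ 2 + A y 0 1 ^+ 2 + A y 0 2 ^+ 2 = 1].

(* Two-sheeted: a one-sheeted hyperboloid has indefinite affine metric. *)
Definition is_hyperboloid (R : realType) (E : set 'rV[R]_3) : Prop :=
  exists A : 'rV[R]_3 -> 'rV[R]_3, affine_transformation A /\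
    E = [set y | A y 0 2 ^+ 2 - A y 0 0 ^+ 2 - A y 0 1 ^+ 2 = 1].

(* Main.v *)
(* At each point the symmetry group is abelian and contains an element of order three, whose
   axis [e] gives the normal form of [K] and [S] with parameters [mu], [lam], [a].  Locally [e]
   is a smooth field, being the simple eigenline of [S] or of the form [tr (K_v K_w)].  The
   Codazzi equation of [K] forces the Levi-Civita derivative of [e] along [v] to be
   [eta (v - h(v, e) e)].

   Put [E = f_* e], let [N] be the conormal map, and set [zeta = xi - (eta + mu) E],
   [nu = a + eta ^ 2 - mu ^ 2], [om = nu E + (eta - mu) zeta], [tau = - N_* e + (eta + mu) N].
   Then [d om], [d tau], [d nu] are multiples of [om], [tau], [nu], and [d (f + zeta / nu)] is a
   multiple of [om].  Hence [om] and [tau] span constant lines, [nu] vanishes nowhere, and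
   [f + zeta / nu] moves on a fixed line directed by [om]; none of this depends on the sign
   of [e], so it propagates over the connected manifold.

   Take that line as first coordinate axis and the annihilator of [tau] as the complementary
   space: the leaves of the distribution orthogonal to [e] lie in the hyperplanes where the first
   coordinate is constant, and [e] only rescales the other three, which is the warped form.  The
   Gauss equation makes a leaf a centroaffine surface with affine metric proportional to [h] and
   affine normal proportional to the position vector, i.e. a proper affine sphere.  In the SO(2)
   case [K] has no component tangent to the leaves, so the conormal map of the sphere solves
   the same linear system as the sphere; it is a constant linear image of it, and the pairing of
   the two gives the quadric. *)
Require Import Defs.
From HB Require Import structures.
From mathcomp Require Import all_boot all_order all_algebra.
From mathcomp Require Import perm.
From mathcomp Require Import all_classical all_reals all_analysis.
From mathcomp Require Import ring lra.
Set Implicit Arguments.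
Unset Strict Implicit.
Unset Printing Implicit Defensive.
Import Order.TTheory GRing.Theory Num.Theory.
Import numFieldNormedType.Exports.
Local Open Scope classical_set_scope.
Local Open Scope ring_scope.

(** * Differential calculus of smooth functions *)

(** No curvature tensor occurs: every integrability condition is the equality of mixed second
    derivatives of a vector-valued map ([f], [N], [xi], [E] or [E']), read off by pairing with the
    conormal map. Commutativity of the symmetry group makes the axis unique up to sign; a cubic form
    with tetrahedral symmetry, for instance, has several axes of order three, and none of them would
    be singled out. No coherent sign is chosen on [M]: the constant data are lines rather than
    vectors, tested by matrices that annihilate them, and such a test holds or fails on a whole
    neighbourhood. Origin of the combinations: along a leaf the derivative of [zeta] is [- nu] times
    that of [f], so [f + zeta / nu] is the centre of the leaf; [om] is the direction in which this
    centre moves along [e], and [tau] is the covector that kills [zeta] and the tangent plane of the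
    leaf. The normalizing affine map of R^4 need not preserve volume, so the volume condition is
    carried with a constant [d] until the metric of the leaf is rescaled. *)

Section Germs.
Context {R : realType}.
Implicit Types V W : normedModType R.

Lemma diff_epsP V W (f : V -> W) (df : {linear V -> W}) (x : V) :
  continuous df ->
  (forall e : R, 0 < e ->
     \forall h \near 0, `|f (h + x) - f x - df h| <= e * `|h|) ->
  is_diff x f df.
Proof.
move=> dfc H.
have E : f \o shift x = cst (f x) + df +o_ 0 id.
  apply/eqaddoP => e e0; near=> h.
  rewrite -[X in `|X|]/(f (h + x) - (f x + df h)) opprD addrA.
  near: h; exact: H.
have dE := diff_unique dfc E.
apply: DiffDef; last by rewrite dE.
by apply/diff_locallyP; rewrite dE.
Unshelve. all: by end_near. Qed.

Lemma diff_eps V W (f : V -> W) (x : V) : differentiable f x ->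
  forall e : R, 0 < e ->
     \forall h \near 0, `|f (h + x) - f x - 'd f x h| <= e * `|h|.
Proof.
move=> /diff_locally /eqaddoP H e e0; have := H e e0.
apply: filterS => h.
by rewrite -[X in `|X|]/(f (h + x) - (f x + 'd f x h)) opprD addrA.
Qed.

Lemma near_eq_diff V W (f g : V -> W) x :
  {near x, f =1 g} -> differentiable f x -> is_diff x g ('d f x).
Proof.
move=> fg df; apply: diff_epsP; first exact: diff_continuous.
move=> e e0; have := diff_eps df e0.
have fgx : f x = g x by apply: (nbhs_singleton fg).
have : \forall h \near 0, f (h + x) = g (h + x).
  move: fg; rewrite [in X in X -> _](near_shift 0 x) subr0.
  by apply: filterS => h.
by apply: filterS2 => h -> ; rewrite fgx.
Qed.

Lemma near_eq_differentiable V W (f g : V -> W) x :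
  {near x, f =1 g} -> differentiable f x -> differentiable g x.
Proof. by move=> fg /(near_eq_diff fg) []. Qed.

Lemma open_near V (U : set V) (P : V -> Prop) x : open U -> U x ->
  (forall y, U y -> P y) -> \forall y \near x, P y.
Proof. by move=> oU Ux H; apply: filterS (open_nbhs_nbhs (conj oU Ux)). Qed.

End Germs.

(** * Closure properties of smooth maps *)

Section Smooth.
Context {R : realType}.

Section General.
Context {V W : normedModType R}.
Implicit Types (U : set V) (f g : V -> W).

Lemma smooth_diff U f x : smooth_on U f -> U x -> differentiable f x.
Proof. by move=> sf Ux; exact: (sf [::] x Ux). Qed.

Lemma smooth_derivable U f x v : smooth_on U f -> U x -> derivable f x v.
Proof. by move=> sf Ux; apply: diff_derivable; exact: smooth_diff sf Ux. Qed.

Lemma smooth_derive U f v : smooth_on U f -> smooth_on U ('D_v f).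
Proof. by move=> sf vs x Ux; have := sf (rcons vs v) x Ux; rewrite foldr_rcons. Qed.

Lemma smooth_subset U U' f : U' `<=` U -> smooth_on U f -> smooth_on U' f.
Proof. by move=> UU' sf vs x /UU' Ux; exact: sf. Qed.

(** [smooth_on] asks for all orders at once, while the derivative of a product, an inverse or a
    composite again contains the undifferentiated factors. Counting the order gives these closure
    proofs an induction; order zero is no condition. *)
Fixpoint ck k U f : Prop :=
  if k is k'.+1 then (forall x, U x -> differentiable f x) /\
                     forall v, ck k' U ('D_v f) else True.

Lemma smooth_ck U f : smooth_on U f <-> forall k, ck k U f.
Proof.
split=> [sf k|H vs].
  elim: k f sf => //= k IH f sf; split=> [x Ux|v]; first exact: smooth_diff sf Ux.
  by apply: IH; exact: smooth_derive.
(* In the fold the last direction of the list is differentiated first, so the list is consumed from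
   its end. *)
have : ck (size vs).+1 U f by [].
elim/last_ind: vs f {H} => [f [H _] x Ux|vs v IH f]; first exact: H.
rewrite size_rcons foldr_rcons => -[_ H]; exact: IH.
Qed.

Lemma ckS k U f : ck k.+1 U f -> ck k U f.
Proof.
elim: k f => [//|k IH] f [H1 H2]; split=> // v; exact/IH/H2.
Qed.

Lemma eq_on_derive U f g v : open U -> (forall x, U x -> f x = g x) ->
  forall x, U x -> 'D_v f x = 'D_v g x.
Proof. by move=> oU H x Ux; apply: near_eq_derive; exact: open_near oU Ux H. Qed.

Lemma ck_ext k U f g : open U -> (forall x, U x -> f x = g x) ->
  ck k U f -> ck k U g.
Proof.
move=> oU; elim: k f g => //= k IH f g H [H1 H2]; split=> [x Ux|v].
  by apply: (near_eq_differentiable _ (H1 x Ux)); exact: open_near oU Ux H.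
by apply: (IH ('D_v f)) => //; exact: eq_on_derive.
Qed.

Lemma ck_cst k U (c : W) : ck k U (fun=> c).
Proof.
elim: k c => //= k IH c; split=> [x Ux|v]; first exact: differentiable_cst.
rewrite (_ : 'D_v _ = fun=> 0) // funeqE => x; exact: derive_cst.
Qed.

Lemma ckD k U f g : open U -> ck k U f -> ck k U g -> ck k U (fun x => f x + g x).
Proof.
move=> oU; elim: k f g => //= k IH f g [f1 f2] [g1 g2]; split=> [x Ux|v].
  by apply: differentiableD; [exact: f1|exact: g1].
apply: (ck_ext oU _ (IH _ _ (f2 v) (g2 v))) => x Ux.
by rewrite [in RHS]deriveD//; apply: diff_derivable; [exact: f1|exact: g1].
Qed.

Lemma ckN k U f : open U -> ck k U f -> ck k U (fun x => - f x).
Proof.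
move=> oU; elim: k f => //= k IH f [f1 f2]; split=> [x Ux|v].
  by apply: differentiableN; exact: f1.
apply: (ck_ext oU _ (IH _ (f2 v))) => x Ux.
by rewrite [in RHS]deriveN//; apply: diff_derivable; exact: f1.
Qed.

Lemma smooth_ext U f g : open U -> (forall x, U x -> f x = g x) ->
  smooth_on U f -> smooth_on U g.
Proof. by move=> oU H /smooth_ck sf; apply/smooth_ck => k; exact: (ck_ext oU H). Qed.

Lemma smooth_cst U (c : W) : smooth_on U (fun=> c).
Proof. by apply/smooth_ck => k; exact: ck_cst. Qed.

Lemma smoothD U f g : open U -> smooth_on U f -> smooth_on U g ->
  smooth_on U (fun x => f x + g x).
Proof. by move=> oU /smooth_ck a /smooth_ck b; apply/smooth_ck => k; exact: ckD. Qed.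

Lemma smoothN U f : open U -> smooth_on U f -> smooth_on U (fun x => - f x).
Proof. by move=> oU /smooth_ck a; apply/smooth_ck => k; exact: ckN. Qed.

Lemma smoothB U f g : open U -> smooth_on U f -> smooth_on U g ->
  smooth_on U (fun x => f x - g x).
Proof. by move=> oU sf sg; apply: smoothD => //; exact: smoothN. Qed.

Lemma eq_smooth U f g : smooth_on U f -> f =1 g -> smooth_on U g.
Proof. by move=> sf /funext <-. Qed.

Lemma smooth_sum U I (r : seq I) (P : pred I) (F : I -> V -> W) : open U ->
  (forall i, P i -> smooth_on U (F i)) ->
  smooth_on U (fun x => \sum_(i <- r | P i) F i x).
Proof.
move=> oU H; elim: r => [|i r IH].
  by apply: (eq_smooth (smooth_cst (0 : W))) => x; rewrite big_nil.
have [Pi|/negbTE Pi] := boolP (P i); last first.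
  by apply: (eq_smooth IH) => x; rewrite big_cons Pi.
by apply: (eq_smooth (smoothD oU (H i Pi) IH)) => x; rewrite big_cons Pi.
Qed.

End General.

Section Scalar.
Context {V : normedModType R}.
Implicit Types (U : set V) (f g : V -> R).

Lemma ckM k U f g : open U -> ck k U f -> ck k U g -> ck k U (fun x => f x * g x).
Proof.
move=> oU; elim: k f g => // k IH f g fk gk.
have [[f1 f2] [g1 g2]] := (fk, gk); split=> [x Ux|v].
  by apply: differentiableM; [exact: f1|exact: g1].
have := ckD oU (IH _ _ (ckS fk) (g2 v)) (IH _ _ (ckS gk) (f2 v)).
apply: ck_ext => // x Ux.
by rewrite [in RHS]deriveM//; apply: diff_derivable; [exact: f1|exact: g1].
Qed.

Lemma smoothM U f g : open U -> smooth_on U f -> smooth_on U g ->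
  smooth_on U (fun x => f x * g x).
Proof. by move=> oU /smooth_ck a /smooth_ck b; apply/smooth_ck => k; exact: ckM. Qed.

Lemma smooth_prod U I (r : seq I) (P : pred I) (F : I -> V -> R) : open U ->
  (forall i, P i -> smooth_on U (F i)) ->
  smooth_on U (fun x => \prod_(i <- r | P i) F i x).
Proof.
move=> oU H; elim: r => [|i r IH].
  by apply: (eq_smooth (smooth_cst (1 : R))) => x; rewrite big_nil.
have [Pi|/negbTE Pi] := boolP (P i); last first.
  by apply: (eq_smooth IH) => x; rewrite big_cons Pi.
by apply: (eq_smooth (smoothM oU (H i Pi) IH)) => x; rewrite big_cons Pi.
Qed.

Lemma ckV k U f : open U -> (forall x, U x -> f x != 0) ->
  ck k U f -> ck k U (fun x => (f x)^-1).
Proof.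
move=> oU f0; elim: k f f0 => // k IH f f0 fk.
have [f1 f2] := fk; split=> [x Ux|v].
  by apply: differentiableV; [exact: f1|exact: f0].
have iv := IH _ f0 (ckS fk).
have := ckN oU (ckM oU (ckM oU iv iv) (f2 v)).
apply: ck_ext => // x Ux.
rewrite [in RHS]deriveV//; [|exact: f0|by apply: diff_derivable; exact: f1].
by rewrite -invrM ?unitfE ?f0// -expr2 -scaleNr.
Qed.

Lemma smoothV U f : open U -> (forall x, U x -> f x != 0) ->
  smooth_on U f -> smooth_on U (fun x => (f x)^-1).
Proof. by move=> oU f0 /smooth_ck a; apply/smooth_ck => k; exact: ckV. Qed.

End Scalar.

Section Entries.
Context {V : normedModType R} {m n : nat}.
Implicit Types (U : set V) (f g : V -> 'M[R]_(m, n)).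

Lemma differentiable_mxP f x :
  differentiable f x <-> forall i j, differentiable (fun y => f y i j) x.
Proof.
split=> [df i j|H].
  exact: (differentiable_comp df (@differentiable_coord _ _ _ (f x) i j)).
have -> : f = \sum_i \sum_j (fun y => f y i j *: delta_mx i j).
  rewrite funeqE => y; rewrite fct_sumE [LHS]matrix_sum_delta.
  by apply: eq_bigr => i _; rewrite fct_sumE.
by apply: differentiable_sum => i; apply: differentiable_sum => j; exact: differentiableZl.
Qed.

Lemma derive_entry f x v i j : differentiable f x ->
  ('D_v f x) i j = 'D_v (fun y => f y i j) x.
Proof. by move=> df; rewrite derive_mx ?mxE//; exact: diff_derivable. Qed.

Lemma ck_mx k U f : open U ->
  ck k U f <-> forall i j, ck k U (fun y => f y i j).
Proof.
move=> oU; elim: k f => [//|k IH] f; split=> [[f1 f2] i j|H].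
  split=> [x Ux|v]; first by have /differentiable_mxP := f1 x Ux; apply.
  have /IH/(_ i j) := f2 v; apply: ck_ext => // x Ux.
  by rewrite derive_entry//; exact: f1.
have f1 x : U x -> differentiable f x.
  by move=> Ux; apply/differentiable_mxP => i j; have [h _] := H i j; exact: h.
split=> // v; apply/IH => i j; have [_ /(_ v)] := H i j; apply: ck_ext => // x Ux.
by rewrite derive_entry//; exact: f1.
Qed.

Lemma smooth_mx U f : open U ->
  smooth_on U f <-> forall i j, smooth_on U (fun y => f y i j).
Proof.
move=> oU; split=> [/smooth_ck H i j|H].
  by apply/smooth_ck => k; have /(ck_mx _ _ oU) := H k; apply.
by apply/smooth_ck => k; apply/ck_mx => // i j; have /smooth_ck := H i j; apply.
Qed.

End Entries.

Section Matrices.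
Context {V : normedModType R}.
Implicit Types (U : set V).

Lemma smooth_mulmx U m n p (f : V -> 'M[R]_(m, n)) (g : V -> 'M[R]_(n, p)) :
  open U -> smooth_on U f -> smooth_on U g -> smooth_on U (fun x => f x *m g x).
Proof.
move=> oU /(smooth_mx _ oU) sf /(smooth_mx _ oU) sg; apply/smooth_mx => // i j.
apply: (@eq_smooth _ _ _ (fun x => \sum_l f x i l * g x l j)); last first.
  by move=> x; rewrite mxE.
by apply: smooth_sum => // l _; exact: smoothM.
Qed.

Lemma smoothZ U m n (c : V -> R) (f : V -> 'M[R]_(m, n)) :
  open U -> smooth_on U c -> smooth_on U f -> smooth_on U (fun x => c x *: f x).
Proof.
move=> oU sc /(smooth_mx _ oU) sf; apply/smooth_mx => // i j.
by apply: (eq_smooth (smoothM oU sc (sf i j))) => x; rewrite mxE.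
Qed.

Lemma smooth_det U n (f : V -> 'M[R]_n) :
  open U -> smooth_on U f -> smooth_on U (fun x => \det (f x)).
Proof.
move=> oU /(smooth_mx _ oU) sf; apply: smooth_sum => // s _.
apply: smoothM => //; first exact: smooth_cst.
by apply: smooth_prod => // i _; exact: sf.
Qed.

Lemma smooth_trmx U m n (f : V -> 'M[R]_(m, n)) :
  open U -> smooth_on U f -> smooth_on U (fun x => (f x)^T).
Proof.
move=> oU /(smooth_mx _ oU) sf; apply/smooth_mx => // i j.
by apply: (eq_smooth (sf j i)) => x; rewrite mxE.
Qed.

Lemma smooth_invmx U n (f : V -> 'M[R]_n) :
  open U -> (forall x, U x -> f x \in unitmx) ->
  smooth_on U f -> smooth_on U (fun x => invmx (f x)).
Proof.
move=> oU uf sf.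
suff : smooth_on U (fun x => (\det (f x))^-1 *: \adj (f x)).
  by apply: smooth_ext => // x Ux; rewrite /invmx uf.
apply: smoothZ => //.
  apply: smoothV => //; last exact: smooth_det.
  by move=> x /uf; rewrite unitmxE unitfE.
apply/smooth_mx => // i j.
apply: (@eq_smooth _ _ _ (fun x => (-1) ^+ (j + i) * \det (row' j (col' i (f x))))); last first.
  by move=> x; rewrite mxE.
apply: smoothM => //; first exact: smooth_cst.
apply: smooth_det => //; apply/smooth_mx => // k l.
have /(smooth_mx _ oU)/(_ (lift j k) (lift i l)) := sf.
by move/eq_smooth; apply=> x; rewrite !mxE.
Qed.

Lemma derive_mulmx m n p (f : V -> 'M[R]_(m, n)) (g : V -> 'M[R]_(n, p)) x v :
  differentiable f x -> differentiable g x ->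
  differentiable (fun y => f y *m g y) x /\
  'D_v (fun y => f y *m g y) x = 'D_v f x *m g x + f x *m 'D_v g x.
Proof.
move=> df dg; have /differentiable_mxP dfe := df; have /differentiable_mxP dge := dg.
have H i j : (fun y => (f y *m g y) i j) = \sum_k (fun y => f y i k * g y k j).
  by rewrite funeqE => y; rewrite mxE fct_sumE.
have dfg : differentiable (fun y => f y *m g y) x.
  apply/differentiable_mxP => i j; rewrite H.
  by apply: differentiable_sum => k; exact: differentiableM.
split=> //; apply/matrixP => i j; rewrite derive_entry// H derive_sum; last first.
  by move=> k; apply: diff_derivable; exact: differentiableM.
rewrite !mxE -big_split /=; apply: eq_bigr => k _.
rewrite deriveM; [|exact: diff_derivable|exact: diff_derivable].
by rewrite !derive_entry// addrC; congr (_ + _); rewrite /GRing.scale /= mulrC.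
Qed.

End Matrices.
End Smooth.

(** * Chain rule, mean values and symmetry of second derivatives *)

Section Chain.
Context {R : realType}.

Lemma derive_comp (U V W : normedModType R) (f : V -> W) (g : U -> V) x v :
  differentiable g x -> differentiable f (g x) ->
  differentiable (f \o g) x /\ 'D_v (f \o g) x = 'D_('D_v g x) f (g x).
Proof.
move=> dg df; have dfg : differentiable (f \o g) x by exact: differentiable_comp.
by split=> //; rewrite !deriveE// diff_comp.
Qed.

Lemma derive_sum_delta n (W : normedModType R) (f : 'rV[R]_n -> W) x v :
  differentiable f x -> 'D_v f x = \sum_i v 0 i *: 'D_(delta_mx 0 i) f x.
Proof.
move=> df; rewrite deriveE// [in LHS](row_sum_delta v) linear_sum.
by apply: eq_bigr => i _; rewrite linearZ deriveE.
Qed.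

Lemma deriveDl (V W : normedModType R) (f : V -> W) x u v : differentiable f x ->
  'D_(u + v) f x = 'D_u f x + 'D_v f x.
Proof. by move=> df; rewrite !deriveE// linearD. Qed.

Lemma deriveZl (V W : normedModType R) (f : V -> W) x c v : differentiable f x ->
  'D_(c *: v) f x = c *: 'D_v f x.
Proof. by move=> df; rewrite !deriveE// linearZ. Qed.

Lemma ck_sum (V W : normedModType R) k (U : set V) I (r : seq I) (F : I -> V -> W) :
  open U -> (forall i, ck k U (F i)) -> ck k U (fun x => \sum_(i <- r) F i x).
Proof.
move=> oU H; elim: r => [|i r IH].
  by rewrite (_ : (fun x => _) = fun=> 0); [exact: ck_cst|rewrite funeqE => x; rewrite big_nil].
rewrite (_ : (fun x => _) = fun x => F i x + \sum_(j <- r) F j x); first exact: ckD.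
by rewrite funeqE => x; rewrite big_cons.
Qed.

(** The direction ['D_v g x] moves with [x], whereas [ck] differentiates along constant directions;
    expanding it in coordinates turns the chain rule into a sum of products of maps of order [k]. *)
Lemma ck_comp n k (V : normedModType R) (U : set V) (U' : set 'rV[R]_n)
    (f : 'rV[R]_n -> R) (g : V -> 'rV[R]_n) :
  open U -> open U' -> (forall x, U x -> U' (g x)) ->
  ck k U' f -> ck k U g -> ck k U (f \o g).
Proof.
move=> oU oU' gU; elim: k f => // k IH f fk gk.
have [[f1 f2] [g1 g2]] := (fk, gk); split=> [x Ux|v].
  by apply: differentiable_comp; [exact: g1|apply: f1; exact: gU].
suff : ck k U (fun x => \sum_i ('D_v g x) 0 i * 'D_(delta_mx 0 i) f (g x)).
  apply: ck_ext => // x Ux; have dg := g1 x Ux; have df := f1 _ (gU x Ux).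
  by rewrite (derive_comp v dg df).2 derive_sum_delta.
apply: ck_sum => // i; apply: ckM => //.
  by have /(ck_mx _ _ oU) := g2 v; apply.
by apply: (ck_ext oU _ (IH ('D_(delta_mx 0 i) f) (f2 _) (ckS gk))).
Qed.

Lemma smooth_comp n m p (V : normedModType R) (U : set V) (U' : set 'rV[R]_n)
    (f : 'rV[R]_n -> 'M[R]_(m, p)) (g : V -> 'rV[R]_n) :
  open U -> open U' -> (forall x, U x -> U' (g x)) ->
  smooth_on U' f -> smooth_on U g -> smooth_on U (fun x => f (g x)).
Proof.
move=> oU oU' gU /(smooth_mx _ oU') sf /smooth_ck sg.
apply/smooth_mx => // i j; apply/smooth_ck => k.
apply: (@ck_comp _ _ _ U U' (fun y => f y i j)) => //.
by have /smooth_ck := sf i j; apply.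
Qed.

Lemma smooth_comp1 n (V : normedModType R) (U : set V) (U' : set 'rV[R]_n)
    (f : 'rV[R]_n -> R) (g : V -> 'rV[R]_n) :
  open U -> open U' -> (forall x, U x -> U' (g x)) ->
  smooth_on U' f -> smooth_on U g -> smooth_on U (fun x => f (g x)).
Proof.
move=> oU oU' gU /smooth_ck sf /smooth_ck sg.
by apply/smooth_ck => k; apply: (@ck_comp _ _ _ U U' f) => //.
Qed.

Lemma smooth_id (V : normedModType R) (U : set V) : smooth_on U (@id V).
Proof.
apply/smooth_ck => -[//|k]; split=> [x _|v].
  by have [] := @is_diff_id _ _ x.
rewrite (_ : 'D_v _ = fun=> v); first exact: ck_cst.
by rewrite funeqE => x; rewrite derive_id.
Qed.

Lemma smooth_coord n (U : set 'rV[R]_n) i : open U -> smooth_on U (fun x => x 0 i : R).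
Proof. by move=> oU; have /(smooth_mx _ oU) := smooth_id (U := U); apply. Qed.

Lemma ck_sqrt k (V : normedModType R) (U : set V) (f : V -> R) :
  open U -> (forall x, U x -> 0 < f x) ->
  ck k U f -> ck k U (fun x => Num.sqrt (f x)).
Proof.
move=> oU f0; elim: k f f0 => // k IH f f0 fk; have [f1 f2] := fk.
have ds x : U x -> differentiable (Num.sqrt : R -> R) (f x).
  by move=> Ux; apply/derivable1_diffP; have [] := is_derive1_sqrt (f0 x Ux).
split=> [x Ux|v].
  by apply: (differentiable_comp (f1 x Ux)); exact: ds.
have := ckM oU (ckM oU (ck_cst _ _ (2^-1 : R)) (ckV oU _ (IH _ f0 (ckS fk)))) (f2 v).
have sq0 x : U x -> Num.sqrt (f x) != 0 by move=> Ux; rewrite gt_eqF// sqrtr_gt0 f0.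
move=> /(_ sq0); apply: ck_ext => // x Ux.
rewrite [in RHS](derive_comp v (f1 x Ux) (ds x Ux)).2.
have := @deriveZl R R _ _ ('D_v f x) 1 (ds x Ux); rewrite [_ *: 1]mulr1 => ->.
by have [_ ->] := is_derive1_sqrt (f0 x Ux); rewrite -invfM mulrC.
Qed.

Lemma smooth_sqrt (V : normedModType R) (U : set V) (f : V -> R) :
  open U -> (forall x, U x -> 0 < f x) ->
  smooth_on U f -> smooth_on U (fun x => Num.sqrt (f x)).
Proof. by move=> oU f0 /smooth_ck a; apply/smooth_ck => k; exact: ck_sqrt. Qed.

Lemma is_derive_line (V W : normedModType R) (f : V -> W) x v (s : R) :
  differentiable f (s *: v + x) ->
  is_derive s 1 (fun s : R => f (s *: v + x)) ('D_v f (s *: v + x)).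
Proof.
move=> df; pose g := fun s : R => s *: v + x.
have dg : differentiable g s by [].
have Dg : 'D_1 g s = v.
  rewrite deriveD ?derive_cst ?addr0//; last first.
    exact: diff_derivable.
  by rewrite deriveE // diff_val scale1r.
have [h1 h2] := @derive_comp R V W f g s 1 dg df.
by apply: DeriveDef; [exact: diff_derivable|rewrite [LHS]h2 Dg].
Qed.

Lemma MVT_line (V : normedModType R) (f : V -> R) x v (t : R) : 0 < t ->
  (forall s, 0 <= s <= t -> differentiable f (s *: v + x)) ->
  exists2 s, 0 < s < t & f (t *: v + x) - f x = t * 'D_v f (s *: v + x).
Proof.
move=> t0 df.
have [||c] := @MVT R (fun s => f (s *: v + x)) (fun s => 'D_v f (s *: v + x)) 0 t t0.
- move=> s; rewrite in_itv /= => /andP[s0 st]; apply: is_derive_line.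
  by apply: df; rewrite !ltW.
- apply: derivable_within_continuous => s; rewrite in_itv /= => st.
  by have [] := is_derive_line (df s st).
- rewrite in_itv /= => ct; rewrite scale0r add0r subr0 mulrC => H.
  by exists c.
Qed.

(** Mean value theorem in direction [v] for [f (y + t w) - f y], followed by differentiability of
    ['D_v f] at the single point [x]. *)
Lemma second_difference (V : normedModType R) (f : V -> R) (x v w : V) :
  (\forall y \near x, differentiable f y) -> differentiable ('D_v f) x ->
  forall e : R, 0 < e -> \forall t \near (0 : R)^'+,
   `|(f (t *: v + (t *: w + x)) - f (t *: v + x) - f (t *: w + x) + f x)
     - t ^+ 2 * 'D_w ('D_v f) x| <= e * t ^+ 2.
Proof.
move=> nf dG e e0; set G := 'D_v f.
(* The two error terms together are governed by a length of at most [t (2 |v| + |w|)]; the last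
   summand keeps [M] positive. *)
pose M := 2 * `|v| + `|w| + 1.
have M0 : 0 < M by rewrite ltr_wpDl// addr_ge0// mulr_ge0.
have e'0 : 0 < e / M by rewrite divr_gt0.
have := diff_eps dG e'0 => /nbhs_ballP[d /= d0 dH].
move/nbhs_ballP : nf => [r /= r0 rH].
pose q := Num.min d r; have q0 : 0 < q by rewrite lt_min d0.
have tq0 : 0 < q / M by rewrite divr_gt0.
near=> t.
have t0 : 0 < t by [].
have tM : t * M < q by rewrite -ltr_pdivlMr//; near: t; exact: nbhs_right_lt.
have bnd (a b : R) : 0 <= a <= t -> 0 <= b <= t -> `|a *: v + b *: w| <= t * M.
  move=> /andP[a0 at_] /andP[b0 bt]; rewrite (le_trans (ler_normD _ _))// !normrZ.
  rewrite !ger0_norm//; have p1 := ler_wpM2r (normr_ge0 v) at_.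
  have p2 := ler_wpM2r (normr_ge0 w) bt; have := mulr_ge0 (ltW t0) (normr_ge0 v).
  by move: p1 p2; rewrite /M; lra.
have bd (a b : R) : 0 <= a <= t -> 0 <= b <= t ->
    `|G (a *: v + b *: w + x) - G x - 'd G x (a *: v + b *: w)| <= e / M * `|a *: v + b *: w|.
  move=> ha hb; apply: dH; rewrite -ball_normE /= sub0r normrN.
  by rewrite (le_lt_trans (bnd _ _ ha hb))// (lt_le_trans tM)// ge_min lexx.
have df (a b : R) : 0 <= a <= t -> 0 <= b <= t -> differentiable f (a *: v + (b *: w + x)).
  move=> ha hb; apply: rH; rewrite -ball_normE /= addrA distrC addrK.
  by rewrite (le_lt_trans (bnd _ _ ha hb))// (lt_le_trans tM)// ge_min lexx orbT.
have t00 : 0 <= t <= t by rewrite lexx ltW.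
have z00 : 0 <= (0 : R) <= t by rewrite lexx ltW.
pose g y := f (y + t *: w) - f y.
have dg s : 0 <= s <= t -> differentiable g (s *: v + x).
  move=> hs; apply: differentiableB; last first.
    by have := df s 0 hs z00; rewrite scale0r add0r.
  apply: (@differentiable_comp _ _ _ _ (fun y => y + t *: w) f) => //.
  by rewrite -addrA [x + _]addrC; exact: df.
have [c /andP[c0 ct]] := MVT_line t0 dg.
have hc : 0 <= c <= t by rewrite !ltW.
have -> : 'D_v g (c *: v + x) = G (c *: v + t *: w + x) - G (c *: v + 0 *: w + x).
  rewrite scale0r addr0 /g deriveB; last 2 first.
  - apply: diff_derivable; apply: (@differentiable_comp _ _ _ _ (fun y => y + t *: w) f) => //.
    by rewrite -addrA [x + _]addrC; exact: df.
  - by apply: diff_derivable; have := df c 0 hc z00; rewrite scale0r add0r.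
  congr (_ - _); have [//||_] := @derive_comp _ _ _ f (fun y => y + t *: w) (c *: v + x) v.
    by rewrite -addrA [x + _]addrC; exact: df.
  rewrite /comp => ->; rewrite deriveD// derive_id derive_cst addr0.
  by rewrite -addrA [x + _]addrC addrA.
have -> : f (t *: v + (t *: w + x)) - f (t *: v + x) - f (t *: w + x) + f x
     = g (t *: v + x) - g x.
  rewrite /g -[t *: v + x + _]addrA [x + _]addrC.
  by move: (f (t *: v + (t *: w + x))) (f _) (f _) (f x) => *; ring.
move=> ->; rewrite expr2 -mulrA -mulrBr normrM gtr0_norm// mulrCA ler_pM2l//.
rewrite deriveE//.
have -> : t * 'd G x w = 'd G x (c *: v + t *: w) - 'd G x (c *: v + 0 *: w).
  by rewrite scale0r addr0 -linearB addrC addKr linearZ.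
have := bd c t hc t00; have := bd c 0 hc z00.
set A := G (c *: v + 0 *: w + x); set B := G (c *: v + t *: w + x) => hA hB.
set A' := 'd G x (c *: v + 0 *: w); set B' := 'd G x (c *: v + t *: w).
rewrite (_ : _ - _ = (B - G x - B') - (A - G x - A')); last first.
  by move: (A) (B) (A') (B') (G x) => *; ring.
rewrite (le_trans (ler_normB _ _))// (le_trans (lerD hB hA))//.
rewrite -mulrDr -mulrA ler_pM2l// ler_pdivrMl//.
rewrite scale0r addr0 (le_trans (lerD (ler_normD _ _) (lexx _)))// !normrZ.
rewrite !ger0_norm ?ltW//; have := ler_wpM2r (normr_ge0 v) (ltW ct).
by move: (ltW t0); rewrite /M; lra.
Unshelve. all: by end_near. Qed.

(** The second difference does not change when [v] and [w] are exchanged, and both mixed derivatives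
    approximate it. *)
Lemma schwarz (V : normedModType R) (U : set V) (f : V -> R) x v w :
  open U -> smooth_on U f -> U x -> 'D_w ('D_v f) x = 'D_v ('D_w f) x.
Proof.
move=> oU sf Ux.
have nf : \forall y \near x, differentiable f y.
  by apply: open_near oU Ux _ => y; exact: smooth_diff.
have dv u : differentiable ('D_u f) x by apply: smooth_diff Ux; exact: smooth_derive.
apply/eqP; rewrite -subr_eq0 -normr_le0; apply/ler_addgt0Pr => e e0; rewrite add0r.
have e20 : 0 < e / 2 by rewrite divr_gt0.
have H1 := second_difference w nf (dv v) e20.
have H2 := second_difference v nf (dv w) e20.
have [t [[h1 h2] t0]] := filter_ex (filterI (filterI H1 H2) (nbhs_right_gt 0)).
have {}t0 : 0 < t ^+ 2 by rewrite exprn_gt0.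
rewrite -(ler_pM2r t0) -[X in _ * X <= _](gtr0_norm t0) -normrM.
move: h1 h2; rewrite /= [t *: w + (t *: v + x)]addrCA.
set A := f (t *: v + _); set B := f (t *: v + x); set C := f (t *: w + x).
set P := 'D_w ('D_v f) x; set Q := 'D_v ('D_w f) x => h1 h2.
have -> : (P - Q) * t ^+ 2 = (A - C - B + f x - t ^+ 2 * Q) - (A - B - C + f x - t ^+ 2 * P).
  by ring.
by rewrite (le_trans (ler_normB _ _))// (le_trans (lerD h2 h1))// -mulrDl -splitr.
Qed.

Lemma schwarz_mx (V : normedModType R) (U : set V) m n (f : V -> 'M[R]_(m, n)) x v w :
  open U -> smooth_on U f -> U x -> 'D_w ('D_v f) x = 'D_v ('D_w f) x.
Proof.
move=> oU sf Ux; apply/matrixP => i j.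
have E u u' : ('D_u ('D_u' f) x) i j = 'D_u ('D_u' (fun y => f y i j)) x.
  rewrite derive_entry; last by apply: smooth_diff Ux; exact: smooth_derive.
  apply: (@eq_on_derive _ _ _ U) => // y Uy.
  by rewrite derive_entry//; exact: smooth_diff sf Uy.
have sfij := (smooth_mx f oU).1 sf i j.
exact: (etrans (E w v) (etrans (schwarz v w oU sfij Ux) (esym (E v w)))).
Qed.

Lemma ball_segment (V : normedModType R) (x y : V) (r s : R) :
  ball x r y -> 0 <= s <= 1 -> ball x r (s *: (y - x) + x).
Proof.
rewrite -!ball_normE /= => xy /andP[s0 s1].
rewrite distrC addrK normrZ ger0_norm// distrC (le_lt_trans _ xy)// ler_piMl//.
Qed.

Lemma constant_on_ball (V : normedModType R) (f : V -> R) x (r : R) :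
  (forall y, ball x r y -> differentiable f y /\ forall v, 'D_v f y = 0) ->
  forall y, ball x r y -> f y = f x.
Proof.
move=> H y xy; have H1 s : 0 <= s <= 1 -> differentiable f (s *: (y - x) + x).
  by move=> hs; have [] := H _ (ball_segment xy hs).
have [s /andP[s0 s1]] := MVT_line ltr01 H1.
have hs : 0 <= s <= 1 by rewrite !ltW.
have [_ ->] := H _ (ball_segment xy hs).
by rewrite mulr0 scale1r subrK => /eqP; rewrite subr_eq0 => /eqP.
Qed.

End Chain.

(** * The inverse function theorem *)

(** Completeness is what Banach's fixed point theorem asks for in [inverse_function_id]. *)
HB.instance Definition _ (R : realType) (m n : nat) :=
  Uniform_isComplete.Build 'M[R]_(m, n) (@mx_complete R m n).

Section Jacobi.
Context {R : realType} {V : normedModType R}.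

Lemma derive_prod n (F : 'I_n -> V -> R) x v :
  (forall i, differentiable (F i) x) ->
  differentiable (fun y => \prod_i F i y) x /\
  'D_v (fun y => \prod_i F i y) x =
  \sum_i \prod_j (if j == i then 'D_v (F j) x else F j x).
Proof.
elim: n F => [|n IH] F dF.
  rewrite (_ : (fun y => _) = fun=> 1); last by rewrite funeqE => y; rewrite big_ord0.
  by rewrite derive_cst big_ord0.
have [d1 d2] := IH (fun i => F (lift ord0 i)) (fun i => dF _).
rewrite (_ : (fun y => _) = fun y => F ord0 y * \prod_i F (lift ord0 i) y); last first.
  by rewrite funeqE => y; rewrite big_ord_recl.
split; first exact: differentiableM.
rewrite deriveM; [|exact: diff_derivable|exact: diff_derivable].
rewrite d2 big_ord_recl [RHS]addrC; congr (_ + _).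
  rewrite /GRing.scale /= mulr_sumr; apply: eq_bigr => i _.
  by rewrite big_ord_recl.
rewrite big_ord_recl eqxx /GRing.scale /= mulrC; congr (_ * _).
Qed.

(** Jacobi's formula. The Leibniz expansion is differentiated one row at a time; the determinant
    with row [i] differentiated is expanded along that row, whose cofactors do not see the
    change. *)
Lemma derive_det n (f : V -> 'M[R]_n) x v : differentiable f x ->
  'D_v (fun y => \det (f y)) x = \tr ('D_v f x *m \adj (f x)).
Proof.
move=> df; have /differentiable_mxP dfe := df.
have dp (s : 'S_n) : differentiable (fun y => \prod_i f y i (s i)) x.
  by have [] := derive_prod v (fun i => dfe i (s i)).
have E : (fun y => \det (f y)) = fun y => \sum_(s : 'S_n) (-1) ^+ s * \prod_i f y i (s i) by [].
have H : 'D_v (fun y => \det (f y)) x =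
    \sum_(s : 'S_n) (-1) ^+ s * 'D_v (fun y => \prod_i f y i (s i)) x.
  rewrite E; elim: (index_enum _) => [|s r IH].
    rewrite big_nil (_ : (fun y => _) = fun=> 0) ?derive_cst//.
    by rewrite funeqE => y; rewrite big_nil.
  rewrite big_cons -IH (_ : (fun y => _) = (fun y => (-1) ^+ s * \prod_i f y i (s i)) +
     (fun y => \sum_(s <- r) (-1) ^+ s * \prod_i f y i (s i))); last first.
    by rewrite funeqE => y; rewrite big_cons.
  rewrite deriveD; first by rewrite deriveMl//; exact: diff_derivable.
    by apply: diff_derivable; apply: differentiableM.
  apply: diff_derivable; elim: r {IH} => [|s' r IH].
    rewrite (_ : (fun y => _) = fun=> 0) //.
    by rewrite funeqE => y; rewrite big_nil.
  rewrite (_ : (fun y => _) = (fun y => (-1) ^+ s' * \prod_i f y i (s' i)) +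
     (fun y => \sum_(s <- r) (-1) ^+ s * \prod_i f y i (s i))); last first.
    by rewrite funeqE => y; rewrite big_cons.
  by apply: differentiableD => //; apply: differentiableM.
pose M i : 'M[R]_n := \matrix_(j, k) if j == i then ('D_v f x) j k else f x j k.
rewrite H (eq_bigr (fun s : 'S_n => \sum_i (-1) ^+ s * \prod_j M i j (s j))); last first.
  move=> s _; rewrite (derive_prod v (fun i => dfe i (s i))).2 mulr_sumr.
  apply: eq_bigr => i _; congr (_ * _); apply: eq_bigr => j _; rewrite mxE.
  by case: eqP => // _; rewrite derive_entry.
rewrite exchange_big /=; apply: eq_bigr => i _.
rewrite -[LHS]/(\det (M i)) (expand_det_row _ i) mxE; apply: eq_bigr => j _.
rewrite mxE eqxx mxE; congr (_ * _); rewrite /cofactor; congr (_ * \det _).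
by apply/matrixP => k l; rewrite !mxE eq_sym (negbTE (neq_lift i k)).
Qed.

End Jacobi.

Section InverseFunction.
Context {R : realType}.

Lemma jacobianE n m (f : 'rV[R]_n -> 'rV[R]_m) x i j : differentiable f x ->
  jacobian f x i j = ('D_(delta_mx 0 i) f x) 0 j.
Proof. by move=> df; rewrite deriveE// /jacobian /lin1_mx mxE. Qed.

Lemma smooth_jacobian n m (U : set 'rV[R]_n) (f : 'rV[R]_n -> 'rV[R]_m) :
  open U -> smooth_on U f -> smooth_on U (jacobian f).
Proof.
move=> oU sf; apply/smooth_mx => // i j.
have /(smooth_derive (delta_mx 0 i))/(smooth_mx _ oU)/(_ 0 j) := sf.
apply: smooth_ext => // x Ux; rewrite jacobianE//; exact: smooth_diff Ux.
Qed.

Lemma mx_norm_entry m n (A : 'M[R]_(m, n)) i j : `|A i j| <= `|A|.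
Proof. by rewrite [leRHS]/Num.Def.normr /= mx_normrE; exact: (le_bigmax _ _ (i, j)). Qed.

Lemma mx_norm_le m n (A : 'M[R]_(m, n)) (c : R) : 0 <= c ->
  (forall i j, `|A i j| <= c) -> `|A| <= c.
Proof.
by move=> c0 H; rewrite [leLHS]/Num.Def.normr /= mx_normrE bigmax_le// => -[i j] _; exact: H.
Qed.

Lemma mulmx_bounded n m (A : 'M[R]_(n, m)) :
  exists2 c : R, 0 < c & forall v : 'rV_n, `|v *m A| <= c * `|v|.
Proof.
exists (n%:R * `|A| + 1) => [|v]; first by rewrite ltr_wpDl// mulr_ge0.
apply: mx_norm_le => [|i j]; first by rewrite mulr_ge0// addr_ge0// mulr_ge0.
rewrite mxE (le_trans (ler_norm_sum _ _ _))//.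
apply: (@le_trans _ _ (\sum_(k < n) `|v| * `|A|)).
  by apply: ler_sum => k _; rewrite normrM ler_pM// mx_norm_entry.
by rewrite sumr_const card_ord -[leLHS]mulr_natl mulrDl mul1r [`|v| * _]mulrC mulrA lerDl.
Qed.

Lemma mulmxr_continuous n m (A : 'M[R]_(n, m)) : continuous (mulmxr A : 'rV_n -> 'rV_m).
Proof.
have [c c0 H] := mulmx_bounded A.
apply/linear_bounded_continuous/linear_boundedP.
near=> r => v; rewrite (le_trans (H v))// ler_wpM2r//; near: r; exact: nbhs_pinfty_ge.
Unshelve. all: by end_near. Qed.

Lemma smooth_continuous (V W : normedModType R) (U : set V) (f : V -> W) x :
  smooth_on U f -> U x -> {for x, continuous f}.
Proof. by move=> sf Ux; apply: differentiable_continuous; exact: smooth_diff Ux. Qed.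

Lemma lipschitz_on_ball n m (E : 'rV[R]_n -> 'rV[R]_m) (x0 : 'rV[R]_n) (r c : R) :
  (forall x, ball x0 r x -> differentiable E x /\ forall v, `|'D_v E x| <= c * `|v|) ->
  forall x y, ball x0 r x -> ball x0 r y -> `|E y - E x| <= c * `|y - x|.
Proof.
move=> H x y Bx By.
have Bs s : 0 <= s <= 1 -> ball x0 r (s *: (y - x) + x).
  move: Bx By; rewrite -!ball_normE /= => Bx By /andP[s0 s1].
  have -> : x0 - (s *: (y - x) + x) = (1 - s) *: (x0 - x) + s *: (x0 - y).
    by apply/matrixP => i j; rewrite !mxE; ring.
  rewrite (le_lt_trans (ler_normD _ _))// !normrZ !ger0_norm ?subr_ge0//.
  have [->|s0'] := eqVneq s 0; first by rewrite subr0 mul1r mul0r addr0.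
  have s0'' : 0 < s by rewrite lt_neqAle eq_sym s0'.
  apply: (@lt_le_trans _ _ ((1 - s) * r + s * r)); last by rewrite -mulrDl subrK mul1r.
  by apply: ler_ltD; [rewrite ler_wpM2l ?subr_ge0// ltW|rewrite ltr_pM2l].
have c0 : 0 <= c * `|y - x|.
  by apply: le_trans (_ : 0 <= `|'D_(y - x) E x|) _ => //; apply: (H x Bx).2.
apply: mx_norm_le => // i j.
have dE s : 0 <= s <= 1 -> differentiable (fun z => E z i j) (s *: (y - x) + x).
  by move=> /Bs/H[/differentiable_mxP dE _]; exact: dE.
have [s /andP[s0 s1]] := MVT_line ltr01 dE.
have hs : 0 <= s <= 1 by rewrite !ltW.
have [d1 d2] := H _ (Bs s hs).
rewrite scale1r subrK mul1r -derive_entry// !mxE => ->.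
exact: le_trans (mx_norm_entry _ _ _) (d2 _).
Qed.

Lemma derive_small_near n m (U : set 'rV[R]_n) (E : 'rV[R]_n -> 'rV[R]_m) x0 (c : R) :
  0 < c -> open U -> smooth_on U E -> U x0 -> jacobian E x0 = 0 ->
  \forall x \near x0, forall v, `|'D_v E x| <= c * `|v|.
Proof.
move=> c0 oU sE Ux0 J0.
have sJ := smooth_jacobian oU sE.
have Jc := smooth_continuous sJ Ux0.
(* A matrix product sums [n] entries; adding 1 keeps the denominator positive for [n = 0]. *)
pose d := c / (n%:R + 1); have d0 : 0 < d by rewrite divr_gt0// ltr_wpDl.
have N1 : \forall x \near x0, `|jacobian E x| < d.
  have /cvgrPdist_lt/(_ d d0) := Jc; rewrite J0.
  by apply: filterS => x; rewrite sub0r normrN.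
have N2 : \forall x \near x0, U x by exact: open_nbhs_nbhs.
apply: filterS2 N1 N2 => x Jx Ux v.
rewrite deriveEjacobian; last exact: smooth_diff Ux.
apply: mx_norm_le => [|i j]; first by rewrite mulr_ge0// ltW.
rewrite mxE (le_trans (ler_norm_sum _ _ _))//.
apply: (@le_trans _ _ (\sum_(k < n) `|v| * d)).
  apply: ler_sum => k _; rewrite normrM ler_pM// ?mx_norm_entry//.
  by rewrite (le_trans (mx_norm_entry _ _ _))// ltW.
rewrite sumr_const card_ord -mulr_natl mulrCA mulrC ler_wpM2r//.
rewrite /d mulrA ler_pdivrMr ?ltr_wpDl//.
by rewrite mulrDr mulr1 mulrC lerDl ltW.
Qed.

(** With [K = id - E] and [E] contracting by one half near [x0], solving [K x = y] means finding the
    fixed point of [x -> y + E x]. The same contraction makes [K] injective with inverse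
    2-Lipschitz, which is enough to differentiate the inverse. *)
Lemma inverse_function_id n (U : set 'rV[R]_n) (K : 'rV[R]_n -> 'rV[R]_n) x0 :
  open U -> smooth_on U K -> U x0 -> jacobian K x0 = 1%:M ->
  exists (U0 V0 : set 'rV[R]_n) (H : 'rV[R]_n -> 'rV[R]_n),
    [/\ open U0, U0 `<=` U, U0 x0, open V0 &
      [/\ forall x, U0 x -> V0 (K x) /\ H (K x) = x,
          forall y, V0 y -> U0 (H y) /\ K (H y) = y & smooth_on V0 H]].
Proof.
move=> oU sK Ux0 J1.
pose E := fun x => x - K x.
have sE : smooth_on U E by apply: smoothB => //; exact: smooth_id.
have JE : jacobian E x0 = 0.
  apply/row_matrixP => i; rewrite row0 rowE -deriveEjacobian; last exact: smooth_diff Ux0.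
  rewrite deriveB; [|exact: derivable_id|exact: smooth_derivable Ux0].
  by rewrite derive_id deriveEjacobian ?J1 ?mulmx1 ?subrr//; exact: smooth_diff Ux0.
have h0 : 0 < (2^-1 : R) by rewrite invr_gt0.
have : \forall x \near x0, U x /\ forall v, `|'D_v E x| <= 2^-1 * `|v|.
  by apply: filterI; [exact: open_nbhs_nbhs|exact: derive_small_near oU sE Ux0 JE].
move=> /nbhs_ballP[r /= r0 rH].
have LE := lipschitz_on_ball (fun x Bx => conj (smooth_diff sE (rH x Bx).1) (rH x Bx).2).
have Kinj x y : ball x0 r x -> ball x0 r y -> `|y - x| <= 2 * `|K y - K x|.
  move=> Bx By; have := LE x y Bx By.
  have -> : E y - E x = (y - x) - (K y - K x).
    by apply/matrixP => i j; rewrite !mxE; ring.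
  move=> h; have := lerB_dist (y - x) (K y - K x).
  have := normr_ge0 (y - x).
  lra.
(* Half the radius keeps the closed ball inside the ball of the Lipschitz bound. For [y] within
   [r' / 2] of [K x0], the map [x -> y + E x] stays within [r' / 2 + r' / 2] of [x0]. *)
pose r' := r / 2; have r'0 : 0 < r' by rewrite divr_gt0.
have r'r x : ball x0 r' x -> ball x0 r x.
  by rewrite -!ball_normE /= => /lt_trans; apply; rewrite /r' ltr_pdivrMr// ltr_pMr// ltr1n.
pose V1 := ball (K x0) (r' / 2).
have surj y : V1 y -> exists x, ball x0 r' x /\ K x = y.
  rewrite /V1 -!ball_normE /= => yV.
  pose B := closed_ball_ Num.norm x0 r'.
  have BB x : B x -> ball x0 r x.
    rewrite -ball_normE /B /closed_ball_ /= => /le_lt_trans; apply.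
    by rewrite /r' ltr_pdivrMr// ltr_pMr// ltr1n.
  have Bx0 : ball x0 r x0 by exact: ballxx.
  pose T := fun x => y + E x.
  have TE x : B x -> `|x0 - T x| < r'.
    move=> Bx; have := LE x0 x Bx0 (BB x Bx).
    move: Bx; rewrite /B /closed_ball_ /= distrC => Bx h.
    have -> : x0 - T x = (K x0 - y) - (E x - E x0).
      by apply/matrixP => i j; rewrite !mxE; ring.
    rewrite (le_lt_trans (ler_normB _ _))//.
    rewrite [ltRHS](_ : _ = r' / 2 + 2^-1 * r'); last by field.
    apply: ltr_leD => //; rewrite (le_trans h)// ler_pM2l//.
  have TB : {homo T : x / B x >-> B x} by move=> x Bx; apply/ltW/TE.
  have ctr : is_contraction (mkfun_fun TB).
    exists (NngNum (ltW h0)); split; first by rewrite /= invf_lt1// ltr1n.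
    move=> [x z] [/= Bx Bz]; rewrite /mkfun /T opprD addrACA subrr add0r.
    exact: LE (BB _ Bz) (BB _ Bx).
  have Bne : B !=set0 by exists x0; rewrite /B /closed_ball_ /= subrr normr0 ltW.
  have [x Bx xT] := banach_fixed_point ctr (@closed_closed_ball_ _ _ _ _) Bne.
  exists x; split; first by rewrite {1}xT; exact: TE.
  move: xT; rewrite /= /mkfun /T /E addrCA => /eqP.
  by rewrite -subr_eq0 opprD addNKr oppr_eq0 subr_eq0 => /eqP.
pose H y := xget x0 [set x | ball x0 r' x /\ K x = y].
have HP y : V1 y -> ball x0 r' (H y) /\ K (H y) = y.
  by move=> /surj [x hx]; rewrite /H; case: xgetP => [z _ //|/(_ x)]; case.
have oV : open V1 by exact: ball_open.
have HL y z : V1 y -> V1 z -> `|H z - H y| <= 2 * `|z - y|.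
  move=> /HP[hy Ky] /HP[hz Kz]; rewrite -{2}Kz -{2}Ky; apply: Kinj; exact: r'r.
have uJ x : ball x0 r x -> jacobian K x \in unitmx.
  move=> /rH[Ux sx]; rewrite -row_free_unit; apply: inj_row_free => v v0.
  have := sx v; rewrite deriveB; [|exact: derivable_id|exact: smooth_derivable Ux].
  rewrite derive_id deriveEjacobian; last exact: smooth_diff Ux.
  rewrite v0 subr0 => h; apply/eqP; rewrite -normr_eq0 eq_le normr_ge0 andbT.
  lra.
have dH y : V1 y -> is_diff y H (mulmxr (invmx (jacobian K (H y)))).
  move=> Vy; have [Hy Ky] := HP y Vy; have uJy := uJ _ (r'r _ Hy).
  have [Ux _] := rH _ (r'r _ Hy).
  apply: diff_epsP; first exact: mulmxr_continuous.
  move=> e e0; have [c c0 cH] := mulmx_bounded (invmx (jacobian K (H y))).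
  have e'0 : 0 < e / (2 * c) by rewrite divr_gt0// mulr_gt0.
  have /nbhs_ballP[d /= d0 dd] := diff_eps (smooth_diff sK Ux) e'0.
  have N1 : \forall k \near (0 : 'rV[R]_n), V1 (k + y).
    have : \forall z \near y, V1 z by exact: (open_nbhs_nbhs (conj oV Vy)).
    by rewrite (near_shift 0 y) subr0.
  have N2 : \forall k \near (0 : 'rV[R]_n), `|k| < d / 2.
    apply/nbhs_ballP; exists (d / 2); first by rewrite /= divr_gt0.
    by move=> k; rewrite -ball_normE /= sub0r normrN.
  apply: filterS2 N1 N2 => k Vk kd.
  have := HL y (k + y) Vy Vk; rewrite addrK => hk.
  pose h := H (k + y) - H y.
  have hd : ball 0 d h.
    rewrite -ball_normE /= sub0r normrN (le_lt_trans hk)//.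
    by rewrite mulrC -ltr_pdivlMr.
  have := dd h hd; rewrite /h subrK (HP _ Vk).2 Ky addrK -/h.
  rewrite -deriveE ?deriveEjacobian; [|exact: smooth_diff Ux|exact: smooth_diff Ux].
  move=> hh; have -> : h - k *m invmx (jacobian K (H y)) =
     - ((k - h *m jacobian K (H y)) *m invmx (jacobian K (H y))).
    by rewrite mulmxBl mulmxK// opprB.
  rewrite normrN (le_trans (cH _))//.
  rewrite (@le_trans _ _ (c * (e / (2 * c) * (2 * `|k|))))//.
    by rewrite ler_pM2l// (le_trans hh)// ler_pM2l.
  by rewrite le_eqVlt; apply/orP; left; apply/eqP; field; rewrite gt_eqF.
have DH y v : V1 y -> 'D_v H y = v *m invmx (jacobian K (H y)).
  by move=> Vy; have [d1 d2] := dH y Vy; rewrite deriveE// d2.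
exists (ball x0 r' `&` K @^-1` V1), V1, H; split.
- rewrite openE => x [Bx Vx]; apply: filterI; first exact: open_nbhs_nbhs (conj (ball_open _ _) Bx).
  have Kc := smooth_continuous sK (rH _ (r'r _ Bx)).1.
  exact: Kc (open_nbhs_nbhs (conj oV Vx)).
- by move=> x [/r'r/rH[]].
- by split; [exact: ballxx|apply: ballxx; rewrite divr_gt0].
- exact: oV.
split.
- move=> x [Bx Vx]; split=> //; have [h1 h2] := HP _ Vx.
  have := Kinj x (H (K x)) (r'r _ Bx) (r'r _ h1); rewrite h2 subrr normr0 mulr0 normr_le0.
  by rewrite subr_eq0 => /eqP.
- by move=> y Vy; have [h1 h2] := HP y Vy; split=> //; split=> //; rewrite /preimage /= h2.
(* Bootstrap: the derivative of [H] is a smooth function of [H], so order [k] of [H] gives order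
   [k + 1]. *)
apply/smooth_ck; elim=> // k IH; split=> [y Vy|v]; first by have [] := dH y Vy.
suff : ck k V1 (fun y => v *m invmx (jacobian K (H y))).
  by apply: ck_ext => // y Vy; rewrite DH.
have oB : open (ball x0 r) by exact: ball_open.
apply/ck_mx => // i j.
apply: (@ck_comp _ _ _ _ V1 (ball x0 r) (fun x => (v *m invmx (jacobian K x)) i j)) => //.
  by move=> y /HP[/r'r].
have sI : smooth_on (ball x0 r) (fun x => v *m invmx (jacobian K x)).
  apply: smooth_mulmx => //; first exact: smooth_cst.
  apply: smooth_invmx => //; apply: smooth_subset (smooth_jacobian oU sK).
  by move=> x /rH[].
exact: ((smooth_ck _ _).1 ((smooth_mx _ oB).1 sI i j)).
Qed.

Lemma smooth_mulmxr n m (U : set 'rV[R]_n) (A : 'M[R]_(n, m)) :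
  open U -> smooth_on U (fun x => x *m A).
Proof.
by move=> oU; apply: smooth_mulmx => //; [exact: smooth_id|exact: smooth_cst].
Qed.

Theorem inverse_function n (U : set 'rV[R]_n) (G : 'rV[R]_n -> 'rV[R]_n) x0 :
  open U -> smooth_on U G -> U x0 -> jacobian G x0 \in unitmx ->
  exists (U0 V0 : set 'rV[R]_n) (H : 'rV[R]_n -> 'rV[R]_n),
    [/\ open U0, U0 `<=` U, U0 x0, open V0 &
      [/\ forall x, U0 x -> V0 (G x) /\ H (G x) = x,
          forall y, V0 y -> U0 (H y) /\ G (H y) = y & smooth_on V0 H]].
Proof.
move=> oU sG Ux0 uJ; pose A := invmx (jacobian G x0).
have uA : A \in unitmx by rewrite unitmx_inv.
pose K x := G x *m A.
have sK : smooth_on U K by apply: smooth_mulmx => //; exact: smooth_cst.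
have J1 : jacobian K x0 = 1%:M.
  apply/row_matrixP => i; rewrite !rowE -deriveEjacobian; last exact: smooth_diff Ux0.
  rewrite (derive_mulmx _ (smooth_diff sG Ux0) (differentiable_cst _ _)).2.
  rewrite derive_cst mulmx0 addr0 deriveEjacobian; last exact: smooth_diff Ux0.
  by rewrite mulmxK// mulmx1.
have [U0 [V0 [H [oU0 U0U U0x oV0 [HK KH sH]]]]] := inverse_function_id oU sK Ux0 J1.
have oV : open [set y : 'rV[R]_n | V0 (y *m A)].
  rewrite openE => y Vy.
  exact: mulmxr_continuous (open_nbhs_nbhs (conj oV0 Vy)).
exists U0, [set y | V0 (y *m A)], (fun y => H (y *m A)); split=> //; split=> [x|y|].
- exact: HK.
- move=> /KH[h1 h2]; split=> //; move: h2; rewrite /K => /(congr1 (mulmxr (invmx A))) /=.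
  by rewrite !mulmxK.
- by apply: (smooth_comp oV oV0 _ sH) => //; exact: smooth_mulmxr.
Qed.

End InverseFunction.

(** * Pointwise symmetry and its normal form *)

Section Point.
Context {R : realType}.
Implicit Types (u v w z e x y : 'rV[R]_3) (g : 'M[R]_3).
Variables (h : 'rV[R]_3 -> 'rV[R]_3 -> R) (K : 'rV[R]_3 -> 'rV[R]_3 -> 'rV[R]_3)
  (S : 'rV[R]_3 -> 'rV[R]_3).

Record point_structure : Prop := PointStructure {
  metric_linear : forall c u v w, h (c *: u + v) w = c * h u w + h v w;
  metric_sym : forall v w, h v w = h w v;
  metric_pos : forall v, v != 0 -> 0 < h v v;
  shape_linear : forall c u v, S (c *: u + v) = c *: S u + S v;
  shape_sym : forall v w, h (S v) w = h v (S w);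
  cubic_linear : forall c u v w, K (c *: u + v) w = c *: K u w + K v w;
  cubic_sym : forall v w, K v w = K w v;
  cubic_totally_sym : forall v w z, h (K v w) z = h (K v z) w;
  apolar : forall v, \tr (\matrix_i K v (delta_mx 0 i)) = 0 }.

Definition point_symmetry : set 'M[R]_3 :=
  [set g | [/\ 0 < \det g, forall v w, h (v *m g) (w *m g) = h v w,
      forall v, S (v *m g) = S v *m g
    & forall v w, K (v *m g) (w *m g) = K v w *m g]].

Definition orthonormal e x y :=
  [/\ h e e = 1, h x x = 1, h y y = 1 & [/\ h e x = 0, h e y = 0 & h x y = 0]].

(** [K_e] is diag(2 mu, - mu, - mu) and [S] is diag(lam, a, a) for the splitting into [e] and its
    orthogonal plane; written without a frame of the plane, which is not canonical. *)
Definition normal_form e (mu lam a : R) :=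
  [/\ h e e = 1, forall v, K e v = - mu *: v + (3 * mu * h v e) *: e
    & forall v, S v = a *: v + ((lam - a) * h v e) *: e].

Hypothesis pt : point_structure.
Let hL := metric_linear pt.
Let hC := metric_sym pt.

Lemma hDl u v w : h (u + v) w = h u w + h v w.
Proof. by rewrite -[u]scale1r hL mul1r scale1r. Qed.
Lemma h0l w : h 0 w = 0.
Proof. by apply: (addrI (h 0 w)); rewrite -hDl !addr0. Qed.
Lemma hZl c v w : h (c *: v) w = c * h v w.
Proof. by rewrite -[c *: v]addr0 hL h0l addr0. Qed.
Lemma hNl v w : h (- v) w = - h v w.
Proof. by rewrite -scaleN1r hZl mulN1r. Qed.
Lemma hDr u v w : h w (u + v) = h w u + h w v.
Proof. by rewrite hC hDl ![h _ w]hC. Qed.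
Lemma hZr c v w : h w (c *: v) = c * h w v.
Proof. by rewrite hC hZl [h _ w]hC. Qed.
Lemma hNr v w : h w (- v) = - h w v.
Proof. by rewrite hC hNl [h _ w]hC. Qed.
Lemma h0r w : h w 0 = 0.
Proof. by rewrite hC h0l. Qed.
Lemma h_eq0 v : h v v = 0 -> v = 0.
Proof. by move=> v0; apply/eqP; apply: contraPT (ltxx (0 : R)) => /(metric_pos pt); rewrite v0 => ->. Qed.
Lemma KDl u v w : K (u + v) w = K u w + K v w.
Proof. by rewrite -[u]scale1r (cubic_linear pt) !scale1r. Qed.
Lemma K0l w : K 0 w = 0.
Proof. by apply: (addrI (K 0 w)); rewrite -KDl !addr0. Qed.
Lemma KZl c v w : K (c *: v) w = c *: K v w.
Proof. by rewrite -[c *: v]addr0 (cubic_linear pt) K0l addr0. Qed.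
Lemma KNl v w : K (- v) w = - K v w.
Proof. by rewrite -scaleN1r KZl scaleN1r. Qed.
Lemma KDr u v w : K w (u + v) = K w u + K w v.
Proof. by rewrite (cubic_sym pt) KDl ![K _ w](cubic_sym pt). Qed.
Lemma KZr c v w : K w (c *: v) = c *: K w v.
Proof. by rewrite (cubic_sym pt) KZl [K _ w](cubic_sym pt). Qed.
Lemma KNr v w : K w (- v) = - K w v.
Proof. by rewrite (cubic_sym pt) KNl [K _ w](cubic_sym pt). Qed.
Lemma SD u v : S (u + v) = S u + S v.
Proof. by rewrite -[u]scale1r (shape_linear pt) !scale1r. Qed.
Lemma S0 : S 0 = 0.
Proof. by apply: (addrI (S 0)); rewrite -SD !addr0. Qed.
Lemma SZ c v : S (c *: v) = c *: S v.
Proof. by rewrite -[c *: v]addr0 (shape_linear pt) S0 addr0. Qed.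
Lemma SN v : S (- v) = - S v.
Proof. by rewrite -scaleN1r SZ scaleN1r. Qed.
Definition hE := (hDl, hDr, hZl, hZr, hNl, hNr, h0l, h0r).

Definition frame_mx e x y : 'M[R]_3 := col_mx e (col_mx x y).

Lemma frame_mx_row e x y :
  [/\ row 0 (frame_mx e x y) = e, row 1 (frame_mx e x y) = x
    & row 2 (frame_mx e x y) = y].
Proof.
split; apply/rowP => j; rewrite mxE mxE; case: splitP => k /= hk.
- by rewrite ord1.
- by [].
- by case: k hk => -[].
- by rewrite mxE; case: splitP => l /= hl; [rewrite ord1|move: hk; rewrite hl].
- by case: k hk => -[].
- rewrite mxE; case: splitP => l /= hl; last by rewrite ord1.
  by move: hk; rewrite hl; case: l hl => -[].
Qed.

Lemma ord3P (P : 'I_3 -> Prop) : P 0 -> P 1 -> P 2 -> forall i, P i.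
Proof.
move=> P0 P1 P2 [[|[|[|//]]] hi].
- by rewrite (_ : Ordinal _ = 0)//; exact/val_inj.
- by rewrite (_ : Ordinal _ = 1)//; exact/val_inj.
- by rewrite (_ : Ordinal _ = 2)//; exact/val_inj.
Qed.

Lemma sum3 (V : nmodType) (F : 'I_3 -> V) : \sum_i F i = F 0 + F 1 + F 2.
Proof.
rewrite !big_ord_recl big_ord0 addr0 addrA.
by congr (_ + F _ + F _); exact/val_inj.
Qed.

Lemma mul_frame_mx (c : 'rV[R]_3) e x y :
  c *m frame_mx e x y = c 0 0 *: e + c 0 1 *: x + c 0 2 *: y.
Proof.
have [r0 r1 r2] := frame_mx_row e x y.
by rewrite mulmx_sum_row sum3 r0 r1 r2.
Qed.

Lemma orthonormal_coef e x y (p q r : R) : orthonormal e x y ->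
  [/\ h (p *: e + q *: x + r *: y) e = p, h (p *: e + q *: x + r *: y) x = q
    & h (p *: e + q *: x + r *: y) y = r].
Proof.
move=> [ee xx yy [ex ey xy]]; rewrite !hE ee xx yy ex ey xy !(hC x e, hC y e, hC y x) ex ey xy.
by split; ring.
Qed.

Lemma frame_unit e x y : orthonormal e x y -> frame_mx e x y \in unitmx.
Proof.
move=> o; rewrite -row_free_unit; apply: inj_row_free => c.
rewrite mul_frame_mx => c0; have := orthonormal_coef (c 0 0) (c 0 1) (c 0 2) o.
rewrite c0 !h0l => -[a b d]; apply/rowP => i; rewrite mxE.
by elim/ord3P: i.
Qed.

Lemma orthonormal_decomp e x y v : orthonormal e x y ->
  v = h v e *: e + h v x *: x + h v y *: y.
Proof.
move=> o; have u := frame_unit o.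
rewrite -[v in LHS](mulmxKV u) -[v in RHS](mulmxKV u) mul_frame_mx.
set c := _ *m invmx _.
by have [-> -> ->] := orthonormal_coef (c 0 0) (c 0 1) (c 0 2) o.
Qed.

Lemma normalize v : v != 0 -> exists2 c : R, 0 < c & h (c *: v) (c *: v) = 1.
Proof.
move=> /(metric_pos pt) v0; exists (Num.sqrt (h v v))^-1.
  by rewrite invr_gt0 sqrtr_gt0.
rewrite !hE mulrA -invfM -expr2 sqr_sqrtr ?ltW// mulVf// gt_eqF//.
Qed.

Lemma h_rows v w : h v w = (v *m (\col_i h (delta_mx 0 i) w)) 0 0.
Proof.
rewrite [v in LHS]row_sum_delta mxE.
elim/big_ind2: _ => [|a b c d <- <-|i _]; [by rewrite h0l|by rewrite hDl|].
by rewrite hZl mxE.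
Qed.

Lemma exists_orthogonal x y : exists2 z : 'rV[R]_3, z != 0 & h z x = 0 /\ h z y = 0.
Proof.
pose A : 'M[R]_(3, 1 + 1) := row_mx (\col_i h (delta_mx 0 i) x) (\col_i h (delta_mx 0 i) y).
have : kermx A != 0.
  rewrite -mxrank_eq0 mxrank_ker subn_eq0 -ltnNge.
  exact: leq_ltn_trans (rank_leq_col A) _.
move=> /rowV0Pn[z /sub_kermxP zA z0]; exists z => //.
by move: zA; rewrite mul_mx_row -row_mx0 => /eq_row_mx[zx zy]; rewrite !h_rows zx zy !mxE.
Qed.

Lemma orthonormal_extend2 e x : h e e = 1 -> h x x = 1 -> h e x = 0 ->
  exists y, orthonormal e x y.
Proof.
move=> ee xx ex; have [z z0 [ze zx]] := exists_orthogonal e x.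
have [c c0 cz] := normalize z0; exists (c *: z).
by split=> //; split=> //; rewrite hE hC ?ze ?zx mulr0.
Qed.

Lemma orthonormal_extend e : h e e = 1 -> exists x y, orthonormal e x y.
Proof.
move=> ee; have [z z0 [ze _]] := exists_orthogonal e e.
have [c c0 cz] := normalize z0.
have ez : h e (c *: z) = 0 by rewrite hE hC ze mulr0.
by have [y o] := orthonormal_extend2 ee cz ez; exists (c *: z), y.
Qed.

Definition metric_mx := \matrix_(i, j) h (delta_mx 0 i) (delta_mx 0 j) : 'M[R]_3.

Lemma metric_mxE v w : h v w = (v *m metric_mx *m w^T) 0 0.
Proof.
rewrite h_rows -mulmxA; congr ((_ *m _) 0 0); apply/colP => i; rewrite !mxE.
rewrite hC h_rows mxE; apply: eq_bigr => j _; rewrite !mxE mulrC hC; congr (_ * _).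
Qed.

Lemma metric_mx_unit : metric_mx \in unitmx.
Proof.
rewrite -row_free_unit; apply: inj_row_free => v v0; apply: h_eq0.
by rewrite metric_mxE v0 mul0mx mxE.
Qed.

Lemma mx_entryE n m (A : 'M[R]_(n, m)) i j :
  A i j = ((delta_mx 0 i : 'rV_n) *m A *m (delta_mx 0 j : 'rV_m)^T) 0 0.
Proof. by rewrite trmx_delta -rowE -colE !mxE. Qed.

Lemma symmetry_metric g : (forall v w, h (v *m g) (w *m g) = h v w) ->
  g *m metric_mx *m g^T = metric_mx.
Proof.
move=> H; apply/matrixP => i j; have := H (delta_mx 0 i) (delta_mx 0 j).
by rewrite !metric_mxE trmx_mul (mx_entryE (g *m _ *m _)) (mx_entryE metric_mx) !mulmxA.
Qed.

Lemma frame_coord v e x y : orthonormal e x y ->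
  [/\ (v *m invmx (frame_mx e x y)) 0 0 = h v e,
      (v *m invmx (frame_mx e x y)) 0 1 = h v x
    & (v *m invmx (frame_mx e x y)) 0 2 = h v y].
Proof.
move=> o; have u := frame_unit o; set c := _ *m _.
have -> : v = c *m frame_mx e x y by rewrite mulmxKV.
by rewrite mul_frame_mx; have [-> -> ->] := orthonormal_coef (c 0 0) (c 0 1) (c 0 2) o.
Qed.

Lemma trace_orthonormal (A : 'M[R]_3) e x y : orthonormal e x y ->
  \tr A = h (e *m A) e + h (x *m A) x + h (y *m A) y.
Proof.
move=> o; have u := frame_unit o; set M := frame_mx e x y in u.
have -> : \tr A = \tr (M *m A *m invmx M) by rewrite mxtrace_mulC mulmxA mulVmx// mul1mx.
rewrite /mxtrace sum3.
have D i : (M *m A *m invmx M) i i = ((row i M *m A) *m invmx M) 0 i.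
  by rewrite -!row_mul [RHS]mxE.
have [r0 r1 r2] := frame_mx_row e x y.
rewrite !D r0 r1 r2.
by have [-> _ _] := frame_coord (e *m A) o; have [_ -> _] := frame_coord (x *m A) o;
   have [_ _ ->] := frame_coord (y *m A) o.
Qed.

Lemma mul_rows_K v w : w *m (\matrix_i K v (delta_mx 0 i)) = K v w.
Proof.
rewrite mulmx_sum_row [w in RHS]row_sum_delta.
elim/big_ind2: _ => [|a b c d -> ->|i _]; [by rewrite (cubic_sym pt) K0l|by rewrite KDr|].
by rewrite rowK KZr.
Qed.

Lemma apolar_orthonormal e x y v : orthonormal e x y ->
  h (K v e) e + h (K v x) x + h (K v y) y = 0.
Proof. by move=> o; have := apolar pt v; rewrite (trace_orthonormal _ o) !mul_rows_K. Qed.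

(** * Normal form from a symmetry of order three *)

Section OrderThree.
Variables (g : 'M[R]_3).
Hypotheses (Gg : point_symmetry g) (g3 : g *m g *m g = 1%:M) (g1 : g != 1%:M).

Let hg v w : h (v *m g) (w *m g) = h v w. Proof. by case: Gg. Qed.
Let g3v v : v *m g *m g *m g = v. Proof. by rewrite -!mulmxA [g *m (g *m g)]mulmxA g3 mulmx1. Qed.

Lemma order3_det : \det g = 1.
Proof.
have [d0 _ _ _] := Gg; have : (\det g) ^+ 3 = 1 ^+ 3.
  by rewrite expr1n !exprS expr0 mulr1 mulrA -!det_mulmx g3 det1.
by move/pexpIrn => -> //; rewrite nnegrE ?ler01// ltW.
Qed.

(** A rotation in odd dimension has a fixed vector: invariance of the metric relates [g - 1] to
    minus its transpose, so in dimension three [det (g - 1)] equals its own opposite. *)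
Lemma order3_fixed : exists2 e, h e e = 1 & e *m g = e.
Proof.
have gH := symmetry_metric hg.
have E : (g - 1%:M) *m metric_mx *m g^T = - (metric_mx *m (g - 1%:M)^T).
  by rewrite !mulmxBl gH mul1mx linearB /= trmx1 mulmxBr mulmx1 opprB.
have := congr1 determinant E; rewrite -mulmxN !det_mulmx det_tr order3_det mulr1 mulrC.
move/(mulfI _); rewrite -unitfE -unitmxE => /(_ metric_mx_unit).
rewrite -[X in _ = \det X]scaleN1r detZ det_tr -signr_odd /= expr1 mulN1r => dd.
have {}dd : \det (g - 1%:M) = 0 by lra.
have : kermx (g - 1%:M) != 0.
  by rewrite kermx_eq0 row_free_unit unitmxE unitfE dd eqxx.
move=> /rowV0Pn[z /sub_kermxP zA z0].
have [c c0 cz] := normalize z0; exists (c *: z) => //.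
move: zA; rewrite mulmxBr mulmx1 => /eqP; rewrite subr_eq0 => /eqP zg.
by rewrite -scalemxAl zg.
Qed.

Variable e : 'rV[R]_3.
Hypotheses (ee : h e e = 1) (eg : e *m g = e).

Let perp v : h v e = 0 -> h (v *m g) e = 0.
Proof. by move=> ve; rewrite -[in LHS]eg hg. Qed.

(** A second fixed direction would leave only a factor [t] on the third axis, with [t ^ 2 = 1] by
    isometry and [t ^ 3 = 1] by the order, so [g] would be the identity. *)
Lemma order3_no_fixed v : h v e = 0 -> v *m g = v -> v = 0.
Proof.
move=> ve vg; apply/eqP; apply: contraT => v0; have [c c0 cv] := normalize v0.
set x := c *: v in cv; have xg : x *m g = x by rewrite -scalemxAl vg.
have ex : h e x = 0 by rewrite hZr hC ve mulr0.
have [y o] := orthonormal_extend2 ee cv ex; have [_ _ yy [_ ey xy]] := o.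
have yg := orthonormal_decomp (y *m g) o.
have ye : h (y *m g) e = 0 by rewrite perp// hC.
have yx : h (y *m g) x = 0 by rewrite -[in LHS]xg hg hC.
rewrite ye yx !scale0r !add0r in yg; set t := h _ _ in yg.
have t1 : t * t = 1 by have := hg y y; rewrite yg !hE yy mulr1.
have t3 : t * t * t = 1.
  have := congr1 (h^~ y) (g3v y); rewrite yg -!scalemxAl yg -scalemxAl yg !hE yy.
  by rewrite mulr1 mulrA.
have t11 : t = 1 by rewrite -t3 t1 mul1r.
suff : g = 1%:M by move/eqP; rewrite (negbTE g1).
apply: (can_inj (mulKmx (frame_unit o))); rewrite mulmx1.
have [r0 r1 r2] := frame_mx_row e x y.
apply/row_matrixP; apply: ord3P; rewrite row_mul ?r0 ?r1 ?r2 //.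
by rewrite yg t11 scale1r.
Qed.

Lemma order3_sum v : h v e = 0 -> v + v *m g + v *m g *m g = 0.
Proof.
move=> ve; apply: order3_no_fixed; first by rewrite !hDl ve !perp// !addr0.
by rewrite !mulmxDl g3v addrC addrA.
Qed.

(** A third of a turn preserves no line of the plane orthogonal to [e], so a self-adjoint operator
    commuting with it is scalar there. The off-diagonal entry [be] is isolated by computing
    [h (T x) (x *m g)] in two ways. *)
Lemma order3_commute (T : 'rV[R]_3 -> 'rV[R]_3) :
  (forall u v, T (u + v) = T u + T v) -> (forall c v, T (c *: v) = c *: T v) ->
  (forall v w, h (T v) w = h v (T w)) -> (forall v, T (v *m g) = T v *m g) ->
  exists t t1, forall v, T v = t *: v + ((t1 - t) * h v e) *: e.
Proof.
move=> TD TZ Ts Tg.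
have Te : T e = h (T e) e *: e.
  apply/eqP; rewrite -subr_eq0; apply/eqP; apply: order3_no_fixed.
    by rewrite hDl hNl hZl ee mulr1 subrr.
  by rewrite mulmxBl -scalemxAl -Tg eg.
have [x [y o]] := orthonormal_extend ee; have [_ xx yy [ex ey xy]] := o.
have [xe ye yx] : [/\ h x e = 0, h y e = 0 & h y x = 0] by split; rewrite hC.
have Txe : h (T x) e = 0 by rewrite Ts Te hZr xe mulr0.
have Tye : h (T y) e = 0 by rewrite Ts Te hZr ye mulr0.
have Dx := orthonormal_decomp (T x) o; have Dy := orthonormal_decomp (T y) o.
have Dg := orthonormal_decomp (x *m g) o.
rewrite Txe Tye perp// !scale0r !add0r in Dx Dy Dg.
set al := h (T x) x in Dx; set be := h (T x) y in Dx.
have bey : h (T y) x = be by rewrite Ts hC.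
rewrite bey in Dy; set de := h (T y) y in Dy.
set c := h (x *m g) x in Dg; set s := h (x *m g) y in Dg.
have cs : c * c + s * s = 1.
  by have := hg x x; rewrite Dg !hE xx yy xy yx !mulr0 !mulr1 !addr0 !add0r.
have xgg : x *m g *m g = - x - x *m g.
  have /eqP := order3_sum xe; rewrite addrC addr_eq0 => /eqP ->.
  by rewrite opprD.
(* The orbit of [x] sums to zero and [h (x g g) x = h x (x g) = c], hence [c = - 1 - c]. *)
have c2 : c = - 2^-1.
  have : h (x *m g *m g) x = c.
    have -> : h (x *m g *m g) x = h (x *m g *m g) (x *m g *m g *m g) by rewrite g3v.
    by rewrite !hg hC.
  rewrite xgg hDl !hNl xx -/c; lra.
have s0 : s != 0 by apply/eqP => s0; move: cs; rewrite s0 c2; lra.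
have yg : h (y *m g) x = - s.
  have : h (y *m g) x = h (x *m g *m g) y.
    by rewrite -[in LHS](g3v x) hg hC.
  by rewrite xgg hDl !hNl xy oppr0 add0r.
have be0 : be = 0.
  have H1 : h (T x) (x *m g) = al * c + be * s by rewrite Dx Dg !hE xx yy xy yx; ring.
  have H2 : h (T x) (x *m g) = al * c - be * s.
    rewrite Ts Tg Dx mulmxDl -!scalemxAl hDr !hZr [h x (x *m g)]hC [h x (y *m g)]hC yg -/c; ring.
  have : be * s = 0 by lra.
  by move/eqP; rewrite mulf_eq0 (negbTE s0) orbF => /eqP.
rewrite be0 ?scale0r ?addr0 ?add0r in Dx Dy.
have dea : de = al.
  have : h (T (x *m g)) y = h (T x *m g) y by rewrite Tg.
  rewrite Dx -scalemxAl Dg TD !TZ Dx Dy !hE yy xy.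
  rewrite !mulr0 !mulr1 !add0r mulrC => /eqP; rewrite -subr_eq0 -mulrBl mulf_eq0 (negbTE s0) orbF.
  by rewrite subr_eq0 => /eqP.
exists al, (h (T e) e) => v.
rewrite [in LHS](orthonormal_decomp v o) !TD !TZ Dx Dy dea {1}Te.
have := orthonormal_decomp v o; move: (h v e) (h v x) (h v y) => p q r ->.
by apply/rowP => j; rewrite !mxE; ring.
Qed.

End OrderThree.

(** Both [S] and [K_e] are self-adjoint and commute with [g]; apolarity makes the eigenvalue of
    [K_e] on [e] minus twice the one on the plane. *)
Lemma order3_normal_form g : point_symmetry g -> g *m g *m g = 1%:M -> g != 1%:M ->
  exists e mu lam a, normal_form e mu lam a /\ e *m g = e.
Proof.
move=> Gg g3 g1; have [e ee eg] := order3_fixed Gg g3.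
have [_ _ gS gK] := Gg.
have [a [lam HS]] := order3_commute Gg g3 g1 ee eg SD SZ (shape_sym pt) gS.
have Ksym v w : h (K e v) w = h v (K e w).
  by rewrite (cubic_totally_sym pt) hC.
have gKe v : K e (v *m g) = K e v *m g by rewrite -[in LHS]eg gK.
have [k [k1 HK]] := order3_commute Gg g3 g1 ee eg (fun u v => KDr u v e) (fun c v => KZr c v e) Ksym gKe.
exists e, (- k), lam, a; split=> //; split=> // v.
have [x [y o]] := orthonormal_extend ee.
have := apolar_orthonormal e o; have [_ xx yy [ex ey xy]] := o.
rewrite !HK !hDl !hZl ee xx yy !(hC x e) !(hC y e) ex ey => tr.
rewrite opprK; congr (_ + _ *: _); congr (_ * _); lra.
Qed.

(* [l] and [m] are the coefficients of the harmonic cubic form that [K] induces on the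
   plane orthogonal to [e]. *)
Definition frame_form e x y (mu l m lam a : R) :=
  orthonormal e x y /\
  [/\ K e e = (2 * mu) *: e, K e x = - mu *: x, K e y = - mu *: y &
    [/\ K x x = - mu *: e + l *: x + m *: y, K x y = m *: x - l *: y,
        K y y = - mu *: e - l *: x - m *: y &
      [/\ S e = lam *: e, S x = a *: x & S y = a *: y]]].

(** Total symmetry reads the [e]-components of [K] on the plane from [K_e]; the vanishing traces of
    [K_x] and [K_y] leave two free coefficients. *)
Lemma normal_frame_form e x y mu lam a : normal_form e mu lam a ->
  orthonormal e x y ->
  frame_form e x y mu (h (K x x) x) (h (K x x) y) lam a.
Proof.
move=> [ee HK HS] o; split=> //; have [_ xx yy [ex ey xy]] := o.
have [xe ye yx] : [/\ h x e = 0, h y e = 0 & h y x = 0] by split; rewrite hC.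
have KE v w : h (K v w) e = - mu * h v w + 3 * mu * h v e * h w e.
  by rewrite (cubic_totally_sym pt) (cubic_sym pt) HK hDl !hZl (hC e w).
have Tx := apolar_orthonormal x o; have Ty := apolar_orthonormal y o.
have Kxe v : h (K v e) e = 2 * mu * h v e by rewrite KE ee; ring.
rewrite Kxe xe mulr0 add0r in Tx; rewrite Kxe ye mulr0 add0r in Ty.
have Kxyx : h (K x y) x = h (K x x) y by rewrite (cubic_totally_sym pt).
have Kxyy : h (K x y) y = - h (K x x) x by lra.
have Kyyx : h (K y y) x = - h (K x x) x.
  by rewrite (cubic_totally_sym pt) (cubic_sym pt).
have Kyyy : h (K y y) y = - h (K x x) y.
  by move: Ty; rewrite (cubic_sym pt y x) Kxyx; lra.
split; rewrite ?HK ?ee ?xe ?ye ?mulr0 ?scale0r ?addr0 //.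
  by rewrite mulr1 -scalerDl; congr (_ *: _); ring.
split.
- rewrite [LHS](orthonormal_decomp _ o) KE xx xe; congr (_ *: _ + _ + _); ring.
- rewrite [LHS](orthonormal_decomp _ o) KE xy xe Kxyx Kxyy; apply/rowP => j; rewrite !mxE; ring.
- rewrite [LHS](orthonormal_decomp _ o) KE yy ye Kyyx Kyyy !scaleNr.
  by congr (_ - _ - _); rewrite -scaleNr; congr (_ *: _); ring.
split; rewrite HS ?ee ?xe ?ye ?mulr0 ?scale0r ?addr0 //.
by rewrite mulr1 scalerBl addrC subrK.
Qed.

Definition comb e x y (p q r : R) := p *: e + q *: x + r *: y.

Lemma frame_form_K e x y mu l m lam a p q r p' q' r' : frame_form e x y mu l m lam a ->
  K (comb e x y p q r) (comb e x y p' q' r') = comb e x y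
    (2 * mu * p * p' - mu * q * q' - mu * r * r')
    (- mu * (p * q' + q * p') + l * (q * q' - r * r') + m * (q * r' + r * q'))
    (- mu * (p * r' + r * p') + m * (q * q' - r * r') - l * (q * r' + r * q')).
Proof.
move=> [_ [Kee Kex Key [Kxx Kxy Kyy _]]].
rewrite /comb !KDl !KDr !KZl !KZr (cubic_sym pt x e) (cubic_sym pt y e) (cubic_sym pt y x).
rewrite Kee Kex Key Kxx Kxy Kyy.
by apply/rowP => j; rewrite !mxE; ring.
Qed.

Lemma frame_form_S e x y mu l m lam a p q r : frame_form e x y mu l m lam a ->
  S (comb e x y p q r) = comb e x y (lam * p) (a * q) (a * r).
Proof.
move=> [_ [_ _ _ [_ _ _ [Se Sx Sy]]]].
by rewrite /comb !SD !SZ Se Sx Sy; apply/rowP => j; rewrite !mxE; ring.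
Qed.

Lemma h_comb e x y p q r p' q' r' : orthonormal e x y ->
  h (comb e x y p q r) (comb e x y p' q' r') = p * p' + q * q' + r * r'.
Proof.
move=> o; have [ee xx yy [ex ey xy]] := o.
rewrite /comb !hE ee xx yy (hC x e) (hC y e) (hC y x) ex ey xy; ring.
Qed.

(** Orthonormal frames of the same orientation with equal structure constants are exchanged by a
    symmetry. Every explicit symmetry below is produced in this way. *)
Lemma frame_form_change e x y e' x' y' mu l m lam a (P : 'M[R]_3) :
  frame_form e x y mu l m lam a ->
  frame_form e' x' y' mu l m lam a ->
  frame_mx e' x' y' = P *m frame_mx e x y -> 0 < \det P ->
  exists g, [/\ point_symmetry g, e *m g = e', x *m g = x' & y *m g = y'].
Proof.
move=> ff ff' MP dP; have [on _] := ff; have [on' _] := ff'.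
have u := frame_unit on.
pose g := invmx (frame_mx e x y) *m frame_mx e' x' y'.
have gM : frame_mx e x y *m g = frame_mx e' x' y' by rewrite mulKVmx.
have [r0 r1 r2] := frame_mx_row e x y; have [r0' r1' r2'] := frame_mx_row e' x' y'.
have ge : e *m g = e' by rewrite -[in LHS]r0 -row_mul gM.
have gx : x *m g = x' by rewrite -[in LHS]r1 -row_mul gM.
have gy : y *m g = y' by rewrite -[in LHS]r2 -row_mul gM.
have gc p q r : comb e x y p q r *m g = comb e' x' y' p q r.
  by rewrite /comb !mulmxDl -!scalemxAl ge gx gy.
exists g; split=> //; split.
- rewrite /g MP !det_mulmx det_inv mulrCA mulVr ?mulr1//.
- move=> v w; rewrite (orthonormal_decomp v on) (orthonormal_decomp w on).
  by rewrite -!/(comb _ _ _ _ _ _) !gc !h_comb.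
- move=> v; rewrite (orthonormal_decomp v on) -/(comb _ _ _ _ _ _) gc.
  by rewrite (frame_form_S _ _ _ ff) (frame_form_S _ _ _ ff') gc.
- move=> v w; rewrite (orthonormal_decomp v on) (orthonormal_decomp w on).
  by rewrite -!/(comb _ _ _ _ _ _) !gc (frame_form_K _ _ _ _ _ _ ff) (frame_form_K _ _ _ _ _ _ ff') gc.
Qed.

Lemma frame_form_signs e x y mu l m lam a : frame_form e x y mu l m lam a ->
  frame_form e (- x) (- y) mu (- l) (- m) lam a.
Proof.
move=> [on [Kee Kex Key [Kxx Kxy Kyy [Se Sx Sy]]]]; have [ee xx yy [ex ey xy]] := on.
split; first by rewrite /orthonormal !hNl !hNr !opprK ?oppr0 ex ey oppr0.
rewrite !KNr !KNl !opprK !SN Kex Key Kxx Kxy Kyy Sx Sy !scalerN.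
by split=> //; split=> //; apply/rowP => j; rewrite !mxE; ring.
Qed.

Lemma comb_orthonormal e x y (P : 'M[R]_3) : orthonormal e x y -> P *m P^T = 1%:M ->
  orthonormal (comb e x y (P 0 0) (P 0 1) (P 0 2)) (comb e x y (P 1 0) (P 1 1) (P 1 2))
    (comb e x y (P 2 0) (P 2 1) (P 2 2)).
Proof.
move=> on PP; rewrite /orthonormal !h_comb//.
have E i j : P i 0 * P j 0 + P i 1 * P j 1 + P i 2 * P j 2 = (i == j)%:R.
  by have /matrixP/(_ i j) := PP; rewrite !mxE sum3 !mxE.
by rewrite !E.
Qed.

Lemma comb_frame_mx e x y (P : 'M[R]_3) :
  frame_mx (comb e x y (P 0 0) (P 0 1) (P 0 2)) (comb e x y (P 1 0) (P 1 1) (P 1 2))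
    (comb e x y (P 2 0) (P 2 1) (P 2 2)) = P *m frame_mx e x y.
Proof.
have [r0 r1 r2] := frame_mx_row (comb e x y (P 0 0) (P 0 1) (P 0 2))
  (comb e x y (P 1 0) (P 1 1) (P 1 2)) (comb e x y (P 2 0) (P 2 1) (P 2 2)).
by apply/row_matrixP; apply: ord3P; rewrite row_mul mul_frame_mx ?r0 ?r1 ?r2 !mxE.
Qed.

Lemma symmetry_of_rotation e x y mu l m lam a (P : 'M[R]_3) :
  let e' := comb e x y (P 0 0) (P 0 1) (P 0 2) in
  let x' := comb e x y (P 1 0) (P 1 1) (P 1 2) in
  let y' := comb e x y (P 2 0) (P 2 1) (P 2 2) in
  frame_form e x y mu l m lam a -> P *m P^T = 1%:M -> 0 < \det P ->
  [/\ K e' e' = (2 * mu) *: e', K e' x' = - mu *: x', K e' y' = - mu *: y' &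
    [/\ K x' x' = - mu *: e' + l *: x' + m *: y', K x' y' = m *: x' - l *: y',
        K y' y' = - mu *: e' - l *: x' - m *: y' &
      [/\ S e' = lam *: e', S x' = a *: x' & S y' = a *: y']]] ->
  exists g, [/\ point_symmetry g, e *m g = e', x *m g = x' & y *m g = y'].
Proof.
move=> e' x' y' ff PP dP H; have [on _] := ff.
apply: (frame_form_change ff (conj (comb_orthonormal on PP) H) (comb_frame_mx e x y P) dP).
Qed.

Definition mx33 (p q r p' q' r' p'' q'' r'' : R) : 'M[R]_3 :=
  \matrix_(i, j) nth 0 (nth [::] [:: [:: p; q; r]; [:: p'; q'; r']; [:: p''; q''; r'']] i) j.

Lemma det3 (A : 'M[R]_3) : \det A = A 0 0 * (A 1 1 * A 2 2 - A 1 2 * A 2 1)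
  - A 0 1 * (A 1 0 * A 2 2 - A 1 2 * A 2 0) + A 0 2 * (A 1 0 * A 2 1 - A 1 1 * A 2 0).
Proof.
have [f fA] : exists f : nat -> nat -> R, forall i j, A i j = f i j.
  by exists (fun i j => A (inord i) (inord j)) => i j; rewrite !inord_val.
rewrite (expand_det_row _ 0) sum3 /cofactor !(expand_det_row _ 0) !big_ord_recl !big_ord0.
by rewrite /cofactor !det_mx11 !mxE !fA /= /bump /=; ring.
Qed.

(** Converse of [order3_normal_form]: a harmonic cubic form on a plane is invariant under a third of
    a turn. Here [s] is the sine of that angle. *)
Lemma rotation_symmetry e x y mu l m lam a : frame_form e x y mu l m lam a ->
  exists r s, [/\ point_symmetry r, e *m r = e, s != 0,
    x *m r = - 2^-1 *: x + s *: y & y *m r = - s *: x - 2^-1 *: y].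
Proof.
move=> ff; pose d : R := Num.sqrt 3.
have d2 : d ^+ 2 = 3 by rewrite sqr_sqrtr.
have d0 : d != 0 by apply/eqP => d0; move: d2; rewrite d0; lra.
pose s := d / 2; have s0 : s != 0 by rewrite mulf_neq0// invr_eq0.
pose P := mx33 1 0 0 0 (- 2^-1) s 0 (- s) (- 2^-1).
have [||//|g [Gg ge gx gy]] := symmetry_of_rotation (P := P) ff.
- apply/matrixP; apply: ord3P; apply: ord3P; rewrite !mxE sum3 !mxE /= /s; by field: d2.
- by rewrite det3 !mxE /= /s (_ : _ + _ = 1)//; field: d2.
- have K3 := frame_form_K _ _ _ _ _ _ ff; rewrite !K3 !(frame_form_S _ _ _ ff) /comb !mxE /= /s.
  by split; [| | |split; [| | |split]]; apply/rowP => j; rewrite !mxE; field: d2.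
exists g, s; split=> //.
  by rewrite ge /comb !mxE /= !scale0r scale1r !addr0.
  by rewrite gx /comb !mxE /= scale0r add0r.
rewrite gy /comb !mxE /= scale0r add0r; apply/rowP => j; rewrite !mxE; ring.
Qed.

(** Turning the plane by [t] turns the pair [(l, m)] by [3 t]. The second coefficient of the turned
    frame, the function [f] of the proof, changes sign between 0 and [pi], so it vanishes
    somewhere. *)
Lemma exists_diagonal_frame e x y mu l m lam a : normal_form e mu lam a ->
  frame_form e x y mu l m lam a ->
  exists x' y' l', frame_form e x' y' mu l' 0 lam a /\ l' ^+ 2 = l ^+ 2 + m ^+ 2.
Proof.
move=> nf ff; have [on _] := ff.
pose A (t : R) := l * (cos t * cos t - sin t * sin t) + 2 * m * (cos t * sin t).
pose B (t : R) := m * (cos t * cos t - sin t * sin t) - 2 * l * (cos t * sin t).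
pose f (t : R) := - sin t * A t + cos t * B t.
have fc : {within `[0, pi], continuous f}.
  apply: continuous_subspaceT => t; rewrite /f.
  have cc : cos x @[x --> t] --> cos t by exact: continuous_cos.
  have cs : sin x @[x --> t] --> sin t by exact: continuous_sin.
  have k (c : R) : (c : R) @[_ --> t] --> c by exact: cvg_cst.
  have cA : A x @[x --> t] --> A t.
    rewrite /A; apply: cvgD; apply: cvgM; [exact: k| |exact: k|exact: cvgM].
    by apply: cvgB; exact: cvgM.
  have cB : B x @[x --> t] --> B t.
    rewrite /B; apply: cvgB; apply: cvgM; [exact: k| |exact: k|exact: cvgM].
    by apply: cvgB; exact: cvgM.
  by apply: cvgD; apply: cvgM => //; exact: cvgN.
have f0 : f 0 = m by rewrite /f /A /B sin0 cos0; ring.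
have fpi : f pi = - m by rewrite /f /A /B sinpi cospi; ring.
have [|t _ ft] := IVT (pi_ge0 R) fc (v := 0).
  by rewrite f0 fpi; rewrite ge_min le_max; case: (leP 0 m) => hm; rewrite ?oppr_le0 ?hm ?oppr_ge0 ?(ltW hm) ?orbT.
move: ft; rewrite /f; have : A t ^+ 2 + B t ^+ 2 = (l ^+ 2 + m ^+ 2) * (cos t ^+ 2 + sin t ^+ 2) ^+ 2.
  by rewrite /A /B; ring.
rewrite cos2Dsin2 expr1n mulr1 => AB ft.
pose c := cos t; pose s := sin t; have cs : c ^+ 2 + s ^+ 2 = 1 by exact: cos2Dsin2.
pose P := mx33 1 0 0 0 c s 0 (- s) c.
have PP : P *m P^T = 1%:M.
  apply/matrixP; apply: ord3P; apply: ord3P; rewrite !mxE sum3 !mxE /= ?mulr0 ?mul0r ?add0r ?addr0; nra.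
have := comb_orthonormal on PP.
have -> : comb e x y (P 0 0) (P 0 1) (P 0 2) = e.
  by rewrite /comb !mxE /= !scale0r scale1r !addr0.
set x' := comb _ _ _ _ _ _; set y' := comb _ _ _ _ _ _ => on'.
exists x', y', (h (K x' x') x'); have := normal_frame_form nf on'.
have -> : h (K x' x') y' = 0.
  rewrite (frame_form_K _ _ _ _ _ _ ff) h_comb// !mxE /= -[RHS]ft /A /B -/c -/s; ring.
split=> //; rewrite -AB -[RHS]mul1r -cs.
have -> : h (K x' x') x' = c * A t + s * B t.
  by rewrite (frame_form_K _ _ _ _ _ _ ff) h_comb// !mxE /= /A /B -/c -/s; ring.
have -> : (c ^+ 2 + s ^+ 2) * (A t ^+ 2 + B t ^+ 2) = (c * A t + s * B t) ^+ 2 + (- s * A t + c * B t) ^+ 2 by ring.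
by rewrite ft expr0n addr0.
Qed.

Lemma exists_diagonal_frame' e mu lam a : normal_form e mu lam a ->
  exists x y l, frame_form e x y mu l 0 lam a.
Proof.
move=> nf; have [ee _ _] := nf; have [x [y on]] := orthonormal_extend ee.
have [x' [y' [l [ff _]]]] := exists_diagonal_frame nf (normal_frame_form nf on).
by exists x', y', l.
Qed.

Lemma rotation_fixed e x y r s v : orthonormal e x y -> s != 0 -> e *m r = e ->
  x *m r = - 2^-1 *: x + s *: y -> y *m r = - s *: x - 2^-1 *: y ->
  v *m r = v -> v = h v e *: e.
Proof.
move=> on s0 E X Y vr; have D := orthonormal_decomp v on.
move: (h v e) (h v x) (h v y) D vr => p q w ->.
rewrite !mulmxDl -!scalemxAl E X Y => H.
have := orthonormal_coef p q w on; rewrite -H.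
have -> : p *: e + q *: (- 2^-1 *: x + s *: y) + w *: (- s *: x - 2^-1 *: y)
   = p *: e + (- 2^-1 * q - s * w) *: x + (s * q - 2^-1 * w) *: y.
  by apply/rowP => j; rewrite !mxE; ring.
have [-> -> ->] := orthonormal_coef p (- 2^-1 * q - s * w) (s * q - 2^-1 * w) on.
move=> [_ H1 H2].
(* The factor is the determinant of the rotation minus the identity on the plane. *)
have q0 : (9 / 4 + s ^+ 2) * q = 0.
  have a1 : s * w = - 3 / 2 * q by lra.
  have a2 : s * q = 3 / 2 * w by lra.
  have -> : (9 / 4 + s ^+ 2) * q = s * (s * q - 3 / 2 * w) + 3 / 2 * (s * w - - 3 / 2 * q).
    by field.
  by rewrite a1 a2 !subrr !mulr0 addr0.
have {q0}q0 : q = 0.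
  move/eqP: q0; rewrite mulf_eq0 gt_eqF ?ltr_wpDr ?sqr_ge0//.
  by move=> /eqP.
have w0 : w = 0 by move: H2; rewrite q0; lra.
by rewrite q0 w0 !mulr0 subrr !scale0r !addr0.
Qed.

(** * Consequences of a commutative symmetry group *)

Section Abelian.
Hypothesis abelian_sym : forall g g', point_symmetry g -> point_symmetry g' ->
  g *m g' = g' *m g.

(** Each axis carries a third of a turn by [rotation_symmetry]. Since [r'] commutes with [r], it
    preserves the axis of [r]; if it fixes [e], then [e] lies on its own axis. *)
Lemma normal_form_unique e mu lam a e' mu' lam' a' :
  normal_form e mu lam a -> normal_form e' mu' lam' a' -> e' = e \/ e' = - e.
Proof.
move=> nf nf'; have [ee _ _] := nf; have [e'e' _ _] := nf'.
have [x [y on]] := orthonormal_extend ee.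
have [r [s [Gr er s0 xr yr]]] := rotation_symmetry (normal_frame_form nf on).
have [x' [y' on']] := orthonormal_extend e'e'.
have [r' [s' [Gr' er' s'0 xr' yr']]] := rotation_symmetry (normal_frame_form nf' on').
have ce : e *m r' *m r = e *m r' by rewrite -mulmxA (abelian_sym Gr' Gr) mulmxA er.
have Er := rotation_fixed on s0 er xr yr ce.
set t := h _ _ in Er.
have t2 : t * t = 1.
  have [_ hr _ _] := Gr'; have := hr e e; rewrite Er !hE ee; lra.
have [t1|t1] : t = 1 \/ t = - 1.
  have : (t - 1) * (t + 1) = 0 by rewrite mulrDr mulrBl t2; ring.
  move/eqP; rewrite mulf_eq0 subr_eq0 addr_eq0 => /orP[/eqP|/eqP]; by [left|right].
  have := rotation_fixed (v := e) on' s'0 er' xr' yr'; rewrite Er t1 scale1r => /(_ erefl) Ee.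
  set q := h _ _ in Ee.
  have : q * q = 1 by move: ee; rewrite Ee !hE e'e' mulr1.
  move=> q2; have : (q - 1) * (q + 1) = 0 by rewrite mulrDr mulrBl q2; ring.
  move/eqP; rewrite mulf_eq0 subr_eq0 addr_eq0 => /orP[/eqP|/eqP] q1; [left|right].
    by rewrite Ee q1 scale1r.
  by rewrite Ee q1 scaleN1r opprK.
(* r' has order three on the plane orthogonal to e', so it cannot map e to -e *)
have := orthonormal_decomp e on'; move: (h e e') (h e x') (h e y') => p q w De.
move: Er; rewrite t1 scaleN1r De !mulmxDl -!scalemxAl er' xr' yr' => H.
have := orthonormal_coef (- p) (- q) (- w) on'.
have <- : p *: e' + q *: (- 2^-1 *: x' + s' *: y') + w *: (- s' *: x' - 2^-1 *: y')
   = (- p) *: e' + (- q) *: x' + (- w) *: y'.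
  by rewrite H !opprD !scaleNr.
have -> : p *: e' + q *: (- 2^-1 *: x' + s' *: y') + w *: (- s' *: x' - 2^-1 *: y')
     = p *: e' + (- 2^-1 * q - s' * w) *: x' + (s' * q - 2^-1 * w) *: y'.
  by apply/rowP => j; rewrite !mxE; ring.
have [-> -> ->] := orthonormal_coef p (- 2^-1 * q - s' * w) (s' * q - 2^-1 * w) on'.
move=> [p0 H1 H2].
(* The factor is the determinant of the rotation plus the identity on the plane. *)
have q0 : (1 / 4 + s' ^+ 2) * q = 0.
  have a1 : s' * w = 1 / 2 * q by lra.
  have a2 : s' * q = - 1 / 2 * w by lra.
  have -> : (1 / 4 + s' ^+ 2) * q = s' * (s' * q - - 1 / 2 * w) + - 1 / 2 * (s' * w - 1 / 2 * q).
    by field.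
  by rewrite a1 a2 !subrr !mulr0 addr0.
have {q0}q0 : q = 0.
  move/eqP: q0; rewrite mulf_eq0 gt_eqF ?ltr_wpDr ?sqr_ge0//.
  by move=> /eqP.
have w0 : w = 0 by move: H2; rewrite q0; lra.
have p00 : p = 0 by lra.
by move: ee; rewrite De p00 q0 w0 !scale0r !addr0 h0l => /eqP; rewrite eq_sym oner_eq0.
Qed.

(** If [mu] vanished, [K] would live on the plane, and in a frame with [m = 0] the half turn about
    [x] would be a symmetry; it does not commute with the rotation about [e]. *)
Lemma normal_form_mu_neq0 e mu lam a : normal_form e mu lam a -> mu != 0.
Proof.
move=> nf; apply/eqP => mu0; have [x [y [l ff]]] := exists_diagonal_frame' nf.
have [r [s [Gr er s0 xr yr]]] := rotation_symmetry ff; have [on _] := ff.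
pose P := mx33 (- 1) 0 0 0 1 0 0 0 (- 1).
have [||//|g [Gg ge gx gy]] := symmetry_of_rotation (P := P) ff.
- apply/matrixP; apply: ord3P; apply: ord3P; rewrite !mxE sum3 !mxE /= ; ring.
- by rewrite det3 !mxE /=; lra.
- have K3 := frame_form_K _ _ _ _ _ _ ff; rewrite !K3 !(frame_form_S _ _ _ ff) /comb !mxE /= mu0.
  by split; [| | |split; [| | |split]]; apply/rowP => j; rewrite !mxE; ring.
have := congr1 (mulmx x) (abelian_sym Gr Gg); rewrite !mulmxA xr gx !mxE /=.
rewrite /comb mulmxDl -!scalemxAl gx gy /comb !mxE /= !scale0r !scale1r !add0r !addr0 xr.
move/(congr1 (fun v => h v y)); have [_ _ yy [_ _ xy]] := on.
rewrite !hE yy xy => H; move/eqP: s0; apply; lra.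
Qed.

(** For this ratio [K] is the cubic form of a regular tetrahedron with a vertex in the direction of
    [e] or [- e], and a scalar [S] does not break its noncommutative symmetry. *)
Lemma normal_form_not_tetrahedral e x y mu l m lam a : frame_form e x y mu l m lam a ->
  normal_form e mu lam a -> lam = a -> l ^+ 2 + m ^+ 2 = 2 * mu ^+ 2 -> False.
Proof.
move=> ff0 nf lama lm; subst a.
have [x1 [y1 [l1 [ff1 lm1]]]] := exists_diagonal_frame nf ff0.
rewrite lm in lm1.
pose d : R := Num.sqrt 2; have d2 : d ^+ 2 = 2 by rewrite sqr_sqrtr.
have [x2 [y2 ff]] : exists x y, frame_form e x y mu (d * mu) 0 lam lam.
  have : (l1 - d * mu) * (l1 + d * mu) = 0.
    by rewrite -subr_sqr exprMn d2 lm1 subrr.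
  move/eqP; rewrite mulf_eq0 subr_eq0 addr_eq0 => /orP[/eqP|/eqP] l1E.
    by exists x1, y1; rewrite -l1E.
  exists (- x1), (- y1); have := frame_form_signs ff1; rewrite l1E opprK oppr0.
  exact.
have [r [s [Gr er s0 xr yr]]] := rotation_symmetry ff; have [on _] := ff.
(* The half turn that exchanges [e] with another vertex direction; [- 1 / 3] is the cosine of the
   angle between two vertices of a regular tetrahedron. *)
pose P := mx33 (- 3^-1) (2 / 3 * d) 0 (2 / 3 * d) (3^-1) 0 0 0 (- 1).
have [||//|g [Gg ge gx gy]] := symmetry_of_rotation (P := P) ff.
- apply/matrixP; apply: ord3P; apply: ord3P; rewrite !mxE sum3 !mxE /=; nra.
- rewrite det3 !mxE /=; nra.
- have K3 := frame_form_K _ _ _ _ _ _ ff; rewrite !K3 !(frame_form_S _ _ _ ff) /comb !mxE /=.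
  by split; [| | |split; [| | |split]]; apply/rowP => j; rewrite !mxE; field: d2.
have := congr1 (mulmx e) (abelian_sym Gr Gg); rewrite !mulmxA er ge !mxE /=.
rewrite /comb !mulmxDl -!scalemxAl er xr yr.
move/(congr1 (fun v => h v y2)); have [_ _ yy [_ ey xy]] := on.
rewrite !hE yy ey xy => H.
have : d * s = 0 by lra.
move/eqP; rewrite mulf_eq0 (negbTE s0) orbF => /eqP d0.
by move: d2; rewrite d0; lra.
Qed.

(** An involution that commutes with the rotation about [e] is a sign on the plane; orientation and
    [g != 1] make it the half turn about [e], which reverses the harmonic cubic form. *)
Lemma normal_form_SO2 e x y mu l m lam a g : frame_form e x y mu l m lam a ->
  point_symmetry g -> g *m g = 1%:M -> g != 1%:M -> l = 0 /\ m = 0.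
Proof.
move=> ff Gg g2 g1; have [on [_ _ _ [Kxx _ _ _]]] := ff.
have [ee xx yy [ex ey xy]] := on; have [dg hg _ gK] := Gg.
have [r [s [Gr er s0 xr yr]]] := rotation_symmetry ff.
have comm v : v *m g *m r = v *m r *m g by rewrite -!mulmxA (abelian_sym Gg Gr).
have eg : e *m g = h (e *m g) e *: e.
  by apply: (rotation_fixed on s0 er xr yr); rewrite comm er.
set t := h _ _ in eg.
have t2 : t * t = 1 by have := hg e e; rewrite eg !hE ee mulr1.
have t0 : t != 0 by apply/eqP => t0; move: t2; rewrite t0 mul0r => /eqP; rewrite eq_sym oner_eq0.
have perp v : h v e = 0 -> h (v *m g) e = 0.
  move=> ve; have := hg v e; rewrite eg hZr ve => /eqP.
  by rewrite mulf_eq0 (negbTE t0) => /eqP.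
have xg := orthonormal_decomp (x *m g) on; have yg := orthonormal_decomp (y *m g) on.
rewrite perp ?(hC x)// scale0r add0r in xg; rewrite perp ?(hC y)// scale0r add0r in yg.
move: (h (x *m g) x) (h (x *m g) y) (h (y *m g) x) (h (y *m g) y) xg yg => q w q' w' xg yg.
have := comm x; rewrite xr xg !mulmxDl -!scalemxAl xr yr xg yg => H.
have H1 : q' * s = - w * s.
  have := congr1 (fun v => h v x) H; rewrite !hE xx (hC y x) xy; lra.
have H2 : w' * s = q * s.
  have := congr1 (fun v => h v y) H; rewrite !hE yy xy; lra.
have q'w : q' = - w by exact: (mulIf s0).
have w'q : w' = q by exact: (mulIf s0).
have : x *m g *m g = x by rewrite -mulmxA g2 mulmx1.
rewrite xg mulmxDl -!scalemxAl xg yg q'w w'q => X.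
have X1 : q * q - w * w = 1.
  by have := congr1 (fun v => h v x) X; rewrite !hE xx (hC y x) xy; lra.
have X2 : q * w = 0.
  by have := congr1 (fun v => h v y) X; rewrite !hE yy xy; lra.
have w0 : w = 0.
  move/eqP: X2; rewrite mulf_eq0 => /orP[/eqP q0|/eqP//].
  by move: X1; rewrite q0; nra.
rewrite q'w w'q w0 oppr0 !scale0r ?addr0 ?add0r in xg yg.
have q2 : q * q = 1 by move: X1; rewrite w0; lra.
have t1 : t = 1.
  have detg : \det g = t * (q * q).
    have M : mx33 t 0 0 0 q 0 0 0 q *m frame_mx e x y = frame_mx e x y *m g.
      have [r0 r1 r2] := frame_mx_row e x y.
      apply/row_matrixP; apply: ord3P; rewrite !row_mul mul_frame_mx ?r0 ?r1 ?r2 ?eg ?xg ?yg !mxE /=;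
        by rewrite !scale0r ?addr0 ?add0r.
    have := congr1 determinant M; rewrite !det_mulmx [RHS]mulrC.
    move=> /mulIf <-; first by rewrite det3 !mxE /=; ring.
    by have := frame_unit on; rewrite unitmxE unitfE.
  move: dg; rewrite detg q2 mulr1 => t0'.
  have : (t - 1) * (t + 1) = 0 by rewrite mulrDr mulrBl t2; ring.
  move/eqP; rewrite mulf_eq0 subr_eq0 addr_eq0 => /orP[/eqP//|/eqP t1].
  by move: t0'; rewrite t1; lra.
have q1 : q = - 1.
  have : (q - 1) * (q + 1) = 0 by rewrite mulrDr mulrBl q2; ring.
  move/eqP; rewrite mulf_eq0 subr_eq0 addr_eq0 => /orP[/eqP q1|/eqP//].
  suff : g = 1%:M by move/eqP; rewrite (negbTE g1).
  apply: (can_inj (mulKmx (frame_unit on))); rewrite mulmx1.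
  have [r0 r1 r2] := frame_mx_row e x y.
  by apply/row_matrixP; apply: ord3P; rewrite row_mul ?r0 ?r1 ?r2 ?eg ?xg ?yg ?t1 ?q1 scale1r.
rewrite q1 scaleN1r in xg yg; rewrite t1 scale1r in eg.
have := gK x x; rewrite xg KNl KNr opprK Kxx !mulmxDl -!scalemxAl eg xg yg => E.
split.
- have := congr1 (fun v => h v x) E; rewrite !hE xx ex (hC y x) xy; lra.
- have := congr1 (fun v => h v y) E; rewrite !hE yy ey xy; lra.
Qed.

End Abelian.
End Point.

(** * Conormal map and structure equations *)

HB.lock Definition pairing (R : realType) (n : nat) (b : 'rV[R]_n) (c : 'cV[R]_n) : R :=
  (b *m c) 0 0.
Notation "⟨ b , c ⟩" := (pairing b c) (at level 0, b at level 99, c at level 99).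

(* Directional derivative, sealed because unification would otherwise unfold nested
   derivatives down to limits of difference quotients. *)
HB.lock Definition dd (R : realType) (V W : normedModType R) (v : V) (f : V -> W) (x : V) : W :=
  'D_v f x.

(** * Calculus with the sealed derivative and pairing *)

Section Sealed.
Context {R : realType}.

Lemma ddE (V W : normedModType R) v (f : V -> W) x : dd v f x = 'D_v f x.
Proof. by rewrite dd.unlock. Qed.

Lemma ddE_fun (V W : normedModType R) v (f : V -> W) : dd v f = 'D_v f.
Proof. by apply/funext => x; rewrite ddE. Qed.

Lemma pairing_unfold n (b : 'rV[R]_n) (c : 'cV[R]_n) : ⟨b, c⟩ = (b *m c) 0 0.
Proof. by rewrite pairing.unlock. Qed.

Lemma smooth_dd (V W : normedModType R) (U : set V) (f : V -> W) v :
  smooth_on U f -> smooth_on U (dd v f).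
Proof. by move=> sf; rewrite ddE_fun; exact: smooth_derive. Qed.

Lemma eq_on_dd (V W : normedModType R) (U : set V) (f g : V -> W) v : open U ->
  (forall x, U x -> f x = g x) -> forall x, U x -> dd v f x = dd v g x.
Proof. by move=> oU fg x Ux; rewrite !ddE; exact: eq_on_derive Ux. Qed.

Lemma schwarz_dd (V : normedModType R) (U : set V) m n (f : V -> 'M[R]_(m, n)) x v w :
  open U -> smooth_on U f -> U x -> dd v (dd w f) x = dd w (dd v f) x.
Proof. by move=> oU sf Ux; rewrite !ddE !ddE_fun; exact: schwarz_mx Ux. Qed.

Lemma dd_cst (V W : normedModType R) (v : V) (c : W) x : dd v (fun=> c) x = 0.
Proof. by rewrite ddE derive_cst. Qed.

Section Linear.
Variables (V W : normedModType R) (U : set V) (f g : V -> W).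
Hypotheses (sf : smooth_on U f) (sg : smooth_on U g).

Lemma ddDl u v x : U x -> dd (u + v) f x = dd u f x + dd v f x.
Proof. by move=> Ux; rewrite !ddE deriveDl//; exact: smooth_diff Ux. Qed.

Lemma ddZl (c : R) v x : U x -> dd (c *: v) f x = c *: dd v f x.
Proof. by move=> Ux; rewrite !ddE deriveZl//; exact: smooth_diff Ux. Qed.

Lemma ddNl v x : U x -> dd (- v) f x = - dd v f x.
Proof. by move=> Ux; rewrite -scaleN1r ddZl// scaleN1r. Qed.

Lemma ddD v x : U x -> dd v (fun y => f y + g y) x = dd v f x + dd v g x.
Proof.
by move=> Ux; rewrite !ddE deriveD//; [exact: smooth_derivable sf Ux|exact: smooth_derivable sg Ux].
Qed.

Lemma ddN v x : U x -> dd v (fun y => - f y) x = - dd v f x.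
Proof. by move=> Ux; rewrite !ddE deriveN//; exact: smooth_derivable sf Ux. Qed.

End Linear.

Lemma ddB (V W : normedModType R) (U : set V) (f g : V -> W) v x : open U ->
  smooth_on U f -> smooth_on U g -> U x ->
  dd v (fun y => f y - g y) x = dd v f x - dd v g x.
Proof. by move=> oU sf sg Ux; rewrite (ddD sf (smoothN oU sg))// (ddN sg). Qed.

Lemma ddM (V : normedModType R) (U : set V) (f g : V -> R) v x :
  smooth_on U f -> smooth_on U g -> U x ->
  dd v (fun y => f y * g y) x = dd v f x * g x + f x * dd v g x.
Proof.
move=> sf sg Ux; rewrite !ddE deriveM; [|exact: smooth_derivable sf Ux|exact: smooth_derivable sg Ux].
by rewrite addrC /GRing.scale /= mulrC.
Qed.

Lemma ddZ (V : normedModType R) m n (U : set V) (c : V -> R) (g : V -> 'M[R]_(m, n)) v x :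
  smooth_on U c -> smooth_on U g -> U x ->
  dd v (fun y => c y *: g y) x = dd v c x *: g x + c x *: dd v g x.
Proof.
move=> sc sg Ux; have dg := smooth_diff sg Ux; have dc := smooth_diff sc Ux.
have /differentiable_mxP dge := dg.
have dcg : differentiable (fun y => c y *: g y) x.
  apply/differentiable_mxP => i j.
  rewrite (_ : (fun y => _) = fun y => c y * g y i j); last by apply/funext => y; rewrite mxE.
  exact: differentiableM.
rewrite !ddE; apply/matrixP => i j; rewrite derive_entry// !mxE !derive_entry//.
rewrite (_ : (fun y => _) = fun y => c y * g y i j); last by apply/funext => y; rewrite mxE.
rewrite deriveM; [|exact: diff_derivable|exact: diff_derivable].
by rewrite addrC /GRing.scale /= [g x i j * _]mulrC.
Qed.

Lemma dd_mulmx (V : normedModType R) m n p (U : set V) (f : V -> 'M[R]_(m, n))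
    (g : V -> 'M[R]_(n, p)) v x :
  smooth_on U f -> smooth_on U g -> U x ->
  dd v (fun y => f y *m g y) x = dd v f x *m g x + f x *m dd v g x.
Proof.
by move=> sf sg Ux; rewrite !ddE (derive_mulmx _ (smooth_diff sf Ux) (smooth_diff sg Ux)).2.
Qed.

Lemma dd_sum_delta n (W : normedModType R) (U : set 'rV[R]_n) (f : 'rV[R]_n -> W) v x :
  smooth_on U f -> U x -> dd v f x = \sum_i v 0 i *: dd (delta_mx 0 i) f x.
Proof.
move=> sf Ux; rewrite ddE (derive_sum_delta v (smooth_diff sf Ux)).
by apply: eq_bigr => i _; rewrite ddE.
Qed.

Lemma dd_entry (V : normedModType R) m n (U : set V) (f : V -> 'M[R]_(m, n)) v x i j :
  smooth_on U f -> U x -> (dd v f x) i j = dd v (fun y => f y i j) x.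
Proof. by move=> sf Ux; rewrite !ddE derive_entry//; exact: smooth_diff Ux. Qed.

Section Pairing.
Variable n : nat.
Implicit Types (b : 'rV[R]_n) (c : 'cV[R]_n).

Lemma pairingDl b b' c : ⟨b + b', c⟩ = ⟨b, c⟩ + ⟨b', c⟩.
Proof. by rewrite !pairing_unfold mulmxDl mxE. Qed.
Lemma pairingDr b c c' : ⟨b, c + c'⟩ = ⟨b, c⟩ + ⟨b, c'⟩.
Proof. by rewrite !pairing_unfold mulmxDr mxE. Qed.
Lemma pairingZl k b c : ⟨k *: b, c⟩ = k * ⟨b, c⟩.
Proof. by rewrite !pairing_unfold -scalemxAl mxE. Qed.
Lemma pairingZr k b c : ⟨b, k *: c⟩ = k * ⟨b, c⟩.
Proof. by rewrite !pairing_unfold -scalemxAr mxE. Qed.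
Lemma pairingNl b c : ⟨- b, c⟩ = - ⟨b, c⟩.
Proof. by rewrite !pairing_unfold mulNmx mxE. Qed.
Lemma pairingNr b c : ⟨b, - c⟩ = - ⟨b, c⟩.
Proof. by rewrite !pairing_unfold mulmxN mxE. Qed.
Lemma pairing0l c : ⟨0, c⟩ = 0.
Proof. by rewrite pairing_unfold mul0mx mxE. Qed.
Lemma pairing0r b : ⟨b, 0⟩ = 0.
Proof. by rewrite pairing_unfold mulmx0 mxE. Qed.

Lemma smooth_pairing (V : normedModType R) (U : set V) (b : V -> 'rV[R]_n) (c : V -> 'cV[R]_n) :
  open U -> smooth_on U b -> smooth_on U c -> smooth_on U (fun y => ⟨b y, c y⟩).
Proof.
move=> oU sb sc; have := (smooth_mx _ oU).1 (smooth_mulmx oU sb sc) 0 0.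
by move/eq_smooth; apply=> x; rewrite pairing_unfold.
Qed.

Lemma dd_pairing (V : normedModType R) (U : set V) (b : V -> 'rV[R]_n) (c : V -> 'cV[R]_n) x v :
  open U -> smooth_on U b -> smooth_on U c -> U x ->
  dd v (fun y => ⟨b y, c y⟩) x = ⟨dd v b x, c x⟩ + ⟨b x, dd v c x⟩.
Proof.
move=> oU sb sc Ux; rewrite !pairing_unfold.
rewrite (_ : (fun y => _) = fun y => (b y *m c y) 0 0); last first.
  by apply/funext => y; rewrite pairing_unfold.
by rewrite -(dd_entry _ _ _ (smooth_mulmx oU sb sc))// (dd_mulmx _ sb sc)// mxE.
Qed.

Lemma dd_pairing_on (V : normedModType R) (U : set V) (b : V -> 'rV[R]_n) (c : V -> 'cV[R]_n)
    (g : V -> R) s v :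
  open U -> smooth_on U b -> smooth_on U c -> (forall y, U y -> ⟨b y, c y⟩ = g y) -> U s ->
  ⟨dd v b s, c s⟩ + ⟨b s, dd v c s⟩ = dd v g s.
Proof. by move=> oU sb sc H Us; rewrite -(dd_pairing _ oU sb sc)//; exact: eq_on_dd Us. Qed.

End Pairing.
End Sealed.

(** * The conormal map *)

Section Conormal.
Context {R : realType} {n : nat}.
Variables (U : set 'rV[R]_n) (f xi : 'rV[R]_n -> 'rV[R]_n.+1).
Implicit Types (s v w z : 'rV[R]_n).
Hypotheses (oU : open U) (imm : immersion_on U f) (nor : affine_normal_on U f xi).

(** The covector equal to 1 on [xi] and 0 on tangent vectors, as the first column of the inverse
    moving frame. Its derivatives turn [h], [K] and [S] into pairings. *)
Definition conormal s : 'cV[R]_(n.+1) := col 0 (invmx (moving_frame f xi s)).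
Local Notation N := conormal.

Let sf : smooth_on U f. Proof. by case: imm. Qed.
Let sxi : smooth_on U xi. Proof. exact: normal_smooth nor. Qed.
Let fu s : U s -> moving_frame f xi s \in unitmx.
Proof. exact: (normal_transversal nor). Qed.

Lemma smooth_moving_frame : smooth_on U (moving_frame f xi).
Proof.
have sJ := smooth_jacobian oU sf.
apply/smooth_mx => // i j; case: (fintype.splitP i) => k ik.
  have /(smooth_mx _ oU)/(_ 0 j) := sxi; move/eq_smooth; apply=> x.
  by rewrite (_ : i = lshift n k); [rewrite col_mxEu ord1|exact: val_inj].
have /(smooth_mx _ oU)/(_ k j) := sJ; move/eq_smooth; apply=> x.
by rewrite (_ : i = rshift 1 k); [rewrite col_mxEd|exact: val_inj].
Qed.

Lemma smooth_invframe : smooth_on U (fun s => invmx (moving_frame f xi s)).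
Proof. exact: smooth_invmx oU fu smooth_moving_frame. Qed.

Lemma smooth_conormal : smooth_on U N.
Proof.
apply/smooth_mx => // i j; have /(smooth_mx _ oU)/(_ i 0) := smooth_invframe.
by move/eq_smooth; apply=> x; rewrite mxE.
Qed.

Lemma normal_partE s b : normal_part f xi s b = ⟨b, N s⟩.
Proof.
rewrite /normal_part /components pairing_unfold /conormal [LHS]mxE [RHS]mxE.
by apply: eq_bigr => k _; rewrite [in RHS]mxE.
Qed.

Lemma frame_decomp s b : U s ->
  b = ⟨b, N s⟩ *: xi s + tangent_part f xi s b *m jacobian f s.
Proof.
move=> Us; have e : b = components f xi s b *m moving_frame f xi s.
  by rewrite /components mulmxKV// fu.
rewrite {1}e /moving_frame -normal_partE /tangent_part.
rewrite -[components f xi s b in LHS]hsubmxK mul_row_col; congr (_ + _).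
rewrite (_ : lsubmx _ = (normal_part f xi s b)%:M) ?mul_scalar_mx//.
apply/matrixP => i j; rewrite !ord1 [LHS]mxE [RHS]mxE eqxx mulr1n /normal_part.
by congr (components f xi s b _ _); apply: val_inj.
Qed.

Lemma frame_inverse s : U s ->
  xi s *m invmx (moving_frame f xi s) = row_mx (1%:M : 'M[R]_1) (0 : 'M[R]_(1, n)) /\
  jacobian f s *m invmx (moving_frame f xi s) = row_mx (0 : 'M[R]_(n, 1)) (1%:M : 'M[R]_n).
Proof.
move=> Us; have := mulmxV (fu Us).
rewrite {1}/moving_frame mul_col_mx scalar_mx_block /block_mx.
by move/eq_col_mx => [-> ->].
Qed.

Lemma conormal_xi s : U s -> ⟨xi s, N s⟩ = 1.
Proof.
move=> Us; have [X _] := frame_inverse Us.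
rewrite -normal_partE /normal_part /components X.
by rewrite (_ : (0 : 'I_(1 + n)) = lshift n 0) ?row_mxEl ?mxE//; exact: val_inj.
Qed.

Lemma conormal_tangent s v : U s -> ⟨v *m jacobian f s, N s⟩ = 0.
Proof.
move=> Us; have [_ J] := frame_inverse Us.
rewrite -normal_partE /normal_part /components -mulmxA J mul_mx_row mulmx0.
by rewrite (_ : (0 : 'I_(1 + n)) = lshift n 0) ?row_mxEl ?mxE//; exact: val_inj.
Qed.

Lemma derive_f s v : U s -> 'D_v f s = v *m jacobian f s.
Proof. by move=> Us; rewrite deriveEjacobian//; exact: smooth_diff Us. Qed.

Lemma dd_f s v : U s -> dd v f s = v *m jacobian f s.
Proof. by rewrite ddE; exact: derive_f. Qed.

Lemma smooth_tangent_part (b : 'rV[R]_n -> 'rV[R]_n.+1) : smooth_on U b ->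
  smooth_on U (fun s => tangent_part f xi s (b s)).
Proof.
move=> sb; have := smooth_mulmx oU sb smooth_invframe => /(smooth_mx _ oU) H.
apply/smooth_mx => // i j; have := H i (rshift 1 j).
by move/eq_smooth; apply=> x; rewrite /tangent_part /components [RHS]mxE.
Qed.

End Conormal.

(* A transversal field xi with vanishing normal part of its derivative, its conormal
   field N, the tangential projection T and the metric h, kept abstract so that
   unification never unfolds the definitions of these objects. *)
Record transversal_structure (R : realType) (n : nat) (U : set 'rV[R]_n)
    (f xi : 'rV[R]_n -> 'rV[R]_n.+1) (N : 'rV[R]_n -> 'cV[R]_n.+1)
    (T : 'rV[R]_n -> 'rV[R]_n.+1 -> 'rV[R]_n) (h : 'rV[R]_n -> 'rV[R]_n -> 'rV[R]_n -> R) : Prop :=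
  TransversalStructure {
  ts_open : open U;
  ts_f : smooth_on U f;
  ts_xi : smooth_on U xi;
  ts_N : smooth_on U N;
  ts_T : forall b, smooth_on U b -> smooth_on U (fun s => T s (b s));
  ts_decomp : forall s b, U s -> b = ⟨b, N s⟩ *: xi s + dd (T s b) f s;
  ts_Nxi : forall s, U s -> ⟨xi s, N s⟩ = 1;
  ts_Nf : forall s v, U s -> ⟨dd v f s, N s⟩ = 0;
  ts_Ndxi : forall s v, U s -> ⟨dd v xi s, N s⟩ = 0;
  ts_h : forall s v w, U s -> h s v w = ⟨dd v (dd w f) s, N s⟩;
  ts_nondeg : forall s v, U s -> (forall w, h s v w = 0) -> v = 0 }.

(** * Affine metric and Christoffel symbols as pairings *)

Section Metric.
Context {R : realType} {n : nat}.
Variables (U : set 'rV[R]_n) (f xi : 'rV[R]_n -> 'rV[R]_n.+1) (N : 'rV[R]_n -> 'cV[R]_n.+1)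
  (T : 'rV[R]_n -> 'rV[R]_n.+1 -> 'rV[R]_n) (h : 'rV[R]_n -> 'rV[R]_n -> 'rV[R]_n -> R).
Implicit Types (s v w z : 'rV[R]_n).
Hypothesis ts : transversal_structure U f xi N T h.

Let oU := ts_open ts.
Let sf := ts_f ts.
Let sxi := ts_xi ts.
Let sN := ts_N ts.
Let sD v : smooth_on U (dd v f). Proof. exact: smooth_dd. Qed.
Let sDN v : smooth_on U (dd v N). Proof. exact: smooth_dd. Qed.
Let sDD v w : smooth_on U (dd v (dd w f)). Proof. exact: smooth_dd. Qed.

(** Derivative of [⟨dd w f, N⟩ = 0]. Only first derivatives remain, so bilinearity and behaviour
    under a change of chart are immediate in this form. *)
Lemma metric_dual s v w : U s -> h s v w = - ⟨dd w f s, dd v N s⟩.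
Proof.
move=> Us; rewrite (ts_h ts)//; apply/eqP; rewrite -addr_eq0; apply/eqP.
rewrite (dd_pairing_on (g := fun=> 0) v oU (sD w) sN)// ?dd_cst//.
by move=> y Uy; rewrite (ts_Nf ts).
Qed.

Lemma metric_symm s v w : U s -> h s v w = h s w v.
Proof.
by move=> Us; have E := schwarz_dd v w oU sf Us; rewrite !(ts_h ts)// E.
Qed.

Lemma metric_dual' s v w : U s -> h s v w = - ⟨dd v f s, dd w N s⟩.
Proof. by move=> Us; rewrite metric_symm// metric_dual. Qed.

Lemma xi_dN s v : U s -> ⟨xi s, dd v N s⟩ = 0.
Proof.
move=> Us; have := dd_pairing_on (g := fun=> 1) v oU sxi sN (ts_Nxi ts) Us.
by rewrite dd_cst (ts_Ndxi ts)// add0r.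
Qed.

Lemma metric_linear_l s (c : R) u v w : U s -> h s (c *: u + v) w = c * h s u w + h s v w.
Proof.
move=> Us; rewrite !metric_dual'// (ddDl sf)// (ddZl sf)//.
by rewrite pairingDl pairingZl; ring.
Qed.

Lemma metric_D s u v w : U s -> h s (u + v) w = h s u w + h s v w.
Proof. by move=> Us; rewrite -[u]scale1r metric_linear_l// mul1r scale1r. Qed.

Lemma metric_0 s w : U s -> h s 0 w = 0.
Proof. by move=> Us; apply: (addrI (h s 0 w)); rewrite -metric_D// !addr0. Qed.

Lemma metric_Z s (c : R) v w : U s -> h s (c *: v) w = c * h s v w.
Proof. by move=> Us; rewrite -[c *: v]addr0 metric_linear_l// metric_0// addr0. Qed.

Lemma metric_N s v w : U s -> h s (- v) w = - h s v w.
Proof. by move=> Us; rewrite -scaleN1r metric_Z// mulN1r. Qed.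

Lemma metric_Dr s u v w : U s -> h s w (u + v) = h s w u + h s w v.
Proof. by move=> Us; rewrite ![h s w _]metric_symm// metric_D. Qed.

Lemma metric_Zr s (c : R) v w : U s -> h s w (c *: v) = c * h s w v.
Proof. by move=> Us; rewrite ![h s w _]metric_symm// metric_Z. Qed.

Lemma metric_sumr s v w : U s -> h s v w = \sum_l w 0 l * h s v (delta_mx 0 l).
Proof.
move=> Us; rewrite [w in LHS]row_sum_delta.
elim/big_ind2: _ => [|a b c d <- <-|i _]; last by rewrite metric_Zr.
  by rewrite metric_symm// metric_0.
by rewrite metric_Dr.
Qed.

Lemma metric_suml s v w : U s -> h s v w = \sum_l v 0 l * h s (delta_mx 0 l) w.
Proof.
move=> Us; rewrite metric_symm// metric_sumr//; apply: eq_bigr => l _.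
by rewrite metric_symm.
Qed.

Lemma gramE s i j : gram (h s) (1%:M : 'M[R]_n) i j = h s (delta_mx 0 i) (delta_mx 0 j).
Proof. by rewrite mxE !row1. Qed.

Lemma metric_gram s v w : U s -> h s v w = (v *m gram (h s) 1%:M *m w^T) 0 0.
Proof.
move=> Us; rewrite mxE metric_sumr//; apply: eq_bigr => j _.
rewrite [w^T _ _]mxE mulrC metric_suml// mxE; congr (_ * _); apply: eq_bigr => i _.
by rewrite gramE.
Qed.

Lemma gram_unit s : U s -> gram (h s) (1%:M : 'M[R]_n) \in unitmx.
Proof.
move=> Us; rewrite -row_free_unit; apply: inj_row_free => v v0.
by apply: (ts_nondeg ts Us) => w; rewrite metric_gram// v0 mul0mx mxE.
Qed.

Lemma metric_eq s v v' : U s -> (forall w, h s v w = h s v' w) -> v = v'.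
Proof.
move=> Us H; apply/eqP; rewrite -subr_eq0; apply/eqP; apply: (ts_nondeg ts Us) => w.
by rewrite metric_D// metric_N// H subrr.
Qed.

Lemma tangent_f s v : U s -> T s (dd v f s) = v.
Proof.
move=> Us; apply: (metric_eq Us) => w; rewrite !metric_dual'//.
have := ts_decomp ts (dd v f s) Us; rewrite (ts_Nf ts)// scale0r add0r => <-.
by [].
Qed.

Lemma tangent_metric s b w : U s -> h s (T s b) w = - ⟨b, dd w N s⟩.
Proof.
move=> Us; rewrite metric_dual'// [X in _ = - ⟨X, _⟩](ts_decomp ts b Us).
by rewrite pairingDl pairingZl xi_dN// mulr0 add0r.
Qed.

Lemma cotangent_eq s c c' : U s -> ⟨xi s, c⟩ = ⟨xi s, c'⟩ ->
  (forall v, ⟨dd v f s, c⟩ = ⟨dd v f s, c'⟩) -> c = c'.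
Proof.
move=> Us cx cf; suff E b : ⟨b, c⟩ = ⟨b, c'⟩.
  apply/colP => i; have := E (delta_mx 0 i).
  by rewrite !pairing_unfold -!rowE !mxE.
by rewrite (ts_decomp ts b Us) !pairingDl !pairingZl cx cf.
Qed.

Lemma smooth_metric v w : smooth_on U (fun s => h s v w).
Proof.
apply: (@smooth_ext _ _ _ _ (fun s => ⟨dd v (dd w f) s, N s⟩)) => //.
  by move=> s Us; rewrite (ts_h ts).
exact: smooth_pairing.
Qed.

Lemma dd_metric s u v w : U s ->
  dd u (fun y => h y v w) s = - (⟨dd u (dd v f) s, dd w N s⟩ + ⟨dd v f s, dd u (dd w N) s⟩).
Proof.
move=> Us; rewrite (dd_pairing_on (g := fun y => - h y v w) u oU (sD v) (sDN w))//.
  by rewrite (ddN (smooth_metric v w))// opprK.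
by move=> y Uy; rewrite metric_dual'// opprK.
Qed.

(** The Levi-Civita connection is the mean of the connections induced by [f] and by its conormal
    map; the difference tensor is half their difference, which is [cubic_eq]. *)
Lemma lower_eq s v w z : U s -> christoffel_lower h s v w z =
  - 2^-1 * (⟨dd z f s, dd v (dd w N) s⟩ + ⟨dd v (dd w f) s, dd z N s⟩).
Proof.
move=> Us; rewrite /christoffel_lower -!ddE.
have D1 : dd v (fun y => h y w z) s = dd v (fun y => h y z w) s.
  by apply: eq_on_dd oU _ _ Us => y Uy; rewrite metric_symm.
have E1 := schwarz_dd z v oU sf Us; have E2 := schwarz_dd z w oU sN Us.
have E3 := schwarz_dd v w oU sf Us.
by rewrite D1 !dd_metric// E1 E2 E3; field.
Qed.

Lemma metric_christoffel s v w z : U s ->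
  h s (christoffel h s v w) z = christoffel_lower h s v w z.
Proof.
move=> Us; rewrite metric_gram// /christoffel mulmxKV; last exact: gram_unit.
rewrite lower_eq// (dd_sum_delta z sf Us) (dd_sum_delta z sN Us) mxE.
have L k : christoffel_lower h s v w (delta_mx 0 k) = - 2^-1 *
   (⟨dd (delta_mx 0 k) f s, dd v (dd w N) s⟩ + ⟨dd v (dd w f) s, dd (delta_mx 0 k) N s⟩).
  exact: lower_eq.
rewrite !pairing_unfold mulmx_suml mulmx_sumr !summxE -big_split mulr_sumr /=.
apply: eq_bigr => k _; rewrite -!pairing_unfold pairingZl pairingZr [(\row_l _) _ _]mxE L [z^T _ _]mxE.
by move: ⟨_, _⟩ ⟨_, _⟩ => a b; ring.
Qed.

Lemma smooth_christoffel v w : smooth_on U (fun s => christoffel h s v w).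
Proof.
apply: smooth_mulmx => //; last first.
  apply: smooth_invmx => //; first exact: gram_unit.
  apply/smooth_mx => // i j; have := smooth_metric (delta_mx 0 i) (delta_mx 0 j).
  by move/eq_smooth; apply=> x; rewrite gramE.
apply/smooth_mx => // i j.
have H : smooth_on U (fun s => christoffel_lower h s v w (delta_mx 0 j)).
  apply: smoothM => //; first exact: smooth_cst.
  by apply: smoothB => //; [apply: smoothD => //|]; apply: smooth_derive; exact: smooth_metric.
by move/eq_smooth: H; apply=> x; rewrite mxE.
Qed.

End Metric.

Record blaschke_structure (R : realType) (n : nat) (U : set 'rV[R]_n)
    (f xi : 'rV[R]_n -> 'rV[R]_n.+1) (N : 'rV[R]_n -> 'cV[R]_n.+1)
    (T : 'rV[R]_n -> 'rV[R]_n.+1 -> 'rV[R]_n) (h : 'rV[R]_n -> 'rV[R]_n -> 'rV[R]_n -> R)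
    (K : 'rV[R]_n -> 'rV[R]_n -> 'rV[R]_n -> 'rV[R]_n) (S : 'rV[R]_n -> 'rV[R]_n -> 'rV[R]_n)
    : Prop := BlaschkeStructure {
  bs_ts :> transversal_structure U f xi N T h;
  bs_K : forall s v w, U s -> K s v w = T s (dd v (dd w f) s) - christoffel h s v w;
  bs_S : forall s v, U s -> S s v = - T s (dd v xi s) }.

(** * Difference tensor and shape operator as pairings *)

Section Cubic.
Context {R : realType} {n : nat}.
Variables (U : set 'rV[R]_n) (f xi : 'rV[R]_n -> 'rV[R]_n.+1) (N : 'rV[R]_n -> 'cV[R]_n.+1)
  (T : 'rV[R]_n -> 'rV[R]_n.+1 -> 'rV[R]_n) (h : 'rV[R]_n -> 'rV[R]_n -> 'rV[R]_n -> R)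
  (K : 'rV[R]_n -> 'rV[R]_n -> 'rV[R]_n -> 'rV[R]_n) (S : 'rV[R]_n -> 'rV[R]_n -> 'rV[R]_n).
Implicit Types (s v w z : 'rV[R]_n).
Hypothesis bs : blaschke_structure U f xi N T h K S.

Let ts : transversal_structure U f xi N T h := bs.
Let oU := ts_open ts.
Let sf := ts_f ts.
Let sxi := ts_xi ts.
Let sN := ts_N ts.
Let sD v : smooth_on U (dd v f). Proof. exact: smooth_dd. Qed.
Let sDN v : smooth_on U (dd v N). Proof. exact: smooth_dd. Qed.

Lemma cubic_eq s v w z : U s -> h s (K s v w) z =
  2^-1 * (⟨dd z f s, dd v (dd w N) s⟩ - ⟨dd v (dd w f) s, dd z N s⟩).
Proof.
move=> Us; rewrite (bs_K bs)// (metric_D ts)// (metric_N ts)// (metric_christoffel ts)//.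
by rewrite (lower_eq ts)// (tangent_metric ts)//; field.
Qed.

Lemma cubic_symm s v w : U s -> K s v w = K s w v.
Proof.
move=> Us; apply: (metric_eq ts Us) => z; rewrite !cubic_eq//.
by have E1 := schwarz_dd v w oU sf Us; have E2 := schwarz_dd v w oU sN Us; rewrite E1 E2.
Qed.

(** The derivative of [h w z] along [v], expanded by [dd_metric], must equal that of [h z w]. *)
Lemma cubic_total s v w z : U s -> h s (K s v w) z = h s (K s v z) w.
Proof.
move=> Us; rewrite !cubic_eq//.
have D1 := dd_metric ts v w z Us; have D2 := dd_metric ts v z w Us.
have D3 : dd v (fun y => h y w z) s = dd v (fun y => h y z w) s.
  by apply: eq_on_dd oU _ _ Us => y Uy; rewrite (metric_symm ts).
lra.
Qed.

Lemma cubic_lin s (c : R) u v w : U s -> K s (c *: u + v) w = c *: K s u w + K s v w.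
Proof.
move=> Us; apply: (metric_eq ts Us) => z.
rewrite (metric_linear_l ts)// !cubic_eq//.
rewrite (ddDl (sDN w))// (ddZl (sDN w))// (ddDl (sD w))// (ddZl (sD w))//.
by rewrite !pairingDr !pairingDl !pairingZr !pairingZl; ring.
Qed.

Lemma metric_shape s v w : U s -> h s (S s v) w = ⟨dd v xi s, dd w N s⟩.
Proof. by move=> Us; rewrite (bs_S bs)// (metric_N ts)// (tangent_metric ts)// opprK. Qed.

Lemma shape_eq s v : U s -> dd v xi s = - dd (S s v) f s.
Proof.
move=> Us; rewrite (bs_S bs)// (ddNl sf)// opprK.
by rewrite [LHS](ts_decomp ts _ Us) (ts_Ndxi ts)// scale0r add0r.
Qed.

Lemma shape_lin s (c : R) u v : U s -> S s (c *: u + v) = c *: S s u + S s v.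
Proof.
move=> Us; apply: (metric_eq ts Us) => z.
rewrite (metric_linear_l ts)// !metric_shape// (ddDl sxi)// (ddZl sxi)//.
by rewrite pairingDl pairingZl.
Qed.

(** Differentiating [⟨xi, dd w N⟩ = 0] moves the second derivative onto [N], whose symmetry is then
    the Ricci equation. *)
Lemma shape_dual s v w : U s -> h s (S s v) w = - ⟨xi s, dd v (dd w N) s⟩.
Proof.
move=> Us; rewrite metric_shape//; apply/eqP; rewrite -addr_eq0; apply/eqP.
rewrite (dd_pairing_on (g := fun=> 0) v oU sxi (sDN w))// ?dd_cst//.
by move=> y Uy; rewrite (xi_dN ts).
Qed.

Lemma shape_symm s v w : U s -> h s (S s v) w = h s v (S s w).
Proof.
move=> Us; rewrite [RHS](metric_symm ts)// !shape_dual//.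
by have E := schwarz_dd v w oU sN Us; rewrite E.
Qed.

Lemma dd_dd_f s v w : U s -> dd v (dd w f) s = h s v w *: xi s + dd (T s (dd v (dd w f) s)) f s.
Proof. by move=> Us; rewrite (ts_h ts)// -(ts_decomp ts). Qed.

(** Gauss formula of the conormal map: its connection is the induced connection of [f] minus [2 K],
    the dual connection with respect to [h]. *)
Lemma dd_dd_N s v w : U s -> dd v (dd w N) s =
  - h s (S s v) w *: N s + dd (T s (dd v (dd w f) s) - (2 : R) *: K s v w) N s.
Proof.
move=> Us; apply: (cotangent_eq ts Us) => [|z].
  rewrite pairingDr pairingZr (ts_Nxi ts)// (xi_dN ts)// mulr1 addr0.
  by rewrite shape_dual// opprK.
rewrite pairingDr pairingZr (ts_Nf ts)// mulr0 add0r.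
have := metric_dual' ts z (T s (dd v (dd w f) s) - (2 : R) *: K s v w) Us.
rewrite (metric_symm ts)// (metric_D ts)// (metric_N ts)// (metric_Z ts)// (tangent_metric ts)// cubic_eq//.
lra.
Qed.

Lemma smooth_cubic v w : smooth_on U (fun s => K s v w).
Proof.
apply: (@smooth_ext _ _ _ _ (fun s => T s (dd v (dd w f) s) - christoffel h s v w)) => //.
  by move=> s Us; rewrite (bs_K bs).
apply: smoothB => //; first by apply: (ts_T ts); exact: smooth_dd.
exact: smooth_christoffel ts _ _.
Qed.

Lemma smooth_shape v : smooth_on U (fun s => S s v).
Proof.
apply: (@smooth_ext _ _ _ _ (fun s => - T s (dd v xi s))) => //.
  by move=> s Us; rewrite (bs_S bs).
by apply: smoothN => //; apply: (ts_T ts); exact: smooth_dd.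
Qed.

End Cubic.

Section Concrete.
Context {R : realType} {n : nat}.
Variables (U : set 'rV[R]_n) (f xi : 'rV[R]_n -> 'rV[R]_n.+1).
Hypotheses (oU : open U) (imm : immersion_on U f) (nor : affine_normal_on U f xi).

(** Bridge from the definitions of the statement to the abstract interface. The volume condition is
    not part of that interface and is carried separately. *)
Lemma blaschke_of_affine_normal :
  blaschke_structure U f xi (conormal f xi) (tangent_part f xi) (affine_metric f xi)
    (difference_tensor f xi) (shape_operator f xi).
Proof.
have [sf _] := imm.
have hE s v w : U s -> affine_metric f xi s v w = ⟨dd v (dd w f) s, conormal f xi s⟩.
  by move=> Us; rewrite /affine_metric normal_partE ddE ddE_fun.
have hD s u v w : U s -> affine_metric f xi s (u + v) w
     = affine_metric f xi s u w + affine_metric f xi s v w.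
  by move=> Us; rewrite !hE// (ddDl (smooth_dd w sf))// pairingDl.
have hZ s (c : R) v w : U s -> affine_metric f xi s (c *: v) w = c * affine_metric f xi s v w.
  by move=> Us; rewrite !hE// (ddZl (smooth_dd w sf))// pairingZl.
have ts : transversal_structure U f xi (conormal f xi) (tangent_part f xi) (affine_metric f xi).
  split=> //.
  - exact: normal_smooth nor.
  - exact: smooth_conormal imm nor.
  - by move=> b sb; apply: smooth_tangent_part.
  - move=> s b Us; by rewrite (dd_f imm)// -(frame_decomp nor).
  - by move=> s Us; rewrite (conormal_xi nor).
  - by move=> s v Us; rewrite (dd_f imm)// (conormal_tangent nor).
  - by move=> s v Us; rewrite -normal_partE ddE (normal_tangential nor).
  - move=> s v Us H.
    have ug : gram (affine_metric f xi s) (1%:M : 'M[R]_n) \in unitmx.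
      by rewrite unitmxE unitfE (metric_nondegenerate nor).
    apply: (can_inj (mulmxK ug)); rewrite mul0mx; apply/rowP => j.
    have := H (delta_mx 0 j); rewrite [v in affine_metric _ _ _ v]row_sum_delta.
    move=> H0; rewrite [RHS]mxE -[RHS]H0 mxE.
    have -> : affine_metric f xi s (\sum_(i < n) v 0 i *: delta_mx 0 i) (delta_mx 0 j)
        = \sum_(i < n) v 0 i * affine_metric f xi s (delta_mx 0 i) (delta_mx 0 j).
      elim/big_ind2: _ => [|a b c d <- <-|i _]; [|by rewrite hD|by rewrite hZ].
      by rewrite -(scale0r 0) hZ// mul0r.
    by apply: eq_bigr => i _; rewrite mxE !row1.
split=> // s v.
- move=> w Us; rewrite /difference_tensor /levi_civita derive_cst add0r.
  by rewrite /induced_connection /flatD -ddE -ddE_fun.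
- by move=> Us; rewrite /shape_operator ddE.
Qed.

End Concrete.

Section RowsAndDeterminants.
Context {R : realType} {V : normedModType R}.

Lemma dd_row (W : set V) m p (A : V -> 'M[R]_(m, p)) v x i :
  open W -> smooth_on W A -> W x -> dd v (fun y => row i (A y)) x = row i (dd v A x).
Proof.
move=> oW sA Wx; have sr : smooth_on W (fun y => row i (A y)).
  apply/smooth_mx => // k j; have := (smooth_mx A oW).1 sA i j.
  by move/eq_smooth; apply=> y; rewrite mxE.
apply/rowP => j; rewrite (dd_entry _ _ _ sr)// mxE (dd_entry _ _ _ sA)//.
by congr (dd v _ x); apply/funext => y; rewrite mxE.
Qed.

Lemma dd_det (W : set V) m (A : V -> 'M[R]_m) v x :
  smooth_on W A -> W x -> A x \in unitmx ->
  dd v (fun y => \det (A y)) x = \det (A x) * \tr (dd v A x *m invmx (A x)).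
Proof.
move=> sA Wx uA; rewrite !ddE derive_det; last exact: smooth_diff Wx.
have -> : \adj (A x) = \det (A x) *: invmx (A x).
  by rewrite /invmx uA scalerA mulrV ?scale1r.
by rewrite -scalemxAr mxtraceZ.
Qed.

End RowsAndDeterminants.

(** * Apolarity from the volume condition *)

Section Apolarity.
Context {R : realType} {n : nat}.
Variables (U : set 'rV[R]_n) (f xi : 'rV[R]_n -> 'rV[R]_n.+1) (N : 'rV[R]_n -> 'cV[R]_n.+1)
  (T : 'rV[R]_n -> 'rV[R]_n.+1 -> 'rV[R]_n) (h : 'rV[R]_n -> 'rV[R]_n -> 'rV[R]_n -> R)
  (K : 'rV[R]_n -> 'rV[R]_n -> 'rV[R]_n -> 'rV[R]_n) (S : 'rV[R]_n -> 'rV[R]_n -> 'rV[R]_n).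
Implicit Types (s v w z : 'rV[R]_n).
Hypothesis bs : blaschke_structure U f xi N T h K S.
Variable M : 'rV[R]_n -> 'M[R]_(1 + n).
Hypotheses (sM : smooth_on U M) (uM : forall s, U s -> M s \in unitmx)
  (M0 : forall s, U s -> row 0 (M s) = xi s)
  (MS : forall s i, U s -> row (rshift 1 i) (M s) = dd (delta_mx 0 i) f s)
  (MN : forall s b, U s -> ⟨b, N s⟩ = (b *m invmx (M s)) 0 0)
  (MT : forall s b i, U s -> (T s b) 0 i = (b *m invmx (M s)) 0 (rshift 1 i))
  (vol : forall s, U s -> \det (M s) ^+ 2 = `|\det (gram (h s) (1%:M : 'M[R]_n))|).

Let ts : transversal_structure U f xi N T h := bs.
Let oU := ts_open ts.
Let sf := ts_f ts.
Let sxi := ts_xi ts.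

Let sH : smooth_on U (fun y => gram (h y) (1%:M : 'M[R]_n)).
Proof.
apply/smooth_mx => // i j; have := smooth_metric ts (delta_mx 0 i) (delta_mx 0 j).
by move/eq_smooth; apply=> x; rewrite gramE.
Qed.

(** The row of [xi] contributes nothing, because the derivative of [xi] is tangential. *)
Lemma trace_frame s v : U s -> \tr (dd v M s *m invmx (M s)) =
  \tr (\matrix_i T s (dd v (dd (delta_mx 0 i) f) s) : 'M[R]_n).
Proof.
move=> Us; rewrite /mxtrace big_split_ord /= big_ord1.
have rowc i b : row i (dd v M s) = b ->
    (dd v M s *m invmx (M s)) i i = (b *m invmx (M s)) 0 i.
  by move=> <-; rewrite -row_mul [RHS]mxE.
have r0 : row (lshift n 0) (dd v M s) = dd v xi s.
  rewrite -(dd_row _ _ oU sM)//; apply: eq_on_dd oU _ _ Us => y Uy.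
  by rewrite -(M0 Uy); congr (row _ _); exact: val_inj.
rewrite (rowc _ _ r0) (_ : lshift n 0 = 0); last exact: val_inj.
rewrite -(MN _ Us) (ts_Ndxi ts)// add0r; apply: eq_bigr => i _.
have ri : row (rshift 1 i) (dd v M s) = dd v (dd (delta_mx 0 i) f) s.
  by rewrite -(dd_row _ _ oU sM)//; apply: eq_on_dd oU _ _ Us => y Uy; exact: MS.
by rewrite (rowc _ _ ri) -(MT _ _ Us) [RHS]mxE.
Qed.

(** The derivative of the Gram matrix is [L + L^T] for the matrix [L] of lowered Christoffel
    symbols, and both summands have the same trace against the symmetric inverse. *)
Lemma trace_gram s v : U s ->
  \tr (dd v (fun y => gram (h y) 1%:M) s *m invmx (gram (h s) (1%:M : 'M[R]_n))) =
  2 * \tr (\matrix_i christoffel h s v (delta_mx 0 i) : 'M[R]_n).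
Proof.
move=> Us; set H := gram (h s) 1%:M.
pose L : 'M[R]_n := \matrix_(i, l) christoffel_lower h s v (delta_mx 0 i) (delta_mx 0 l).
have -> : \matrix_i christoffel h s v (delta_mx 0 i) = L *m invmx H.
  apply/row_matrixP => i; rewrite rowK row_mul /christoffel; congr (_ *m _).
  by apply/rowP => j; rewrite !mxE.
have HT : (invmx H)^T = invmx H.
  rewrite trmx_inv; congr invmx; apply/matrixP => i j.
  by rewrite mxE !gramE (metric_symm ts).
have LT : \tr (L *m invmx H) = \tr (L^T *m invmx H).
  by rewrite -mxtrace_tr trmx_mul HT mxtrace_mulC.
have DH : dd v (fun y => gram (h y) 1%:M) s = L + L^T.
  apply/matrixP => i j; rewrite (dd_entry _ _ _ sH)// [RHS]mxE [L^T _ _]mxE.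
  have LE k l : L k l = christoffel_lower h s v (delta_mx 0 k) (delta_mx 0 l) by rewrite mxE.
  rewrite !LE /christoffel_lower -!ddE.
  have -> : dd v (fun y => gram (h y) 1%:M i j) s = dd v (fun y => h y (delta_mx 0 i) (delta_mx 0 j)) s.
    by congr (dd v _ s); apply/funext => y; rewrite gramE.
  have -> : dd v (fun y => h y (delta_mx 0 j) (delta_mx 0 i)) s =
      dd v (fun y => h y (delta_mx 0 i) (delta_mx 0 j)) s.
    by apply: eq_on_dd oU _ _ Us => y Uy; rewrite (metric_symm ts).
  by field.
by rewrite DH mulmxDl mxtraceD -LT mulr_natl mulr2n.
Qed.

(* Both traces are half the logarithmic derivative along v of |det h|: the volume
   condition on the affine normal identifies the two determinants. *)
Lemma cubic_trace s v : U s -> \tr (\matrix_i K s v (delta_mx 0 i) : 'M[R]_n) = 0.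
Proof.
move=> Us; pose H y := gram (h y) (1%:M : 'M[R]_n).
have uH := gram_unit ts Us.
have H0 : \det (H s) != 0 by rewrite -unitfE -unitmxE.
have sdM : smooth_on U (fun y => \det (M y)) by exact: smooth_det.
have sdH : smooth_on U (fun y => \det (H y)) by exact: smooth_det.
(* The locally constant sign [c] removes the absolute value, so that the volume condition can be
   differentiated. *)
have [c c2 Hc] : exists2 c : R, c * c = 1 & \forall y \near s, `|\det (H y)| = c * \det (H y).
  have Hcont : {for s, continuous (fun y => \det (H y))} by exact: smooth_continuous sdH Us.
  case: (ltgtP 0 (\det (H s))) => [p|p|p]; last by rewrite -p eqxx in H0.
    exists 1; first by rewrite mulr1.
    have : \forall y \near s, 0 < \det (H y) by exact: (cvgr_gt _ Hcont).
    by apply: filterS => y y0; rewrite gtr0_norm// mul1r.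
  exists (-1); first by rewrite mulrNN mulr1.
  have : \forall y \near s, \det (H y) < 0 by exact: (cvgr_lt _ Hcont).
  by apply: filterS => y y0; rewrite ltr0_norm// mulN1r.
have E : dd v (fun y => \det (M y) * \det (M y)) s = dd v (fun y => c * \det (H y)) s.
  rewrite !ddE; apply: near_eq_derive; have := open_near oU Us vol.
  by apply: filterS2 Hc => y e1 e2; rewrite -expr2 e2 e1.
move: E; rewrite (ddM _ sdM sdM)// (ddM _ (smooth_cst c) sdH)// dd_cst mul0r add0r.
rewrite (dd_det _ sM)// ?uM// (dd_det _ sH)// trace_frame// trace_gram// -/(H s).
have volc : \det (M s) * \det (M s) = c * \det (H s).
  by rewrite -expr2 vol// (nbhs_singleton Hc).
set tM := \tr _; set tH := \tr _ => E.
have -> : \matrix_i K s v (delta_mx 0 i) =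
    \matrix_i T s (dd v (dd (delta_mx 0 i) f) s)
    - \matrix_i christoffel h s v (delta_mx 0 i) :> 'M[R]_n.
  by apply/row_matrixP => i; rewrite linearB /= !rowK (bs_K bs).
rewrite raddfB /= -/tM -/tH.
have : (2 * (c * \det (H s))) * (tM - tH) = 0.
  have -> : 2 * (c * \det (H s)) * (tM - tH) =
     2 * (c * \det (H s)) * tM - c * (\det (H s) * (2 * tH)) by ring.
  by rewrite -E -volc; ring.
move/eqP; rewrite mulf_eq0 => /orP[|/eqP//].
rewrite !mulf_eq0 pnatr_eq0 (negbTE H0) /= orbF => /eqP c0.
by move: c2; rewrite c0 mulr0 => /eqP; rewrite eq_sym oner_eq0.
Qed.

End Apolarity.

Section ConcreteApolarity.
Context {R : realType}.
Variables (U : set 'rV[R]_3) (f xi : 'rV[R]_3 -> 'rV[R]_4).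
Hypotheses (oU : open U) (imm : immersion_on U f) (nor : affine_normal_on U f xi)
  (pos : positive_definite_on U f xi).

Lemma affine_normal_point_structure s : U s ->
  point_structure (affine_metric f xi s) (difference_tensor f xi s) (shape_operator f xi s).
Proof.
have bs := blaschke_of_affine_normal oU imm nor.
have tr s' v : U s' -> \tr (\matrix_i difference_tensor f xi s' v (delta_mx 0 i) : 'M[R]_3) = 0.
  have [sf _] := imm.
  apply: (cubic_trace bs (smooth_moving_frame oU imm nor) (normal_transversal nor)).
  - move=> y Uy; apply/rowP => j; rewrite mxE.
    rewrite -[RHS](col_mxEu (xi y) (jacobian f y)).
    by congr (moving_frame f xi y _ j); exact: val_inj.
  - move=> y i Uy; rewrite (dd_f imm)// -rowE; apply/rowP => j.
    by rewrite [LHS]mxE [RHS]mxE -[RHS](col_mxEd (xi y) (jacobian f y)).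
  - by move=> y b Uy; rewrite -normal_partE.
  - by move=> y b i Uy; rewrite /tangent_part mxE.
  - move=> y Uy; have := normal_volume nor 1%:M Uy; rewrite mul1mx => /(congr1 (fun r => r ^+ 2)).
    by rewrite sqr_sqrtr// real_normK ?num_real.
move=> Us; split.
- by move=> c u v w; rewrite (metric_linear_l bs).
- by move=> v w; rewrite (metric_symm bs).
- by move=> v v0; exact: pos.
- by move=> c u v; rewrite (shape_lin bs).
- by move=> v w; rewrite (shape_symm bs).
- by move=> c u v w; rewrite (cubic_lin bs).
- by move=> v w; rewrite (cubic_symm bs).
- by have H := cubic_total bs; move=> v w z; exact: H.
- by move=> v; exact: tr.
Qed.

End ConcreteApolarity.

(** * The axis field *)

Section Fields.
Context {R : realType} {n : nat}.
Variables (U : set 'rV[R]_n) (e : 'rV[R]_n -> 'rV[R]_n).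
Hypotheses (oU : open U) (se : smooth_on U e).

Let sei i : smooth_on U (fun s => e s 0 i). Proof. exact: ((smooth_mx e oU).1 se). Qed.

Lemma smooth_linear_field (L : 'rV[R]_n -> 'rV[R]_n -> R) :
  (forall s, U s -> forall (c : R) u v, L s (c *: u + v) = c * L s u + L s v) ->
  (forall v, smooth_on U (fun s => L s v)) -> smooth_on U (fun s => L s (e s)).
Proof.
move=> lin sL; have : smooth_on U (fun s => \sum_i e s 0 i * L s (delta_mx 0 i)).
  by apply: smooth_sum => // i _; exact: smoothM.
apply: smooth_ext => // s Us; have L0 : L s 0 = 0.
  by have := lin s Us 1 0 0; rewrite scale1r addr0 mul1r => /eqP; rewrite -subr_eq subrr eq_sym => /eqP.
have LD u v : L s (u + v) = L s u + L s v by rewrite -[u]scale1r lin// mul1r scale1r.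
have LZ c v : L s (c *: v) = c * L s v by rewrite -[c *: v]addr0 lin// L0 addr0.
rewrite [in RHS](row_sum_delta (e s)).
by elim/big_ind2: _ => [|a b c d -> ->|i _] //; rewrite ?LD ?LZ.
Qed.

Lemma smooth_linear_field_mx m p (L : 'rV[R]_n -> 'rV[R]_n -> 'M[R]_(m, p)) :
  (forall s, U s -> forall (c : R) u v, L s (c *: u + v) = c *: L s u + L s v) ->
  (forall v, smooth_on U (fun s => L s v)) -> smooth_on U (fun s => L s (e s)).
Proof.
move=> lin sL; apply/smooth_mx => // i j.
apply: (@smooth_linear_field (fun s v => L s v i j)) => [s Us c u v|v].
  by rewrite lin// !mxE.
exact: ((smooth_mx _ oU).1 (sL v)).
Qed.

Lemma smooth_dd_field m p (g : 'rV[R]_n -> 'M[R]_(m, p)) : smooth_on U g ->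
  smooth_on U (fun s => dd (e s) g s).
Proof.
move=> sg; apply: (@smooth_linear_field_mx m p (fun s v => dd v g s)) => [s Us c u v|v].
  by rewrite (ddDl sg)// (ddZl sg).
exact: smooth_dd.
Qed.

(** [dd] takes a fixed direction, so along a field the motion of the field gives an extra first
    order term. *)
Lemma dd_dd_field m p (g : 'rV[R]_n -> 'M[R]_(m, p)) s v : smooth_on U g -> U s ->
  dd v (fun y => dd (e y) g y) s = dd (dd v e s) g s + dd v (dd (e s) g) s.
Proof.
move=> sg Us; pose F (k : 'I_n) y := e y 0 k *: dd (delta_mx 0 k) g y.
have sF k : smooth_on U (F k) by apply: smoothZ => //; exact: smooth_dd.
have dsum (G : 'I_n -> 'rV[R]_n -> 'M[R]_(m, p)) : (forall k, smooth_on U (G k)) ->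
    dd v (fun y => \sum_k G k y) s = \sum_k dd v (G k) s.
  move=> sG; elim: (index_enum _) => [|k r IH].
    rewrite big_nil -[RHS](dd_cst v (0 : 'M[R]_(m, p)) s); congr (dd v _ s).
    by apply/funext => y; rewrite big_nil.
  rewrite big_cons -IH -(ddD (sG k) (smooth_sum r (P := predT) oU (fun k _ => sG k)))//.
  by congr (dd v _ s); apply/funext => y; rewrite big_cons.
have -> : dd v (fun y => dd (e y) g y) s = dd v (fun y => \sum_k F k y) s.
  by apply: eq_on_dd oU _ _ Us => y Uy; exact: dd_sum_delta sg Uy.
rewrite dsum// (dd_sum_delta _ sg Us).
have -> : dd v (dd (e s) g) s = \sum_k e s 0 k *: dd v (dd (delta_mx 0 k) g) s.
  rewrite (schwarz_dd v (e s) oU sg Us) (dd_sum_delta (e s) (smooth_dd v sg) Us).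
  apply: eq_bigr => k _; congr (_ *: _); exact: schwarz_dd oU sg Us.
rewrite -big_split; apply: eq_bigr => k _ /=.
by rewrite (ddZ _ (sei k) (smooth_dd _ sg))// (dd_entry v 0 k se Us).
Qed.

End Fields.

Section AxisField.
Context {R : realType}.
Variables (U : set 'rV[R]_3) (f xi : 'rV[R]_3 -> 'rV[R]_4) (N : 'rV[R]_3 -> 'cV[R]_4)
  (T : 'rV[R]_3 -> 'rV[R]_4 -> 'rV[R]_3) (h : 'rV[R]_3 -> 'rV[R]_3 -> 'rV[R]_3 -> R)
  (K : 'rV[R]_3 -> 'rV[R]_3 -> 'rV[R]_3 -> 'rV[R]_3) (S : 'rV[R]_3 -> 'rV[R]_3 -> 'rV[R]_3)
  (e : 'rV[R]_3 -> 'rV[R]_3).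
Implicit Types (s v w z : 'rV[R]_3).
Hypotheses (bs : blaschke_structure U f xi N T h K S)
  (pt : forall s, U s -> point_structure (h s) (K s) (S s))
  (se : smooth_on U e)
  (nf : forall s, U s -> exists mu lam a, mu != 0 /\ normal_form (h s) (K s) (S s) (e s) mu lam a).

Let ts : transversal_structure U f xi N T h := bs.
Let oU := ts_open ts.
Let sf := ts_f ts.
Let sxi := ts_xi ts.
Let sN := ts_N ts.

(** The parameters of the normal form are given as contractions and traces of smooth tensors, so
    their smoothness follows from that of [e]; [axis_normal_form] identifies them. *)
Definition axis_mu s := 2^-1 * h s (K s (e s) (e s)) (e s).
Definition axis_lam s := h s (S s (e s)) (e s).
Definition axis_a s := 2^-1 * (\tr (\matrix_i S s (delta_mx 0 i) : 'M[R]_3) - axis_lam s).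
Definition axis_E s := dd (e s) f s.
Definition axis_E' s := dd (e s) N s.
Local Notation mu := axis_mu.
Local Notation lam := axis_lam.
Local Notation a := axis_a.
Local Notation E := axis_E.
Local Notation E' := axis_E'.

Lemma mul_rows_lin (L : 'rV[R]_3 -> 'rV[R]_3) v :
  (forall (c : R) u w, L (c *: u + w) = c *: L u + L w) ->
  v *m (\matrix_i L (delta_mx 0 i) : 'M[R]_3) = L v.
Proof.
move=> lin; have L0 : L 0 = 0.
  by have := lin 1 0 0; rewrite !scale1r addr0 => /eqP; rewrite -subr_eq subrr eq_sym => /eqP.
have LD u w : L (u + w) = L u + L w by rewrite -[u]scale1r lin !scale1r.
have LZ c w : L (c *: w) = c *: L w by rewrite -[c *: w]addr0 lin L0 addr0.
rewrite mulmx_sum_row [v in RHS]row_sum_delta.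
by elim/big_ind2: _ => [|? ? ? ? -> ->|i _] //; rewrite ?LD ?LZ ?rowK.
Qed.

Lemma axis_normal_form s : U s ->
  mu s != 0 /\ normal_form (h s) (K s) (S s) (e s) (mu s) (lam s) (a s).
Proof.
move=> Us; have [m [l [b [m0 nf0]]]] := nf Us; have [ee HK HS] := nf0.
have p := pt Us.
have muE : mu s = m.
  by rewrite /mu HK ee (hDl p) !(hZl p) ee; field.
have lamE : lam s = l by rewrite /lam HS ee (hDl p) !(hZl p) ee; ring.
have aE : a s = b.
  have [x [y on]] := orthonormal_extend p ee; have [_ xx yy [ex ey xy]] := on.
  rewrite /a lamE (trace_orthonormal p _ on) !(mul_rows_lin _ (shape_linear p)).
  rewrite !HS !(hDl p) !(hZl p) ee xx yy !(metric_sym p x (e s)) !(metric_sym p y (e s)) ex ey.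
  by field.
by rewrite muE lamE aE.
Qed.

Let ee s : U s -> h s (e s) (e s) = 1. Proof. by move=> /axis_normal_form[_ []]. Qed.
Let Ke s v : U s -> K s (e s) v = - mu s *: v + (3 * mu s * h s v (e s)) *: e s.
Proof. by move=> /axis_normal_form[_ []]. Qed.
Let Se s v : U s -> S s v = a s *: v + ((lam s - a s) * h s v (e s)) *: e s.
Proof. by move=> /axis_normal_form[_ []]. Qed.

Lemma smooth_axis_E : smooth_on U E.
Proof. exact: smooth_dd_field. Qed.
Lemma smooth_axis_E' : smooth_on U E'.
Proof. exact: smooth_dd_field. Qed.
Let sE := smooth_axis_E.
Let sE' := smooth_axis_E'.

Lemma smooth_axis_th v : smooth_on U (fun s => h s v (e s)).
Proof.
apply: (smooth_linear_field oU se (L := fun s w => h s v w)) => [s Us c u w|w].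
  by rewrite (metric_Dr ts)// (metric_Zr ts).
exact: smooth_metric ts _ _.
Qed.

Lemma smooth_axis_lam : smooth_on U lam.
Proof.
have sSe : smooth_on U (fun s => S s (e s)).
  apply: (smooth_linear_field_mx oU se (L := S)) => [s Us c u v|v].
    exact: shape_lin bs _ _ _ _ Us.
  exact: smooth_shape bs _.
apply: (smooth_linear_field oU se (L := fun s w => h s (S s (e s)) w)) => [s Us c u w|w].
  by rewrite (metric_Dr ts)// (metric_Zr ts).
apply: (smooth_linear_field oU sSe (L := fun s v => h s v w)) => [s Us c u v|v].
  by rewrite (metric_linear_l ts).
exact: smooth_metric ts _ _.
Qed.

Lemma smooth_axis_mu : smooth_on U mu.
Proof.
have sKe : smooth_on U (fun s => K s (e s) (e s)).
  apply: (smooth_linear_field_mx oU se (L := fun s v => K s v (e s))) => [s Us c u v|v].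
    exact: cubic_lin bs _ _ _ _ _ Us.
  apply: (smooth_linear_field_mx oU se (L := fun s w => K s v w)) => [s Us c u w|w].
    by rewrite !(cubic_symm bs v)// (cubic_lin bs).
  exact: smooth_cubic bs _ _.
apply: smoothM => //; first exact: smooth_cst.
apply: (smooth_linear_field oU se (L := fun s w => h s (K s (e s) (e s)) w)) => [s Us c u w|w].
  by rewrite (metric_Dr ts)// (metric_Zr ts).
apply: (smooth_linear_field oU sKe (L := fun s v => h s v w)) => [s Us c u v|v].
  by rewrite (metric_linear_l ts).
exact: smooth_metric ts _ _.
Qed.

Lemma smooth_axis_a : smooth_on U a.
Proof.
apply: smoothM => //; first exact: smooth_cst.
apply: smoothB => //; last exact: smooth_axis_lam.
apply: smooth_sum => // i _.
have /(smooth_mx _ oU)/(_ 0 i) := smooth_shape bs (delta_mx 0 i).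
by move/eq_smooth; apply=> s; rewrite mxE.
Qed.

Let sth := smooth_axis_th.
Let smu := smooth_axis_mu.
Let sa := smooth_axis_a.

(* The Levi-Civita derivative of the axis field in the direction v. *)
Definition axis_A s v := T s (dd v E s) - K s v (e s).
Local Notation A := axis_A.
Local Notation th s v := (h s v (e s)).

Lemma smooth_axis_A v : smooth_on U (fun s => A s v).
Proof.
apply: smoothB => //; first by apply: (ts_T ts); exact: smooth_dd.
apply: (smooth_linear_field_mx oU se (L := fun s w => K s v w)) => [s Us c u w|w].
  by rewrite !(cubic_symm bs v)// (cubic_lin bs).
exact: smooth_cubic bs _ _.
Qed.

Lemma axis_EN s : U s -> ⟨E s, N s⟩ = 0.
Proof. by move=> Us; exact: ts_Nf ts _ _ Us. Qed.

Lemma axis_E_dN s z : U s -> ⟨E s, dd z N s⟩ = - th s z.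
Proof.
by move=> Us; rewrite (metric_dual ts z (e s) Us) opprK.
Qed.

Lemma axis_df_E' s z : U s -> ⟨dd z f s, E' s⟩ = - th s z.
Proof.
by move=> Us; rewrite (metric_dual' ts z (e s) Us) opprK.
Qed.

Lemma axis_xi_E' s : U s -> ⟨xi s, E' s⟩ = 0.
Proof. by move=> Us; rewrite /E' (xi_dN ts). Qed.

Lemma dd_axis_E_N s v : U s -> ⟨dd v E s, N s⟩ = th s v.
Proof.
move=> Us; have := dd_pairing_on (g := fun=> 0) v oU sE sN axis_EN Us.
by rewrite dd_cst axis_E_dN// => /eqP; rewrite subr_eq0 => /eqP.
Qed.

Lemma dd_axis_E s v : U s ->
  dd v E s = dd (A s v) f s - mu s *: dd v f s + th s v *: ((3 * mu s) *: E s + xi s).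
Proof.
move=> Us; rewrite [LHS](ts_decomp ts _ Us) dd_axis_E_N//.
have -> : T s (dd v E s) = A s v + (- mu s *: v + (3 * mu s * th s v) *: e s).
  by rewrite -Ke// (cubic_symm bs (e s) v Us) /axis_A subrK.
rewrite !(ddDl sf)// !(ddZl sf)// -/(E s).
by rewrite scalerDr scalerA scaleNr [_ * (3 * _)]mulrC [_ *: xi s + _]addrC -!addrA.
Qed.

Lemma dd_axis_E_dN s v z : U s -> ⟨dd v E s, dd z N s⟩ =
  - h s (A s v) z + (mu s * h s v z - 3 * mu s * th s v * th s z).
Proof.
move=> Us; rewrite dd_axis_E// !pairingDl pairingNl !pairingZl !pairingDl !pairingZl.
rewrite axis_E_dN// (xi_dN ts)//.
have -> : ⟨dd (A s v) f s, dd z N s⟩ = - h s (A s v) z by rewrite (metric_dual' ts _ _ Us) opprK.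
have -> : ⟨dd v f s, dd z N s⟩ = - h s v z by rewrite (metric_dual' ts _ _ Us) opprK.
ring.
Qed.

Lemma cubic_axis s v z : U s -> h s (K s v z) (e s) = - mu s * h s v z + 3 * mu s * th s v * th s z.
Proof.
move=> Us; have p := pt Us.
rewrite (cubic_totally_sym p) (cubic_sym p) Ke// (hDl p) !(hZl p) (metric_sym p (e s) z).
ring.
Qed.

Lemma dd_axis_E'_xi s v : U s -> ⟨xi s, dd v E' s⟩ = - lam s * th s v.
Proof.
move=> Us; have := dd_pairing_on (g := fun=> 0) v oU sxi sE' axis_xi_E' Us.
rewrite dd_cst (shape_eq bs)// pairingNl axis_df_E'// opprK.
have p := pt Us; rewrite Se// (hDl p) !(hZl p) ee// => H.
have {}H : ⟨xi s, dd v E' s⟩ = - (a s * th s v + (lam s - a s) * th s v * 1) by lra.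
by rewrite H; ring.
Qed.

Lemma df_dd_axis_E' s v z : U s -> ⟨dd z f s, dd v E' s⟩ =
  - h s (A s v) z - (mu s * h s v z - 3 * mu s * th s v * th s z).
Proof.
move=> Us.
have H1 := dd_pairing_on (g := fun y => - th y z) v oU (smooth_dd z sf) sE' (fun y Uy => axis_df_E' z Uy) Us.
have H2 := dd_pairing_on (g := fun y => - th y z) v oU sE (smooth_dd z sN) (fun y Uy => axis_E_dN z Uy) Us.
have H3 := cubic_eq bs v z (e s) Us.
rewrite cubic_axis// -/(E s) -/(E' s) in H3.
rewrite dd_axis_E_dN// in H2.
have {}H3 : ⟨E s, dd v (dd z N) s⟩ - ⟨dd v (dd z f) s, E' s⟩ = 2 * (- mu s * h s v z + 3 * mu s * th s v * th s z).
  by rewrite H3 mulrA mulfV ?mul1r// pnatr_eq0.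
lra.
Qed.

Lemma dd_axis_E' s v : U s -> dd v E' s =
  dd (A s v) N s + mu s *: dd v N s - th s v *: ((3 * mu s) *: E' s + lam s *: N s).
Proof.
move=> Us; apply: (cotangent_eq ts Us) => [|z].
  rewrite dd_axis_E'_xi// !pairingDr pairingNr !pairingZr !pairingDr !pairingZr.
  by rewrite axis_xi_E'// !(xi_dN ts)// (ts_Nxi ts)//; ring.
rewrite df_dd_axis_E'// !pairingDr pairingNr !pairingZr !pairingDr !pairingZr.
rewrite axis_df_E'// (ts_Nf ts)//.
have -> : ⟨dd z f s, dd (A s v) N s⟩ = - h s (A s v) z by rewrite (metric_dual ts _ _ Us) opprK.
have -> : ⟨dd z f s, dd v N s⟩ = - h s v z by rewrite (metric_dual ts _ _ Us) opprK.
ring.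
Qed.

(** Derivative of [⟨E, E'⟩ = -1], which is [h e e = 1]. *)
Lemma axis_A_perp s v : U s -> h s (A s v) (e s) = 0.
Proof.
move=> Us; have EE y : U y -> ⟨E y, E' y⟩ = - 1.
  by move=> Uy; rewrite axis_df_E'// ee.
have := dd_pairing_on (g := fun=> -1) v oU sE sE' EE Us.
rewrite dd_cst.
have H1 := dd_axis_E_dN v (e s) Us; have H2 := df_dd_axis_E' v (e s) Us.
rewrite -/(E' s) ee// in H1; rewrite -/(E s) ee// in H2.
rewrite H1 H2; lra.
Qed.

Lemma dd_axis_th s v w : U s -> dd w (fun y => th y v) s =
  th s (T s (dd w (dd v f) s) - K s w v) + h s (A s w) v.
Proof.
move=> Us; have p := pt Us.
have := dd_pairing_on (g := fun y => - th y v) w oU (smooth_dd v sf) sE' (fun y Uy => axis_df_E' v Uy) Us.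
rewrite (ddN (sth v))// df_dd_axis_E'// => H.
rewrite (hDl p) (hNl p) cubic_axis//.
have -> : th s (T s (dd w (dd v f) s)) = - ⟨dd w (dd v f) s, E' s⟩.
  by rewrite (tangent_metric ts).
lra.
Qed.

Lemma dd_metric_levi s v w z : U s -> dd w (fun y => h y v z) s =
  h s (T s (dd w (dd v f) s) - K s w v) z + h s v (T s (dd w (dd z f) s) - K s w z).
Proof.
move=> Us; have p := pt Us; rewrite (dd_metric ts)//.
have D := dd_dd_N bs w z Us.
have P : ⟨dd v f s, dd w (dd z N) s⟩ = - h s v (T s (dd w (dd z f) s) - (2 : R) *: K s w z).
  rewrite D pairingDr pairingZr (ts_Nf ts)// mulr0 add0r.
  by rewrite (metric_dual' ts _ _ Us) opprK.
rewrite P !(hDl p) !(hDr p) !(hNl p) !(hNr p) (hZr p) (tangent_metric ts)//.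
have : h s (K s w v) z = h s v (K s w z).
  by rewrite (cubic_totally_sym p) (metric_sym p).
lra.
Qed.

(** The Codazzi equation of [K] contracted with [e]. The expression [⟨dd w (dd v E), dd z N⟩ - ⟨dd z
    f, dd w (dd v E')⟩] is symmetric in [v] and [w]; expanding it leaves [Phi] and terms that are
    themselves symmetric. *)
Lemma codazzi s v w z : U s ->
  let Phi w v := dd w mu s * (h s v z - 3 * th s v * th s z)
    - 3 * mu s * h s (A s w) v * th s z - 3 * mu s * th s v * h s (A s w) z
    - h s (A s v) (K s w z) + 2^-1 * th s v * (h s (S s w) z - lam s * h s w z) in
  Phi w v = Phi v w.
Proof.
move=> Us Phi; have p := pt Us.
(* [be] is minus [h (K_e v) z], and [G] below is the Christoffel symbol, symmetric in its two
   arguments. *)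
pose be s v z := mu s * h s v z - 3 * mu s * th s v * th s z.
pose G w v := T s (dd w (dd v f) s) - K s w v.
have GC w' v' : G w' v' = G v' w'.
  by rewrite /G (cubic_sym p); have H := schwarz_dd w' v' oU sf Us; rewrite H.
suff key w' v' : ⟨dd w' (dd v' E) s, dd z N s⟩ - ⟨dd z f s, dd w' (dd v' E') s⟩ =
    2 * (Phi w' v' + mu s * h s (G w' v') z - 3 * mu s * th s (G w' v') * th s z).
  have := key w v; have := key v w.
  have H1 := schwarz_dd w v oU sE Us; have H2 := schwarz_dd w v oU sE' Us.
  rewrite H1 H2 (GC w v); lra.
have smh : smooth_on U (fun y => mu y * h y v' z).
  by apply: smoothM => //; exact: smooth_metric ts _ _.
have stt : smooth_on U (fun y => th y v' * th y z) by exact: smoothM.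
have s3 : smooth_on U (fun y => 3 * mu y) by apply: smoothM => //; exact: smooth_cst.
have Dbe : dd w' (fun y => be y v' z) s =
    dd w' mu s * (h s v' z - 3 * th s v' * th s z)
    + mu s * (h s (G w' v') z + h s v' (G w' z))
    - 3 * mu s * ((th s (G w' v') + h s (A s w') v') * th s z
                  + th s v' * (th s (G w' z) + h s (A s w') z)).
  have -> : dd w' (fun y => be y v' z) s = dd w' (fun y => mu y * h y v' z - 3 * mu y * (th y v' * th y z)) s.
    by congr (dd w' _ s); apply/funext => y; rewrite /be -mulrA.
  rewrite (ddB _ oU smh (smoothM oU s3 stt))//.
  rewrite (ddM _ smu (smooth_metric ts v' z))// (ddM _ s3 stt)// (ddM _ (sth v') (sth z))//.
  rewrite (ddM _ (smooth_cst (3 : R)) smu)// dd_cst dd_metric_levi// !dd_axis_th// -/(G w' v') -/(G w' z).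
  ring.
have H1 := dd_pairing_on (g := fun y => - h y (A y v') z + be y v' z) w' oU
   (smooth_dd v' sE) (smooth_dd z sN) (fun y Uy => dd_axis_E_dN v' z Uy) Us.
have H2 := dd_pairing_on (g := fun y => - h y (A y v') z - be y v' z) w' oU
   (smooth_dd z sf) (smooth_dd v' sE') (fun y Uy => df_dd_axis_E' v' z Uy) Us.
have sAz : smooth_on U (fun y => h y (A y v') z).
  apply: (smooth_linear_field oU (smooth_axis_A v') (L := fun s v => h s v z)) => [y Uy c u v0|v0].
    by rewrite (metric_linear_l ts).
  exact: smooth_metric ts _ _.
have sbe : smooth_on U (fun y => be y v' z).
  apply: smoothB => //; apply: smoothM => //; exact: smoothM.
rewrite (ddD (smoothN oU sAz) sbe)// (ddN sAz)// in H1.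
rewrite (ddB _ oU (smoothN oU sAz) sbe)// (ddN sAz)// in H2.
have P1 : ⟨dd v' E s, dd w' (dd z N) s⟩ = - h s (S s w') z * th s v'
    - h s (A s v') (G w' z) + h s (A s v') (K s w' z) + be s v' (G w' z) - be s v' (K s w' z).
  rewrite (dd_dd_N bs)// pairingDr pairingZr dd_axis_E_N//.
  rewrite dd_axis_E_dN// /be /G !(hDr p) !(hNr p) !(hZr p) !(hDl p) !(hNl p) !(hZl p).
  ring.
have P2 : ⟨dd w' (dd z f) s, dd v' E' s⟩ = - h s w' z * lam s * th s v'
    - h s (A s v') (G w' z) - h s (A s v') (K s w' z) - be s v' (G w' z) - be s v' (K s w' z).
  rewrite (dd_dd_f bs)// pairingDl pairingZl dd_axis_E'_xi// df_dd_axis_E'// /be /G.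
  by rewrite !(hDr p) !(hNr p) !(hDl p) !(hNl p); ring.
rewrite P1 in H1; rewrite P2 in H2; rewrite Dbe in H1 H2.
rewrite /Phi; move: H1 H2; rewrite /be.
move: (dd w' _ s) (dd w' _ s) => d1 d2 H1 H2.
lra.
Qed.

End AxisField.

Lemma open_nonzero (R : realType) (V : normedModType R) (U : set V) (g : V -> R) :
  open U -> smooth_on U g -> open [set s | U s /\ g s != 0].
Proof.
move=> oU sg; rewrite openE => s [Us gs].
have c := smooth_continuous sg Us; apply: filterI; first exact: open_nbhs_nbhs.
exact: (c _ (open_nbhs_nbhs (conj (@open_neq _ (0 : R)) gs))).
Qed.

(** * Solving the Codazzi equation in a frame *)

Section CodazziFrame.
Context {R : realType}.
Variables (h : 'rV[R]_3 -> 'rV[R]_3 -> R) (K : 'rV[R]_3 -> 'rV[R]_3 -> 'rV[R]_3)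
  (S : 'rV[R]_3 -> 'rV[R]_3).
Hypothesis pt : point_structure h K S.
Variables (e x y : 'rV[R]_3) (mu l m lam a : R) (A : 'rV[R]_3 -> 'rV[R]_3) (d : 'rV[R]_3 -> R).
Hypotheses (ff : frame_form h K S e x y mu l m lam a) (mu0 : mu != 0)
  (Ae : forall v, h (A v) e = 0).
Hypothesis cod : let Phi w v z := d w * (h v z - 3 * h v e * h z e)
    - 3 * mu * h (A w) v * h z e - 3 * mu * h v e * h (A w) z
    - h (A v) (K w z) + 2^-1 * h v e * (h (S w) z - lam * h w z) in
  forall w v z, Phi w v z = Phi v w z.

(** Eight scalar equations, linear in the entries of [A] and [d], suffice: they make [e] geodesic
    and [A] scalar on the plane, whatever the harmonic part [l], [m]. *)
Lemma codazzi_frame : [/\ h (A e) x = 0, h (A e) y = 0, h (A x) y = 0, h (A y) x = 0 &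
  [/\ h (A y) y = h (A x) x, d x = 0, d y = 0 & d e = 2^-1 * (a - lam) - 4 * mu * h (A x) x]].
Proof.
have [[ee xx yy [ex ey xy]] [Kee Kex Key [Kxx Kxy Kyy [Se Sx Sy]]]] := ff.
have [xe ye yx] : [/\ h x e = 0, h y e = 0 & h y x = 0] by split; rewrite (metric_sym pt).
have [Kxe Kye Kyx] : [/\ K x e = - mu *: x, K y e = - mu *: y & K y x = m *: x - l *: y].
  by split; rewrite (cubic_sym pt).
pose val := (ee, xx, yy, ex, ey, xy, (xe, ye, yx), (Kee, Kex, Key, Kxx, Kxy, Kyy, (Kxe, Kye, Kyx), (Se, Sx, Sy))).
pose lin := (hDr pt, hNr pt, hZr pt, hDl pt, hNl pt, hZl pt, Ae).
have := cod x e e; have := cod y e e; have := cod x e x; have := cod x e y.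
have := cod y e x; have := cod y e y; have := cod x y y; have := cod y x x.
rewrite !val !lin !val; clear cod.
move: (h (A e) x) (h (A e) y) (h (A x) x) (h (A x) y) (h (A y) x) (h (A y) y) (d x) (d y) (d e).
move=> b c p q q' r dx dy de; clear val lin.
move=> H; have {H}By : dy = m * p - l * q - l * q' - m * r by lra.
move=> H; have {H}Bx : dx = m * q' - l * r + l * p + m * q by lra.
move=> H; have {H}E2 : de = 2^-1 * (a - lam) - 4 * mu * r + l * b + m * c by lra.
move=> H; have {H}Q2 : 4 * mu * q' = l * c - m * b by lra.
move=> H; have {H}Q1 : 4 * mu * q = l * c - m * b by lra.
move=> H; have {H}E1 : de = 2^-1 * (a - lam) - 4 * mu * p - l * b - m * c by lra.
move=> H; have {H}Dy : dy = 2 * mu * c by lra.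
move=> H; have {H}Dx : dx = 2 * mu * b by lra.
have PR : 4 * mu * (p - r) = - 2 * (l * b + m * c) by lra.
(* Eliminating the other unknowns leaves [b] with a sum of squares as coefficient, positive because
   [mu != 0]. *)
have b0 : b = 0.
  have : (8 * mu ^+ 2 + 2 * (l ^+ 2 + m ^+ 2)) * b = 0.
    have : 4 * mu * dx = m * (4 * mu * q' + 4 * mu * q) + l * (4 * mu * (p - r)) by rewrite Bx; ring.
    by rewrite Dx Q1 Q2 PR => H; rewrite -[RHS](subrr (4 * mu * (2 * mu * b))) [X in _ - X]H; ring.
  move/eqP; rewrite mulf_eq0 => /orP[/eqP|/eqP//]; have := sqr_ge0 l; have := sqr_ge0 m.
  have : 0 < mu ^+ 2 by rewrite exprn_even_gt0.
  lra.
have c0 : c = 0.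
  have : (8 * mu ^+ 2 + 2 * (l ^+ 2 + m ^+ 2)) * c = 0.
    have : 4 * mu * dy = m * (4 * mu * (p - r)) - l * (4 * mu * q + 4 * mu * q') by rewrite By; ring.
    by rewrite Dy Q1 Q2 PR => H; rewrite -[RHS](subrr (4 * mu * (2 * mu * c))) [X in _ - X]H; ring.
  move/eqP; rewrite mulf_eq0 => /orP[/eqP|/eqP//]; have := sqr_ge0 l; have := sqr_ge0 m.
  have : 0 < mu ^+ 2 by rewrite exprn_even_gt0.
  lra.
subst b c; have m4 : 4 * mu != 0 by rewrite mulf_neq0 ?pnatr_eq0.
have q0 : q = 0 by apply: (mulfI m4); rewrite Q1; ring.
have q0' : q' = 0 by apply: (mulfI m4); rewrite Q2; ring.
have pr : r = p by apply: (mulfI m4); lra.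
by split=> //; split=> //; [rewrite Dx mulr0|rewrite Dy mulr0|rewrite E1 !mulr0 !subr0].
Qed.
End CodazziFrame.

(** * The first order system along the axis *)

Section AxisSystem.
Context {R : realType}.
Variables (U : set 'rV[R]_3) (f xi : 'rV[R]_3 -> 'rV[R]_4) (N : 'rV[R]_3 -> 'cV[R]_4)
  (T : 'rV[R]_3 -> 'rV[R]_4 -> 'rV[R]_3) (h : 'rV[R]_3 -> 'rV[R]_3 -> 'rV[R]_3 -> R)
  (K : 'rV[R]_3 -> 'rV[R]_3 -> 'rV[R]_3 -> 'rV[R]_3) (S : 'rV[R]_3 -> 'rV[R]_3 -> 'rV[R]_3)
  (e : 'rV[R]_3 -> 'rV[R]_3).
Implicit Types (s v w z : 'rV[R]_3).
Hypotheses (bs : blaschke_structure U f xi N T h K S)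
  (pt : forall s, U s -> point_structure (h s) (K s) (S s))
  (se : smooth_on U e)
  (nf : forall s, U s -> exists mu lam a, mu != 0 /\ normal_form (h s) (K s) (S s) (e s) mu lam a).

Let ts : transversal_structure U f xi N T h := bs.
Let oU := ts_open ts.
Let sf := ts_f ts.
Let sxi := ts_xi ts.
Let sN := ts_N ts.
Local Notation mu := (axis_mu h K e).
Local Notation lam := (axis_lam h S e).
Local Notation a := (axis_a h S e).
Local Notation E := (axis_E f e).
Local Notation E' := (axis_E' N e).
Local Notation A := (axis_A f T K e).
Local Notation th s v := (h s v (e s)).

(** Half the trace, since [A] kills [e] and is scalar on the plane; the trace makes smoothness
    automatic. *)
Definition axis_eta s := 2^-1 * \tr (\matrix_i A s (delta_mx 0 i) : 'M[R]_3).
Local Notation eta := axis_eta.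

Let smu : smooth_on U mu. Proof. exact: smooth_axis_mu bs se. Qed.
Let slam : smooth_on U lam. Proof. exact: smooth_axis_lam bs se. Qed.
Let sa : smooth_on U a. Proof. exact: smooth_axis_a bs se. Qed.
Let sE : smooth_on U E. Proof. exact: smooth_axis_E bs se. Qed.
Let sE' : smooth_on U E'. Proof. exact: smooth_axis_E' bs se. Qed.
Let sth v : smooth_on U (fun s => th s v). Proof. exact: smooth_axis_th bs se v. Qed.

Lemma smooth_axis_eta : smooth_on U eta.
Proof.
apply: smoothM => //; first exact: smooth_cst.
apply: smooth_sum => // i _.
have sA := smooth_axis_A bs se (delta_mx 0 i).
have /(smooth_mx _ oU)/(_ 0 i) := sA; move/eq_smooth; apply=> s; by rewrite mxE.
Qed.
Let seta := smooth_axis_eta.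

Lemma axis_A_linear s (c : R) v w : U s -> A s (c *: v + w) = c *: A s v + A s w.
Proof.
move=> Us; have p := pt Us; apply: (metric_eq ts Us) => z.
rewrite /axis_A !(hDl p, hNl p, hZl p) !(tangent_metric ts)// (cubic_linear p).
by rewrite (ddDl sE)// (ddZl sE)// !(hDl p, hZl p) pairingDl pairingZl; ring.
Qed.

Lemma axis_A_mu s v : U s -> A s v = eta s *: (v - th s v *: e s) /\
  dd v mu s = th s v * (2^-1 * (a s - lam s) - 4 * mu s * eta s).
Proof.
move=> Us; have p := pt Us; have [mu0 nf0] := axis_normal_form pt nf Us.
have [ee _ _] := nf0; have [x [y on]] := orthonormal_extend p ee.
have ff := normal_frame_form p nf0 on.
have Ap w := axis_A_perp bs pt se nf w Us.
have cod w v' z := codazzi bs pt se nf v' w z Us.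
have [bx by_ q1 q2 [r dx dy de]] := codazzi_frame p (d := fun w => dd w mu s) ff mu0 Ap cod.
have [_ xx yy [ex ey xy]] := on.
have [xe ye yx] : [/\ h s x (e s) = 0, h s y (e s) = 0 & h s y x = 0] by split; rewrite (metric_sym p).
have lA (c : R) u w : A s (c *: u + w) = c *: A s u + A s w by rewrite axis_A_linear.
have Eeta : eta s = h s (A s x) x.
  rewrite /eta (trace_orthonormal p _ on) !(mul_rows_lin _ lA) Ap r; by field.
have AE : A s (e s) = 0 by rewrite (orthonormal_decomp p (A s (e s)) on) Ap bx by_ !scale0r !addr0.
have AX : A s x = eta s *: x.
  by rewrite (orthonormal_decomp p (A s x) on) Ap q1 Eeta !scale0r addr0 add0r.
have AY : A s y = eta s *: y.
  by rewrite (orthonormal_decomp p (A s y) on) Ap q2 r Eeta !scale0r !add0r.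
have dec := orthonormal_decomp p v on; split.
  rewrite [v in LHS]dec -addrA !lA AE scaler0 add0r -[h s v y *: y]addr0 lA AX AY.
  have -> : A s 0 = 0.
    by have := lA 1 0 0; rewrite !scale1r addr0 => /eqP; rewrite -subr_eq subrr eq_sym => /eqP.
  rewrite addr0 [v in eta s *: (v - _)]dec.
  by apply/rowP => j; rewrite !mxE; ring.
rewrite [v in LHS]dec !(ddDl smu)// !(ddZl smu)// dx dy de Eeta.
by rewrite !scaler0 !addr0.
Qed.

Lemma axis_A_sym s v w : U s -> h s (A s v) w = h s (A s w) v.
Proof.
move=> Us; have p := pt Us; rewrite !(axis_A_mu _ Us).1 !(hZl p) !(hDl p) !(hNl p) !(hZl p).
by rewrite (metric_sym p w v) !(metric_sym p (e s)); ring.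
Qed.

Lemma dd_axis_A m n (g : 'rV[R]_3 -> 'M[R]_(m, n)) s v : U s -> smooth_on U g ->
  dd (A s v) g s = eta s *: (dd v g s - th s v *: dd (e s) g s).
Proof.
move=> Us sg; rewrite (axis_A_mu _ Us).1 (ddZl sg)// (ddDl sg)// (ddNl sg)//.
by rewrite (ddZl sg).
Qed.

Lemma dd_E s v : U s ->
  dd v E s = (eta s - mu s) *: dd v f s + th s v *: (xi s + (3 * mu s - eta s) *: E s).
Proof.
move=> Us; rewrite (dd_axis_E bs pt se nf)// dd_axis_A// -/(E s).
by apply/rowP => j; rewrite !mxE; ring.
Qed.

Lemma dd_E' s v : U s -> dd v E' s =
  (eta s + mu s) *: dd v N s - th s v *: ((eta s + 3 * mu s) *: E' s + lam s *: N s).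
Proof.
move=> Us; rewrite (dd_axis_E' bs pt se nf)// dd_axis_A// -/(E' s).
by apply/colP => j; rewrite !mxE; ring.
Qed.

Lemma dd_mu s v : U s -> dd v mu s = th s v * (2^-1 * (a s - lam s) - 4 * mu s * eta s).
Proof. by move=> Us; have [_ ->] := axis_A_mu v Us. Qed.

Lemma dd_xi s v : U s -> dd v xi s = - (a s *: dd v f s) - ((lam s - a s) * th s v) *: E s.
Proof.
move=> Us; have [_ [_ _ HS]] := axis_normal_form pt nf Us.
by rewrite (shape_eq bs)// HS (ddDl sf)// !(ddZl sf)// opprD.
Qed.

Lemma dd_th_sym s v w : U s -> dd w (fun y => th y v) s = dd v (fun y => th y w) s.
Proof.
move=> Us; rewrite !(dd_axis_th bs pt se nf)// axis_A_sym// (cubic_symm bs w v Us).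
by have H := schwarz_dd w v oU sf Us; rewrite H.
Qed.

(* Testing against a vector w orthogonal to v and to e isolates the first coefficient. *)
Lemma axis_wedge s (al : 'rV[R]_3 -> R) (be : 'rV[R]_3 -> 'rV[R]_3 -> R) : U s ->
  (forall v w, al v *: dd w f s = al w *: dd v f s + be v w *: E s) -> forall v, al v = 0.
Proof.
move=> Us H v; have p := pt Us; have [w w0 [we wv]] := exists_orthogonal p (e s) v.
have := congr1 (fun b => ⟨b, dd w N s⟩) (H v w).
rewrite pairingDl !pairingZl.
have D u : ⟨dd u f s, dd w N s⟩ = - h s u w by rewrite (metric_dual' ts _ _ Us) opprK.
rewrite !D [h s v w](metric_sym p) [h s (e s) w](metric_sym p) we wv oppr0 !mulr0 addr0.
by move/eqP; rewrite mulrN oppr_eq0 mulf_eq0 (gt_eqF (metric_pos p w0)) orbF => /eqP.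
Qed.

(** Codazzi equation of [S]: the mixed derivatives of [xi] agree, and [axis_wedge] extracts the
    coefficient of [dd w f]. *)
Lemma dd_a s v : U s -> dd v a s = th s v * ((lam s - a s) * (eta s - mu s)).
Proof.
move=> Us; apply/eqP; rewrite -subr_eq0; apply/eqP; move: v.
pose P v w := dd v (fun y => (lam y - a y) * th y w) s.
apply: (axis_wedge (be := fun v w => P w v - P v w
   + (lam s - a s) * (th s v * (th s w * (3 * mu s - eta s)) - th s w * (th s v * (3 * mu s - eta s)))) Us) => v w.
have sla : smooth_on U (fun y => lam y - a y) by apply: smoothB.
have D v' w' : dd v' (dd w' xi) s = - (dd v' a s *: dd w' f s + a s *: dd v' (dd w' f) s)
    - (P v' w' *: E s + ((lam s - a s) * th s w') *: dd v' E s).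
  have s1 : smooth_on U (fun y => a y *: dd w' f y) by apply: smoothZ => //; exact: smooth_dd.
  have s2 : smooth_on U (fun y => (lam y - a y) * th y w') by apply: smoothM.
  have s3 : smooth_on U (fun y => ((lam y - a y) * th y w') *: E y) by apply: smoothZ.
  rewrite (eq_on_dd v' oU (fun y Uy => dd_xi w' Uy) Us).
  rewrite (ddB v' oU (smoothN oU s1) s3)// (ddN s1)// (ddZ v' sa (smooth_dd w' sf))//.
  by rewrite (ddZ v' s2 sE).
have H := schwarz_dd v w oU sxi Us; rewrite !D !dd_E// in H.
have H' := schwarz_dd v w oU sf Us; rewrite H' in H.
apply/rowP => j; have := congr1 (fun b : 'rV[R]_4 => b 0 j) H; rewrite !mxE.
move: (dd w (dd v f) s 0 j) (P v w) (P w v) => q p1 p2 K0; lra.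
Qed.

(** The same comparison for the mixed derivatives of [E]. Together with [dd_mu], which comes from
    the Codazzi equation of [K], it gives the derivative of [eta]. *)
Lemma dd_eta_mu s v : U s -> dd v (fun y => eta y - mu y) s =
  th s v * (- a s + (3 * mu s - eta s) * (eta s - mu s)).
Proof.
move=> Us; apply/eqP; rewrite -subr_eq0; apply/eqP; move: v.
have sk : smooth_on U (fun y => eta y - mu y) by apply: smoothB.
have sc : smooth_on U (fun y => 3 * mu y - eta y).
  by apply: smoothB => //; apply: smoothM => //; exact: smooth_cst.
pose P v := dd v (fun y => 3 * mu y - eta y) s.
apply: (axis_wedge (be := fun v w => th s v * P w - th s w * P v) Us) => v w.
have scE : smooth_on U (fun y => (3 * mu y - eta y) *: E y) by apply: smoothZ.
have sW : smooth_on U (fun y => xi y + (3 * mu y - eta y) *: E y) by apply: smoothD.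
have D v' w' : dd v' (dd w' E) s = dd v' (fun y => eta y - mu y) s *: dd w' f s
    + (eta s - mu s) *: dd v' (dd w' f) s + (dd v' (fun y => th y w') s *: (xi s + (3 * mu s - eta s) *: E s)
    + th s w' *: (dd v' xi s + (P v' *: E s + (3 * mu s - eta s) *: dd v' E s))).
  have s1 : smooth_on U (fun y => (eta y - mu y) *: dd w' f y) by apply: smoothZ => //; exact: smooth_dd.
  have s3 : smooth_on U (fun y => th y w' *: (xi y + (3 * mu y - eta y) *: E y)) by apply: smoothZ.
  rewrite (eq_on_dd v' oU (fun y Uy => dd_E w' Uy) Us).
  rewrite (ddD s1 s3)// (ddZ v' sk (smooth_dd w' sf))// (ddZ v' (sth w') sW)//.
  by rewrite (ddD sxi scE)// (ddZ v' sc sE).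
have H := schwarz_dd v w oU sE Us; rewrite !D !dd_xi// !dd_E// in H.
have H' := schwarz_dd v w oU sf Us; rewrite H' (dd_th_sym w v Us) in H.
apply/rowP => j; have := congr1 (fun b : 'rV[R]_4 => b 0 j) H; rewrite !mxE.
move: (dd w (dd v f) s 0 j) (P v) (P w) => q p1 p2 K0; lra.
Qed.

Lemma dd_eta s v : U s -> dd v eta s = th s v *
  (2^-1 * (a s - lam s) - 4 * mu s * eta s - a s + (3 * mu s - eta s) * (eta s - mu s)).
Proof.
move=> Us; have := dd_eta_mu v Us; rewrite (ddB v oU seta smu)// dd_mu// => /eqP.
by rewrite subr_eq => /eqP ->; ring.
Qed.

(* The combinations for which [d om] and [d tau] are multiples of [om] and [tau], so that
   [om] and [tau] span constant lines, while [d (f + zeta / nu)] is a multiple of [om]. *)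
Definition axis_nu s := a s + eta s ^+ 2 - mu s ^+ 2.
Definition axis_zeta s := xi s - (eta s + mu s) *: E s.
Definition axis_om s := axis_nu s *: E s + (eta s - mu s) *: axis_zeta s.
Definition axis_tau s := - E' s + (eta s + mu s) *: N s.
Local Notation nu := axis_nu.
Local Notation zeta := axis_zeta.
Local Notation om := axis_om.
Local Notation tau := axis_tau.

Let sem : smooth_on U (fun y => eta y + mu y). Proof. exact: smoothD. Qed.
Let sek : smooth_on U (fun y => eta y - mu y). Proof. exact: smoothB. Qed.

Lemma smooth_axis_nu : smooth_on U nu.
Proof. by apply: smoothB => //; [apply: smoothD => //|]; exact: smoothM. Qed.
Lemma smooth_axis_zeta : smooth_on U zeta.
Proof. by apply: smoothB => //; exact: smoothZ. Qed.
Lemma smooth_axis_om : smooth_on U om.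
Proof.
by apply: smoothD => //; apply: smoothZ => //; [exact: smooth_axis_nu|exact: smooth_axis_zeta].
Qed.
Lemma smooth_axis_tau : smooth_on U tau.
Proof. by apply: smoothD => //; [exact: smoothN|exact: smoothZ]. Qed.

Lemma dd_nu s v : U s -> dd v nu s = - 2 * eta s * nu s * th s v.
Proof.
move=> Us; have s2 := smoothM oU seta seta; have s3 := smoothM oU smu smu.
rewrite /nu (ddB v oU (smoothD oU sa s2) s3)// (ddD sa s2)// (ddM v seta seta)// (ddM v smu smu)//.
by rewrite dd_a// dd_eta// dd_mu//; field.
Qed.

(** For [v] tangent to a leaf the right side is [- nu dd v f]: [zeta] is a normal field of the leaf
    whose lines meet at [f + zeta / nu]. *)
Lemma dd_zeta s v : U s -> dd v zeta s =
  - (nu s *: dd v f s) + th s v *: (- (eta s + mu s) *: zeta s + nu s *: E s).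
Proof.
move=> Us; rewrite /zeta (ddB v oU sxi (smoothZ oU sem sE))// (ddZ v sem sE)// (ddD seta smu)//.
rewrite dd_xi// dd_E// dd_eta// dd_mu//; apply/rowP => j; rewrite !mxE /nu; by field.
Qed.

Lemma dd_om s v : U s -> dd v om s = ((3 * mu s - eta s) * th s v) *: om s.
Proof.
move=> Us; rewrite /om (ddD (smoothZ oU smooth_axis_nu sE) (smoothZ oU sek smooth_axis_zeta))//.
rewrite (ddZ v smooth_axis_nu sE)// (ddZ v sek smooth_axis_zeta)// dd_nu// dd_zeta// dd_eta_mu// dd_E//.
apply/rowP => j; rewrite !mxE /nu; ring.
Qed.

Lemma dd_tau s v : U s -> dd v tau s = (- (eta s + 3 * mu s) * th s v) *: tau s.
Proof.
move=> Us; rewrite /tau (ddD (smoothN oU sE') (smoothZ oU sem sN))// (ddN sE')// (ddZ v sem sN)//.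
rewrite (ddD seta smu)// dd_E'// dd_eta// dd_mu//; apply/colP => j; rewrite !mxE; by field.
Qed.

(** Leaves are tangent to the kernel of [tau]; with [zeta_tau] their normals lie in it too. *)
Lemma df_tau s v : U s -> ⟨dd v f s, tau s⟩ = th s v.
Proof.
move=> Us; rewrite /tau pairingDr pairingNr pairingZr (ts_Nf ts)//.
by rewrite (metric_dual' ts v (e s) Us) mulr0 addr0.
Qed.

Lemma E_tau s : U s -> ⟨E s, tau s⟩ = 1.
Proof. by move=> Us; rewrite df_tau//; have [_ []] := axis_normal_form pt nf Us. Qed.

Lemma xi_tau s : U s -> ⟨xi s, tau s⟩ = eta s + mu s.
Proof.
move=> Us; rewrite /tau pairingDr pairingNr pairingZr (ts_Nxi ts)// mulr1.
by rewrite (xi_dN ts)// oppr0 add0r.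
Qed.

Lemma zeta_tau s : U s -> ⟨zeta s, tau s⟩ = 0.
Proof.
by move=> Us; rewrite /zeta pairingDl pairingNl pairingZl xi_tau// E_tau// mulr1 subrr.
Qed.

Lemma om_tau s : U s -> ⟨om s, tau s⟩ = nu s.
Proof.
by move=> Us; rewrite /om pairingDl !pairingZl zeta_tau// E_tau// mulr1 mulr0 addr0.
Qed.

Lemma dd_center s v : U s -> nu s != 0 ->
  dd v (fun y => f y + (nu y)^-1 *: zeta y) s = (th s v * (nu s)^-1) *: om s.
Proof.
have oU' := open_nonzero oU smooth_axis_nu; set U' := [set s | _] in oU'.
have sU : U' `<=` U by move=> y [].
have snu := smooth_subset sU smooth_axis_nu; have szeta := smooth_subset sU smooth_axis_zeta.
have sV : smooth_on U' (fun y => (nu y)^-1) by apply: smoothV => // y [].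
move=> Us nus; have U's : U' s by [].
have one y : U' y -> nu y * (nu y)^-1 = 1 by move=> [Uy nuy]; rewrite mulfV.
have D : dd v (fun y => (nu y)^-1) s = 2 * eta s * (nu s)^-1 * th s v.
  have := eq_on_dd v oU' one U's; rewrite dd_cst (ddM v snu sV)// dd_nu// => H.
  apply: (mulfI nus); rewrite -[LHS]addr0 -[X in _ + X = _]oppr0 -[X in _ - X = _]H.
  by field; rewrite nus.
rewrite (ddD (smooth_subset sU sf) (smoothZ oU' sV szeta))// (ddZ v sV szeta)// D dd_zeta// /om.
apply/rowP => j; rewrite !mxE; field; exact: nus.
Qed.

Lemma tangent_D s b c : U s -> T s (b + c) = T s b + T s c.
Proof.
move=> Us; apply: (metric_eq ts Us) => z.
by rewrite (metric_D ts)// !(tangent_metric ts)// pairingDl opprD.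
Qed.

(** Makes [axis_eta] comparable with the [eta] of an [adapted_frame]. *)
Lemma levi_civita_axis s v : U s -> levi_civita h (fun=> v) e s = A s v.
Proof.
move=> Us; rewrite /levi_civita /axis_A /axis_E (dd_dd_field oU se v sf Us) tangent_D//.
rewrite (tangent_f ts)// (bs_K bs)// ddE.
by apply/rowP => j; rewrite !mxE; ring.
Qed.

End AxisSystem.

(** * Existence of a smooth axis *)

Lemma det2 (R : comNzRingType) (g : 'M[R]_2) : \det g = g 0 0 * g 1 1 - g 0 1 * g 1 0.
Proof.
rewrite (expand_det_row _ 0) !big_ord_recl big_ord0 addr0 /cofactor !det_mx11 !mxE.
have -> : lift (0 : 'I_2) 0 = 1 by exact: val_inj.
rewrite (_ : lift 1 0 = 0 :> 'I_2); last exact: val_inj.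
by rewrite /= addn0 add0n expr0 expr1 mul1r mulN1r mulrN.
Qed.

(** * The groups SO(2) and Z/3 as symmetry groups *)

Section GroupFacts.
Context {R : realType}.
Variable G : set 'M[R]_3.
Hypothesis Gdet : forall g, G g -> 0 < \det g.

(** The image of the unit is an idempotent matrix, invertible because its determinant is
    positive. *)
Lemma group_iso_one (T : Type) (A : set T) op (phi : T -> 'M[R]_3) one : set_bij A G phi ->
  (forall a b, A a -> A b -> phi (op a b) = phi a *m phi b) -> A one -> op one one = one ->
  phi one = 1%:M.
Proof.
move=> [fA _ _] phiM A1 one1; have := phiM one one A1 A1; rewrite one1 => E.
have u : phi one \in unitmx by rewrite unitmxE unitfE gt_eqF// Gdet//; exact: fA.
by have := congr1 (mulmx (invmx (phi one))) E; rewrite mulVmx// mulKmx.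
Qed.

Lemma group_iso_comm (T : Type) (A : set T) op : group_iso A op G mulmx ->
  (forall a b, A a -> A b -> op a b = op b a) ->
  forall g g', G g -> G g' -> g *m g' = g' *m g.
Proof.
move=> [phi [[_ _ sphi] phiM]] comm g g' Gg Gg'.
have [a Aa <-] := sphi g Gg; have [b Ab <-] := sphi g' Gg'.
by rewrite -!phiM// comm.
Qed.

Lemma SO2_entries (g : 'M[R]_2) : SO2 g ->
  [/\ g 1 1 = g 0 0, g 1 0 = - g 0 1 & g 0 0 ^+ 2 + g 0 1 ^+ 2 = 1].
Proof.
move=> [gg dg]; have e2 : lift ord0 ord0 = 1 :> 'I_2 by exact: val_inj.
have E i j : g i 0 * g j 0 + g i 1 * g j 1 = (i == j)%:R.
  have := congr1 (fun A : 'M[R]_2 => A i j) gg; rewrite !mxE !big_ord_recl big_ord0 addr0.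
  by rewrite !mxE e2.
have D : g 0 0 * g 1 1 - g 0 1 * g 1 0 = 1.
  by rewrite -det2.
have := E 0 0; have := E 0 1; have := E 1 1; rewrite !eqxx /= ?mulr1n => E1 E2 E3.
have {E2} E2 : g 0 0 * g 1 0 + g 0 1 * g 1 1 = 0 by rewrite E2.
move: (g 0 0) (g 0 1) (g 1 0) (g 1 1) E1 E2 E3 D => a b c d E1 E2 E3 D.
split; last by rewrite -E3; ring.
- transitivity (d * (a * a + b * b)); first by rewrite E3 mulr1.
  by rewrite (_ : d * _ = a * (a * d - b * c) + b * (a * c + b * d)); [rewrite D E2; ring|ring].
- transitivity (c * (a * a + b * b)); first by rewrite E3 mulr1.
  by rewrite (_ : c * _ = a * (a * c + b * d) - b * (a * d - b * c)); [rewrite D E2; ring|ring].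
Qed.

Definition rotation2 (c s : R) : 'M[R]_2 :=
  \matrix_(i, j) (if i == j then c else if i == 0 then s else - s).

Lemma rotation2M c s c' s' :
  rotation2 c s *m rotation2 c' s' = rotation2 (c * c' - s * s') (c * s' + s * c').
Proof.
apply/matrixP => i j; rewrite !mxE !big_ord_recl big_ord0 addr0 !mxE.
by case: i => [[|[|]]]//= ?; case: j => [[|[|]]]//= ?; ring.
Qed.

Lemma rotation2_1 : rotation2 1 0 = 1%:M.
Proof.
apply/matrixP => i j; rewrite !mxE oppr0 if_same.
by case: (i == j).
Qed.

Lemma SO2_rotation2 (g : 'M[R]_2) : SO2 g -> g = rotation2 (g 0 0) (g 0 1).
Proof.
move=> /SO2_entries[d c _]; apply/matrixP => i j; rewrite !mxE.
case: i => [[|[|]]]//= hi; case: j => [[|[|]]]//= hj; last 2 first.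
- by rewrite -c; congr (g _ _); exact: val_inj.
- by rewrite -d; congr (g _ _); exact: val_inj.
- by congr (g _ _); exact: val_inj.
- by congr (g _ _); exact: val_inj.
Qed.

Lemma rotation2_SO2 c s : c ^+ 2 + s ^+ 2 = 1 -> SO2 (rotation2 c s).
Proof.
move=> cs; split.
  have -> : (rotation2 c s)^T = rotation2 c (- s).
    by apply/matrixP => -[[|[|]]//= ?] [[|[|]]//= ?]; rewrite !mxE //= opprK.
  by rewrite rotation2M -rotation2_1; congr rotation2; [rewrite -cs|]; ring.
by rewrite det2 !mxE /= mulrN opprK -!expr2.
Qed.

Lemma SO2_comm (g g' : 'M[R]_2) : SO2 g -> SO2 g' -> g *m g' = g' *m g.
Proof.
move=> /SO2_rotation2 -> /SO2_rotation2 ->; rewrite !rotation2M; congr rotation2; ring.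
Qed.

Lemma SO2_group_half_turn : group_iso (@SO2 R) mulmx G mulmx ->
  exists g, [/\ G g, g *m g = 1%:M & g != 1%:M].
Proof.
move=> [phi [bphi phiM]]; have [fphi iphi _] := bphi.
have A1 : SO2 (1%:M : 'M[R]_2) by rewrite -rotation2_1; apply: rotation2_SO2; ring.
have Am : SO2 (rotation2 (- 1) 0) by apply: rotation2_SO2; ring.
have p1 := group_iso_one bphi phiM A1 (mulmx1 _).
exists (phi (rotation2 (- 1) 0)); split; first exact: fphi.
  rewrite -phiM// -p1; congr phi; rewrite rotation2M -rotation2_1.
  by congr rotation2; ring.
rewrite -p1; apply/eqP => /iphi; rewrite !inE => /(_ Am A1).
move/matrixP/(_ 0 0); rewrite !mxE eqxx /= => H.
have : (2 : R) = 0 by move: H; rewrite mulr1n; lra.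
by move/eqP; rewrite pnatr_eq0.
Qed.

Lemma symmetry_group_facts :
  group_iso (@SO2 R) mulmx G mulmx \/ group_iso [set: 'Z_3] +%R G mulmx ->
  (forall g g', G g -> G g' -> g *m g' = g' *m g) /\
  exists g, [/\ G g, g *m g *m g = 1%:M & g != 1%:M].
Proof.
case=> iso; split.
- exact: group_iso_comm iso SO2_comm.
- have [phi [bphi phiM]] := iso; have [fphi iphi _] := bphi.
  have A1 : SO2 (1%:M : 'M[R]_2) by rewrite -rotation2_1; apply: rotation2_SO2; ring.
  pose d : R := Num.sqrt 3; have d2 : d ^+ 2 = 3 by rewrite sqr_sqrtr.
  have Aw : SO2 (rotation2 (- 2^-1) (d / 2)).
    by apply: rotation2_SO2; field: d2.
  have p1 := group_iso_one bphi phiM A1 (mulmx1 _).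
  have Aww : SO2 (rotation2 (- 2^-1) (d / 2) *m rotation2 (- 2^-1) (d / 2)).
    by rewrite rotation2M; apply: rotation2_SO2; field: d2.
  exists (phi (rotation2 (- 2^-1) (d / 2))); split; first exact: fphi.
    rewrite -!phiM// -p1; congr phi; rewrite !rotation2M -rotation2_1.
    by congr rotation2; field: d2.
  rewrite -p1; apply/eqP => /iphi; rewrite !inE => /(_ Aw A1).
  by move/matrixP/(_ 0 0); rewrite !mxE eqxx /= mulr1n => H; lra.
- by apply: group_iso_comm iso _ => a b _ _; exact: addrC.
- have [phi [bphi phiM]] := iso; have [fphi iphi _] := bphi.
  have p0 := group_iso_one bphi phiM (one := 0) I (addr0 _).
  exists (phi 1); split; first exact: fphi.
    by rewrite -!phiM// -p0; congr phi; exact: val_inj.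
  by rewrite -p0; apply/eqP => /iphi; rewrite !inE => /(_ I I).
Qed.
End GroupFacts.

(** * Recovering the axis from an operator *)

Section AxisProjector.
Context {R : realType}.
Variables (h : 'rV[R]_3 -> 'rV[R]_3 -> R) (K : 'rV[R]_3 -> 'rV[R]_3 -> 'rV[R]_3)
  (S : 'rV[R]_3 -> 'rV[R]_3).
Hypothesis pt : point_structure h K S.

Lemma normal_form_opp e mu lam a : normal_form h K S e mu lam a ->
  normal_form h K S (- e) (- mu) lam a.
Proof.
move=> [ee HK HS]; split=> [|v|v].
- by rewrite (hNl pt) (hNr pt) opprK.
- by rewrite (KNl pt) HK (hNr pt); apply/rowP => j; rewrite !mxE; ring.
- by rewrite HS (hNr pt); apply/rowP => j; rewrite !mxE; ring.
Qed.

Definition cubic_mx v : 'M[R]_3 := \matrix_i K v (delta_mx 0 i).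

(** The eigenvalues relative to [h] are [6 mu ^ 2] on the axis and [2 mu ^ 2 + 2 (l ^ 2 + m ^ 2)] on
    the plane; they agree exactly when [l ^ 2 + m ^ 2 = 2 mu ^ 2]. *)
Lemma cubic_form e x y mu l m lam a v w : frame_form h K S e x y mu l m lam a ->
  \tr (cubic_mx v *m cubic_mx w) = (2 * mu ^+ 2 + 2 * (l ^+ 2 + m ^+ 2)) * h v w +
    (4 * mu ^+ 2 - 2 * (l ^+ 2 + m ^+ 2)) * h v e * h w e.
Proof.
move=> ff; have [on _] := ff; have C u := orthonormal_decomp pt u on.
rewrite (trace_orthonormal pt _ on) !mulmxA !(mul_rows_K pt).
have [ee xx yy [ex ey xy]] := on.
have E1 : e = comb e x y 1 0 0 by rewrite /comb !scale0r scale1r !addr0.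
have E2 : x = comb e x y 0 1 0 by rewrite /comb !scale0r scale1r addr0 add0r.
have E3 : y = comb e x y 0 0 1 by rewrite /comb !scale0r scale1r !add0r.
rewrite [v](C v) [w](C w) -!/(comb _ _ _ _ _ _).
move: (h v e) (h v x) (h v y) (h w e) (h w x) (h w y) => p q r p' q' r'.
have Ke u : K u e = K u (comb e x y 1 0 0) by rewrite -E1.
have Kx u : K u x = K u (comb e x y 0 1 0) by rewrite -E2.
have Ky u : K u y = K u (comb e x y 0 0 1) by rewrite -E3.
rewrite Ke Kx Ky !(frame_form_K pt _ _ _ _ _ _ ff).
have he p0 q0 r0 : h (comb e x y p0 q0 r0) e = p0.
  by rewrite [X in h _ X]E1 (h_comb pt)//; ring.
have hx p0 q0 r0 : h (comb e x y p0 q0 r0) x = q0.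
  by rewrite [X in h _ X]E2 (h_comb pt)//; ring.
have hy p0 q0 r0 : h (comb e x y p0 q0 r0) y = r0.
  by rewrite [X in h _ X]E3 (h_comb pt)//; ring.
rewrite !he hx hy (h_comb pt)//; ring.
Qed.

Definition axis_proj (e : 'rV[R]_3) : 'M[R]_3 := \matrix_i (h (delta_mx 0 i) e *: e).

Lemma mul_axis_proj v e : v *m axis_proj e = h v e *: e.
Proof.
apply: (mul_rows_lin (L := fun v => h v e *: e)) => c u w.
by rewrite (hDl pt) (hZl pt) scalerDl scalerA.
Qed.

Lemma axis_proj_tr e : h e e = 1 -> \tr (axis_proj e) = 1.
Proof.
move=> ee; have [x [y on]] := orthonormal_extend pt ee; have [_ _ _ [ex ey _]] := on.
rewrite (trace_orthonormal pt _ on) !mul_axis_proj !(hZl pt) ee ex ey.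
by rewrite !(metric_sym pt x) !(metric_sym pt y) ex ey; ring.
Qed.

Lemma axis_projM e : h e e = 1 -> axis_proj e *m axis_proj e = axis_proj e.
Proof.
move=> ee; apply/row_matrixP => i; rewrite !rowE mulmxA !mul_axis_proj.
by rewrite (hZl pt) ee mulr1.
Qed.

(* If [P = be + de p] with [p] a projector of rank one and [T] is its traceless part, then
   [T ^ 2 = de ^ 2 (p / 3 + 1 / 9)]: this recovers [p] rationally, hence smoothly, from [P]. *)
Definition traceless (P : 'M[R]_3) := P - (3^-1 * \tr P)%:M.
Definition spectral_proj (P : 'M[R]_3) := let T := traceless P in
  (2 / \tr (T *m T)) *: (T *m T) - (3^-1)%:M.

Lemma tracelessE e be de : h e e = 1 ->
  traceless (be%:M + de *: axis_proj e) = de *: (axis_proj e - (3^-1)%:M).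
Proof.
move=> ee; rewrite /traceless linearD linearZ /= axis_proj_tr// mxtrace_scalar.
apply/matrixP => i j; rewrite !mxE; case: (i == j); rewrite ?mulr1n ?mulr0n; by field.
Qed.

Lemma traceless_sqr e be de : h e e = 1 ->
  let T := traceless (be%:M + de *: axis_proj e) in
  T *m T = de ^+ 2 *: (3^-1 *: axis_proj e + (9^-1)%:M).
Proof.
move=> ee T; rewrite /T tracelessE// -scalemxAl -scalemxAr scalerA -expr2; congr (_ *: _).
rewrite mulmxBl !mulmxBr axis_projM// mul_mx_scalar !mul_scalar_mx.
apply/matrixP => i j; rewrite !mxE; case: (i == j); rewrite ?mulr1n ?mulr0n; by field.
Qed.

Lemma traceless_sqr_tr e be de : h e e = 1 ->
  let T := traceless (be%:M + de *: axis_proj e) in \tr (T *m T) = 2 / 3 * de ^+ 2.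
Proof.
move=> ee T; rewrite traceless_sqr// linearZ linearD linearZ /= axis_proj_tr// mxtrace_scalar.
by field.
Qed.

Lemma spectral_projE e be de : h e e = 1 -> de != 0 ->
  spectral_proj (be%:M + de *: axis_proj e) = axis_proj e.
Proof.
move=> ee de0; rewrite /spectral_proj traceless_sqr_tr// traceless_sqr//.
apply/matrixP => i j; rewrite !mxE; case: (i == j); rewrite ?mulr1n ?mulr0n; by field.
Qed.

End AxisProjector.

(** * Smooth local axis fields *)

Section AxisExistence.
Context {R : realType}.
Variables (U : set 'rV[R]_3) (f xi : 'rV[R]_3 -> 'rV[R]_4) (N : 'rV[R]_3 -> 'cV[R]_4)
  (T : 'rV[R]_3 -> 'rV[R]_4 -> 'rV[R]_3) (h : 'rV[R]_3 -> 'rV[R]_3 -> 'rV[R]_3 -> R)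
  (K : 'rV[R]_3 -> 'rV[R]_3 -> 'rV[R]_3 -> 'rV[R]_3) (S : 'rV[R]_3 -> 'rV[R]_3 -> 'rV[R]_3).
Hypotheses (bs : blaschke_structure U f xi N T h K S)
  (pt : forall s, U s -> point_structure (h s) (K s) (S s)).
Let ts : transversal_structure U f xi N T h := bs.
Let oU := ts_open ts.

Lemma smooth_traceless (P : 'rV[R]_3 -> 'M[R]_3) : smooth_on U P ->
  smooth_on U (fun s => traceless (P s)).
Proof.
move=> sP; apply: smoothB => //; apply/smooth_mx => // i j.
have s1 : smooth_on U (fun s => 3^-1 * \tr (P s) * (i == j)%:R).
  apply: smoothM => //; last exact: smooth_cst.
  apply: smoothM => //; first exact: smooth_cst.
  by apply: smooth_sum => // k _; exact: ((smooth_mx _ oU).1 sP).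
by move: s1; move/eq_smooth; apply=> s; rewrite !mxE mulr_natr.
Qed.

Lemma smooth_mxtrace (P : 'rV[R]_3 -> 'M[R]_3) : smooth_on U P ->
  smooth_on U (fun s => \tr (P s)).
Proof.
by move=> sP; apply: smooth_sum => // k _; exact: ((smooth_mx _ oU).1 sP).
Qed.

(** The spectral projector of [P] is smooth where its traceless part does not degenerate. Projecting
    the fixed vector [w0], the axis at [s0], and normalizing gives a smooth unit field as long as
    the projection is nonzero; the set where the field is defined shrinks accordingly. *)
Lemma axis_of_operator (P : 'rV[R]_3 -> 'M[R]_3) s0 : smooth_on U P ->
  (forall s, U s -> exists e mu lam a be de, [/\ mu != 0, normal_form (h s) (K s) (S s) e mu lam a
     & P s = be%:M + de *: axis_proj (h s) e]) -> U s0 ->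
  \tr (traceless (P s0) *m traceless (P s0)) != 0 ->
  exists U0 e, [/\ open U0, U0 `<=` U, U0 s0, smooth_on U0 e & forall s, U0 s ->
    exists mu lam a, mu != 0 /\ normal_form (h s) (K s) (S s) (e s) mu lam a].
Proof.
move=> sP HP Us0 t0; pose t s := \tr (traceless (P s) *m traceless (P s)).
have st : smooth_on U t.
  by apply: smooth_mxtrace; apply: smooth_mulmx => //; exact: smooth_traceless.
pose U1 := [set s | U s /\ t s != 0].
have oU1 : open U1 by exact: open_nonzero.
have sU1 : U1 `<=` U by move=> s [].
have eP s : U1 s -> exists e mu lam a, [/\ mu != 0, normal_form (h s) (K s) (S s) e mu lam a
     & forall v, v *m spectral_proj (P s) = h s v e *: e].
  move=> [Us ts0]; have [e [mu [lam [a [be [de [mu0 nf PE]]]]]]] := HP s Us.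
  exists e, mu, lam, a; split=> // v; have [ee _ _] := nf.
  rewrite PE (spectral_projE (pt Us))// ?mul_axis_proj ?(mul_axis_proj (pt Us))//.
  apply: contraNneq ts0 => de0.
  by rewrite /t PE (traceless_sqr_tr (pt Us))// de0 expr0n mulr0.
have sspec : smooth_on U1 (fun s => spectral_proj (P s)).
  have sTT : smooth_on U1 (fun s => traceless (P s) *m traceless (P s)).
    apply: smooth_subset sU1 _; apply: smooth_mulmx => //; exact: smooth_traceless.
  apply: smoothB => //; last exact: smooth_cst.
  apply: smoothZ => //; apply: smoothM => //; first exact: smooth_cst.
  by apply: smoothV => //; [by move=> s []|exact: smooth_subset sU1 st].
have U1s0 : U1 s0 by [].
have [w0 [mu0 [lam0 [a0 [_ [ww _ _] Hw]]]]] := eP s0 U1s0.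
pose w s := w0 *m spectral_proj (P s); pose q s := h s (w s) (w s).
have sw : smooth_on U1 w by apply: smooth_mulmx => //; exact: smooth_cst.
have sq : smooth_on U1 q.
  apply: (smooth_linear_field oU1 sw (L := fun s v => h s (w s) v)) => [s [Us _] c u v|v].
    by rewrite (metric_Dr ts)// (metric_Zr ts).
  apply: (smooth_linear_field oU1 sw (L := fun s u => h s u v)) => [s [Us _] c u z|u].
    by rewrite (metric_linear_l ts).
  by apply: smooth_subset sU1 _; exact: smooth_metric ts _ _.
pose U2 := [set s | U1 s /\ q s != 0].
have oU2 : open U2 by exact: open_nonzero.
have sU2 : U2 `<=` U1 by move=> s [].
have qE s e : U1 s -> h s e e = 1 -> w s = h s w0 e *: e -> q s = h s w0 e ^+ 2.
  by move=> [Us _] ee wE; rewrite /q wE (hZl (pt Us)) (hZr (pt Us)) ee mulr1 expr2.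
have U2s0 : U2 s0 by split=> //; rewrite /q /w Hw ww scale1r ww oner_neq0.
have q_gt0 s : U2 s -> 0 < q s.
  move=> [U1s qs]; have [e [mu [lam [a [_ [ee _ _] H]]]]] := eP s U1s.
  by move: qs; rewrite (qE s e) ?/w ?H// => qs; rewrite exprn_even_gt0//; apply: contraNneq qs => ->; rewrite expr0n.
exists U2, (fun s => (Num.sqrt (q s))^-1 *: w s); split=> //.
- by apply: subset_trans sU2 sU1.
- have sq2 := smooth_subset sU2 sq.
  have sr : smooth_on U2 (fun s => Num.sqrt (q s)) by exact: smooth_sqrt.
  apply: smoothZ => //; last exact: smooth_subset sU2 sw.
  by apply: smoothV => // s /q_gt0 q0; rewrite gt_eqF// sqrtr_gt0.
move=> s U2s; have U1s := sU2 _ U2s; have Us := sU1 _ U1s.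
have [e [mu [lam [a [mu_n0 nf H]]]]] := eP s U1s; have [ee _ _] := nf.
have qs := q_gt0 s U2s; rewrite (qE s e) ?/w ?H// in qs *.
rewrite sqrtr_sqr scalerA; set c := h s w0 e in qs *.
have c0 : c != 0 by apply: contraTneq qs => ->; rewrite expr0n ltxx.
have [cp|cn] := ltrP 0 c.
  by exists mu, lam, a; rewrite ger0_norm ?ltW// mulVf// scale1r.
exists (- mu), lam, a; rewrite ler0_norm// invrN mulNr mulVf// scaleN1r oppr_eq0.
by split=> //; exact: (@normal_form_opp _ _ _ _ (pt Us) _ _ _ _ nf).
Qed.

Hypothesis sym : forall s, U s ->
  (forall g g', point_symmetry (h s) (K s) (S s) g -> point_symmetry (h s) (K s) (S s) g' ->
     g *m g' = g' *m g) /\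
  exists g, [/\ point_symmetry (h s) (K s) (S s) g, g *m g *m g = 1%:M & g != 1%:M].

Lemma point_axis s : U s ->
  exists e mu lam a, mu != 0 /\ normal_form (h s) (K s) (S s) e mu lam a.
Proof.
move=> Us; have [ab [g [Gg g3 g1]]] := sym Us; have p := pt Us.
have [e [mu [lam [a [nf _]]]]] := order3_normal_form p Gg g3 g1.
by exists e, mu, lam, a; split=> //; exact: (@normal_form_mu_neq0 _ _ _ _ p ab _ _ _ _ nf).
Qed.

(* The form [tr (K_v K_w)], raised by the metric. It singles out the axis where [S] is
   scalar: there its two eigenvalues coincide only if [K] has tetrahedral symmetry. *)
Definition cubic_operator s := (\matrix_(i, j)
  \tr (cubic_mx (K s) (delta_mx 0 i) *m cubic_mx (K s) (delta_mx 0 j)) : 'M[R]_3)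
  *m invmx (gram (h s) 1%:M).

Lemma cubic_operatorE s e x y mu l m lam a : U s ->
  frame_form (h s) (K s) (S s) e x y mu l m lam a ->
  cubic_operator s = (2 * mu ^+ 2 + 2 * (l ^+ 2 + m ^+ 2))%:M +
    (4 * mu ^+ 2 - 2 * (l ^+ 2 + m ^+ 2)) *: axis_proj (h s) e.
Proof.
move=> Us ff; have u := gram_unit ts Us; have p := pt Us.
apply: (can_inj (mulmxK u)); rewrite /cubic_operator mulmxKV//.
rewrite mulmxDl mul_scalar_mx -scalemxAl; apply/matrixP => i j; rewrite [LHS]mxE.
rewrite (cubic_form p _ _ ff) [RHS]mxE; congr (_ + _).
  by rewrite mxE (gramE h).
rewrite mxE -mulrA; congr (_ * _).
have -> : (axis_proj (h s) e *m gram (h s) 1%:M) i j =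
    (((delta_mx 0 i : 'rV[R]_3) *m axis_proj (h s) e) *m gram (h s) 1%:M *m (delta_mx 0 j : 'rV[R]_3)^T) 0 0.
  by rewrite -!mulmxA [in RHS]mulmxA -rowE trmx_delta -colE !mxE; apply: eq_bigr => k _; rewrite !mxE.
by rewrite -(metric_gram ts _ _ Us) (mul_axis_proj p) (hZl p) (metric_sym p e).
Qed.

Lemma smooth_cubic_operator : smooth_on U cubic_operator.
Proof.
apply: smooth_mulmx => //; last first.
  apply: smooth_invmx => //; first by move=> s Us; have := gram_unit ts Us.
  apply/smooth_mx => // i j; have := smooth_metric ts (delta_mx 0 i) (delta_mx 0 j).
  by move/eq_smooth; apply=> s; rewrite (gramE h).
have sc i : smooth_on U (fun s => cubic_mx (K s) (delta_mx 0 i)).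
  apply/smooth_mx => // k j.
  have /(smooth_mx _ oU)/(_ 0 j) := smooth_cubic bs (delta_mx 0 i) (delta_mx 0 k).
  by move/eq_smooth; apply=> s; rewrite mxE.
apply/smooth_mx => // i j.
have : smooth_on U (fun s => \tr (cubic_mx (K s) (delta_mx 0 i) *m cubic_mx (K s) (delta_mx 0 j))).
  by apply: smooth_mxtrace; exact: smooth_mulmx.
by move/eq_smooth; apply=> s; rewrite mxE.
Qed.

(** The choice between [S] and [cubic_operator] is made at [s0] alone: an operator with a simple
    axis there keeps it nearby. *)
Lemma local_axis s0 : U s0 ->
  exists U0 e, [/\ open U0, U0 `<=` U, U0 s0, smooth_on U0 e & forall s, U0 s ->
    exists mu lam a, mu != 0 /\ normal_form (h s) (K s) (S s) (e s) mu lam a].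
Proof.
move=> Us0; have p := pt Us0; have [ab _] := sym Us0.
have [e [mu [lam [a [mu0 nf]]]]] := point_axis Us0; have [ee _ _] := nf.
have [x [y on]] := orthonormal_extend p ee; have ff := normal_frame_form p nf on.
have tr_neq0 be de : de != 0 ->
    \tr (traceless (be%:M + de *: axis_proj (h s0) e) *m
         traceless (be%:M + de *: axis_proj (h s0) e)) != 0.
  move=> d0; rewrite (traceless_sqr_tr p)// mulf_neq0 ?expf_neq0//.
have [lama|lama] := eqVneq lam a.
- apply: (axis_of_operator smooth_cubic_operator _ Us0) => [s Us|].
    have q := pt Us; have [e1 [mu1 [lam1 [a1 [mu10 nf1]]]]] := point_axis Us.
    have [ee1 _ _] := nf1; have [x1 [y1 on1]] := orthonormal_extend q ee1.
    have ff1 := normal_frame_form q nf1 on1.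
    exists e1, mu1, lam1, a1; do 2 eexists; split=> //; exact: cubic_operatorE Us ff1.
  rewrite (cubic_operatorE Us0 ff); apply: tr_neq0; apply/eqP => H.
  apply: (normal_form_not_tetrahedral p ab ff nf lama); lra.
- have SE s e1 mu1 lam1 a1 : U s -> normal_form (h s) (K s) (S s) e1 mu1 lam1 a1 ->
    (\matrix_i S s (delta_mx 0 i) : 'M[R]_3) = a1%:M + (lam1 - a1) *: axis_proj (h s) e1.
    move=> Us [_ _ HS]; apply/row_matrixP => i; rewrite rowK HS rowE mulmxDr.
    by rewrite mul_mx_scalar -scalemxAr (mul_axis_proj (pt Us)) scalerA.
  apply: (axis_of_operator (P := fun s => \matrix_i S s (delta_mx 0 i)) _ _ Us0).
  + apply/smooth_mx => // i j; have /(smooth_mx _ oU)/(_ 0 j) := smooth_shape bs (delta_mx 0 i).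
    by move/eq_smooth; apply=> s; rewrite mxE.
  + move=> s Us; have [e1 [mu1 [lam1 [a1 [mu10 nf1]]]]] := point_axis Us.
    by exists e1, mu1, lam1, a1; do 2 eexists; split=> //; exact: SE Us nf1.
  + by rewrite (SE _ _ _ _ _ Us0 nf); apply: tr_neq0; rewrite subr_eq0.
Qed.

End AxisExistence.

(** * Change of parametrization *)

Lemma normal_form_params (R : realType) (h : 'rV[R]_3 -> 'rV[R]_3 -> R)
    (K : 'rV[R]_3 -> 'rV[R]_3 -> 'rV[R]_3) (S : 'rV[R]_3 -> 'rV[R]_3)
    (p : point_structure h K S) e mu lam a mu' lam' a' :
  normal_form h K S e mu lam a -> normal_form h K S e mu' lam' a' ->
  [/\ mu = mu', lam = lam' & a = a'].
Proof.
move=> [ee HK HS] [_ HK' HS']; have [x [y [_ xx _ [ex _ _]]]] := orthonormal_extend p ee.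
have := congr1 (h e) (HK e); have := congr1 (h e) (HS e); have := congr1 (h x) (HS x).
have xe : h x e = 0 by rewrite (metric_sym p).
rewrite HK' !HS' !(hDr p) !(hZr p) ee xx xe => H1 H2 H3.
by split; lra.
Qed.

Section ChartChange.
Context {R : realType}.
Variables (U1 U2 W : set 'rV[R]_3) (f1 xi1 f2 xi2 : 'rV[R]_3 -> 'rV[R]_4)
  (N1 N2 : 'rV[R]_3 -> 'cV[R]_4) (T1 T2 : 'rV[R]_3 -> 'rV[R]_4 -> 'rV[R]_3)
  (h1 h2 : 'rV[R]_3 -> 'rV[R]_3 -> 'rV[R]_3 -> R)
  (K1 K2 : 'rV[R]_3 -> 'rV[R]_3 -> 'rV[R]_3 -> 'rV[R]_3)
  (S1 S2 : 'rV[R]_3 -> 'rV[R]_3 -> 'rV[R]_3) (e1 e2 : 'rV[R]_3 -> 'rV[R]_3)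
  (phi : 'rV[R]_3 -> 'rV[R]_3).
Implicit Types (s v w z : 'rV[R]_3).
Hypotheses (bs1 : blaschke_structure U1 f1 xi1 N1 T1 h1 K1 S1)
  (bs2 : blaschke_structure U2 f2 xi2 N2 T2 h2 K2 S2)
  (pt1 : forall s, U1 s -> point_structure (h1 s) (K1 s) (S1 s))
  (pt2 : forall s, U2 s -> point_structure (h2 s) (K2 s) (S2 s))
  (oW : open W) (W1 : W `<=` U1) (sphi : smooth_on W phi) (W2 : forall s, W s -> U2 (phi s))
  (f12 : forall s, W s -> f1 s = f2 (phi s)) (xi12 : forall s, W s -> xi1 s = xi2 (phi s)).

Let ts1 : transversal_structure U1 f1 xi1 N1 T1 h1 := bs1.
Let ts2 : transversal_structure U2 f2 xi2 N2 T2 h2 := bs2.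
Let oU2 := ts_open ts2.
Let sf2 := ts_f ts2.
Let sxi2 := ts_xi ts2.
Let sN2 := ts_N ts2.
Local Notation J s v := (dd v phi s).

Lemma dd_comp (X : normedModType R) (g : 'rV[R]_3 -> X) s v : smooth_on U2 g -> W s ->
  dd v (fun y => g (phi y)) s = dd (J s v) g (phi s).
Proof.
move=> sg Ws; rewrite !ddE.
have [_ E] := derive_comp v (smooth_diff sphi Ws) (smooth_diff sg (W2 Ws)).
exact: E.
Qed.

Lemma smooth_comp_W m n (g : 'rV[R]_3 -> 'M[R]_(m, n)) : smooth_on U2 g ->
  smooth_on W (fun y => g (phi y)).
Proof. by move=> sg; exact: smooth_comp oW oU2 W2 sg sphi. Qed.

Lemma dd_dd_comp m n (g : 'rV[R]_3 -> 'M[R]_(m, n)) s v w : smooth_on U2 g -> W s ->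
  dd v (fun y => dd (J y w) g (phi y)) s =
  dd (dd v (dd w phi) s) g (phi s) + dd (J s v) (dd (J s w) g) (phi s).
Proof.
move=> sg Ws; have Us := W2 Ws.
have sJ k : smooth_on W (fun y => J y w 0 k) by exact: ((smooth_mx _ oW).1 (smooth_dd w sphi)).
have sgk (k : 'I_3) : smooth_on W (fun y => dd (delta_mx 0 k) g (phi y)).
  by apply: smooth_comp_W; exact: smooth_dd.
pose G (k : 'I_3) y := J y w 0 k *: dd (delta_mx 0 k) g (phi y).
have sG k : smooth_on W (G k) by apply: smoothZ.
have DG k : dd v (G k) s = dd v (dd w phi) s 0 k *: dd (delta_mx 0 k) g (phi s)
    + J s w 0 k *: dd (J s v) (dd (delta_mx 0 k) g) (phi s).
  rewrite (ddZ v (sJ k) (sgk k))// (dd_comp _ (smooth_dd _ sg))//.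
  by rewrite (dd_entry v 0 k (smooth_dd w sphi)).
have E3 (A : 'I_3 -> 'M[R]_(m, n)) : \sum_k A k = A 0 + A 1 + A 2.
  by rewrite !big_ord_recl big_ord0 addr0 addrA; congr (_ + A _ + A _); exact: val_inj.
transitivity (dd v (fun y => G 0 y + G 1 y + G 2 y) s).
  apply: eq_on_dd oW _ _ Ws => y Wy; rewrite (dd_sum_delta _ sg (W2 Wy)) E3//.
have sG01 : smooth_on W (fun y => G 0 y + G 1 y) by apply: smoothD.
rewrite (ddD sG01 (sG 2))// (ddD (sG 0) (sG 1))// !DG.
rewrite (dd_sum_delta (dd v (dd w phi) s) sg Us) E3.
have -> : dd (J s v) (dd (J s w) g) (phi s) =
    \sum_k J s w 0 k *: dd (J s v) (dd (delta_mx 0 k) g) (phi s).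
  rewrite (schwarz_dd _ _ oU2 sg Us) (dd_sum_delta _ (smooth_dd _ sg) Us).
  by apply: eq_bigr => k _; congr (_ *: _); exact: schwarz_dd oU2 sg Us.
by rewrite E3 !addrA; apply/matrixP => i j; rewrite !mxE; ring.
Qed.

Lemma chart_df s v : W s -> dd v f1 s = dd (J s v) f2 (phi s).
Proof. by move=> Ws; rewrite (eq_on_dd v oW f12 Ws) (dd_comp v sf2 Ws). Qed.

Lemma chart_dxi s v : W s -> dd v xi1 s = dd (J s v) xi2 (phi s).
Proof. by move=> Ws; rewrite (eq_on_dd v oW xi12 Ws) (dd_comp v sxi2 Ws). Qed.

Lemma chart_N s : W s -> N1 s = N2 (phi s).
Proof.
move=> Ws; have Us := W1 Ws; have Us2 := W2 Ws.
apply: (cotangent_eq ts1 Us) => [|v]; first by rewrite (ts_Nxi ts1)// xi12// (ts_Nxi ts2).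
by rewrite (ts_Nf ts1)// chart_df// (ts_Nf ts2).
Qed.

Lemma chart_dN s v : W s -> dd v N1 s = dd (J s v) N2 (phi s).
Proof. by move=> Ws; rewrite (eq_on_dd v oW chart_N Ws) (dd_comp v sN2 Ws). Qed.

Lemma chart_h s v w : W s -> h1 s v w = h2 (phi s) (J s v) (J s w).
Proof.
move=> Ws; rewrite (metric_dual ts1 _ _ (W1 Ws)) (metric_dual ts2 _ _ (W2 Ws)).
by rewrite chart_df// chart_dN.
Qed.

Definition chart_jacobian s : 'M[R]_3 := \matrix_i J s (delta_mx 0 i).

Lemma mul_chart_jacobian s v : W s -> v *m chart_jacobian s = J s v.
Proof.
move=> Ws; apply: (mul_rows_lin (L := fun v => J s v)) => c u w.
by rewrite (ddDl sphi)// (ddZl sphi).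
Qed.

Lemma chart_jacobian_unit s : W s -> chart_jacobian s \in unitmx.
Proof.
move=> Ws; rewrite -row_free_unit; apply: inj_row_free => v; rewrite mul_chart_jacobian// => v0.
rewrite -(tangent_f ts1 v (W1 Ws)) chart_df// v0.
have -> : dd 0 f2 (phi s) = 0 by rewrite -(scale0r (0 : 'rV[R]_3)) (ddZl sf2 _ _ (W2 Ws)) scale0r.
have := tangent_f ts1 0 (W1 Ws); rewrite -(scale0r (0 : 'rV[R]_3)) (ddZl (ts_f ts1) _ _ (W1 Ws)).
by rewrite scale0r.
Qed.

Lemma chart_surj s w : W s -> exists v, w = J s v.
Proof.
move=> Ws; exists (w *m invmx (chart_jacobian s)).
by rewrite -mul_chart_jacobian// mulmxKV// chart_jacobian_unit.
Qed.

Lemma chart_S s v : W s -> J s (S1 s v) = S2 (phi s) (J s v).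
Proof.
move=> Ws; have Us2 := W2 Ws; rewrite -[LHS](tangent_f ts2 _ Us2) -[RHS](tangent_f ts2 _ Us2).
congr (T2 (phi s) _); rewrite -chart_df//; apply: oppr_inj.
by rewrite -(shape_eq bs1 _ (W1 Ws)) -(shape_eq bs2 _ Us2) chart_dxi.
Qed.

(** In the form [cubic_eq] the second derivatives of [phi] enter once through [N] and once through
    [f]; by [metric_dual] and [metric_dual'] the two contributions cancel. *)
Lemma chart_K s v w : W s -> J s (K1 s v w) = K2 (phi s) (J s v) (J s w).
Proof.
move=> Ws; have Us2 := W2 Ws; apply: (metric_eq ts2 Us2) => z'.
have [z ->] := chart_surj z' Ws.
rewrite -chart_h// (cubic_eq bs1 _ _ _ (W1 Ws)) (cubic_eq bs2 _ _ _ Us2).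
have D1 : dd v (dd w N1) s = dd v (fun y => dd (J y w) N2 (phi y)) s.
  by apply: eq_on_dd oW _ _ Ws => y Wy; exact: chart_dN.
have D2 : dd v (dd w f1) s = dd v (fun y => dd (J y w) f2 (phi y)) s.
  by apply: eq_on_dd oW _ _ Ws => y Wy; exact: chart_df.
rewrite D1 D2 (dd_dd_comp v w sN2 Ws) (dd_dd_comp v w sf2 Ws) chart_df// chart_dN//.
rewrite pairingDl pairingDr.
have := metric_dual ts2 (dd v (dd w phi) s) (J s z) Us2.
have := metric_dual' ts2 (dd v (dd w phi) s) (J s z) Us2.
by move=> -> /oppr_inj ->; ring.
Qed.

Hypotheses (se1 : smooth_on U1 e1) (se2 : smooth_on U2 e2)
  (nf1 : forall s, U1 s -> exists mu lam a, mu != 0 /\ normal_form (h1 s) (K1 s) (S1 s) (e1 s) mu lam a)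
  (nf2 : forall s, U2 s -> exists mu lam a, mu != 0 /\ normal_form (h2 s) (K2 s) (S2 s) (e2 s) mu lam a)
  (ab2 : forall s, U2 s -> forall g g', point_symmetry (h2 s) (K2 s) (S2 s) g ->
     point_symmetry (h2 s) (K2 s) (S2 s) g' -> g *m g' = g' *m g).

Lemma chart_normal_form s e mu lam a : W s -> normal_form (h1 s) (K1 s) (S1 s) e mu lam a ->
  normal_form (h2 (phi s)) (K2 (phi s)) (S2 (phi s)) (J s e) mu lam a.
Proof.
move=> Ws [ee HK HS]; split=> [|w|w]; first by rewrite -chart_h.
- have [v ->] := chart_surj w Ws; rewrite -chart_K// HK -chart_h//.
  by rewrite (ddDl sphi)// !(ddZl sphi).
- have [v ->] := chart_surj w Ws; rewrite -chart_S// HS -chart_h//.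
  by rewrite (ddDl sphi)// !(ddZl sphi).
Qed.

Let mu1 := axis_mu h1 K1 e1. Let mu2 := axis_mu h2 K2 e2.
Let lam1 := axis_lam h1 S1 e1. Let lam2 := axis_lam h2 S2 e2.
Let a1 := axis_a h1 S1 e1. Let a2 := axis_a h2 S2 e2.
Let E1 := axis_E f1 e1. Let E2 := axis_E f2 e2.
Let E1' := axis_E' N1 e1. Let E2' := axis_E' N2 e2.
Let eta1 := axis_eta f1 T1 K1 e1. Let eta2 := axis_eta f2 T2 K2 e2.

Lemma chart_axis s : W s -> exists sg : R, [/\ sg = 1 \/ sg = - 1, J s (e1 s) = sg *: e2 (phi s),
  mu1 s = sg * mu2 (phi s), lam1 s = lam2 (phi s) & a1 s = a2 (phi s)].
Proof.
move=> Ws; have Us := W1 Ws; have Us2 := W2 Ws; have p := pt2 Us2.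
have [_ n1] := axis_normal_form pt1 nf1 Us; have [_ n2] := axis_normal_form pt2 nf2 Us2.
have n1' := chart_normal_form Ws n1.
have [ee|ee] := @normal_form_unique _ _ _ _ p (ab2 Us2) _ _ _ _ _ _ _ _ n2 n1'.
  exists 1; rewrite scale1r mul1r ee in n1' *.
  have [M L A] := normal_form_params p n1' n2.
  by rewrite /mu1 /lam1 /a1 M L A; split=> //; left.
exists (- 1); rewrite scaleN1r mulN1r ee in n1' *.
have [M L A] := normal_form_params p n1' (@normal_form_opp _ _ _ _ p _ _ _ _ n2).
by rewrite /mu1 /lam1 /a1 M L A; split=> //; right.
Qed.

Lemma chart_system s : W s -> exists sg : R, [/\ sg = 1 \/ sg = - 1,
  E1 s = sg *: E2 (phi s), E1' s = sg *: E2' (phi s), mu1 s = sg * mu2 (phi s) &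
  [/\ eta1 s = sg * eta2 (phi s), lam1 s = lam2 (phi s) & a1 s = a2 (phi s)]].
Proof.
move=> Ws0.
have EE y : W y -> exists sg : R, [/\ sg = 1 \/ sg = - 1, E1 y = sg *: E2 (phi y),
    E1' y = sg *: E2' (phi y) & J y (e1 y) = sg *: e2 (phi y)].
  move=> Wy; have [sg [sg1 je _ _ _]] := chart_axis Wy; exists sg; split=> //.
  - by rewrite /E1 /axis_E chart_df// je (ddZl sf2)//; exact: W2.
  - by rewrite /E1' /axis_E' chart_dN// je (ddZl sN2)//; exact: W2.
have sE1 : smooth_on W E1 by apply: smooth_subset W1 _; exact: smooth_axis_E bs1 se1.
have sE2 := smooth_axis_E bs2 se2; have sE2' := smooth_axis_E' bs2 se2.
have sE2p : smooth_on W (fun y => E2 (phi y)) by exact: smooth_comp_W.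
have sE2p' : smooth_on W (fun y => E2' (phi y)) by exact: smooth_comp_W.
(* The sign is a smooth function with square 1, hence has zero derivative. *)
pose sg y := - ⟨E1 y, E2' (phi y)⟩.
have ssg : smooth_on W sg by apply: smoothN => //; exact: smooth_pairing.
have nn y : W y -> ⟨E2 (phi y), E2' (phi y)⟩ = - 1.
  move=> Wy; have Uy := W2 Wy; have [_ [ee _ _]] := axis_normal_form pt2 nf2 Uy.
  by rewrite /E2 /E2' /axis_E (axis_df_E' e2 bs2)// ee.
have sgE y k : W y -> E1 y = k *: E2 (phi y) -> sg y = k.
  by move=> Wy H; rewrite /sg H pairingZl nn// mulrN1 opprK.
have sg2 y : W y -> sg y * sg y = 1.
  by move=> Wy; have [k [k1 H _ _]] := EE y Wy; rewrite (sgE y k)//; case: k1 => ->; ring.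
have dsg v : dd v sg s = 0.
  have := eq_on_dd v oW sg2 Ws0; rewrite dd_cst (ddM v ssg ssg)// => H.
  have := sg2 s Ws0; have : sg s * dd v sg s = 0 by lra.
  move=> /eqP; rewrite mulf_eq0 => /orP[/eqP ->|/eqP//]; rewrite mul0r => /esym/eqP.
  by rewrite oner_eq0.
have E12 y : W y -> E1 y = sg y *: E2 (phi y).
  by move=> Wy; have [k [_ H _ _]] := EE y Wy; rewrite (sgE y k).
have dE v : dd v E1 s = sg s *: dd (J s v) E2 (phi s).
  rewrite (eq_on_dd v oW E12 Ws0) (ddZ v ssg sE2p)// dsg scale0r add0r.
  by rewrite (dd_comp v sE2 Ws0).
have [k [k1 je mE lamE aE]] := chart_axis Ws0.
have [k' [k1' H H' je']] := EE s Ws0.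
have Us := W1 Ws0; have Us2 := W2 Ws0; have p1 := pt1 Us; have p2 := pt2 Us2.
have kk : k' = k.
  have [_ [ee _ _]] := axis_normal_form pt2 nf2 Us2.
  have := congr1 (h2 (phi s) (e2 (phi s))) (etrans (esym je) je').
  by rewrite !(hZr p2) ee !mulr1.
subst k'; exists k; split=> //; split=> //.
(* Along a direction orthogonal to the axis the derivative of [E] is [(eta - mu) dd v f], so
   comparing both charts there yields the law for [eta]. *)
have [v v0 [ve _]] := exists_orthogonal p1 (e1 s) (e1 s).
have := dE v; rewrite (sgE s k)// /E1 /E2 (dd_E bs1 pt1 se1 nf1)// (dd_E bs2 pt2 se2 nf2)//.
have je2 : h2 (phi s) (J s v) (e2 (phi s)) = 0.
  have : h2 (phi s) (J s v) (J s (e1 s)) = 0 by rewrite -chart_h.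
  rewrite je (hZr p2) => /eqP; rewrite mulf_eq0 => /orP[/eqP k0|/eqP//].
  by case: k1; rewrite k0 => /eqP; rewrite eq_sym ?oppr_eq0 ?oner_eq0// eq_sym oppr_eq0 oner_eq0.
rewrite ve je2 !scale0r !addr0 chart_df// scalerA -/eta1 -/eta2 -/mu1 -/mu2.
move/(congr1 (fun b => h2 (phi s) (T2 (phi s) b) (J s v))).
rewrite -!(ddZl sf2)// !(tangent_f ts2)// !(hZl p2).
have hv : h2 (phi s) (J s v) (J s v) != 0 by rewrite -chart_h// gt_eqF// (metric_pos p1).
by move/(mulIf hv); rewrite mE; case: k1 => ->; lra.
Qed.

(** [E], [E'], [mu] and [eta] are odd in the axis, hence products of two of them are even; only the
    lines of [om] and [tau] are well defined. *)
Lemma chart_invariants s : W s -> exists sg : R, [/\ sg = 1 \/ sg = - 1,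
  axis_nu f1 T1 h1 K1 S1 e1 s = axis_nu f2 T2 h2 K2 S2 e2 (phi s),
  axis_zeta f1 xi1 T1 h1 K1 e1 s = axis_zeta f2 xi2 T2 h2 K2 e2 (phi s),
  axis_om f1 xi1 T1 h1 K1 S1 e1 s = sg *: axis_om f2 xi2 T2 h2 K2 S2 e2 (phi s)
  & axis_tau f1 N1 T1 h1 K1 e1 s = sg *: axis_tau f2 N2 T2 h2 K2 e2 (phi s)].
Proof.
move=> Ws; have [k [k1 H H' mE [eE lE aE]]] := chart_system Ws.
rewrite /axis_om /axis_nu /axis_zeta /axis_tau -/mu1 -/mu2 -/a1 -/a2 -/eta1 -/eta2.
rewrite -/E1 -/E2 -/E1' -/E2' H H' mE eE aE (xi12 Ws) (chart_N Ws).
by exists k; case: k1 => ->; split; rewrite ?mul1r ?mulN1r ?scale1r ?scaleN1r; auto;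
  first [ring | by apply/rowP => j; rewrite !mxE; ring | by apply/colP => j; rewrite !mxE; ring].
Qed.

End ChartChange.

(** * The constant lines *)

(* Gronwall's argument along the segments issued from [s0]. *)
Lemma linear_zero_near (R : realType) (n : nat) (U : set 'rV[R]_n) (g : 'rV[R]_n -> R)
    (c : 'rV[R]_n -> 'rV[R]_n -> R) s0 : open U -> smooth_on U g ->
  (forall i, smooth_on U (fun s => c s (delta_mx 0 i))) ->
  (forall s v, U s -> c s v = \sum_i v 0 i * c s (delta_mx 0 i)) ->
  (forall s v, U s -> dd v g s = c s v * g s) -> U s0 -> g s0 = 0 ->
  \forall s \near s0, g s = 0.
Proof.
move=> oU sg sc clin Dg Us0 g0.
pose C s : 'rV[R]_n := \row_i c s (delta_mx 0 i).
have sC : smooth_on U C.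
  by apply/smooth_mx => // i j; apply: (eq_smooth (sc j)) => s; rewrite mxE.
have bC : \forall s \near s0, `|C s| <= `|C s0| + 1.
  have Cc := smooth_continuous sC Us0.
  have /cvgrPdist_lt/(_ 1 ltr01) := Cc; apply: filterS => s /ltW H.
  by rewrite -lerBlDl (le_trans _ H)// distrC lerB_dist.
pose B := n%:R * (`|C s0| + 1).
have cB s v : U s -> `|C s| <= `|C s0| + 1 -> `|c s v| <= B * `|v|.
  move=> Us H; rewrite clin//; apply: le_trans (ler_norm_sum _ _ _) _.
  have -> : B * `|v| = \sum_(i < n) ((`|C s0| + 1) * `|v|).
    by rewrite sumr_const card_ord -mulrA mulr_natl.
  apply: ler_sum => i _; rewrite normrM mulrC; apply: ler_pM => //; last exact: mx_norm_entry.
  by apply: le_trans H; have := mx_norm_entry (C s) 0 i; rewrite mxE.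
have [r /= r0 rH] : exists2 r : R, 0 < r & forall s, ball s0 r s -> U s /\ `|C s| <= `|C s0| + 1.
  have : \forall s \near s0, U s /\ `|C s| <= `|C s0| + 1.
    by apply: filterI => //; exact: open_nbhs_nbhs.
  by move=> /nbhs_ballP[r r0 H]; exists r.
near=> y; have yB : ball s0 r y by near: y; apply: nbhsx_ballx.
(* [k] bounds twice the coefficient along the segment, so the damped square [H] below starts at
   zero, is nonnegative and does not increase. *)
pose v := y - s0; pose k := 2 * (B * `|v|).
pose z (t : R) := t *: v + s0.
have zB t : 0 <= t <= 1 -> U (z t) /\ `|C (z t)| <= `|C s0| + 1.
  by move=> ht; apply: rH; exact: ball_segment.
pose H (t : R) := g (z t) * g (z t) * expR (- k * t).
pose H' (t : R) := (2 * c (z t) v - k) * H t.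
have DH (t : R) : 0 <= t <= 1 -> is_derive t 1 H (H' t).
  move=> ht; have [Uz _] := zB t ht.
  have D1 := is_derive_line (x := s0) (v := v) (s := t) (smooth_diff sg Uz).
  rewrite -ddE Dg// in D1.
  apply: is_derive_eq; rewrite /GRing.scale /= /H' /H; ring.
have [||t] := @MVT R H H' 0 1 ltr01.
- by move=> t; rewrite in_itv /= => /andP[t0 t1]; apply: (DH t); rewrite !ltW.
- apply: derivable_within_continuous => t; rewrite in_itv /= => ht.
  by have [] := DH t ht.
rewrite in_itv /= => /andP[t0 t1]; rewrite subr0 mulr1.
have ht : 0 <= t <= 1 by rewrite !ltW.
have -> : H 0 = 0 by rewrite /H /z scale0r add0r g0 !mul0r.
rewrite subr0 => E; have [Uz Cz] := zB t ht.
have Hneg : H' t <= 0.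
  rewrite /H' mulr_le0_ge0 ?subr_le0//; last by rewrite /H mulr_ge0 ?expR_ge0// -expr2 sqr_ge0.
  rewrite /k ler_pM2l//; apply: le_trans (ler_norm _) _; exact: cB.
have : H 1 <= 0 by rewrite E.
rewrite /H /z scale1r subrK pmulr_lle0 ?expR_gt0// -expr2 => g2.
by apply/eqP; rewrite -sqrf_eq0 eq_le g2 sqr_ge0.
Unshelve. all: by end_near.
Qed.

Lemma smooth_near_neq0 (R : realType) (V : normedModType R) m n (U : set V)
    (g : V -> 'M[R]_(m, n)) s0 :
  smooth_on U g -> U s0 -> g s0 != 0 -> \forall s \near s0, g s != 0.
Proof.
move=> sg Us0 g0; have gc := smooth_continuous sg Us0.
have /cvgrPdist_lt/(_ `|g s0|) := gc; rewrite normr_gt0 => /(_ g0).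
by apply: filterS => s H; apply: contraTneq H => ->; rewrite subr0 ltxx.
Qed.

(** * Prescribed lines and centres, locally *)

Section LineCondition.
Context {R : realType}.
Variables (U : set 'rV[R]_3) (f xi : 'rV[R]_3 -> 'rV[R]_4) (N : 'rV[R]_3 -> 'cV[R]_4)
  (T : 'rV[R]_3 -> 'rV[R]_4 -> 'rV[R]_3) (h : 'rV[R]_3 -> 'rV[R]_3 -> 'rV[R]_3 -> R)
  (K : 'rV[R]_3 -> 'rV[R]_3 -> 'rV[R]_3 -> 'rV[R]_3) (S : 'rV[R]_3 -> 'rV[R]_3 -> 'rV[R]_3)
  (e : 'rV[R]_3 -> 'rV[R]_3).
Implicit Types (s v w z : 'rV[R]_3).
Hypotheses (bs : blaschke_structure U f xi N T h K S)
  (pt : forall s, U s -> point_structure (h s) (K s) (S s))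
  (se : smooth_on U e)
  (nf : forall s, U s -> exists mu lam a, mu != 0 /\ normal_form (h s) (K s) (S s) (e s) mu lam a).
Let ts : transversal_structure U f xi N T h := bs.
Let oU := ts_open ts.
Let sf := ts_f ts.
Local Notation nu := (axis_nu f T h K S e).
Local Notation zeta := (axis_zeta f xi T h K e).
Local Notation om := (axis_om f xi T h K S e).
Local Notation tau := (axis_tau f N T h K e).
Local Notation mu := (axis_mu h K e).
Local Notation eta := (axis_eta f T K e).
Let seta := smooth_axis_eta bs se.
Let smu := smooth_axis_mu bs se.
Let sth := smooth_axis_th bs se.

Lemma axis_linear_zero (g : 'rV[R]_3 -> R) (c : 'rV[R]_3 -> R) s0 : smooth_on U g ->
  smooth_on U c -> (forall s v, U s -> dd v g s = (c s * h s v (e s)) * g s) -> U s0 ->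
  g s0 = 0 -> \forall s \near s0, g s = 0.
Proof.
move=> sg sc Dg Us0 g0.
apply: (@linear_zero_near _ _ U g (fun s v => c s * h s v (e s)) s0) => //.
- by move=> i; exact: smoothM.
- by move=> s v Us; rewrite (metric_suml ts)// mulr_sumr; apply: eq_bigr => i _; rewrite mulrCA.
Qed.

Lemma axis_linear_zero_mx m n (g : 'rV[R]_3 -> 'M[R]_(m, n)) (c : 'rV[R]_3 -> R) s0 :
  smooth_on U g -> smooth_on U c ->
  (forall s v, U s -> dd v g s = (c s * h s v (e s)) *: g s) -> U s0 ->
  g s0 = 0 -> \forall s \near s0, g s = 0.
Proof.
move=> sg sc Dg Us0 g0.
have H ij : \forall s \near s0, g s ij.1 ij.2 = 0.
  apply: (@axis_linear_zero (fun s => g s ij.1 ij.2) c) => //; last by rewrite g0 mxE.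
    exact: ((smooth_mx _ oU).1 sg).
  by move=> s v Us; rewrite -(dd_entry v _ _ sg Us) Dg// mxE.
have : \forall s \near s0, forall ij, g s ij.1 ij.2 = 0 
  by apply: (@filter_forall _ ('I_m * 'I_n)%type (fun ij s => g s ij.1 ij.2 = 0) (nbhs s0)) => ij; exact: H.
by apply: filterS => s Hs; apply/matrixP => i j; rewrite (Hs (i, j)) mxE.
Qed.

(** With cokernels for [A] and [B], this says that [om] and [tau] lie on given lines and that the
    centre lies on the line through [c0] directed by [om]. Linear tests do not see the sign of
    [e]. *)
Definition line_condition (A B : 'M[R]_4) (c0 : 'rV[R]_4) s : Prop :=
  [/\ nu s != 0, om s *m A = 0, (tau s)^T *m B = 0
    & (f s + (nu s)^-1 *: zeta s - c0) *m A = 0].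

(** A vanishing [nu], [om *m A] or [tau^T *m B] persists by uniqueness for its linear homogeneous
    equation, a nonvanishing one by continuity. The derivative of the centre is a multiple of [om],
    already annihilated by [A]. Both directions are needed for an open and closed set. *)
Lemma line_condition_locally_constant A B c0 s0 : U s0 ->
  \forall s \near s0, line_condition A B c0 s <-> line_condition A B c0 s0.
Proof.
move=> Us0; have snu := smooth_axis_nu bs se; have szeta := smooth_axis_zeta bs se.
have som := smooth_axis_om bs se; have stau := smooth_axis_tau bs se.
have near_U : \forall s \near s0, U s by exact: open_nbhs_nbhs.
have [nu0|nu0] := eqVneq (nu s0) 0.
  have : \forall s \near s0, nu s = 0.
    apply: (@axis_linear_zero _ (fun s => - 2 * eta s) s0) => //.
      by apply: smoothM => //; exact: smooth_cst.
    by move=> s v Us; rewrite (dd_nu bs pt se nf)//; ring.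
  by apply: filterS => s nus; split=> -[]; rewrite ?nus ?nu0 eqxx.
pose U' := [set s | U s /\ nu s != 0].
have oU' : open U' by exact: open_nonzero.
have U's0 : U' s0 by [].
have sU : U' `<=` U by move=> s [].
have near_U' : \forall s \near s0, U' s by exact: open_nbhs_nbhs.
have sV : smooth_on U' (fun s => (nu s)^-1).
  by apply: smoothV => //; [by move=> s []|exact: smooth_subset sU snu].
pose ce s := f s + (nu s)^-1 *: zeta s.
have sce : smooth_on U' ce.
  apply: smoothD => //; first exact: smooth_subset sU sf.
  by apply: smoothZ => //; exact: smooth_subset sU szeta.
have sA (g : 'rV[R]_3 -> 'rV[R]_4) (O : set 'rV[R]_3) : open O -> smooth_on O g ->
    smooth_on O (fun s => g s *m A).
  by move=> oO sg; apply: smooth_mulmx => //; exact: smooth_cst.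
have stB : smooth_on U (fun s => (tau s)^T *m B).
  apply: smooth_mulmx => //; last exact: smooth_cst.
  exact: smooth_trmx.
have DA (g : 'rV[R]_3 -> 'rV[R]_4) (O : set 'rV[R]_3) s v : smooth_on O g -> O s ->
    dd v (fun s => g s *m A) s = dd v g s *m A.
  by move=> sg Os; rewrite (dd_mulmx v sg (smooth_cst A) Os) dd_cst mulmx0 addr0.
have c1 : smooth_on U (fun s => 3 * mu s - eta s).
  by apply: smoothB => //; apply: smoothM => //; exact: smooth_cst.
have [om0|om0] := eqVneq (om s0 *m A) 0; last first.
  have : \forall s \near s0, om s *m A != 0 by exact: smooth_near_neq0 (sA _ _ oU som) Us0 om0.
  by apply: filterS => s oms; split=> -[_ /eqP]; rewrite ?(negbTE oms) ?(negbTE om0).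
have near_om : \forall s \near s0, om s *m A = 0.
  apply: (axis_linear_zero_mx (sA _ _ oU som) c1) => // s v Us.
  by rewrite (DA om U)// (dd_om bs pt se nf)// scalemxAl.
have [tau0|tau0] := eqVneq ((tau s0)^T *m B) 0; last first.
  have : \forall s \near s0, (tau s)^T *m B != 0 by exact: smooth_near_neq0 stB Us0 tau0.
  by apply: filterS => s oms; split=> -[_ _ /eqP]; rewrite ?(negbTE oms) ?(negbTE tau0).
have near_tau : \forall s \near s0, (tau s)^T *m B = 0.
  have c2 : smooth_on U (fun s => - (eta s + 3 * mu s)).
    by apply: smoothN => //; apply: smoothD => //; apply: smoothM => //; exact: smooth_cst.
  apply: (axis_linear_zero_mx stB c2) => // s v Us.
  rewrite (dd_mulmx v (smooth_trmx oU stau) (smooth_cst B) Us) dd_cst mulmx0 addr0 scalemxAl.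
  congr (_ *m _); apply/rowP => j; rewrite (dd_entry v 0 j (smooth_trmx oU stau) Us) [RHS]mxE [X in _ = _ * X]mxE.
  transitivity (dd v (fun y => tau y j 0) s); first by congr (dd v _ s); apply/funext => y; rewrite mxE.
  by rewrite -(dd_entry v j 0 stau Us) (dd_tau bs pt se nf)// [LHS]mxE.
have sceA : smooth_on U' (fun s => (ce s - c0) *m A).
  by apply: (sA (fun s => ce s - c0)) => //; apply: smoothB => //; exact: smooth_cst.
have [ce0|ce0] := eqVneq ((ce s0 - c0) *m A) 0; last first.
  have : \forall s \near s0, (ce s - c0) *m A != 0 by exact: smooth_near_neq0 sceA U's0 ce0.
  by apply: filterS => s oms; split=> -[_ _ _ /eqP]; rewrite ?(negbTE oms) ?(negbTE ce0).
have near_ce : \forall s \near s0, (ce s - c0) *m A = 0.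
  have : \forall s \near s0, U' s /\ om s *m A = 0 by apply: filterI.
  move=> /nbhs_ballP[r /= r0 H].
  have sB : ball s0 r `<=` U' by move=> y /H[].
  have DceA y v : ball s0 r y -> dd v (fun s => (ce s - c0) *m A) y = 0.
    move=> By; have [U'y omy] := H y By; have [Uy nuy] := U'y.
    rewrite (DA (fun s => ce s - c0) U')//; last by apply: smoothB => //; exact: smooth_cst.
    rewrite (ddB v oU' sce (smooth_cst c0))// dd_cst subr0 (dd_center bs pt se nf)//.
    by rewrite -scalemxAl omy scaler0.
  have cst y : ball s0 r y -> (ce y - c0) *m A = 0.
    move=> By; rewrite -ce0; apply/rowP => j.
    apply: (constant_on_ball (f := fun s => ((ce s - c0) *m A) 0 j) (r := r)) By => y' By'.
    have sj := (smooth_mx _ oU').1 sceA 0 j.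
    split; first exact: smooth_diff sj (sB _ By').
    by move=> v; rewrite -ddE -(dd_entry v 0 j sceA (sB _ By')) DceA// mxE.
  by apply/nbhs_ballP; exists r.
have : \forall s \near s0, (U' s /\ om s *m A = 0) /\ ((tau s)^T *m B = 0 /\ (ce s - c0) *m A = 0).
  by apply: filterI; apply: filterI.
by apply: filterS => s [[[Us nus] oms] [taus ces]]; split=> _; split.
Qed.

End LineCondition.

(** * Local parametrizations of a manifold *)

Section Charts.
Context {R : realType} {n : nat} {M : smooth_manifold R n}.
Implicit Types (U V : set 'rV[R]_n) (x y : 'rV[R]_n -> M).

Lemma embedding_continuous U x : open_embedding U x -> forall s, U s -> {for s, continuous x}.
Proof.
by move=> [oU _ cx _] s Us; move: cx; rewrite continuous_open_subspace// => /(_ s); rewrite inE; apply.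
Qed.

Lemma embedding_preimage U x (O : set M) : open_embedding U x -> open O ->
  open (U `&` x @^-1` O).
Proof.
move=> ex oO; have [oU _ _ _] := ex; rewrite openE => s [Us Os]; apply: filterI.
  exact: open_nbhs_nbhs.
exact: (embedding_continuous ex Us (open_nbhs_nbhs (conj oO Os))).
Qed.

Lemma embedding_image U x : open_embedding U x -> open (x @` U).
Proof. by move=> [oU _ _ H]; exact: H. Qed.

Lemma embedding_inj U x : open_embedding U x ->
  forall s t, U s -> U t -> x s = x t -> s = t.
Proof. by move=> [_ ix _ _] s t Us Ut; apply: ix; exact: mem_set. Qed.

Lemma param_open U x : local_param U x -> open U.
Proof. by move=> [[]]. Qed.

Lemma param_restrict U U0 x : local_param U x -> open U0 -> U0 `<=` U -> local_param U0 x.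
Proof.
move=> [ex tr] oU0 sU; have [oU ix cx ox] := ex; split.
  split=> // [s t /set_mem Us /set_mem Ut||O oO OU0].
  - by apply: (embedding_inj ex); exact: sU.
  - exact: continuous_subspaceW cx.
  - by apply: ox => //; exact: subset_trans sU.
move=> c ac; have [[t1 [st1 t1E]] [t2 [st2 t2E]]] := tr c ac; split.
  exists t1; split=> [|s [U0s ys]]; last by apply: t1E; split=> //; exact: sU.
  by apply: smooth_subset st1 => s [/sU Us].
have sub : c.1 `&` c.2 @^-1` (x @` U0) `<=` c.1 `&` c.2 @^-1` (x @` U).
  by move=> s [cs [u U0u us]]; split=> //; exists u => //; exact: sU.
exists t2; split=> [|s cs]; first exact: smooth_subset st2.
have [Ut xt] := t2E s (sub s cs); split=> //; have [_ [u U0u us]] := cs.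
by rewrite (embedding_inj ex Ut (sU _ U0u))// xt.
Qed.

Lemma atlas_param (c : set 'rV[R]_n * ('rV[R]_n -> M)) : atlas M c -> local_param c.1 c.2.
Proof.
move=> ac; split=> [|c' ac']; first exact: atlas_embedding.
by split; exact: atlas_compatible.
Qed.

(** Compatibility is given only with the charts of the atlas, so the transition passes through an
    atlas chart at the point and is local. *)
Lemma param_transition U x V y s0 : local_param U x -> local_param V y -> U s0 ->
  (y @` V) (x s0) -> exists W phi, [/\ open W, W s0, W `<=` U, smooth_on W phi
    & forall s, W s -> V (phi s) /\ y (phi s) = x s].
Proof.
move=> [ex trx] [ey try_] Us0 yVs0; have [c [ac cs0]] := atlas_cover (x s0).
have ec := atlas_embedding ac.
have [t1 [st1 t1E]] := (trx c ac).1; have [t2 [st2 t2E]] := (try_ c ac).2.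
pose W := U `&` x @^-1` ((c.2 @` c.1) `&` (y @` V)).
have oW : open W.
  by apply: embedding_preimage => //; apply: openI; exact: embedding_image.
have W1 : W `<=` U `&` x @^-1` (c.2 @` c.1) by move=> s [Us [cs _]].
have W2 s : W s -> (c.1 `&` c.2 @^-1` (y @` V)) (t1 s).
  move=> Ws; have [c1 c1E] := t1E s (W1 s Ws); split=> //.
  by rewrite /preimage /= c1E; case: Ws => _ [].
have oW2 : open (c.1 `&` c.2 @^-1` (y @` V)).
  by apply: embedding_preimage => //; exact: embedding_image.
exists W, (t2 \o t1); split=> //.
- by move=> s [].
- exact: (smooth_comp oW oW2 W2 st2 (smooth_subset W1 st1)).
- move=> s Ws; have [V2 y2] := t2E _ (W2 s Ws); split=> //=.
  by rewrite y2; have [_ ->] := t1E s (W1 s Ws).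
Qed.

End Charts.

(** * Propagation over the connected manifold *)

Section Global.
Context {R : realType} {M : smooth_manifold R 3}.
Variables (F xi : M -> 'rV[R]_4).
Hypotheses (F_immersion : immersion F) (xi_normal : affine_normal F xi)
  (h_positive : positive_definite F xi)
  (M_symmetric : pointwise_SO2_symmetry F xi \/ pointwise_Z3_symmetry F xi).
Implicit Types (U V : set 'rV[R]_3) (x y : 'rV[R]_3 -> M) (e : 'rV[R]_3 -> 'rV[R]_3).

Local Notation hh x := (affine_metric (F \o x) (xi \o x)).
Local Notation KK x := (difference_tensor (F \o x) (xi \o x)).
Local Notation SS x := (shape_operator (F \o x) (xi \o x)).
Local Notation NN x := (conormal (F \o x) (xi \o x)).
Local Notation TT x := (tangent_part (F \o x) (xi \o x)).

Lemma param_blaschke U x : local_param U x ->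
  blaschke_structure U (F \o x) (xi \o x) (NN x) (TT x) (hh x) (KK x) (SS x).
Proof.
move=> ux; exact: blaschke_of_affine_normal (param_open ux) (F_immersion ux) (xi_normal ux).
Qed.

Lemma param_point U x : local_param U x -> forall s, U s ->
  point_structure (hh x s) (KK x s) (SS x s).
Proof.
move=> ux s Us; have im := F_immersion ux; have no := xi_normal ux; have po := h_positive ux.
exact: affine_normal_point_structure (param_open ux) im no po _ Us.
Qed.

Lemma param_symmetry U x : local_param U x -> forall s, U s ->
  (forall g g', point_symmetry (hh x s) (KK x s) (SS x s) g ->
     point_symmetry (hh x s) (KK x s) (SS x s) g' -> g *m g' = g' *m g) /\
  exists g, [/\ point_symmetry (hh x s) (KK x s) (SS x s) g, g *m g *m g = 1%:M & g != 1%:M].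
Proof.
move=> ux s Us; apply: symmetry_group_facts; first by move=> g [].
by case: M_symmetric => H; [left|right]; exact: H ux Us.
Qed.

Record axis_chart U x e : Prop := AxisChart {
  ac_param : local_param U x;
  ac_smooth : smooth_on U e;
  ac_form : forall s, U s -> exists mu lam a, mu != 0 /\
    normal_form (hh x s) (KK x s) (SS x s) (e s) mu lam a }.

Lemma axis_chart_near U x s0 : local_param U x -> U s0 ->
  exists U0 e, [/\ axis_chart U0 x e, U0 s0 & U0 `<=` U].
Proof.
move=> ux Us0; have bs := param_blaschke ux; have pt := param_point ux.
have [U0 [e [oU0 U0U U0s0 se nf]]] := local_axis bs pt (param_symmetry ux) Us0.
by exists U0, e; split=> //; split=> //; exact: param_restrict U0U.
Qed.

Lemma axis_chart_at (p : M) : exists U x e s, [/\ axis_chart U x e, U s & x s = p].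
Proof.
have [c [ac [s cs sp]]] := atlas_cover p.
have [U0 [e [ax U0s _]]] := axis_chart_near (atlas_param ac) cs.
by exists U0, c.2, e, s.
Qed.

Definition chart_line (A B : 'M[R]_4) (c0 : 'rV[R]_4) x e s :=
  line_condition (F \o x) (xi \o x) (NN x) (TT x) (hh x) (KK x) (SS x) e A B c0 s.

Lemma chart_line_compat A B c0 U x e V y e' s t : axis_chart U x e -> axis_chart V y e' ->
  U s -> V t -> x s = y t -> chart_line A B c0 x e s -> chart_line A B c0 y e' t.
Proof.
move=> [ux se nf] [vy se' nf'] Us Vt st.
have yV : (y @` V) (x s) by rewrite st; exists t.
have [W [phi [oW Ws WU sphi phiE]]] := param_transition ux vy Us yV.
have WV s' : W s' -> V (phi s') by move=> /phiE[].
have f12 s' : W s' -> (F \o x) s' = (F \o y) (phi s') by move=> /phiE[_ /=->].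
have x12 s' : W s' -> (xi \o x) s' = (xi \o y) (phi s') by move=> /phiE[_ /=->].
have ab s' (Vs : V s') := (param_symmetry vy Vs).1.
have [sg [sg1 nuE zetaE omE tauE]] := chart_invariants (param_blaschke ux) (param_blaschke vy)
  (param_point ux) (param_point vy) oW WU sphi WV f12 x12 se se' nf nf' ab Ws.
have phis : phi s = t.
  have [ey _] := vy; have [Vp yp] := phiE s Ws.
  by apply: (embedding_inj ey Vp Vt); rewrite yp; exact: st.
move=> [n1 n2 n3 n4]; rewrite phis in nuE zetaE omE tauE.
have sg0 : sg != 0 by case: sg1 => ->; rewrite ?oppr_eq0 oner_eq0.
split.
- by rewrite -nuE.
- by apply: (scalerI sg0); rewrite scalemxAl -omE n2 scaler0.
- apply: (scalerI sg0); rewrite scalemxAl -[sg *: _^T]linearZ /= -tauE n3 scaler0//.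
- by rewrite -nuE -zetaE /= -st.
Qed.

(** The set [good] is open and closed: the condition is locally constant in one axis chart, and
    [chart_line_compat] makes it independent of the chart. *)
Lemma chart_line_global A B c0 U x e s V y e' t : connected [set: M] ->
  axis_chart U x e -> U s -> chart_line A B c0 x e s ->
  axis_chart V y e' -> V t -> chart_line A B c0 y e' t.
Proof.
move=> conM ax Us Ls ay Vt.
pose good (p : M) := exists U x e s, [/\ axis_chart U x e, U s, x s = p & chart_line A B c0 x e s].
have near_good (p : M) (Q : Prop) : (forall U x e s, axis_chart U x e -> U s -> x s = p ->
    (chart_line A B c0 x e s <-> Q)) -> \forall q \near p, (good q <-> Q).
  move=> HQ; have [U1 [x1 [e1 [s1 [a1 U1s1 xs1]]]]] := axis_chart_at p.
  have lc := line_condition_locally_constant (param_blaschke (ac_param a1))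
    (param_point (ac_param a1)) (ac_smooth a1) (ac_form a1) A B c0 U1s1.
  have [e_x _] := ac_param a1; have [oU1 _ _ ox1] := e_x.
  have : \forall s \near s1, U1 s /\ (chart_line A B c0 x1 e1 s <-> chart_line A B c0 x1 e1 s1).
    by apply: filterI => //; exact: open_nbhs_nbhs.
  move=> /nbhs_ballP[r /= r0 YH]; pose Y := ball s1 r.
  have oY : open Y by exact: ball_open.
  have Ys1 : Y s1 by exact: ballxx.
  have YU : Y `<=` U1 by move=> s' /YH[].
  have oxO : open (x1 @` Y) by exact: ox1 oY YU.
  have xO : (x1 @` Y) p by exists s1.
  apply: filterS (open_nbhs_nbhs (conj oxO xO)) => q [s' Ys' <-].
  have [U1s' iff1] := YH s' Ys'; have iff2 := HQ _ _ _ _ a1 U1s1 xs1.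
  rewrite -iff2 -iff1; split=> [[U2 [x2 [e2 [s2 [a2 U2s2 xs2 L2]]]]]|L1].
    exact: chart_line_compat a2 a1 U2s2 U1s' xs2 L2.
  by exists U1, x1, e1, s'.
have goodE U1 x1 e1 s1 : axis_chart U1 x1 e1 -> U1 s1 ->
    (chart_line A B c0 x1 e1 s1 <-> good (x1 s1)).
  move=> a1 U1s1; split=> [L1|[U2 [x2 [e2 [s2 [a2 U2s2 xs2 L2]]]]]].
    by exists U1, x1, e1, s1.
  exact: chart_line_compat a2 a1 U2s2 U1s1 xs2 L2.
have near_good' (p : M) : \forall q \near p, (good q <-> good p).
  by apply: near_good => U1 x1 e1 s1 a1 Us1 xs1; have := goodE _ _ _ _ a1 Us1; rewrite xs1.
have og : open good.
  by rewrite openE => p gp; have := near_good' p; apply: filterS => q [_ H]; exact: H.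
have cg : closed good.
  rewrite -[good]setCK; apply: open_closedC; rewrite openE => p gp.
  by have := near_good' p; apply: filterS => q [H _] /H.
have : good = [set: M].
  by apply: conM; [exists (x s), U, x, e, s|exists good; rewrite ?setTI|exists good; rewrite ?setTI].
move=> gT; apply/(goodE _ _ _ _ ay Vt); by rewrite gT.
Qed.

End Global.

(** * The warped form *)

Lemma pairing_mulmxl (R : realType) m n (c : 'rV[R]_m) (Q : 'M[R]_(m, n)) (N : 'cV[R]_n) :
  ⟨c *m Q, N⟩ = ⟨c, Q *m N⟩.
Proof. by rewrite !pairing_unfold mulmxA. Qed.

(** * Effect of an affine map of R^4 *)

Section AffineChange.
Context {R : realType}.
Variables (U : set 'rV[R]_3) (f xi : 'rV[R]_3 -> 'rV[R]_4) (N : 'rV[R]_3 -> 'cV[R]_4)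
  (T : 'rV[R]_3 -> 'rV[R]_4 -> 'rV[R]_3) (h : 'rV[R]_3 -> 'rV[R]_3 -> 'rV[R]_3 -> R)
  (K : 'rV[R]_3 -> 'rV[R]_3 -> 'rV[R]_3 -> 'rV[R]_3) (S : 'rV[R]_3 -> 'rV[R]_3 -> 'rV[R]_3)
  (e : 'rV[R]_3 -> 'rV[R]_3) (Q : 'M[R]_4) (b : 'rV[R]_4).
Implicit Types (s v w z : 'rV[R]_3).
Hypotheses (bs : blaschke_structure U f xi N T h K S) (uQ : Q \in unitmx).
Let ts : transversal_structure U f xi N T h := bs.
Let oU := ts_open ts.
Let sf := ts_f ts.
Let sxi := ts_xi ts.

Let f' s := f s *m Q + b.
Let xi' s := xi s *m Q.
Let N' s := invmx Q *m N s.
Let T' s c := T s (c *m invmx Q).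

Let sQ (g : 'rV[R]_3 -> 'rV[R]_4) : smooth_on U g -> smooth_on U (fun s => g s *m Q).
Proof. by move=> sg; apply: smooth_mulmx => //; exact: smooth_cst. Qed.

Let ddQ (g : 'rV[R]_3 -> 'rV[R]_4) s v : smooth_on U g -> U s ->
  dd v (fun s => g s *m Q) s = dd v g s *m Q.
Proof.
by move=> sg Us; rewrite (dd_mulmx v sg (smooth_cst Q) Us) dd_cst mulmx0 addr0.
Qed.

Let ddf' s v : U s -> dd v f' s = dd v f s *m Q.
Proof. by move=> Us; rewrite (ddD (sQ sf) (smooth_cst b))// dd_cst addr0 ddQ. Qed.

Let dddf' s v w : U s -> dd v (dd w f') s = dd v (dd w f) s *m Q.
Proof.
move=> Us; rewrite (eq_on_dd v oU (fun y Uy => ddf' w Uy) Us).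
by rewrite ddQ//; exact: smooth_dd.
Qed.

Lemma blaschke_affine : blaschke_structure U f' xi' N' T' h K S.
Proof.
have QV (c : 'rV[R]_4) : c *m Q *m invmx Q = c by rewrite mulmxK.
split; [split|..] => //.
- by apply: smoothD => //; [exact: sQ|exact: smooth_cst].
- exact: sQ.
- by apply: smooth_mulmx => //; [exact: smooth_cst|exact: (ts_N ts)].
- move=> c sc; apply: (ts_T ts); apply: smooth_mulmx => //; exact: smooth_cst.
- move=> s c Us; rewrite ddf'// /xi' scalemxAl -mulmxDl -pairing_mulmxl.
  by rewrite -(ts_decomp ts _ Us) mulmxKV.
- by move=> s Us; rewrite -pairing_mulmxl QV (ts_Nxi ts).
- by move=> s v Us; rewrite ddf'// -pairing_mulmxl QV (ts_Nf ts).
- by move=> s v Us; rewrite ddQ// -pairing_mulmxl QV (ts_Ndxi ts).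
- by move=> s v w Us; rewrite dddf'// -pairing_mulmxl QV (ts_h ts).
- exact: ts_nondeg ts.
- by move=> s v w Us; rewrite /T' dddf'// QV (bs_K bs).
- by move=> s v Us; rewrite /T' ddQ// QV (bs_S bs).
Qed.

Hypothesis se : smooth_on U e.

Let E'Q s : U s -> axis_E f' e s = axis_E f e s *m Q.
Proof. by move=> Us; rewrite /axis_E ddf'. Qed.

Lemma axis_eta_affine s : U s -> axis_eta f' T' K e s = axis_eta f T K e s.
Proof.
move=> Us; rewrite /axis_eta; congr (_ * \tr _); apply/row_matrixP => i; rewrite !rowK.
rewrite /axis_A /T' (eq_on_dd _ oU E'Q Us) ddQ ?mulmxK//; exact: smooth_axis_E bs se.
Qed.

Lemma axis_nu_affine s : U s -> axis_nu f' T' h K S e s = axis_nu f T h K S e s.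
Proof. by move=> Us; rewrite /axis_nu axis_eta_affine. Qed.

Lemma axis_zeta_affine s : U s -> axis_zeta f' xi' T' h K e s = axis_zeta f xi T h K e s *m Q.
Proof. by move=> Us; rewrite /axis_zeta axis_eta_affine// E'Q// mulmxBl scalemxAl. Qed.

Lemma axis_om_affine s : U s -> axis_om f' xi' T' h K S e s = axis_om f xi T h K S e s *m Q.
Proof.
move=> Us; rewrite /axis_om axis_eta_affine// axis_zeta_affine// axis_nu_affine// E'Q//.
by rewrite !scalemxAl -mulmxDl.
Qed.

Lemma axis_tau_affine s : U s -> axis_tau f' N' T' h K e s = invmx Q *m axis_tau f N T h K e s.
Proof.
move=> Us; rewrite /axis_tau axis_eta_affine// mulmxDr mulmxN -scalemxAr; congr (- _ + _).
rewrite /axis_E' /N' (dd_mulmx _ (smooth_cst (invmx Q)) (ts_N ts) Us) dd_cst mul0mx add0r//.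
Qed.

(** An affine map need not preserve volume: the transformed field satisfies the volume condition of
    an affine normal only up to the factor [|det Q|]. *)
Lemma volume_affine (d : R) s :
  (forall X : 'M[R]_3, `|\det (col_mx (xi s) (X *m jacobian f s) : 'M[R]_(1 + 3))| =
     d * Num.sqrt `|\det (gram (h s) X)|) -> U s ->
  forall X : 'M[R]_3, `|\det (col_mx (xi' s) (X *m jacobian f' s) : 'M[R]_(1 + 3))| =
     (`|\det Q| * d) * Num.sqrt `|\det (gram (h s) X)|.
Proof.
move=> vol Us X; rewrite -mulrA -vol -normrM mulrC -det_mulmx mul_col_mx -mulmxA.
congr (`|\det (col_mx _ (X *m _))|); apply/row_matrixP => i.
have [df df'] : differentiable f s /\ differentiable f' s.
  split; first exact: smooth_diff sf Us.
  have [ts' _ _] := blaschke_affine; exact: smooth_diff (ts_f ts') Us.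
have D1 := deriveEjacobian (delta_mx 0 i) df; have D2 := deriveEjacobian (delta_mx 0 i) df'.
have D3 := ddf' (delta_mx 0 i) Us; rewrite !ddE D1 D2 in D3.
by rewrite !rowE mulmxA; exact: D3.
Qed.

End AffineChange.

Lemma ord_rshiftP n (j : 'I_n.+1) : j = 0 \/ exists k : 'I_n, j = rshift 1 k.
Proof.
have [k ->|->] := unliftP ord0 j; last by left; exact: val_inj.
by right; exists k; exact: val_inj.
Qed.

(** Component in the complement W of the first axis; after normalization W is the kernel of
    [tau]. *)
Definition wpart (R : realType) (b : 'rV[R]_4) : 'rV[R]_3 := rsubmx (b : 'rV[R]_(1 + 3)).

Section WPart.
Context {R : realType}.
Implicit Types (b c : 'rV[R]_4).

Lemma wpartE b j : wpart b 0 j = b 0 (rshift 1 j).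
Proof. by rewrite mxE. Qed.
Lemma wpartD b c : wpart (b + c) = wpart b + wpart c.
Proof. by apply/rowP => j; rewrite wpartE !mxE. Qed.
Lemma wpartZ k b : wpart (k *: b) = k *: wpart b.
Proof. by apply/rowP => j; rewrite wpartE !mxE. Qed.
Lemma wpartN b : wpart (- b) = - wpart b.
Proof. by apply/rowP => j; rewrite wpartE !mxE. Qed.
Lemma wpart0 : wpart (0 : 'rV[R]_4) = 0.
Proof. by apply/rowP => j; rewrite wpartE !mxE. Qed.
Lemma row4_eq b c : b 0 0 = c 0 0 -> wpart b = wpart c -> b = c.
Proof.
move=> bc0 bc; apply/rowP => j; have [->//|[k ->]] := ord_rshiftP j.
by rewrite -!wpartE bc.
Qed.

Lemma smooth_wpart (V : normedModType R) (U : set V) (g : V -> 'rV[R]_4) : open U ->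
  smooth_on U g -> smooth_on U (fun s => wpart (g s)).
Proof.
move=> oU sg; apply/smooth_mx => // i j; have := (smooth_mx _ oU).1 sg 0 (rshift 1 j).
by move/eq_smooth; apply=> s; rewrite ord1 wpartE.
Qed.

Lemma dd_wpart (V : normedModType R) (U : set V) (g : V -> 'rV[R]_4) v s : open U ->
  smooth_on U g -> U s -> dd v (fun s => wpart (g s)) s = wpart (dd v g s).
Proof.
move=> oU sg Us; apply/rowP => j; rewrite wpartE (dd_entry v 0 j (smooth_wpart oU sg) Us).
rewrite (dd_entry v 0 _ sg Us); congr (dd v _ s); apply/funext => y; exact: wpartE.
Qed.

End WPart.

Lemma point3_0 (R : realType) (t : R) u : point3 t u 0 0 = t.
Proof.
rewrite /point3 (_ : (0 : 'I_3) = lshift 2 (0 : 'I_1)); last exact: val_inj.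
by rewrite [LHS](row_mxEl (t%:M : 'rV[R]_1) u 0 0) mxE eqxx mulr1n.
Qed.

Lemma point3_S (R : realType) (t : R) u j : point3 t u 0 (rshift 1 j) = u 0 j.
Proof. exact: (row_mxEr (t%:M : 'rV[R]_1) u 0 j). Qed.

Lemma point3_eta (R : realType) (s : 'rV[R]_3) :
  s = point3 (s 0 0) (rsubmx (s : 'rV[R]_(1 + 2))).
Proof.
apply/rowP => j; have [->|[k ->]] := ord_rshiftP j; first by rewrite point3_0.
by rewrite point3_S mxE.
Qed.

(** * Normalized position: lines along the coordinate splitting *)

Section Straight.
Context {R : realType}.
Variables (U : set 'rV[R]_3) (f xi : 'rV[R]_3 -> 'rV[R]_4) (N : 'rV[R]_3 -> 'cV[R]_4)
  (T : 'rV[R]_3 -> 'rV[R]_4 -> 'rV[R]_3) (h : 'rV[R]_3 -> 'rV[R]_3 -> 'rV[R]_3 -> R)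
  (K : 'rV[R]_3 -> 'rV[R]_3 -> 'rV[R]_3 -> 'rV[R]_3) (S : 'rV[R]_3 -> 'rV[R]_3 -> 'rV[R]_3)
  (e : 'rV[R]_3 -> 'rV[R]_3).
Implicit Types (s v w z : 'rV[R]_3).
Local Notation nu := (axis_nu f T h K S e).
Local Notation zeta := (axis_zeta f xi T h K e).
Local Notation om := (axis_om f xi T h K S e).
Local Notation tau := (axis_tau f N T h K e).
Local Notation mu := (axis_mu h K e).
Local Notation eta := (axis_eta f T K e).
Local Notation E := (axis_E f e).

(* After an affine change of R^4 the constant line spanned by om is the first coordinate
   axis, the constant line spanned by tau is its annihilator, and the centers
   f + zeta / nu lie on the first axis. *)
Record straight_chart : Prop := StraightChart {
  st_bs : blaschke_structure U f xi N T h K S;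
  st_pt : forall s, U s -> point_structure (h s) (K s) (S s);
  st_smooth : smooth_on U e;
  st_nf : forall s, U s -> exists mu lam a, mu != 0 /\ normal_form (h s) (K s) (S s) (e s) mu lam a;
  st_nu : forall s, U s -> nu s != 0;
  st_om : forall s, U s -> wpart (om s) = 0;
  st_tau : forall s j, U s -> tau s (rshift 1 j) 0 = 0;
  st_center : forall s, U s -> wpart (f s + (nu s)^-1 *: zeta s) = 0 }.

Hypothesis st : straight_chart.
Let bs := st_bs st.
Let pt := st_pt st.
Let se := st_smooth st.
Let nf := st_nf st.
Let ts : transversal_structure U f xi N T h := bs.
Let oU := ts_open ts.
Let sf := ts_f ts.
Let nu0 := st_nu st.

Definition tau0 s := tau s 0 0.

Lemma smooth_tau0 : smooth_on U tau0.
Proof. exact: ((smooth_mx _ oU).1 (smooth_axis_tau bs se)). Qed.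

Lemma pairing_tau b s : U s -> ⟨b, tau s⟩ = b 0 0 * tau0 s.
Proof.
move=> Us; rewrite pairing_unfold mxE (@big_ord_recl _ _ _ 3) /= big1 ?addr0// => j _.
have -> : lift ord0 j = rshift 1 j :> 'I_4 by exact: val_inj.
by rewrite (st_tau st)// mulr0.
Qed.

Lemma head_df s v : U s -> dd v f s 0 0 * tau0 s = h s v (e s).
Proof. by move=> Us; rewrite -pairing_tau// (df_tau e bs). Qed.

Lemma tau0_neq0 s : U s -> tau0 s != 0.
Proof.
move=> Us; have := E_tau bs pt nf Us; rewrite pairing_tau// => /eqP.
by apply: contraTneq => ->; rewrite mulr0 eq_sym oner_eq0.
Qed.

Lemma head_E s : U s -> E s 0 0 = (tau0 s)^-1.
Proof.
move=> Us; apply: (mulIf (tau0_neq0 Us)); rewrite mulVf ?tau0_neq0//.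
by rewrite -pairing_tau// (E_tau bs pt nf).
Qed.

Lemma head_zeta s : U s -> zeta s 0 0 = 0.
Proof.
move=> Us; apply: (mulIf (tau0_neq0 Us)); rewrite mul0r -pairing_tau//.
by rewrite (zeta_tau bs pt nf).
Qed.

Lemma wpart_zeta s : U s -> wpart (zeta s) = - nu s *: wpart (f s).
Proof.
move=> Us; have := st_center st Us; rewrite wpartD wpartZ => /eqP; rewrite addr_eq0 => /eqP ->.
by rewrite scaleNr scalerN opprK scalerA mulfV ?scale1r// nu0.
Qed.

(** Since [om] and the centres lie on the first axis, the W-parts of [E], [zeta] and [f] are
    proportional: moving along [e] only rescales the W-part of [f]. *)
Lemma wpart_E s : U s -> wpart (E s) = (eta s - mu s) *: wpart (f s).
Proof.
move=> Us; have := st_om st Us; rewrite /axis_om wpartD !wpartZ wpart_zeta//.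
move/eqP; rewrite addr_eq0 => /eqP H; apply: (scalerI (nu0 Us)); rewrite H.
by apply/rowP => j; rewrite !mxE; ring.
Qed.

Lemma zeta_N s : U s -> ⟨zeta s, N s⟩ = 1.
Proof.
move=> Us; rewrite /axis_zeta pairingDl pairingNl pairingZl (ts_Nxi ts)//.
by rewrite /axis_E (ts_Nf ts)// mulr0 subr0.
Qed.

(** Such a tangent vector would be a multiple of [zeta], which is transversal because
    [⟨zeta, N⟩ = 1]. This gives the independence of the slice coordinates and of position and
    tangent vectors on a leaf. *)
Lemma vertical_eq0 s v (c : R) : U s -> dd v f s 0 0 = 0 ->
  wpart (dd v f s) = c *: wpart (f s) -> v = 0 /\ c = 0.
Proof.
move=> Us v0 vW; have D : dd v f s = - (c / nu s) *: zeta s.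
  apply: row4_eq; first by rewrite v0 mxE head_zeta// mulr0.
  rewrite vW wpartZ wpart_zeta// scalerA mulNr mulrN opprK.
  by rewrite -mulrA mulVf ?mulr1// nu0.
have c0 : c = 0.
  have := ts_Nf ts v Us; rewrite D pairingZl zeta_N// mulr1 => /eqP.
  by rewrite oppr_eq0 mulf_eq0 invr_eq0 (negbTE (nu0 Us)) orbF => /eqP.
split=> //; rewrite -(tangent_f ts v Us) D c0 mul0r oppr0 scale0r.
have := tangent_f ts 0 Us; rewrite -[X in dd X](scale0r (0 : 'rV[R]_3)) (ddZl sf)//.
by rewrite scale0r.
Qed.

Lemma wpart_f_neq0 s : U s -> wpart (f s) != 0.
Proof.
move=> Us; apply/eqP => f0; have : zeta s = 0.
  by apply: row4_eq; [rewrite head_zeta// mxE|rewrite wpart_zeta// f0 scaler0 wpart0].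
move=> z0; have := zeta_N Us; rewrite z0 pairing0l => /eqP.
by rewrite eq_sym oner_eq0.
Qed.

Lemma dd_tau0 s v : U s -> dd v tau0 s = - (eta s + 3 * mu s) * h s v (e s) * tau0 s.
Proof.
move=> Us; rewrite -(dd_entry v 0 0 (smooth_axis_tau bs se) Us) (dd_tau bs pt se nf)//.
by rewrite [LHS]mxE.
Qed.

Section SliceCoordinates.
Variable i0 : 'I_3.
(** The first coordinate, constant on leaves, with two ratios of W-coordinates, constant along [e]
    because [e] only rescales the W-part. The index [i0] selects a nonzero denominator. *)
Definition slice_coord s : 'rV[R]_3 := point3 (f s 0 0)
  (\row_(j < 2) (wpart (f s) 0 (lift i0 j) / wpart (f s) 0 i0)).
Let U' := [set s | U s /\ wpart (f s) 0 i0 != 0].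

Let sW j : smooth_on U (fun s => wpart (f s) 0 j).
Proof. exact: ((smooth_mx _ oU).1 (smooth_wpart oU sf)). Qed.

Lemma slice_open : open U'.
Proof. exact: open_nonzero. Qed.

Lemma smooth_slice_coord : smooth_on U' slice_coord.
Proof.
have sU : U' `<=` U by move=> s [].
have oU' := slice_open; apply/smooth_mx => // i j; rewrite ord1.
have [->|[k ->]] := ord_rshiftP j.
  have : smooth_on U' (fun s => f s 0 0).
    by apply: smooth_subset sU _; exact: ((smooth_mx _ oU).1 sf).
  by move/eq_smooth; apply=> s; rewrite point3_0.
have : smooth_on U' (fun s => wpart (f s) 0 (lift i0 k) * (wpart (f s) 0 i0)^-1).
  apply: smoothM => //; first exact: smooth_subset sU (sW _).
  by apply: smoothV => //; [by move=> s []|exact: smooth_subset sU (sW _)].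
by move/eq_smooth; apply=> s; rewrite /slice_coord point3_S [RHS]mxE.
Qed.

Lemma slice_jacobian_unit s : U' s -> jacobian slice_coord s \in unitmx.
Proof.
move=> U's; have [Us rho0] := U's; have oU' := slice_open; have sG := smooth_slice_coord.
have sU : U' `<=` U by move=> y [].
rewrite -row_free_unit; apply: inj_row_free => v vJ.
have D : dd v slice_coord s = 0.
  by rewrite ddE (deriveEjacobian v (smooth_diff sG U's)).
have D0 : dd v f s 0 0 = 0.
  have := congr1 (fun A : 'rV[R]_3 => A 0 0) D; rewrite (dd_entry v 0 0 sG U's) mxE => <-.
  rewrite (dd_entry v 0 0 sf Us); congr (dd v _ s); apply/funext => y.
  by rewrite point3_0.
pose rho y := wpart (f y) 0 i0.
have Dj (j : 'I_2) : wpart (dd v f s) 0 (lift i0 j) =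
    wpart (f s) 0 (lift i0 j) / rho s * dd v rho s.
  pose q y := wpart (f y) 0 (lift i0 j) / rho y.
  have sq : smooth_on U' q.
    have := (smooth_mx _ oU').1 sG 0 (rshift 1 j); move/eq_smooth; apply=> y.
    by rewrite point3_S mxE.
  have Dq : dd v q s = 0.
    have := congr1 (fun A : 'rV[R]_3 => A 0 (rshift 1 j)) D.
    rewrite (dd_entry v 0 (rshift 1 j) sG U's) mxE => <-.
    by congr (dd v _ s); apply/funext => y; rewrite point3_S mxE.
  have srho : smooth_on U' rho by exact: smooth_subset sU (sW i0).
  rewrite -(dd_wpart v oU sf Us) (dd_entry v 0 _ (smooth_wpart oU sf) Us).
  have qr y : U' y -> wpart (f y) 0 (lift i0 j) = q y * rho y.
    by move=> [Uy ry]; rewrite /q mulfVK.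
  by rewrite (eq_on_dd v oU' qr U's) (ddM v sq srho)// Dq mul0r add0r.
have [] // := @vertical_eq0 s v (dd v rho s / rho s) Us D0.
apply/rowP => k; rewrite [RHS]mxE; have [j ->|->] := unliftP i0 k.
  by rewrite Dj; ring.
rewrite -(dd_wpart v oU sf Us) (dd_entry v 0 _ (smooth_wpart oU sf) Us).
by rewrite -/(rho s) mulfVK.
Qed.

End SliceCoordinates.
End Straight.

Lemma frame_parts (R : realType) n (f xi : 'rV[R]_n -> 'rV[R]_n.+1) s (c : R) v :
  moving_frame f xi s \in unitmx ->
  normal_part f xi s (c *: xi s + v *m jacobian f s) = c /\
  tangent_part f xi s (c *: xi s + v *m jacobian f s) = v.
Proof.
move=> u; have E : components f xi s (c *: xi s + v *m jacobian f s) = row_mx (c%:M : 'M[R]_1) v.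
  rewrite /components -[RHS](mulmxK u); congr (_ *m _).
  by rewrite /moving_frame mul_row_col mul_scalar_mx.
rewrite /normal_part /tangent_part E row_mxKr; split=> //.
rewrite (_ : (0 : 'I_(1 + n)) = lshift n (0 : 'I_1)); last exact: val_inj.
by rewrite row_mxEl mxE eqxx mulr1n.
Qed.

(** * Centroaffine surfaces that are proper affine spheres *)

Section CentroaffineSphere.
Context {R : realType}.
Variables (N : set 'rV[R]_2) (phi : 'rV[R]_2 -> 'rV[R]_3) (kap : R)
  (g : 'rV[R]_2 -> 'rV[R]_2 -> 'rV[R]_2 -> R).
Implicit Types (u al be : 'rV[R]_2).
Hypotheses (oN : open N) (sphi : smooth_on N phi) (kap0 : kap != 0)
  (gauss : forall u al be, N u -> exists ga,
     dd al (dd be phi) u = - (kap * g u al be) *: phi u + dd ga phi u)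
  (free : forall u c al, N u -> c *: phi u + dd al phi u = 0 -> c = 0 /\ al = 0)
  (vol : forall u (X : 'M[R]_2), N u ->
     `|kap * \det (col_mx (phi u) (X *m jacobian phi u) : 'M[R]_(1 + 2))| =
     Num.sqrt `|\det (gram (g u) X)|)
  (gpos : forall u al, N u -> al != 0 -> 0 < g u al al).

Let xi u : 'rV[R]_3 := - kap *: phi u.

Let dphi u al : N u -> dd al phi u = al *m jacobian phi u.
Proof. by move=> Nu; rewrite ddE (deriveEjacobian al (smooth_diff sphi Nu)). Qed.

Let sxi : smooth_on N xi.
Proof. by apply: smoothZ => //; exact: smooth_cst. Qed.

Let dxi u al : N u -> dd al xi u = (- kap *: al) *m jacobian phi u.
Proof.
move=> Nu; rewrite /xi (ddZ al (smooth_cst (- kap)) sphi Nu) dd_cst scale0r add0r dphi//.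
by rewrite scalemxAl.
Qed.

Lemma centroaffine_immersion : immersion_on N phi.
Proof.
split=> // u Nu; apply: inj_row_free => al H.
by have [] := free (u := u) (c := 0) (al := al) Nu; rewrite // scale0r add0r dphi.
Qed.

Let frame_unit' u : N u -> moving_frame phi xi u \in unitmx.
Proof.
move=> Nu; rewrite -row_free_unit; apply: inj_row_free => v.
rewrite -[v]hsubmxK /moving_frame mul_row_col [lsubmx v]mx11_scalar mul_scalar_mx.
rewrite -dphi// /xi scalerA => H; have [c0 a0] := free Nu H.
move/eqP: c0; rewrite mulf_eq0 oppr_eq0 (negbTE kap0) orbF => /eqP ->.
by rewrite a0 raddf0 row_mx0.
Qed.

Let metricE u al be : N u -> affine_metric phi xi u al be = g u al be.
Proof.
move=> Nu; rewrite /affine_metric /flatD -[X in normal_part _ _ _ X]ddE.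
rewrite -(ddE_fun be phi).
have [ga ->] := gauss al be Nu; rewrite dphi//.
have -> : - (kap * g u al be) *: phi u = g u al be *: xi u.
  by rewrite /xi scalerA mulrN mulrC.
by have [-> _] := frame_parts (g u al be) ga (frame_unit' Nu).
Qed.

Let shapeE u al : N u -> shape_operator phi xi u al = kap *: al.
Proof.
move=> Nu; rewrite /shape_operator -ddE dxi//.
have := (frame_parts 0 (- kap *: al) (frame_unit' Nu)).2.
by rewrite scale0r add0r => ->; rewrite scaleNr opprK.
Qed.

Let gramE u (X : 'M[R]_2) : N u -> gram (affine_metric phi xi u) X = gram (g u) X.
Proof. by move=> Nu; apply/matrixP => i j; rewrite !mxE metricE. Qed.

Let volE u (X : 'M[R]_2) : N u ->
  `|\det (col_mx (xi u) (X *m jacobian phi u) : 'M[R]_(1 + 2))| =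
  Num.sqrt `|\det (gram (affine_metric phi xi u) X)|.
Proof.
move=> Nu; rewrite gramE// -vol//.
have -> : (col_mx (xi u) (X *m jacobian phi u) : 'M[R]_(1 + 2)) =
    block_mx (- kap)%:M 0 0 1%:M *m (col_mx (phi u) (X *m jacobian phi u)).
  by rewrite mul_block_col !mul0mx addr0 add0r mul1mx mul_scalar_mx.
by rewrite det_mulmx det_ublock det_scalar1 det1 mulr1 mulNr normrN.
Qed.

Lemma centroaffine_normal : affine_normal_on N phi xi.
Proof.
split=> //.
- move=> u al Nu; rewrite -ddE dxi//.
  have := (frame_parts 0 (- kap *: al) (frame_unit' Nu)).1.
  by rewrite scale0r add0r.
- move=> u Nu; have := frame_unit' Nu; rewrite unitmxE unitfE => d0.
  have := volE 1%:M Nu; rewrite mul1mx -/(moving_frame phi xi u) => H.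
  apply: contraNneq d0 => G0; move: H; rewrite G0 normr0 sqrtr0 => /eqP.
  by rewrite normr_eq0.
Qed.

(** The affine normal [- kap phi] points along the position vector, so the centre is the origin; its
    shape operator is [kap] times the identity, and the sign of [kap] decides the type. *)
Lemma centroaffine_sphere : elliptic_affine_sphere N phi \/ hyperbolic_affine_sphere N phi.
Proof.
have prop : proper_affine_sphere_on N phi xi.
  split; first exact: centroaffine_normal.
  by exists 0 => u Nu; exists kap^-1; rewrite /xi scalerA mulrN mulVf// scaleN1r subrr.
have pos : positive_definite_on N phi xi by move=> u al Nu a0; rewrite metricE//; exact: gpos.
have sh u al : N u -> shape_operator phi xi u al = kap *: al by exact: shapeE.
have [kp|kn] := ltrP 0 kap; [left|right]; exists xi; split=> //; exists kap; split=> //.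
by rewrite lt_neqAle kap0.
Qed.

End CentroaffineSphere.

Section Point3.
Context {R : realType}.
Implicit Types (t k : R) (u : 'rV[R]_2).

Lemma point3D t u t' u' : point3 t u + point3 t' u' = point3 (t + t') (u + u').
Proof.
apply/rowP => j; have [->|[i ->]] := ord_rshiftP j; first by rewrite mxE !point3_0.
by rewrite mxE !point3_S mxE.
Qed.

Lemma point3Z k t u : k *: point3 t u = point3 (k * t) (k *: u).
Proof.
apply/rowP => j; have [->|[i ->]] := ord_rshiftP j; first by rewrite mxE !point3_0.
by rewrite mxE !point3_S mxE.
Qed.

Lemma point3_inj t u t' u' : point3 t u = point3 t' u' -> t = t' /\ u = u'.
Proof.
move=> H; split; first by rewrite -(point3_0 t u) H point3_0.
by apply/rowP => j; rewrite -(point3_S t u) H point3_S.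
Qed.

Lemma dd_id (V : normedModType R) (v s : V) : dd v (fun y => y) s = v.
Proof. by rewrite ddE derive_id. Qed.

Lemma smooth_slice (O : set 'rV[R]_2) t : open O -> smooth_on O (point3 t).
Proof.
move=> oO; apply/smooth_mx => // i j; rewrite ord1; have [->|[k ->]] := ord_rshiftP j.
  by move: (smooth_cst (U := O) t); move/eq_smooth; apply=> u; rewrite point3_0.
by move: (smooth_coord k oO); move/eq_smooth; apply=> u; rewrite point3_S.
Qed.

Lemma dd_slice t u al : dd al (point3 t) u = point3 0 al.
Proof.
have sT := smooth_slice t (@openT _); have sI := smooth_id (U := [set: 'rV[R]_2]).
apply/rowP => j; rewrite (dd_entry al 0 j sT I).
have [->|[k ->]] := ord_rshiftP j.
  rewrite point3_0 -[RHS](dd_cst al t u); congr (dd al _ u).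
  by apply/funext => y; rewrite point3_0.
rewrite point3_S -[in RHS](dd_id al u) (dd_entry al 0 k sI I).
by congr (dd al _ u); apply/funext => y; rewrite point3_S.
Qed.

Lemma smooth_line (O : set R) u : open O -> smooth_on O (fun t => point3 t u).
Proof.
move=> oO; apply/smooth_mx => // i j; rewrite ord1; have [->|[k ->]] := ord_rshiftP j.
  by move: (smooth_id (U := O)); move/eq_smooth; apply=> t; rewrite point3_0.
by move: (smooth_cst (U := O) (u 0 k)); move/eq_smooth; apply=> t; rewrite point3_S.
Qed.

Lemma dd_line t u (v : R) : dd v (fun t => point3 t u) t = point3 v 0.
Proof.
have sT := smooth_line u (@openT R).
apply/rowP => j; rewrite (dd_entry v 0 j sT I).
have [->|[k ->]] := ord_rshiftP j.
  rewrite point3_0 -[in RHS](dd_id v t); congr (dd v _ t).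
  by apply/funext => y; rewrite point3_0.
rewrite point3_S mxE -[RHS](dd_cst v (u 0 k) t).
by congr (dd v _ t); apply/funext => y; rewrite point3_S.
Qed.

Lemma point3_0_0 : point3 (0 : R) 0 = 0.
Proof.
apply/rowP => j; have [->|[k ->]] := ord_rshiftP j; first by rewrite point3_0 mxE.
by rewrite point3_S !mxE.
Qed.

Definition slice_mx n (X : 'M[R]_(n, 2)) : 'M[R]_(n, 3) := row_mx (0 : 'cV[R]_n) X.

Lemma row_slice_mx n (X : 'M[R]_(n, 2)) (i : 'I_n) : row i (slice_mx X) = point3 0 (row i X).
Proof.
apply/rowP => j; rewrite mxE; have [->|[k ->]] := ord_rshiftP j.
  rewrite point3_0 (_ : (0 : 'I_3) = lshift 2 (0 : 'I_1)); last exact: val_inj.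
  by rewrite [LHS](row_mxEl (0 : 'cV[R]_n)) mxE.
by rewrite point3_S [LHS](row_mxEr (0 : 'cV[R]_n)) mxE.
Qed.

Lemma entry_row m n (A : 'M[R]_(m, n)) i j v : row i A = v -> A i j = v 0 j.
Proof. by move=> <-; rewrite mxE. Qed.

Lemma row0_col_mx n p (v : 'rV[R]_p) (Y : 'M[R]_(n, p)) :
  row 0 (col_mx v Y : 'M[R]_(n.+1, p)) = v.
Proof.
rewrite (_ : (0 : 'I_n.+1) = lshift n (0 : 'I_1)); last exact: val_inj.
by rewrite [LHS](@rowKu _ 1) row_id.
Qed.

Lemma rowS_col_mx n p (v : 'rV[R]_p) (Y : 'M[R]_(n, p)) (i : 'I_n) :
  row (rshift 1 i) (col_mx v Y : 'M[R]_(n.+1, p)) = row i Y.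
Proof. exact: (@rowKd _ 1). Qed.

Lemma det_head n (c : R) (W : 'M[R]_n) (A : 'M[R]_n.+1) :
  A 0 0 = c -> (forall i : 'I_n, A (rshift 1 i) 0 = 0) ->
  (forall i j : 'I_n, A (rshift 1 i) (rshift 1 j) = W i j) -> \det A = c * \det W.
Proof.
have l1 (i : 'I_n) : lift (0 : 'I_n.+1) i = rshift 1 i by exact: val_inj.
move=> A00 AS0 AS; rewrite (expand_det_col A 0) big_ord_recl big1 ?addr0 => [|i _].
  rewrite A00 /cofactor addn0 expr0 mul1r; congr (_ * \det _); apply/matrixP => i j.
  by rewrite !mxE !l1 AS.
by rewrite (_ : lift ord0 i = rshift 1 i) ?AS0 ?mul0r//; exact: l1.
Qed.

End Point3.

(** * Uniqueness for second order linear systems *)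

Section LinearSystem.
Context {R : realType}.
Variables (u0 : 'rV[R]_2) (r : R) (c : 'rV[R]_2 -> 'rV[R]_2 -> 'rV[R]_2 -> R)
  (ga : 'rV[R]_2 -> 'rV[R]_2 -> 'rV[R]_2 -> 'rV[R]_2).
Let B := ball u0 r : set 'rV[R]_2.
Implicit Types (p : 'rV[R]_2 -> 'rV[R]_3) (u al be : 'rV[R]_2).
Let oB : open B. Proof. exact: ball_open. Qed.

Definition linear_system p := smooth_on B p /\ forall u al be, B u ->
  dd al (dd be p) u = c u al be *: p u + dd (ga u al be) p u.

Definition system_frame p u := frame_mx (p u) (dd (delta_mx 0 0) p u) (dd (delta_mx 0 1) p u).
Let Om u al := frame_mx (point3 0 al)
  (point3 (c u al (delta_mx 0 0)) (ga u al (delta_mx 0 0)))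
  (point3 (c u al (delta_mx 0 1)) (ga u al (delta_mx 0 1))).

Lemma mul_system_frame p u (k : R) al : smooth_on B p -> B u ->
  point3 k al *m system_frame p u = k *: p u + dd al p u.
Proof.
move=> sp Bu; rewrite mul_frame_mx point3_0.
have -> : point3 k al 0 1 = al 0 0.
  by rewrite -[in RHS](point3_S k al) (_ : 1 = rshift 1 0)//; exact: val_inj.
have -> : point3 k al 0 2 = al 0 1.
  by rewrite -[in RHS](point3_S k al) (_ : 2 = rshift 1 1)//; exact: val_inj.
rewrite (dd_sum_delta al sp Bu) big_ord_recl big_ord1 -addrA.
by rewrite (_ : lift ord0 ord0 = 1)//; exact: val_inj.
Qed.

Lemma smooth_system_frame p : smooth_on B p -> smooth_on B (system_frame p).
Proof.
move=> sp; apply/smooth_mx => //; apply: ord3P => j.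
- have := (smooth_mx _ oB).1 sp 0 j; move/eq_smooth; apply=> u.
  by have [r0 _ _] := frame_mx_row (p u) (dd (delta_mx 0 0) p u) (dd (delta_mx 0 1) p u); rewrite (entry_row j r0).
- have := (smooth_mx _ oB).1 (smooth_dd (delta_mx 0 0) sp) 0 j; move/eq_smooth; apply=> u.
  by have [_ r1 _] := frame_mx_row (p u) (dd (delta_mx 0 0) p u) (dd (delta_mx 0 1) p u); rewrite (entry_row j r1).
- have := (smooth_mx _ oB).1 (smooth_dd (delta_mx 0 1) sp) 0 j; move/eq_smooth; apply=> u.
  by have [_ _ r2] := frame_mx_row (p u) (dd (delta_mx 0 0) p u) (dd (delta_mx 0 1) p u); rewrite (entry_row j r2).
Qed.

Let dd_frame p u al : linear_system p -> B u ->
  dd al (system_frame p) u = Om u al *m system_frame p u.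
Proof.
move=> [sp sys] Bu; have sF := smooth_system_frame sp.
have [w0 w1 w2] := frame_mx_row (point3 0 al)
  (point3 (c u al (delta_mx 0 0)) (ga u al (delta_mx 0 0)))
  (point3 (c u al (delta_mx 0 1)) (ga u al (delta_mx 0 1))).
have fr y := frame_mx_row (p y) (dd (delta_mx 0 0) p y) (dd (delta_mx 0 1) p y).
have rowE i (q : 'rV[R]_2 -> 'rV[R]_3) v : smooth_on B q -> (forall y, row i (system_frame p y) = q y) ->
    row i (Om u al) = v -> dd al q u = v *m system_frame p u ->
    row i (dd al (system_frame p) u) = row i (Om u al *m system_frame p u).
  move=> sq qE vE H; rewrite row_mul vE -H; apply/rowP => j.
  rewrite mxE (dd_entry al i j sF Bu) (dd_entry al 0 j sq Bu).
  by congr (dd al _ u); apply/funext => y; exact: entry_row.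
apply/row_matrixP; apply: ord3P.
- apply: (rowE 0 p) w0 _ => //; first by move=> y; have [] := fr y.
  by rewrite mul_system_frame// scale0r add0r.
- apply: (rowE 1 (dd (delta_mx 0 0) p)) w1 _; first exact: smooth_dd.
    by move=> y; have [] := fr y.
  by rewrite mul_system_frame// sys.
- apply: (rowE 2 (dd (delta_mx 0 1) p)) w2 _; first exact: smooth_dd.
    by move=> y; have [] := fr y.
  by rewrite mul_system_frame// sys.
Qed.

(** Both frames solve the same equation [dF = Om F], so the inverse of one times the other is
    constant. *)
Lemma linear_system_unique p p' : linear_system p -> linear_system p' ->
  (forall u, B u -> system_frame p u \in unitmx) ->
  exists Q : 'M[R]_3, forall u, B u -> p' u = p u *m Q.
Proof.
move=> lp lp' up; have [sp _] := lp; have [sp' _] := lp'.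
have sF := smooth_system_frame sp; have sF' := smooth_system_frame sp'.
have sV : smooth_on B (fun u => invmx (system_frame p u)) by exact: smooth_invmx.
pose G u := invmx (system_frame p u) *m system_frame p' u.
have sG : smooth_on B G by exact: smooth_mulmx.
have dG u al : B u -> dd al G u = 0.
  move=> Bu; rewrite (dd_mulmx al sV sF' Bu) dd_frame//.
  have FV y : B y -> system_frame p y *m invmx (system_frame p y) = 1%:M.
    by move=> By; rewrite mulmxV// up.
  have := eq_on_dd al oB FV Bu; rewrite dd_cst (dd_mulmx al sF sV Bu) dd_frame//.
  rewrite -mulmxA mulmxV ?up// mulmx1 => /eqP; rewrite addrC addr_eq0 => /eqP H.
  have -> : dd al (fun u => invmx (system_frame p u)) u = - (invmx (system_frame p u) *m Om u al).
    by rewrite -mulmxN -H mulKmx// up.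
  by rewrite mulNmx mulmxA addNr.
exists (G u0) => u Bu; have GE : G u = G u0.
  apply/matrixP => i j; apply: (constant_on_ball (f := fun u => G u i j) (r := r)) Bu => y By.
  split; first by apply: smooth_diff By; exact: ((smooth_mx _ oB).1 sG).
  by move=> al; rewrite -ddE -(dd_entry al i j sG By) dG// mxE.
have [r0 _ _] := frame_mx_row (p u) (dd (delta_mx 0 0) p u) (dd (delta_mx 0 1) p u).
have [r0' _ _] := frame_mx_row (p' u) (dd (delta_mx 0 0) p' u) (dd (delta_mx 0 1) p' u).
rewrite -r0' -r0 -row_mul -GE; congr (row 0 _).
by rewrite /G mulKVmx// up.
Qed.

End LinearSystem.

(** * The warped form on a product of balls *)

Section Warped.
Context {R : realType}.
Variables (c0 : R) (u0 : 'rV[R]_2) (r : R).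
Let I := ball c0 r : set R.
Let NN := ball u0 r : set 'rV[R]_2.
Let D := product_domain I NN.
Variables (f xi : 'rV[R]_3 -> 'rV[R]_4) (N : 'rV[R]_3 -> 'cV[R]_4)
  (T : 'rV[R]_3 -> 'rV[R]_4 -> 'rV[R]_3) (h : 'rV[R]_3 -> 'rV[R]_3 -> 'rV[R]_3 -> R)
  (K : 'rV[R]_3 -> 'rV[R]_3 -> 'rV[R]_3 -> 'rV[R]_3) (S : 'rV[R]_3 -> 'rV[R]_3 -> 'rV[R]_3)
  (e : 'rV[R]_3 -> 'rV[R]_3) (d : R) (i0 : 'I_3).
Implicit Types (s v w z : 'rV[R]_3) (t : R) (u al be : 'rV[R]_2).
Local Notation nu := (axis_nu f T h K S e).
Local Notation zeta := (axis_zeta f xi T h K e).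
Local Notation om := (axis_om f xi T h K S e).
Local Notation tau := (axis_tau f N T h K e).
Local Notation mu := (axis_mu h K e).
Local Notation eta := (axis_eta f T K e).
Local Notation E := (axis_E f e).
Local Notation t0 := (tau0 f N T h K e).
Hypotheses (r0 : 0 < r) (st : straight_chart D f xi N T h K S e) (d0 : 0 < d)
  (vol : forall s, D s -> forall X : 'M[R]_3,
    `|\det (col_mx (xi s) (X *m jacobian f s) : 'M[R]_(1 + 3))| =
     d * Num.sqrt `|\det (gram (h s) X)|)
  (hf0 : forall s, D s -> f s 0 0 = s 0 0)
  (rho0 : forall s, D s -> wpart (f s) 0 i0 != 0)
  (hfS : forall s, D s -> forall j : 'I_2,
     wpart (f s) 0 (lift i0 j) = s 0 (rshift 1 j) * wpart (f s) 0 i0).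
Let bs := st_bs st.
Let pt := st_pt st.
Let se := st_smooth st.
Let nf := st_nf st.
Let ts : transversal_structure D f xi N T h := bs.
Let oD : open D := ts_open ts.
Let sf := ts_f ts.
Let nu0 := st_nu st.
Let oI : open I. Proof. exact: ball_open. Qed.
Let oN : open NN. Proof. exact: ball_open. Qed.
Let Ic : I c0. Proof. exact: ballxx. Qed.
Let Nu : NN u0. Proof. exact: ballxx. Qed.
Let DP t u : I t -> NN u -> D (point3 t u). Proof. by move=> It Nu'; exists t, u. Qed.
Let rho s := wpart (f s) 0 i0.
Let srho : smooth_on D rho.
Proof. exact: ((smooth_mx _ oD).1 (smooth_wpart oD sf)). Qed.
Let stau0 : smooth_on D t0. Proof. exact: smooth_tau0 st. Qed.
Let snu : smooth_on D nu. Proof. exact: smooth_axis_nu bs se. Qed.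
Let sem : smooth_on D (fun s => eta s - mu s).
Proof. by apply: smoothB => //; [exact: smooth_axis_eta bs se|exact: smooth_axis_mu bs se]. Qed.

Lemma smooth_on_slice m n (g : 'rV[R]_3 -> 'M[R]_(m, n)) t : I t -> smooth_on D g ->
  smooth_on NN (fun u => g (point3 t u)).
Proof.
by move=> It sg; apply: (smooth_comp oN oD _ sg (smooth_slice t oN)) => u Nu'; exact: DP.
Qed.

Lemma smooth_on_slice1 (g : 'rV[R]_3 -> R) t : I t -> smooth_on D g ->
  smooth_on NN (fun u => g (point3 t u)).
Proof.
by move=> It sg; apply: (smooth_comp1 oN oD _ sg (smooth_slice t oN)) => u Nu'; exact: DP.
Qed.

Lemma smooth_on_line (g : 'rV[R]_3 -> R) u : NN u -> smooth_on D g ->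
  smooth_on I (fun t => g (point3 t u)).
Proof.
by move=> Nu' sg; apply: (smooth_comp1 oI oD _ sg (smooth_line u oI)) => t It; exact: DP.
Qed.

Lemma dd_on_slice (W : normedModType R) (g : 'rV[R]_3 -> W) t u al : I t -> NN u ->
  smooth_on D g -> dd al (fun u => g (point3 t u)) u = dd (point3 0 al) g (point3 t u).
Proof.
move=> It Nu' sg; have sT := smooth_diff (smooth_slice t oN) Nu'.
have [_ H] := derive_comp al sT (smooth_diff sg (DP It Nu')).
by rewrite ddE [LHS]H -!ddE dd_slice.
Qed.

Lemma dd_on_line (W : normedModType R) (g : 'rV[R]_3 -> W) t u (v : R) : I t -> NN u ->
  smooth_on D g -> dd v (fun t => g (point3 t u)) t = dd (point3 v 0) g (point3 t u).
Proof.
move=> It Nu' sg; have sT := smooth_diff (smooth_line u oI) It.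
have [_ H] := derive_comp v sT (smooth_diff sg (DP It Nu')).
by rewrite ddE [LHS]H -!ddE dd_line.
Qed.

Lemma constant_on_slice (g : 'rV[R]_3 -> R) t u : smooth_on D g ->
  (forall s al, D s -> dd (point3 0 al) g s = 0) -> I t -> NN u ->
  g (point3 t u) = g (point3 t u0).
Proof.
move=> sg Dg It; apply: (constant_on_ball (f := fun u => g (point3 t u)) (r := r)) => y Ny.
split; first exact: smooth_diff (smooth_on_slice1 It sg) Ny.
by move=> al; rewrite -ddE dd_on_slice// Dg//; exact: DP.
Qed.

Lemma head_dd_f s v : D s -> dd v f s 0 0 = v 0 0.
Proof.
move=> Ds; rewrite (dd_entry v 0 0 sf Ds) (eq_on_dd v oD hf0 Ds).
have sI := smooth_id (U := D); rewrite -(dd_entry v 0 0 sI Ds).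
by rewrite dd_id.
Qed.

Lemma theta_head s v : D s -> h s v (e s) = v 0 0 * t0 s.
Proof. by move=> Ds; rewrite -(head_df st v Ds) head_dd_f. Qed.

Let w0 : 'rV[R]_3 := point3 1 0.

Lemma wpart_dd_w0 s : D s -> wpart (dd w0 f s) = (dd w0 rho s / rho s) *: wpart (f s).
Proof.
move=> Ds; apply/rowP => k; rewrite [RHS]mxE.
rewrite -(dd_wpart w0 oD sf Ds) (dd_entry w0 0 k (smooth_wpart oD sf) Ds).
have [j ->|->] := unliftP i0 k; last by rewrite mulfVK// rho0.
have sj : smooth_on D (fun s => s 0 (rshift 1 j)).
  exact: smooth_coord.
rewrite (eq_on_dd w0 oD (fun y Dy => hfS Dy j) Ds) (ddM w0 sj srho)//.
rewrite -(dd_entry w0 0 (rshift 1 j) (smooth_id (U := D)) Ds) dd_id point3_S mxE mul0r add0r.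
by rewrite hfS// mulrCA mulfVK ?rho0.
Qed.

(** Both [w0] and [e] change the W-part radially, and [t0] matches their first coordinates; the
    difference vanishes by [vertical_eq0]. The logarithmic derivative of [rho] obtained here is
    constant on slices. *)
Lemma w0_axis s : D s -> w0 = t0 s *: e s /\ dd w0 rho s = t0 s * (eta s - mu s) * rho s.
Proof.
move=> Ds; have tn := tau0_neq0 st Ds.
pose k := dd w0 rho s / rho s.
have Dv : dd (w0 - t0 s *: e s) f s = dd w0 f s - t0 s *: E s.
  by rewrite (ddDl sf)// (ddNl sf)// (ddZl sf).
have [] := @vertical_eq0 _ _ _ _ _ _ _ _ _ _ st s (w0 - t0 s *: e s) (k - t0 s * (eta s - mu s)) Ds.
- by rewrite Dv !mxE (head_E st Ds) mulfV// head_dd_f// point3_0 subrr.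
- rewrite Dv wpartD wpartN wpartZ wpart_dd_w0// (wpart_E st Ds) -/k.
  by apply/rowP => j; rewrite !mxE; ring.
move=> /eqP; rewrite subr_eq0 => /eqP wE /eqP; rewrite subr_eq0 => /eqP kE; split=> //.
by rewrite -kE mulfVK//; exact: rho0.
Qed.

Let Da s al : D s -> h s (point3 0 al) (e s) = 0.
Proof. by move=> Ds; rewrite theta_head// point3_0 mul0r. Qed.

Let tau0_slice t u : I t -> NN u -> t0 (point3 t u) = t0 (point3 t u0).
Proof.
by apply: constant_on_slice => // s al Ds; rewrite (dd_tau0 st)// Da// mulr0 mul0r.
Qed.

Let em_slice t u : I t -> NN u ->
  eta (point3 t u) - mu (point3 t u) = eta (point3 t u0) - mu (point3 t u0).
Proof.
apply: (@constant_on_slice (fun s => eta s - mu s)) => // s al Ds.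
by rewrite (dd_eta_mu bs pt se nf)// Da// mul0r.
Qed.

Let nu_slice t u : I t -> NN u -> nu (point3 t u) = nu (point3 t u0).
Proof.
by apply: constant_on_slice => // s al Ds; rewrite (dd_nu bs pt se nf)// Da// mulr0.
Qed.

(** The logarithmic derivative of [rho] in [t] does not depend on [u], so the quotient of its values
    at [u] and [u0] is constant in [t]. *)
Lemma rho_separates t u : I t -> NN u ->
  rho (point3 t u) * rho (point3 c0 u0) = rho (point3 t u0) * rho (point3 c0 u).
Proof.
move=> It Nu'; pose q u t := rho (point3 t u).
have sq u' : NN u' -> smooth_on I (q u') by move=> N'; exact: smooth_on_line.
have q0 u' t' : NN u' -> I t' -> q u' t' != 0 by move=> N' I'; apply: rho0; exact: DP.
have Dq u' t' (v : R) : NN u' -> I t' -> dd v (q u') t' =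
    v * (t0 (point3 t' u0) * (eta (point3 t' u0) - mu (point3 t' u0))) * q u' t'.
  move=> N' I'; rewrite (dd_on_line v I' N' srho).
  have -> : point3 v 0 = v *: w0 by rewrite point3Z mulr1 scaler0.
  rewrite (ddZl srho _ _ (DP I' N')) (w0_axis (DP I' N')).2 tau0_slice// em_slice//.
  by rewrite /GRing.scale /= !mulrA.
have sV : smooth_on I (fun t => (q u0 t)^-1) by apply: smoothV => //; [move=> ? ?; exact: q0|exact: sq].
have sp : smooth_on I (fun t => q u t * (q u0 t)^-1) by apply: smoothM => //; exact: sq.
have Dp t' (v : R) : I t' -> dd v (fun t => q u t * (q u0 t)^-1) t' = 0.
  move=> I'; pose p t := q u t * (q u0 t)^-1.
  have E1 y : I y -> q u y = p y * q u0 y by move=> Iy; rewrite /p mulfVK// q0.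
  have := eq_on_dd v oI E1 I'; rewrite (ddM v sp (sq u0 Nu))// !Dq// -/(p t') E1//.
  set dp := dd v _ t' => H; have : dp * q u0 t' = 0 by lra.
  by move/eqP; rewrite mulf_eq0 (negbTE (q0 _ _ Nu I')) orbF => /eqP.
have := constant_on_ball (f := fun t => q u t * (q u0 t)^-1) (x := c0) (r := r).
move=> /(_ _ t It) H; have {}H : q u t * (q u0 t)^-1 = q u c0 * (q u0 c0)^-1.
  apply: H => y Iy; split; first exact: smooth_diff sp Iy.
  by move=> v; rewrite -ddE Dp.
rewrite -/(q u t) -/(q u0 c0) -/(q u0 t) -/(q u c0).
by rewrite -(mulfVK (q0 _ _ Nu It) (q u t)) H; field; exact: q0.
Qed.

(** Normalized to 1 at [c0], so that [warp_phi] is the leaf at [t = c0] itself. *)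
Definition warp_gamma t := rho (point3 t u0) / rho (point3 c0 u0).
Definition warp_phi u : 'rV[R]_3 := wpart (f (point3 c0 u)).

Lemma warp_f t u : I t -> NN u -> f (point3 t u) =
  warped_hypersurface (fun t => t) warp_gamma warp_phi t u.
Proof.
move=> It Nu'; have Ds := DP It Nu'; have Dc := DP Ic Nu'; have Du := DP Ic Nu.
apply: row4_eq.
  rewrite hf0// point3_0 /warped_hypersurface (_ : (0 : 'I_4) = lshift 3 (0 : 'I_1)).
    by rewrite [RHS](row_mxEl (t%:M : 'rV[R]_1) _ 0 0) mxE eqxx mulr1n.
  exact: val_inj.
have -> : wpart (warped_hypersurface (fun t => t) warp_gamma warp_phi t u) =
    warp_gamma t *: warp_phi u.
  by rewrite /wpart /warped_hypersurface row_mxKr.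
have R0 : warp_gamma t * rho (point3 c0 u) = rho (point3 t u).
  by rewrite /warp_gamma mulrAC -rho_separates// mulfK//; exact: rho0.
apply/rowP => k; rewrite [RHS]mxE /warp_phi; have [j ->|->] := unliftP i0 k; last by [].
by rewrite !hfS// !point3_S mulrCA; congr (_ * _).
Qed.

Lemma smooth_warp_phi : smooth_on NN warp_phi.
Proof. exact: (smooth_on_slice Ic (smooth_wpart oD sf)). Qed.

Lemma dd_warp_phi u al : NN u -> dd al warp_phi u = wpart (dd (point3 0 al) f (point3 c0 u)).
Proof.
move=> Nu'; have sw := smooth_wpart oD sf.
rewrite /warp_phi (dd_on_slice al Ic Nu' sw); exact: dd_wpart oD sf (DP Ic Nu').
Qed.

Lemma dd_dd_warp_phi u al be : NN u -> dd al (dd be warp_phi) u =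
  wpart (dd (point3 0 al) (dd (point3 0 be) f) (point3 c0 u)).
Proof.
move=> Nu'; have sdf := smooth_dd (point3 0 be) sf; have sw := smooth_wpart oD sdf.
rewrite (eq_on_dd al oN (fun y Ny => dd_warp_phi be Ny) Nu').
rewrite (dd_on_slice al Ic Nu' sw); exact: dd_wpart oD sdf (DP Ic Nu').
Qed.

Lemma smooth_warp_gamma : smooth_on I warp_gamma.
Proof.
by apply: smoothM => //; [exact: smooth_on_line|exact: smooth_cst].
Qed.

(** With identity as first component the condition is a nonzero second derivative of [warp_gamma].
    If it vanished, the second derivative of [f] along [w0] would vanish, against [h w0 w0 > 0]. *)
Lemma warp_curve : affine_curve I (fun t => t) warp_gamma.
Proof.
split; [exact: smooth_id|exact: smooth_warp_gamma|move=> t It].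
have Ds := DP It Nu; have Du := DP Ic Nu.
have D1 y : I y -> dd (1 : R) warp_gamma y = dd w0 rho (point3 y u0) / rho (point3 c0 u0).
  move=> Iy; have sq := smooth_on_line Nu srho.
  rewrite (ddM (1 : R) sq (smooth_cst (rho (point3 c0 u0))^-1))// dd_cst mulr0 addr0.
  by rewrite dd_on_line.
have D2 : dd (1 : R) (dd (1 : R) warp_gamma) t = dd w0 (dd w0 rho) (point3 t u0) / rho (point3 c0 u0).
  have sd := smooth_dd w0 srho; have sq := smooth_on_line Nu sd.
  rewrite (eq_on_dd (1 : R) oI D1 It).
  rewrite (ddM (1 : R) sq (smooth_cst (rho (point3 c0 u0))^-1))// dd_cst mulr0 addr0.
  by rewrite dd_on_line.
have G1 : (fun t : R => t)^`()%classic = fun=> 1.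
  by apply/funext => y; rewrite derive1E derive_id.
have -> : (fun t : R => t)^`(2)%classic t = 0.
  by rewrite derive1nS derive1n1 G1 derive1_cst.
have -> : warp_gamma^`(2)%classic t = dd (1 : R) (dd (1 : R) warp_gamma) t.
  rewrite derive1nS derive1n1 derive1E !ddE !ddE_fun; congr ('D_1 _ t).
  by apply/funext => y; rewrite derive1E.
rewrite G1 mul0r subr0 mul1r D2 mulf_neq0 ?invr_eq0//; last exact: rho0.
apply/eqP => r2; have h0 : h (point3 t u0) w0 w0 != 0.
  rewrite gt_eqF// (metric_pos (pt Ds))//; apply/eqP => /(congr1 (fun s => s 0 0)).
  by rewrite point3_0 mxE => /eqP; rewrite oner_eq0.
move: h0; rewrite (ts_h ts)//.
suff -> : dd w0 (dd w0 f) (point3 t u0) = 0 by rewrite pairing0l eqxx.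
have sdf := smooth_dd w0 sf; apply: row4_eq.
  rewrite (dd_entry w0 0 0 sdf Ds) mxE (eq_on_dd w0 oD (fun y Dy => head_dd_f w0 Dy) Ds).
  by rewrite dd_cst.
rewrite wpart0; apply/rowP => k; rewrite [RHS]mxE.
have E2 j : wpart (dd w0 (dd w0 f) (point3 t u0)) 0 j =
    dd w0 (dd w0 (fun s => wpart (f s) 0 j)) (point3 t u0).
  have sw := smooth_wpart oD sf; have swd := smooth_wpart oD sdf.
  rewrite -(dd_wpart w0 oD sdf Ds) (dd_entry w0 0 j swd Ds).
  apply: eq_on_dd oD _ _ Ds => y Dy.
  by rewrite -(dd_wpart w0 oD sf Dy) (dd_entry w0 0 j sw Dy).
have [j ->|->] := unliftP i0 k; last by rewrite E2.
rewrite E2.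
have sj : smooth_on D (fun s => s 0 (rshift 1 j)) by exact: smooth_coord.
have Dj y : D y -> dd w0 (fun s => wpart (f s) 0 (lift i0 j)) y = y 0 (rshift 1 j) * dd w0 rho y.
  move=> Dy; rewrite (eq_on_dd w0 oD (fun y Dy => hfS Dy j) Dy) (ddM w0 sj srho)//.
  by rewrite -(dd_entry w0 0 (rshift 1 j) (smooth_id (U := D)) Dy) dd_id point3_S mxE mul0r add0r.
rewrite (eq_on_dd w0 oD Dj Ds) (ddM w0 sj (smooth_dd w0 srho))// r2 mulr0 addr0.
by rewrite -(dd_entry w0 0 (rshift 1 j) (smooth_id (U := D)) Ds) dd_id point3_S mxE mul0r.
Qed.

(** Slice part of the tangential second derivative, the connection of the leaf; the complementary
    part is a multiple of [e], determined in [gauss_T] by the vanishing first coordinate. *)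
Definition warp_conn u al be : 'rV[R]_2 :=
  rsubmx (T (point3 c0 u) (dd (point3 0 al) (dd (point3 0 be) f) (point3 c0 u)) : 'rV[R]_(1 + 2)).

Let gauss_T u al be : NN u -> let s := point3 c0 u in
  T s (dd (point3 0 al) (dd (point3 0 be) f) s) =
  - (h s (point3 0 al) (point3 0 be) * (eta s + mu s)) *: e s + point3 0 (warp_conn u al be).
Proof.
move=> Nu' s; have Ds := DP Ic Nu'; rewrite -/s in Ds.
pose a := point3 0 al; pose b := point3 0 be; pose G := T s (dd a (dd b f) s).
have tn := tau0_neq0 st Ds; have sdf := smooth_dd b sf.
have D2 := dd_dd_f bs a b Ds; rewrite -/G in D2.
have G0 : G 0 0 * t0 s = - (h s a b * (eta s + mu s)).
  have H0 : dd a (dd b f) s 0 0 = 0.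
    rewrite (dd_entry a 0 0 sdf Ds) (eq_on_dd a oD (fun y Dy => head_dd_f b Dy) Ds).
    by rewrite dd_cst.
  have xi0 : xi s 0 0 * t0 s = eta s + mu s.
    by rewrite -(pairing_tau st _ Ds) (xi_tau e bs).
  have := congr1 (fun A : 'rV[R]_4 => A 0 0 * t0 s) D2.
  rewrite H0 mul0r !mxE head_dd_f// mulrDl -mulrA xi0; lra.
rewrite -/G -G0 -scalerA -(w0_axis Ds).1 point3Z mulr1 scaler0 point3D addr0 add0r.
exact: point3_eta.
Qed.

(** The multiple of [e] in [gauss_T] combines with [xi] into [zeta], whose W-part is [- nu] times
    the position. *)
Lemma warp_gauss u al be : NN u -> let s := point3 c0 u in
  dd al (dd be warp_phi) u =
  - (nu s * h s (point3 0 al) (point3 0 be)) *: warp_phi u + dd (warp_conn u al be) warp_phi u.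
Proof.
move=> Nu' s; have Ds := DP Ic Nu'; rewrite -/s in Ds.
pose a := point3 0 al; pose b := point3 0 be.
have D2 := dd_dd_f bs a b Ds.
rewrite gauss_T// -/s -/a -/b (ddDl sf)// (ddZl sf)// -/(E s) in D2.
rewrite dd_dd_warp_phi// -/s -/a -/b D2 dd_warp_phi// -/s.
rewrite !wpartD !wpartZ addrA; congr (_ + _).
have zW := wpart_zeta st Ds; rewrite /axis_zeta wpartD wpartN wpartZ in zW.
have -> : warp_phi u = wpart (f s) by [].
move/eqP: zW; rewrite subr_eq => /eqP ->.
by apply/rowP => j; rewrite !mxE; ring.
Qed.

Lemma warp_free u c al : NN u -> c *: warp_phi u + dd al warp_phi u = 0 -> c = 0 /\ al = 0.
Proof.
move=> Nu' H; have Ds := DP Ic Nu'.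
have [] := @vertical_eq0 _ _ _ _ _ _ _ _ _ _ st (point3 c0 u) (point3 0 al) (- c) Ds.
- by rewrite head_dd_f// point3_0.
- by move/eqP: H; rewrite addrC addr_eq0 dd_warp_phi// => /eqP ->; rewrite scaleNr.
move=> a0 /eqP; rewrite oppr_eq0 => /eqP ->; split=> //.
by move: a0; rewrite -point3_0_0 => /point3_inj[].
Qed.

Let hN u al be := h (point3 c0 u) (point3 0 al) (point3 0 be).

Definition axis_slice s (X : 'M[R]_2) : 'M[R]_3 := col_mx (e s) (slice_mx X).

Lemma slice_gram u (X : 'M[R]_2) : NN u ->
  \det (gram (h (point3 c0 u)) (axis_slice (point3 c0 u) X)) = \det (gram (hN u) X).
Proof.
move=> Nu'; have Ds := DP Ic Nu'; have p := pt Ds.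
have [_ [ee _ _]] := axis_normal_form pt nf Ds.
have rowS k : row (rshift 1 k) (axis_slice (point3 c0 u) X) = point3 0 (row k X).
  by rewrite [LHS]rowS_col_mx row_slice_mx.
have row0 : row 0 (axis_slice (point3 c0 u) X) = e (point3 c0 u) by exact: row0_col_mx.
rewrite (@det_head _ 2 1 (gram (hN u) X)) ?mul1r//.
- by rewrite mxE row0.
- by move=> i; rewrite mxE row0 rowS Da.
- by move=> i j; rewrite [LHS]mxE !rowS mxE.
Qed.

(** Row operations: [xi] becomes [zeta] by subtracting a multiple of [E], then [E], the only row
    with a nonzero first coordinate, is moved to the top. It contributes [1 / t0], and the W-part of
    [zeta] contributes [nu]. *)
Lemma slice_det u (X : 'M[R]_2) : NN u -> let s := point3 c0 u in
  `|\det (col_mx (xi s) (axis_slice s X *m jacobian f s) : 'M[R]_(1 + 3))| =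
  `|nu s / t0 s| * `|\det (col_mx (warp_phi u) (X *m jacobian warp_phi u) : 'M[R]_(1 + 2))|.
Proof.
move=> Nu' s; have Ds : D s := DP Ic Nu'.
have Jf v : v *m jacobian f s = dd v f s.
  by rewrite ddE (deriveEjacobian v (smooth_diff sf Ds)).
pose Y := slice_mx X *m jacobian f s.
have JE : axis_slice s X *m jacobian f s = col_mx (E s) Y by rewrite [LHS](@mul_col_mx _ 1 2 3 4 (e s)) Jf.
have rowY k : row k Y = dd (point3 0 (row k X)) f s by rewrite -Jf /Y row_mul row_slice_mx.
pose Z : 'M[R]_4 := col_mx (zeta s) (col_mx (E s) Y : 'M[R]_(3, 4)).
have xiE : (col_mx (xi s) (axis_slice s X *m jacobian f s) : 'M[R]_(1 + 3)) =
    block_mx 1%:M (row_mx (eta s + mu s)%:M (0 : 'rV[R]_2)) 0 1%:M *m Z.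
  rewrite JE mul_block_col !mul1mx mul0mx add0r mul_row_col mul0mx addr0 mul_scalar_mx.
  by rewrite /axis_zeta subrK.
rewrite xiE det_mulmx (@det_ublock _ 1 3) !det1 !mul1r.
pose W : 'M[R]_3 := col_mx (wpart (zeta s)) (rsubmx (Y : 'M[R]_(2, 1 + 3))).
have Z0 : row 0 Z = zeta s by exact: row0_col_mx.
have Z1 : row (rshift 1 0) Z = E s by rewrite [LHS]rowS_col_mx; exact: row0_col_mx.
have Z2 k : row (rshift 1 (rshift 1 k)) Z = row k Y.
  by rewrite [LHS]rowS_col_mx; exact: rowS_col_mx.
have W0 : row 0 W = wpart (zeta s) by exact: row0_col_mx.
have W2 k : row (rshift 1 k) W = wpart (row k Y).
  by rewrite [LHS]rowS_col_mx; apply/rowP => j; rewrite !mxE.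
have -> : `|\det Z| = `|\det (xrow 0 (rshift 1 0) Z)|.
  by rewrite xrowE det_mulmx det_perm normrM normrX normrN1 expr1n mul1r.
rewrite (@det_head _ 3 (t0 s)^-1 W); last 3 first.
- by rewrite mxE tpermL (entry_row _ Z1) (head_E st Ds).
- move=> i; rewrite mxE; have [->|[k ->]] := ord_rshiftP (i : 'I_(1 + 2)).
    by rewrite tpermR (entry_row _ Z0) (head_zeta st Ds).
  by rewrite tpermD// (entry_row _ (Z2 k)) rowY head_dd_f// point3_0.
- move=> i j; rewrite mxE; have [->|[k ->]] := ord_rshiftP (i : 'I_(1 + 2)).
    by rewrite tpermR (entry_row _ Z0) (entry_row _ W0) wpartE.
  by rewrite tpermD// (entry_row _ (Z2 k)) (entry_row _ (W2 k)) wpartE.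
have -> : W = block_mx (- nu s)%:M 0 0 1%:M *m
    (col_mx (warp_phi u) (X *m jacobian warp_phi u) : 'M[R]_(1 + 2)).
  rewrite mul_block_col !mul0mx addr0 add0r mul1mx mul_scalar_mx.
  apply/row_matrixP => i; have [->|[k ->]] := ord_rshiftP (i : 'I_(1 + 2)).
    by rewrite W0 [RHS]row0_col_mx (wpart_zeta st Ds).
  rewrite W2 [RHS]rowS_col_mx.
  rewrite [RHS]row_mul -(deriveEjacobian _ (smooth_diff smooth_warp_phi Nu')) -ddE dd_warp_phi//.
  by rewrite -rowY.
rewrite det_mulmx (@det_ublock _ 1 2) det_scalar1 det1 mulr1 !normrM normrN mulrA.
by rewrite [`|_^-1| * _]mulrC.
Qed.

(* Normalises the volume: [- kap *: phi] is then the affine normal of the leaf. *)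
Let sig := Num.sqrt (d * `|t0 (point3 c0 u0)|).
Let kap := nu (point3 c0 u0) / sig.

Let sig_gt0 : 0 < sig.
Proof. by rewrite sqrtr_gt0 mulr_gt0// normr_gt0 (tau0_neq0 st (DP Ic Nu)). Qed.

Lemma warp_sphere : immersion_on NN warp_phi /\
  (elliptic_affine_sphere NN warp_phi \/ hyperbolic_affine_sphere NN warp_phi).
Proof.
have Dc := DP Ic Nu; have sg0 := lt0r_neq0 sig_gt0.
have kap0 : kap != 0 by rewrite mulf_neq0 ?invr_eq0// nu0.
(* The product [kap g = nu h] is independent of [sig]. The volume condition, with a [2 x 2] Gram
   determinant of [g], then asks for [sig ^ 2 = d |t0|]. *)
pose g u al be := sig * hN u al be.
have kg u al be : NN u -> kap * g u al be = nu (point3 c0 u) * hN u al be.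
  by move=> Nu'; rewrite /g mulrA mulfVK// nu_slice.
have gs u al be : NN u -> exists ga,
    dd al (dd be warp_phi) u = - (kap * g u al be) *: warp_phi u + dd ga warp_phi u.
  by move=> Nu'; exists (warp_conn u al be); rewrite kg//; exact: warp_gauss.
have gp u al : NN u -> al != 0 -> 0 < g u al al.
  move=> Nu' a0; apply: mulr_gt0 => //; apply: (metric_pos (pt (DP Ic Nu'))).
  apply: contraNneq a0 => H; apply/eqP/rowP => j.
  by have := congr1 (fun s : 'rV[R]_3 => s 0 (rshift 1 j)) H; rewrite point3_S !mxE.
have vl u (X : 'M[R]_2) : NN u ->
    `|kap * \det (col_mx (warp_phi u) (X *m jacobian warp_phi u) : 'M[R]_(1 + 2))| =
    Num.sqrt `|\det (gram (g u) X)|.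
  move=> Nu'; have Ds := DP Ic Nu'.
  have := vol Ds (axis_slice (point3 c0 u) X).
  rewrite slice_det// slice_gram// nu_slice// tau0_slice// => H.
  have -> : gram (g u) X = sig *: gram (hN u) X by apply/matrixP => i j; rewrite !mxE.
  have -> : Num.sqrt `|\det (sig *: gram (hN u) X)| = sig * Num.sqrt `|\det (gram (hN u) X)|.
    rewrite detZ normrM normrX sqrtrM ?exprn_ge0// sqrtr_sqr normr_id.
    by rewrite (ger0_norm (ltW sig_gt0)).
  have s2 : sig ^+ 2 = d * `|t0 (point3 c0 u0)| by rewrite sqr_sqrtr// mulr_ge0// ltW.
  have tn : `|t0 (point3 c0 u0)| != 0 by rewrite normr_eq0 (tau0_neq0 st Dc).
  have nn : `|nu (point3 c0 u0)| != 0 by rewrite normr_eq0 nu0.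
  rewrite /kap !normrM normfV (ger0_norm (ltW sig_gt0)).
  move: H; rewrite normrM normfV; move: (`|\det _|) (Num.sqrt _) => A B H.
  have -> : `|nu (point3 c0 u0)| / sig * A =
      (`|nu (point3 c0 u0)| / `|t0 (point3 c0 u0)| * A) * `|t0 (point3 c0 u0)| / sig.
    by field; rewrite sg0 tn.
  rewrite H; apply: (mulIf sg0); rewrite mulfVK//.
  have -> : sig * B * sig = sig ^+ 2 * B by ring.
  by rewrite s2; ring.
split; first exact: centroaffine_immersion smooth_warp_phi warp_free.
exact: centroaffine_sphere oN smooth_warp_phi kap0 gs warp_free vl gp.
Qed.

(* The conormal map of the affine sphere solves the same linear system as the sphere, so
   it is a constant linear image of it. *)
Section Quadric.
Hypothesis hK : forall s v w, D s -> h s v (e s) = 0 -> h s w (e s) = 0 ->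
  K s v w = (- mu s * h s v w) *: e s.
Local Notation nuc := (nu (point3 c0 u0)).

(** Conormal of the leaf: the factor makes it 1 on the position vector, and it vanishes on the
    tangent plane, as [warp_dual] records. *)
Definition warp_psi u : 'rV[R]_3 := - nuc *: wpart (N (point3 c0 u))^T.

Let NT s := (N s)^T : 'rV[R]_4.
Let sNT : smooth_on D NT. Proof. exact: smooth_trmx (ts_N ts). Qed.

Let dd_trmx (g : 'rV[R]_3 -> 'cV[R]_4) s v : smooth_on D g -> D s ->
  dd v (fun s => (g s)^T) s = (dd v g s)^T.
Proof.
move=> sg Ds; apply/rowP => j; rewrite (dd_entry v 0 j (smooth_trmx oD sg) Ds) [RHS]mxE.
rewrite (dd_entry v j 0 sg Ds); congr (dd v _ s); apply/funext => y; exact: mxE.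
Qed.

Lemma smooth_warp_psi : smooth_on NN warp_psi.
Proof.
apply: smoothZ => //; first exact: smooth_cst.
exact: (smooth_on_slice Ic (smooth_wpart oD sNT)).
Qed.

Lemma dd_warp_psi u al : NN u ->
  dd al warp_psi u = - nuc *: wpart (dd (point3 0 al) N (point3 c0 u))^T.
Proof.
move=> Nu'; have sw := smooth_wpart oD sNT; have Ds := DP Ic Nu'.
rewrite (ddZ al (smooth_cst (- nuc)) (smooth_on_slice Ic sw))// dd_cst scale0r add0r.
congr (_ *: _); rewrite (dd_on_slice al Ic Nu' sw) (dd_wpart _ oD sNT Ds).
by rewrite (dd_trmx _ (ts_N ts) Ds).
Qed.

(** By [dd_dd_N] the conormal connection differs by [2 K], which [hK] makes a multiple of [e]; on W
    the vanishing of [tau] turns [E'] into [(eta + mu) N]. With the term of [S] the coefficients of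
    [N] add up to [- nu h]. *)
Lemma warp_psi_gauss u al be : NN u -> let s := point3 c0 u in
  dd al (dd be warp_psi) u =
  - (nu s * h s (point3 0 al) (point3 0 be)) *: warp_psi u + dd (warp_conn u al be) warp_psi u.
Proof.
move=> Nu' s; have Ds := DP Ic Nu'; rewrite -/s in Ds.
pose a := point3 0 al; pose b := point3 0 be; have sdN := smooth_dd b (ts_N ts).
have sdT := smooth_trmx oD sdN; have sw := smooth_wpart oD sdT.
rewrite (eq_on_dd al oN (fun y Ny => dd_warp_psi be Ny) Nu').
rewrite (ddZ al (smooth_cst (- nuc)) (smooth_on_slice Ic sw))// dd_cst scale0r add0r.
rewrite (dd_on_slice al Ic Nu' sw) (dd_wpart _ oD sdT Ds) (dd_trmx _ sdN Ds) -/s -/a -/b.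
have D2 := dd_dd_N bs a b Ds.
have [_ [_ _ HS]] := axis_normal_form pt nf Ds.
have sN := ts_N ts.
rewrite gauss_T// -/s -/a -/b hK ?Da// HS Da// mulr0 scale0r addr0 (metric_Z ts)// in D2.
have E1 : dd (- (h s a b * (eta s + mu s)) *: e s + point3 0 (warp_conn u al be) -
     (2 : R) *: ((- mu s * h s a b) *: e s)) N s =
    (h s a b * (mu s - eta s)) *: axis_E' N e s + dd (point3 0 (warp_conn u al be)) N s.
  rewrite (ddDl sN)// (ddDl sN)// (ddNl sN)// !(ddZl sN)// -/(axis_E' N e s).
  by apply/colP => j; rewrite !mxE; ring.
rewrite E1 in D2; rewrite D2 (dd_warp_psi _ Nu') /warp_psi -/s.
have tW j : axis_E' N e s (rshift 1 j) 0 = (eta s + mu s) * N s (rshift 1 j) 0.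
  by have := st_tau st j Ds; rewrite !mxE => /eqP; rewrite addrC subr_eq0 => /eqP ->.
apply/rowP => j; rewrite /wpart !mxE tW /axis_nu; ring.
Qed.

Let pairingE4 (b : 'rV[R]_4) (c : 'cV[R]_4) :
  ⟨b, c⟩ = b 0 0 * c 0 0 + (wpart b *m (wpart c^T)^T) 0 0.
Proof.
rewrite pairing_unfold mxE big_ord_recl /= mxE; congr (_ + _); apply: eq_bigr => j _.
have -> : lift ord0 j = rshift 1 j :> 'I_4 by exact: val_inj.
by rewrite !mxE.
Qed.

Let dot (p q : 'rV[R]_3) : R := (p *m q^T) 0 0.
Let dotZ k p q : dot p (k *: q) = k * dot p q.
Proof. by rewrite /dot linearZ /= -scalemxAr mxE. Qed.

Lemma warp_dual u al be : NN u ->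
  [/\ dot (warp_phi u) (warp_psi u) = 1, dot (warp_phi u) (dd be warp_psi u) = 0,
      dot (dd al warp_phi u) (warp_psi u) = 0
    & dot (dd al warp_phi u) (dd be warp_psi u) = nuc * hN u al be].
Proof.
move=> Nu'; pose s := point3 c0 u; have Ds : D s := DP Ic Nu'.
rewrite !dd_warp_psi// !dd_warp_phi// /warp_psi !dotZ -/s -(nu_slice Ic Nu') -/s.
have a00 (ga : 'rV[R]_2) : dd (point3 0 ga) f s 0 0 = 0 by rewrite head_dd_f// point3_0.
have zE c : - nu s * dot (warp_phi u) (wpart c^T) = ⟨zeta s, c⟩.
  by rewrite pairingE4 (head_zeta st Ds) mul0r add0r (wpart_zeta st Ds) -scalemxAl mxE.
have fE (ga : 'rV[R]_2) c : dot (wpart (dd (point3 0 ga) f s)) (wpart c^T) = ⟨dd (point3 0 ga) f s, c⟩.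
  by rewrite pairingE4 a00 mul0r add0r.
rewrite !zE !fE; split.
- by rewrite (zeta_N st).
- rewrite /axis_zeta pairingDl pairingNl pairingZl (xi_dN ts)//.
  by rewrite (axis_E_dN e bs)// Da// oppr0 mulr0 subr0.
- by rewrite (ts_Nf ts)// mulr0.
- by rewrite /hN (metric_dual' ts _ _ Ds) mulrN mulNr.
Qed.

Lemma warp_psi_linear : exists Q : 'M[R]_3, forall u, NN u -> warp_psi u = warp_phi u *m Q.
Proof.
apply: (@linear_system_unique _ u0 r
  (fun u al be => - (nu (point3 c0 u) * h (point3 c0 u) (point3 0 al) (point3 0 be))) warp_conn).
- split; first exact: smooth_warp_phi.
  by move=> u al be Nu'; exact: warp_gauss.
- split; first exact: smooth_warp_psi.
  by move=> u al be Nu'; exact: warp_psi_gauss.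
- move=> u Nu'; rewrite -row_free_unit; apply: inj_row_free => v.
  rewrite [v]point3_eta (mul_system_frame _ _ smooth_warp_phi Nu').
  by move=> /(warp_free Nu')[-> ->]; exact: point3_0_0.
Qed.

(** The bilinear form of [Q] takes the value 1 on every pair [(phi u, phi u)], so the leaf lies on a
    quadric. At [u0], in a frame of two [h]-orthonormal tangents and the position, [warp_dual]
    diagonalizes it as (nu, nu, 1); the sign of [nu] separates ellipsoid and hyperboloid. *)
Lemma warp_quadric : exists X : set 'rV[R]_3,
  (is_ellipsoid X \/ is_hyperboloid X) /\ warp_phi @` NN `<=` X.
Proof.
have [Q HQ] := warp_psi_linear; have Dc := DP Ic Nu; have p := pt Dc.
have dQ u al : NN u -> dd al warp_psi u = dd al warp_phi u *m Q.
  move=> Nu'; rewrite (eq_on_dd al oN HQ Nu').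
  by rewrite (dd_mulmx al smooth_warp_phi (smooth_cst Q) Nu') dd_cst mulmx0 addr0.
have [_ [ee _ _]] := axis_normal_form pt nf Dc.
have [x [y [_ xx yy [ex ey xy]]]] := orthonormal_extend p ee.
have slice v : h (point3 c0 u0) (e (point3 c0 u0)) v = 0 -> exists al, v = point3 0 al.
  rewrite (metric_sym p) (theta_head _ Dc) => /eqP.
  rewrite mulf_eq0 (negbTE (tau0_neq0 st Dc)) orbF => /eqP v0.
  by exists (rsubmx (v : 'rV[R]_(1 + 2))); rewrite -v0; exact: point3_eta.
have [al xE] := slice x ex; have [be yE] := slice y ey; subst x y.
pose k := Num.sqrt `|nuc|; have nn : nuc != 0 by exact: nu0.
have k2 : k ^+ 2 = `|nuc| by rewrite sqr_sqrtr.
have k0 : k != 0 by rewrite gt_eqF// sqrtr_gt0 normr_gt0.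
pose bil (v w : 'rV[R]_3) : R := (v *m Q^T *m w^T) 0 0.
(* Sign of [nu]; dividing the tangent vectors by [k] below reduces the diagonal to (eps, eps, 1). *)
pose eps := nuc / `|nuc|.
pose C := frame_mx (k^-1 *: dd al warp_phi u0) (k^-1 *: dd be warp_phi u0) (warp_phi u0).
have Bpsi v : bil v (warp_phi u0) = dot v (warp_psi u0).
  by rewrite /bil /dot HQ// trmx_mul mulmxA.
have Bdpsi v ga : bil v (dd ga warp_phi u0) = dot v (dd ga warp_psi u0).
  by rewrite /bil /dot dQ// trmx_mul mulmxA.
have bilDl v v' w : bil (v + v') w = bil v w + bil v' w by rewrite /bil !mulmxDl mxE.
have bilDr v w w' : bil v (w + w') = bil v w + bil v w'.
  by rewrite /bil linearD /= mulmxDr mxE.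
have bilZl c v w : bil (c *: v) w = c * bil v w by rewrite /bil -!scalemxAl mxE.
have bilZr c v w : bil v (c *: w) = c * bil v w by rewrite /bil linearZ /= -scalemxAr mxE.
have [d1 d2 d3 d4] := warp_dual al al Nu; have [_ d5 d6 d7] := warp_dual be be Nu.
have [_ _ _ d8] := warp_dual al be Nu; have [_ _ _ d9] := warp_dual be al Nu.
rewrite /hN xx in d4; rewrite /hN yy in d7; rewrite /hN xy in d8.
rewrite /hN (metric_sym p) xy in d9.
have CB z : bil (z *m C) (z *m C) = eps * z 0 0 ^+ 2 + eps * z 0 1 ^+ 2 + z 0 2 ^+ 2.
  rewrite mul_frame_mx !(bilDl, bilDr, bilZl, bilZr) !Bpsi !Bdpsi d1 d2 d3 d4 d5 d6 d7 d8 d9.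
  rewrite /eps -k2; field; exact: k0.
have uC : C \in unitmx.
  rewrite -row_free_unit; apply: inj_row_free => z.
  rewrite mul_frame_mx !scalerA -!(ddZl smooth_warp_phi)// -(ddDl smooth_warp_phi)// addrC.
  move=> /(warp_free Nu)[z2 z01].
  have H : point3 0 ((z 0 0 / k) *: al + (z 0 1 / k) *: be) = 0 by rewrite z01 point3_0_0.
  have {}H : (z 0 0 / k) *: point3 0 al + (z 0 1 / k) *: point3 0 be = 0.
    by rewrite !point3Z point3D !mulr0 addr0.
  have H1 := congr1 (h (point3 c0 u0) (point3 0 al)) H.
  have H2 := congr1 (h (point3 c0 u0) (point3 0 be)) H.
  rewrite (hDr p) !(hZr p) xx xy (h0r p) in H1.
  rewrite (hDr p) !(hZr p) (metric_sym p _ (point3 0 al)) yy xy (h0r p) in H2.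
  apply/rowP; apply: ord3P; rewrite mxE.
  - by apply: (mulIf (invr_neq0 k0)); lra.
  - by apply: (mulIf (invr_neq0 k0)); lra.
  - exact: z2.
pose A (y : 'rV[R]_3) := y *m invmx C.
have affA : affine_transformation A.
  by exists (invmx C), 0; split=> [|y]; rewrite ?unitmx_inv// addr0.
have onX u : NN u -> bil (warp_phi u) (warp_phi u) = 1.
  move=> Nu'; have [H _ _ _] := warp_dual 0 0 Nu'.
  by rewrite -H /dot HQ// trmx_mul mulmxA.
have AE u : NN u -> eps * A (warp_phi u) 0 0 ^+ 2 + eps * A (warp_phi u) 0 1 ^+ 2 +
    A (warp_phi u) 0 2 ^+ 2 = 1.
  by move=> Nu'; rewrite -CB mulmxKV// onX.
have [np|nn'] := ltrP 0 nuc.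
- have eps1 : eps = 1 by rewrite /eps gtr0_norm// divff.
  exists [set y | A y 0 0 ^+ 2 + A y 0 1 ^+ 2 + A y 0 2 ^+ 2 = 1]; split.
    by left; exists A.
  by move=> _ [u Nu' <-] /=; rewrite -(AE u)// eps1 !mul1r.
- have eps1 : eps = - 1 by rewrite /eps ler0_norm// invrN mulrN divff.
  exists [set y | A y 0 2 ^+ 2 - A y 0 0 ^+ 2 - A y 0 1 ^+ 2 = 1]; split.
    by right; exists A.
  by move=> _ [u Nu' <-] /=; rewrite -(AE u)// eps1; ring.
Qed.
End Quadric.

End Warped.

(** * Global statement *)

(** The inverse of [Q] has rows [om] and a basis of the kernel of [tau], independent because [tau]
    does not vanish on [om]. *)
Lemma normalizing_matrix (R : realType) (om : 'rV[R]_4) (tau : 'cV[R]_4) : ⟨om, tau⟩ != 0 ->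
  exists Q : 'M[R]_4, [/\ Q \in unitmx, wpart (om *m Q) = 0
    & forall j, (invmx Q *m tau) (rshift 1 j) 0 = 0].
Proof.
move=> ot; have tau0 : tau != 0 by apply: contraNneq ot => ->; rewrite pairing0r.
have [Kr [frK Kt]] : exists Kr : 'M[R]_(3, 4), row_free Kr /\ Kr *m tau = 0.
  have rk : \rank (kermx tau) = 3%N.
    rewrite mxrank_ker (_ : \rank tau = 1%N)//; apply/eqP; rewrite eqn_leq rank_leq_col.
    by rewrite lt0n mxrank_eq0.
  have : exists Kr : 'M[R]_(\rank (kermx tau), 4), row_free Kr /\ Kr *m tau = 0.
    exists (row_base (kermx tau)); split; first exact: row_base_free.
    by apply/sub_kermxP; rewrite eq_row_base.
  by rewrite rk.
pose P : 'M[R]_4 := col_mx om Kr.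
have rE (v : 'rV[R]_4) : v *m P = v 0 0 *: om + wpart v *m Kr.
  have -> : v *m P = lsubmx (v : 'rV[R]_(1 + 3)) *m om + rsubmx (v : 'rV[R]_(1 + 3)) *m Kr.
    by rewrite -mul_row_col hsubmxK.
  congr (_ + _); rewrite [lsubmx _]mx11_scalar mul_scalar_mx mxE; congr (v _ _ *: _); exact: val_inj.
have uP : P \in unitmx.
  rewrite -row_free_unit; apply: inj_row_free => v; rewrite rE => H.
  have v0 : v 0 0 = 0.
    have := congr1 (fun b => ⟨b, tau⟩) H; rewrite pairingDl pairingZl pairing_mulmxl Kt.
    by rewrite pairing0r pairing0l addr0 => /eqP; rewrite mulf_eq0 (negbTE ot) orbF => /eqP.
  move: H; rewrite v0 scale0r add0r => H; apply: row4_eq; first by rewrite v0 mxE.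
  by rewrite wpart0; apply: (row_free_inj frK); rewrite H mul0mx.
exists (invmx P); rewrite unitmx_inv invmxK; split=> // [|j].
  have -> : om *m invmx P = delta_mx 0 0.
    apply: (can_inj (mulmxK uP)); rewrite mulmxKV// rE !mxE eqxx scale1r.
    rewrite (_ : wpart _ = 0) ?mul0mx ?addr0//.
    by apply/rowP => j; rewrite wpartE !mxE.
  by apply/rowP => j; rewrite wpartE !mxE.
have : row (rshift 1 j) (P *m tau) = row j (Kr *m tau).
  by rewrite !row_mul; congr (_ *m _); exact: rowS_col_mx.
by move=> H; rewrite (entry_row 0 H) Kt !mxE.
Qed.

(** * Reparametrization and product neighbourhoods *)

Section ParamComp.
Context {R : realType} {n : nat} {M : smooth_manifold R n}.

Lemma param_comp (U U0 V0 : set 'rV[R]_n) (x : 'rV[R]_n -> M) (G H : 'rV[R]_n -> 'rV[R]_n) :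
  local_param U x -> open U0 -> U0 `<=` U -> open V0 ->
  smooth_on U0 G -> smooth_on V0 H ->
  (forall s, U0 s -> V0 (G s) /\ H (G s) = s) -> (forall s, V0 s -> U0 (H s) /\ G (H s) = s) ->
  local_param V0 (x \o H).
Proof.
move=> [ex tr] oU0 sU oV0 sG sH GE HE; have [oU ix cx ox] := ex.
have openH (Y : set 'rV[R]_n) : open Y -> Y `<=` V0 -> open ((x \o H) @` Y).
  move=> oY YV; rewrite -image_comp.
  have -> : H @` Y = U0 `&` G @^-1` Y.
    apply/seteqP; split=> [_ [s Ys <-]|s [U0s Ys]].
      by have [U0s GHs] := HE s (YV s Ys); split=> //; rewrite /preimage /= GHs.
    by exists (G s) => //; have [] := GE s U0s.
  apply: ox; last by move=> s [/sU].
  rewrite openE => s [U0s Ys]; apply: filterI; first exact: open_nbhs_nbhs.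
  exact: (smooth_continuous sG U0s (open_nbhs_nbhs (conj oY Ys))).
have eH : open_embedding V0 (x \o H).
  split=> // [s t /set_mem Vs /set_mem Vt st|].
    have [Us Gs] := HE s Vs; have [Ut Gt] := HE t Vt.
    by rewrite -Gs -Gt; congr G; apply: (embedding_inj ex (sU _ Us) (sU _ Ut)).
  rewrite continuous_open_subspace// => s /set_mem Vs.
  have [Us _] := HE s Vs.
  apply: continuous_comp; first exact: smooth_continuous sH Vs.
  exact: embedding_continuous ex _ (sU _ Us).
split=> // c ac; have [[t1 [st1 t1E]] [t2 [st2 t2E]]] := tr c ac.
have ec := atlas_embedding ac; split.
  pose W := V0 `&` (x \o H) @^-1` (c.2 @` c.1).
  have oW : open W by apply: embedding_preimage => //; exact: embedding_image.
  have oW' : open (U `&` x @^-1` (c.2 @` c.1)).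
    by apply: embedding_preimage => //; exact: embedding_image.
  have WW s : W s -> (U `&` x @^-1` (c.2 @` c.1)) (H s).
    by move=> [Vs cs]; split=> //; apply: sU; have [] := HE s Vs.
  exists (t1 \o H); split=> [|s Ws]; last exact: t1E (WW s Ws).
  apply: (smooth_comp oW oW' WW st1); apply: smooth_subset sH => s []//.
pose W := c.1 `&` c.2 @^-1` ((x \o H) @` V0).
have oW : open W by apply: embedding_preimage => //; exact: openH.
have sW : W `<=` c.1 `&` c.2 @^-1` (x @` U).
  move=> s [cs [v Vv vs]]; split=> //; exists (H v) => //.
  by apply: sU; have [] := HE v Vv.
have WU s : W s -> exists2 v, V0 v & t2 s = H v.
  move=> Ws; have [Ut xt] := t2E s (sW s Ws); have [_ [v Vv vs]] := Ws; exists v => //.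
  by apply: (embedding_inj ex Ut); [apply: sU; have [] := HE v Vv|rewrite xt].
have WU0 s : W s -> U0 (t2 s) by move=> /WU[v Vv ->]; have [] := HE v Vv.
exists (G \o t2); split=> [|s Ws].
  by apply: (smooth_comp oW oU0 WU0 sG); exact: smooth_subset sW st2.
have [v Vv tv] := WU s Ws; have [_ Gv] := HE v Vv; have [_ xt] := t2E s (sW s Ws).
by rewrite /= tv Gv -xt tv.
Qed.

End ParamComp.

Lemma convex_ball_connected (R : realType) (V : normedModType R) (c : V) (r : R) : 0 < r ->
  connected (ball c r).
Proof.
move=> r0; pose seg (y : V) := (fun t : R => t *: (y - c) + c) @` `[0, 1].
have -> : ball c r = \bigcup_(y in ball c r) seg y.
  apply/seteqP; split=> [y By|z [y By [t /= ht <-]]].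
    exists y => //; exists 1; last by rewrite scale1r subrK.
    by rewrite /= in_itv /= ler01 lexx.
  by apply: ball_segment By _; move: ht; rewrite in_itv.
apply: bigcup_connected => [|y By].
  exists c => y By; exists 0; last by rewrite scale0r add0r.
  by rewrite /= in_itv /= ler01 lexx.
apply: connected_continuous_connected; first exact: segment_connected.
by apply: continuous_subspaceT => t; apply: differentiable_continuous.
Qed.

(** Row vectors carry the supremum norm, so balls are products of balls. *)
Lemma product_ball (R : realType) (c : 'rV[R]_3) (r : R) : 0 < r ->
  product_domain (ball (c 0 0) r) (ball (rsubmx (c : 'rV[R]_(1 + 2))) r) = ball c r.
Proof.
move=> r0; apply/seteqP; split=> [_ [t [u [ht [_ hu] ->]]]|s [_ hs]].
  split=> // i j; rewrite ord1; have [->|[k ->]] := ord_rshiftP j; first by rewrite point3_0.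
  by have := hu 0 k; rewrite point3_S mxE.
exists (s 0 0), (rsubmx (s : 'rV[R]_(1 + 2))); split; [exact: hs| |exact: point3_eta].
by split=> // i j; rewrite !mxE; exact: hs.
Qed.

(** * Normal forms read from frames and from half turns *)

Section FrameForms.
Context {R : realType}.
Variables (h : 'rV[R]_3 -> 'rV[R]_3 -> R) (K : 'rV[R]_3 -> 'rV[R]_3 -> 'rV[R]_3)
  (S : 'rV[R]_3 -> 'rV[R]_3).
Hypothesis pt : point_structure h K S.

Lemma gram_orthonormal e x y : gram h (frame_mx e x y) = 1%:M -> orthonormal h e x y.
Proof.
move=> G; have [r0 r1 r2] := frame_mx_row e x y.
have E i j : h (row i (frame_mx e x y)) (row j (frame_mx e x y)) = (i == j)%:R.
  by have := congr1 (fun A : 'M[R]_3 => A i j) G; rewrite !mxE.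
have := E 0 0; have := E 1 1; have := E 2 2; have := E 0 1; have := E 0 2; have := E 1 2.
rewrite !r0 !r1 !r2 !eqxx.
by rewrite (_ : (0 == 1 :> 'I_3) = false)// (_ : (0 == 2 :> 'I_3) = false)//
  (_ : (1 == 2 :> 'I_3) = false)//; split.
Qed.

Lemma frame_normal_form e x y mu lam a : orthonormal h e x y ->
  K e e = (2 * mu) *: e -> K e x = - mu *: x -> K e y = - mu *: y ->
  S e = lam *: e -> S x = a *: x -> S y = a *: y -> normal_form h K S e mu lam a.
Proof.
move=> on Kee Kex Key Se Sx Sy; have [ee _ _ _] := on; split=> // v.
- rewrite {1 2}(orthonormal_decomp pt v on) !(KDr pt) !(KZr pt) Kee Kex Key.
  by apply/rowP => j; rewrite !mxE; ring.
- rewrite {1 2}(orthonormal_decomp pt v on) !(SD pt) !(SZ pt) Se Sx Sy.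
  by apply/rowP => j; rewrite !mxE; ring.
Qed.

Lemma half_turn_cubic e mu lam a g v w :
  (forall g g', point_symmetry h K S g -> point_symmetry h K S g' -> g *m g' = g' *m g) ->
  normal_form h K S e mu lam a -> point_symmetry h K S g -> g *m g = 1%:M -> g != 1%:M ->
  h v e = 0 -> h w e = 0 -> K v w = (- mu * h v w) *: e.
Proof.
move=> ab nf Gg g2 g1 ve we; have [ee _ _] := nf.
have [x [y on]] := orthonormal_extend pt ee; have ff := normal_frame_form pt nf on.
have [l0 m0] := @normal_form_SO2 _ _ _ _ pt ab _ _ _ _ _ _ _ _ _ ff Gg g2 g1.
rewrite l0 m0 in ff.
rewrite [v](orthonormal_decomp pt v on) [w](orthonormal_decomp pt w on).
rewrite -!/(comb _ _ _ _ _ _) (frame_form_K pt _ _ _ _ _ _ ff) (h_comb pt)// ve we.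
by apply/rowP => j; rewrite !mxE; ring.
Qed.

End FrameForms.

(** * Passage to the statement on the manifold *)

Section Assembly.
Context {R : realType} {M : smooth_manifold R 3}.
Variables (F xi : M -> 'rV[R]_4).
Hypotheses (M_connected : connected [set: M])
  (F_immersion : immersion F) (xi_normal : affine_normal F xi)
  (h_positive : positive_definite F xi)
  (M_symmetric : pointwise_SO2_symmetry F xi \/ pointwise_Z3_symmetry F xi).
Implicit Types (U V : set 'rV[R]_3) (x y : 'rV[R]_3 -> M) (e : 'rV[R]_3 -> 'rV[R]_3).

Local Notation hh x := (affine_metric (F \o x) (xi \o x)).
Local Notation KK x := (difference_tensor (F \o x) (xi \o x)).
Local Notation SS x := (shape_operator (F \o x) (xi \o x)).
Local Notation NN x := (conormal (F \o x) (xi \o x)).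
Local Notation TT x := (tangent_part (F \o x) (xi \o x)).
Local Notation chart_nu x e := (axis_nu (F \o x) (TT x) (hh x) (KK x) (SS x) e).
Let blas U x (ux : local_param U x) := param_blaschke F_immersion xi_normal ux.
Let poin U x (ux : local_param U x) := param_point F_immersion xi_normal h_positive ux.
Let symm U x (ux : local_param U x) := param_symmetry M_symmetric ux.

(** Translates the adapted frame of the hypothesis: its [e1] is an axis field, and uniqueness of the
    parameters identifies the given function with [axis_nu]. *)
Lemma adapted_axis_chart U x e1 e2 e3 mu1 mu2 lambda a eta : local_param U x ->
  adapted_frame U (F \o x) (xi \o x) e1 e2 e3 mu1 mu2 lambda a eta ->
  axis_chart F xi U x e1 /\
  forall s, U s -> chart_nu x e1 s = a s + eta s ^+ 2 - mu1 s ^+ 2.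
Proof.
move=> ux [[se _ _] on HK HS Heta]; have pt := poin ux.
have nf s : U s -> normal_form (hh x s) (KK x s) (SS x s) (e1 s) (mu1 s) (lambda s) (a s).
  move=> Us; have [k1 [k2 [k3 _]]] := HK s Us; have [s1 s2 s3] := HS s Us.
  have on' := gram_orthonormal (on s Us); exact: (frame_normal_form (pt s Us) on').
have mu0 s : U s -> mu1 s != 0.
  move=> Us; have [ab _] := symm ux Us.
  exact: (@normal_form_mu_neq0 _ _ _ _ (pt s Us) ab _ _ _ _ (nf s Us)).
have ax : axis_chart F xi U x e1.
  by split=> // s Us; exists (mu1 s), (lambda s), (a s); split; [exact: mu0|exact: nf].
split=> // s Us; have p := pt s Us.
have [_ nf'] := axis_normal_form pt (ac_form ax) Us.
have [muE _ aE] := normal_form_params p nf' (nf s Us).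
have [v v0 [ve _]] := exists_orthogonal p (e1 s) (e1 s).
have etaE : axis_eta (F \o x) (TT x) (KK x) e1 s = eta s.
  have := levi_civita_axis (blas ux) se v Us; rewrite Heta//.
  have [-> _] := axis_A_mu (blas ux) pt se (ac_form ax) v Us.
  rewrite ve scale0r subr0 => /eqP; rewrite -subr_eq0 -scalerBl scaler_eq0 (negbTE v0) orbF.
  by rewrite subr_eq0 => /eqP ->.
by rewrite /axis_nu muE aE etaE.
Qed.

Section Normalized.
Variables (Q : 'M[R]_4) (b : 'rV[R]_4).
Hypothesis uQ : Q \in unitmx.
Local Notation ff x := (fun s => (F \o x) s *m Q + b).
Local Notation xx x := (fun s => (xi \o x) s *m Q).
Local Notation NQ x := (fun s => invmx Q *m NN x s).
Local Notation TQ x := (fun s c => TT x s (c *m invmx Q)).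
Local Notation straight U x e :=
  (straight_chart U (ff x) (xx x) (NQ x) (TQ x) (hh x) (KK x) (SS x) e).

(** Annihilation by the cokernel of a vector means being a multiple of it, so the line conditions
    become coordinate conditions after [Q]. *)
Lemma straight_of_line om0 (tau0 : 'cV[R]_4) c0 U x e : axis_chart F xi U x e ->
  wpart (om0 *m Q) = 0 -> (forall j, (invmx Q *m tau0) (rshift 1 j) 0 = 0) -> b = - (c0 *m Q) ->
  (forall s, U s -> chart_line F xi (cokermx om0) (cokermx tau0^T) c0 x e s) -> straight U x e.
Proof.
move=> ax omQ tauQ bE line; have bs := blas (ac_param ax); have se := ac_smooth ax.
have colin (v v0 : 'rV[R]_4) : v *m cokermx v0 = 0 -> exists k, v = k *: v0.
  by move=> /eqP; rewrite -submxE => /sub_rVP.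
apply: StraightChart.
- exact: blaschke_affine bs uQ.
- exact: poin (ac_param ax).
- exact: se.
- exact: ac_form ax.
- by move=> s Us; rewrite (axis_nu_affine b bs uQ se)//; have [] := line s Us.
- move=> s Us; rewrite (axis_om_affine b bs uQ se)//; have [_ /colin[k ->] _ _] := line s Us.
  by rewrite -scalemxAl wpartZ omQ scaler0.
- move=> s j Us; rewrite (axis_tau_affine b bs uQ se)//; have [_ _ /colin[k tE] _] := line s Us.
  have -> : axis_tau (F \o x) (NN x) (TT x) (hh x) (KK x) e s = k *: tau0.
    by apply: trmx_inj; rewrite tE linearZ.
  by rewrite -scalemxAr mxE tauQ mulr0.
- move=> s Us; rewrite (axis_nu_affine b bs uQ se)// (axis_zeta_affine b bs uQ se)//.
  have [_ _ _ /colin[k cE]] := line s Us.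
  rewrite scalemxAl addrAC -mulmxDl bE -mulmxBl cE.
  by rewrite -scalemxAl wpartZ omQ scaler0.
Qed.

Lemma warped_param (p : M) : (forall U x e, axis_chart F xi U x e -> straight U x e) ->
  exists I gamma1 gamma2 N phi x,
    [/\ @open_interval R I /\ affine_curve I gamma1 gamma2,
        [/\ open N, connected N & immersion_on N phi],
        elliptic_affine_sphere N phi \/ hyperbolic_affine_sphere N phi,
        [/\ local_param (product_domain I N) x, (x @` product_domain I N) p
          & forall t u, I t -> N u -> F (x (point3 t u)) *m Q + b =
              warped_hypersurface gamma1 gamma2 phi t u]
      & pointwise_SO2_symmetry F xi -> exists E : set 'rV[R]_3,
          (is_ellipsoid E \/ is_hyperboloid E) /\ phi @` N `<=` E].
Proof.
move=> strH.
have [U [x [e [s1 [ax Us1 xs1]]]]] := axis_chart_at F_immersion xi_normal h_positive M_symmetric p.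
have st := strH U x e ax; have ux := ac_param ax; have oU := param_open ux.
have [i0 fi0] : exists i0, wpart (ff x s1) 0 i0 != 0.
  have := wpart_f_neq0 st Us1; apply: contra_neqP => H; apply/rowP => i; rewrite [RHS]mxE.
  by apply/eqP/negPn/negP => fi; apply: H; exists i.
pose U' := [set s | U s /\ wpart (ff x s) 0 i0 != 0].
have oU' : open U' by have := slice_open (i0 := i0) st.
have U's1 : U' s1 by [].
have sG := smooth_slice_coord (i0 := i0) st; have uJ := slice_jacobian_unit st U's1.
pose G := slice_coord (ff x) i0; rewrite -/G -/U' in sG uJ.
have [U0 [V0 [H [oU0 U0U' U0s1 oV0 [GE HE sH]]]]] := inverse_function oU' sG U's1 uJ.
have U0U : U0 `<=` U by move=> s /U0U'[].
have vy : local_param V0 (x \o H).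
  exact: param_comp ux oU0 U0U oV0 (smooth_subset U0U' sG) sH GE HE.
have [V0G HG] := GE s1 U0s1; pose c := G s1.
(* A fresh axis is chosen in the slice coordinates instead of transporting [e]; [strH] covers every
   axis chart. *)
have [V1 [e' [ay V1c V1V0]]] :=
  axis_chart_near F_immersion xi_normal h_positive M_symmetric vy V0G.
have oV1 := param_open (ac_param ay).
have [r r0 BV1] : exists2 r : R, 0 < r & ball c r `<=` V1.
  by have /nbhs_ballP[r r0 rB] := open_nbhs_nbhs (conj oV1 V1c); exists r.
set y := x \o H in vy ay.
pose I := ball (c 0 0) r : set R; pose N := ball (rsubmx (c : 'rV[R]_(1 + 2))) r : set 'rV[R]_2.
have DB : product_domain I N = ball c r by exact: product_ball.
pose D := product_domain I N.
have oD : open D by rewrite /D DB; exact: ball_open.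
have DV1 : D `<=` V1 by rewrite /D DB.
have az : axis_chart F xi D y e'.
  split.
  - exact: param_restrict (ac_param ay) oD DV1.
  - exact: smooth_subset DV1 (ac_smooth ay).
  - by move=> s /DV1 V1s; have := ac_form ay V1s.
have sty := strH D y e' az; have uy := ac_param az.
have GH s : D s -> G (H s) = s /\ U' (H s).
  by move=> /DV1/V1V0/HE[Us Gs]; split=> //; exact: U0U'.
have hf0 s : D s -> ff y s 0 0 = s 0 0.
  by move=> /GH[E _]; rewrite -[in RHS]E /G /slice_coord point3_0.
have rho0 s : D s -> wpart (ff y s) 0 i0 != 0 by move=> /GH[_ []].
have hfS s : D s -> forall j : 'I_2,
    wpart (ff y s) 0 (lift i0 j) = s 0 (rshift 1 j) * wpart (ff y s) 0 i0.
  move=> Ds j; have [E _] := GH s Ds.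
  have -> : s 0 (rshift 1 j) = wpart (ff y s) 0 (lift i0 j) / wpart (ff y s) 0 i0.
    by rewrite -[in LHS]E /G /slice_coord point3_S mxE.
  by rewrite mulfVK// rho0.
have d0 : 0 < `|\det Q| * 1 by rewrite mulr1 normr_gt0 -unitfE -unitmxE.
have vol s : D s -> forall X : 'M[R]_3,
    `|\det (col_mx (xx y s) (X *m jacobian (ff y) s) : 'M[R]_(1 + 3))| =
     `|\det Q| * 1 * Num.sqrt `|\det (gram (hh y s) X)|.
  move=> Ds; have v1 (X : 'M[R]_3) : `|\det (col_mx ((xi \o y) s) (X *m jacobian (F \o y) s)
      : 'M[R]_(1 + 3))| = 1 * Num.sqrt `|\det (gram (hh y s) X)|.
    by rewrite mul1r; exact: (normal_volume (xi_normal uy) X Ds).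
  exact: (volume_affine b (blas uy) uQ v1 Ds).
exists I, id, (warp_gamma (c 0 0) (rsubmx (c : 'rV[R]_(1 + 2))) (ff y) i0), N,
  (warp_phi (c 0 0) (ff y)), y.
have [imm sph] := warp_sphere r0 sty d0 vol hf0 rho0 hfS.
have Dc : D c by rewrite /D DB; exact: ballxx.
split=> //.
- split; last exact: warp_curve r0 sty hf0 rho0 hfS.
  split; [exact: ball_open| |by exists (c 0 0); exact: ballxx].
  by apply/connected_intervalP; exact: convex_ball_connected.
- by split=> //; [exact: ball_open|exact: convex_ball_connected].
- split=> //; last by move=> t u It Nu; exact: (warp_f r0 sty hf0 rho0 hfS It Nu).
  by exists c => //; rewrite /y /= HG.
move=> so2; apply: warp_quadric r0 sty hf0 rho0 hfS _ => s v w Ds ve we.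
have pts := poin uy Ds; have [ab _] := symm uy Ds.
have [g [Gg g2 g1]] := SO2_group_half_turn (G := symmetry_group (F \o y) (xi \o y) s)
  (fun g => fun '(And4 dg _ _ _) => dg) (so2 _ _ _ uy Ds).
have [_ nf] := axis_normal_form (poin uy) (ac_form az) Ds.
exact: (half_turn_cubic pts ab nf (g := g)).
Qed.

End Normalized.

End Assembly.

Theorem theorem1 (R : realType) (M : smooth_manifold R 3)
    (F xi : M -> 'rV[R]_4)
    (M_connected : connected [set: M])
    (F_immersion : immersion F)
    (xi_normal : affine_normal F xi)
    (h_positive : positive_definite F xi)
    (M_symmetric : pointwise_SO2_symmetry F xi \/ pointwise_Z3_symmetry F xi)
    (not_identically_zero :
       exists p r, symmetry_function_at F xi p r /\ r <> 0) :
  exists A : 'rV[R]_4 -> 'rV[R]_4, affine_transformation A /\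
  forall p : M,
  exists (I : set R) (gamma1 gamma2 : R -> R)
         (N : set 'rV[R]_2) (phi : 'rV[R]_2 -> 'rV[R]_3)
         (x : 'rV[R]_3 -> M),
    [/\ open_interval I /\ affine_curve I gamma1 gamma2,
        [/\ open N, connected N & immersion_on N phi],
        elliptic_affine_sphere N phi \/ hyperbolic_affine_sphere N phi,
        [/\ local_param (product_domain I N) x,
            (x @` product_domain I N) p
          & forall t u, I t -> N u ->
              A (F (x (point3 t u))) =
              warped_hypersurface gamma1 gamma2 phi t u]
      & pointwise_SO2_symmetry F xi ->
        exists E : set 'rV[R]_3,
          (is_ellipsoid E \/ is_hyperboloid E) /\ phi @` N `<=` E].
Proof.
have [p0 [r [sf r0]]] := not_identically_zero.
have [U [x [e1 [e2 [e3 [mu1 [mu2 [la [a [eta [s [ux fr Us _ rE]]]]]]]]]]]] := sf.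
have [ax nuE] := adapted_axis_chart F_immersion xi_normal h_positive M_symmetric ux fr.
have bs := param_blaschke F_immersion xi_normal ux.
have pt := param_point F_immersion xi_normal h_positive ux.
pose f := F \o x; pose xi' := xi \o x; pose N := conormal f xi'.
pose T := tangent_part f xi'; pose h := affine_metric f xi'.
pose K := difference_tensor f xi'; pose S := shape_operator f xi'.
have nu0 : axis_nu f T h K S e1 s != 0 by rewrite nuE// -rE; exact/eqP.
pose om0 := axis_om f xi' T h K S e1 s; pose tau0 := axis_tau f N T h K e1 s.
pose c0 := f s + (axis_nu f T h K S e1 s)^-1 *: axis_zeta f xi' T h K e1 s.
have ot : ⟨om0, tau0⟩ != 0 by rewrite /om0 /tau0 (om_tau bs pt (ac_form ax)).
have [Q [uQ omQ tauQ]] := normalizing_matrix ot.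
(* At the base point the tests hold by construction, as the lines are those of [om], [tau] and the
   centre at [s] itself. *)
have line : chart_line F xi (cokermx om0) (cokermx tau0^T) c0 x e1 s.
  by split; rewrite ?mulmx_coker// subrr mul0mx.
(* The translation sends [c0] to the origin, so that the line of centres becomes the first
   coordinate axis itself. *)
exists (fun z : 'rV[R]_4 => z *m Q + - (c0 *m Q)); split; first by exists Q, (- (c0 *m Q)).
move=> p; apply: (warped_param F_immersion xi_normal h_positive M_symmetric uQ) => V y e ay.
apply: (straight_of_line F_immersion xi_normal h_positive uQ ay omQ tauQ erefl) => t Vt.
exact: (chart_line_global F_immersion xi_normal h_positive M_symmetric M_connected ax
  Us line ay Vt).
Qed.
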